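(* Let $K>0$, $n\in\mathbb Z_+$ and let $(N,g)$ be a compact $n$-dimensional Riemannian manifold with sectional curvature bounded by $|\mathrm{Sec}_N|\le K$. There exist $\delta_0=\delta_0(n,K)>0$ and $C_9=C_9(n)>0$, $C_{10}=C_{10}(n)>0$ (depending only on the indicated parameters) such that if $0<\hat\delta<\delta_0$ then the following holds. Let $r=(\hat\delta/K)^{1/3}$ and suppose that the injectivity radius of $N$ satisfies $\operatorname{inj}_N>2r$. Let $X=\{x_j: j=1,\dots,J\}\subset N$ be a $\hat\delta$-net of $N$ and let $\tilde d:X\times X\to\mathbb R_+\cup\{0\}$ be a function that satisfies, for all $x,y\in X$, $$|\tilde d(x,y)-d_N(x,y)|\le\hat\delta\ \text{ if } d_N(x,y)<r,\qquad \tilde d(x,y)>r-\hat\delta\ \text{ if } d_N(x,y)\ge r.$$ Then, given the set $X$ and the function $\tilde d$, one can effectively construct a compact, smooth $n$-dimensional Riemannian manifold $(M,g_M)$, with distance function $d_M$, which approximates $(N,g)$ in the following way: (1) There is a diffeomorphism $F:M\to N$ satisfying $$\frac1L\le\frac{d_N(F(x),F(y))}{d_M(x,y)}\le L\quad\text{for all }x,y\in M\ (x\neq y),$$ where $L=1+C_{10}K^{1/3}\hat\delta^{2/3}$. (2) The sectional curvature of $M$ satisfies $|\mathrm{Sec}_M|\le C_9K$. (3) The injectivity radius of $M$ satisfies $$\operatorname{inj}_M\ge\min\{(C_9K)^{-1/2},\ (1-C_{10}K^{1/3}\hat\delta^{2/3})\operatorname{inj}_N\}.$$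
   Context: $d_N$ is the Riemannian distance of $(N,g)$. A subset $S$ of a metric space $Y$ is an $\varepsilon$-net if every point of $Y$ lies within distance $\varepsilon$ of $S$. ''Effectively construct'' means that $(M,g_M)$ is produced from the data $(X,\tilde d)$ (and the parameters $n,K,\hat\delta$) only. *)

(* Defs.v *)
From HB Require Import structures.
From mathcomp Require Import all_boot all_order all_algebra.
From mathcomp Require Import all_classical all_reals all_analysis.
Import Order.TTheory GRing.Theory Num.Theory.
Import numFieldNormedType.Exports.

Set Implicit Arguments.
Unset Strict Implicit.
Unset Printing Implicit Defensive.

Local Open Scope classical_set_scope.
Local Open Scope ring_scope.

(** Points, tangent vectors and coordinates in R^n are row vectors, so a
    differential acts by [v |-> v *m jacobian f x]. *)

Definition continuous_on (T U : topologicalType) (A : set T) (f : T -> U) :=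
  forall x, A x -> {for x, continuous f}.

Definition partial (R : realType) (n : nat) (i : 'I_n) (f : 'rV[R]_n -> R) :
    'rV[R]_n -> R :=
  fun x => 'D_(delta_mx 0 i) f x.

(** Only meaningful for open [U]; the values of [f] off [U] are irrelevant. *)
Fixpoint Ck (R : realType) (n k : nat) (U : set 'rV[R]_n) (f : 'rV[R]_n -> R) :
    Prop :=
  continuous_on U f /\
  match k with
  | 0 => True
  | k'.+1 => forall i : 'I_n,
      (forall x, U x -> derivable f x (delta_mx 0 i)) /\ Ck k' U (partial i f)
  end.

Definition smooth_fun (R : realType) (n : nat) (U : set 'rV[R]_n)
    (f : 'rV[R]_n -> R) :=
  forall k, Ck k U f.

Definition smooth_on (R : realType) (n m : nat) (U : set 'rV[R]_n)
    (f : 'rV[R]_n -> 'rV[R]_m) :=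
  forall j : 'I_m, smooth_fun U (fun x => f x 0 j).

(** A homeomorphism between an open set of [T] and an open set of R^n; both
    directions are total functions, with junk values off [dom] and [cod]. *)
Record chart (R : realType) (n : nat) (T : topologicalType) := Chart {
  dom : set T;
  cod : set 'rV[R]_n;
  fwd : T -> 'rV[R]_n;
  bwd : 'rV[R]_n -> T;
  open_dom : open dom;
  open_cod : open cod;
  fwd_cod : forall p, dom p -> cod (fwd p);
  bwd_dom : forall x, cod x -> dom (bwd x);
  fwdK : forall p, dom p -> bwd (fwd p) = p;
  bwdK : forall x, cod x -> fwd (bwd x) = x;
  fwd_continuous : continuous_on dom fwd;
  bwd_continuous : continuous_on cod bwd }.

Definition transition (R : realType) (n : nat) (T : topologicalType)
    (c c' : chart R n T) : 'rV[R]_n -> 'rV[R]_n :=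
  fwd c' \o bwd c.

Definition overlap (R : realType) (n : nat) (T : topologicalType)
    (c c' : chart R n T) : set 'rV[R]_n :=
  cod c `&` bwd c @^-1` dom c'.

Record smoothManifold (R : realType) (n : nat) := SmoothManifold {
  points :> topologicalType;
  points_hausdorff : hausdorff_space points;
  points_second_countable : @second_countable points;
  atlas : set (chart R n points);
  atlas_cover : forall p : points, exists2 c, atlas c & dom c p;
  atlas_smooth : forall c c', atlas c -> atlas c' ->
    smooth_on (overlap c c') (transition c c') }.

Definition chart_at (R : realType) (n : nat) (M : smoothManifold R n) (p : M) :
    chart R n M :=
  s2val (cid2 (atlas_cover p)).

(** [U] open in R^n. *)
Definition smooth_into (R : realType) (m n : nat) (N : smoothManifold R n)
    (U : set 'rV[R]_m) (f : 'rV[R]_m -> N) :=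
  continuous_on U f /\
  forall c, atlas (s := N) c -> smooth_on (U `&` f @^-1` dom c) (fwd c \o f).

(** [W] open in [M]. *)
Definition smooth_from (R : realType) (m n : nat) (M : smoothManifold R m)
    (W : set M) (f : M -> 'rV[R]_n) :=
  forall c, atlas (s := M) c -> smooth_on (cod c `&` bwd c @^-1` W) (f \o bwd c).

Definition smooth_map (R : realType) (m n : nat) (M : smoothManifold R m)
    (N : smoothManifold R n) (F : M -> N) :=
  forall c, atlas (s := M) c -> smooth_into (cod c) (F \o bwd c).

Definition diffeomorphism (R : realType) (m n : nat) (M : smoothManifold R m)
    (N : smoothManifold R n) (F : M -> N) :=
  smooth_map F /\
  exists G : N -> M, [/\ cancel F G, cancel G F & smooth_map G].

Definition inner (R : realType) (n : nat) (g : 'M[R]_n) (u v : 'rV[R]_n) : R :=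
  (u *m g *m v^T) 0 0.

(** [metric c x] is the matrix (g_ij) in the chart [c] at the coordinates [x]. *)
Record riemannianManifold (R : realType) (n : nat) := RiemannianManifold {
  manifold :> smoothManifold R n;
  metric : chart R n manifold -> 'rV[R]_n -> 'M[R]_n;
  metric_smooth : forall c, atlas c ->
    forall i j, smooth_fun (cod c) (fun x => metric c x i j);
  metric_sym : forall c, atlas c -> forall x, cod c x ->
    (metric c x)^T = metric c x;
  metric_pos : forall c, atlas c -> forall x, cod c x ->
    forall v, v != 0 -> 0 < inner (metric c x) v v;
  metric_transition : forall c c', atlas c -> atlas c' ->
    forall x, overlap c c' x ->
    let J := jacobian (transition c c') x in
    metric c x = J *m metric c' (transition c c' x) *m J^T }.

Definition C1_curve (R : realType) (n : nat) (M : smoothManifold R n) (a b : R)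
    (gamma : R -> M) :=
  forall t, t \in `]a, b[ ->
    {for t, continuous gamma} /\
    forall c, atlas c -> dom c (gamma t) ->
      derivable (fwd c \o gamma) t 1 /\
      {for t, continuous (derive1 (fwd c \o gamma))}.

(** On each interval of a subdivision of [0, 1], [gamma] is C^1 up to the end
    points, i.e. agrees with a curve that is C^1 on a larger open interval. *)
Definition piecewise_C1 (R : realType) (n : nat) (M : smoothManifold R n)
    (gamma : R -> M) :=
  exists (k : nat) (t : nat -> R),
    [/\ t 0%N = 0, t k = 1 &
     forall i, (i < k)%N ->
       t i < t i.+1 /\
       exists (eta : R -> M) (e : R),
         [/\ 0 < e, C1_curve (t i - e) (t i.+1 + e) eta &
          {in `[t i, t i.+1], gamma =1 eta}]].

Definition speed (R : realType) (n : nat) (M : riemannianManifold R n)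
    (gamma : R -> M) (t : R) : R :=
  let c := chart_at (gamma t) in
  let v := derive1 (fwd c \o gamma) t in
  Num.sqrt (inner (metric c (fwd c (gamma t))) v v).

Definition curve_length (R : realType) (n : nat) (M : riemannianManifold R n)
    (gamma : R -> M) : R :=
  (\int[lebesgue_measure]_(t in `[0, 1]) speed gamma t)%R.

(** Meaningful for connected [M], where the set is nonempty ([inf set0] is 0). *)
Definition rdist (R : realType) (n : nat) (M : riemannianManifold R n)
    (p q : M) : R :=
  inf [set l | exists gamma : R -> M,
    [/\ piecewise_C1 gamma, gamma 0 = p, gamma 1 = q & curve_length gamma = l]].

(** Gamma^k_ij, upper index first. *)
Definition christoffel (R : realType) (n : nat) (g : 'rV[R]_n -> 'M[R]_n)
    (k i j : 'I_n) (x : 'rV[R]_n) : R :=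
  2^-1 * \sum_(l < n) invmx (g x) k l *
    (partial i (fun y => g y j l) x + partial j (fun y => g y i l) x
     - partial l (fun y => g y i j) x).

(** The [l]-th component of R(d_i, d_j) d_k, for the sign convention
    R(U, V) W = D_U D_V W - D_V D_U W - D_[U, V] W. *)
Definition curvature_coef (R : realType) (n : nat) (g : 'rV[R]_n -> 'M[R]_n)
    (l i j k : 'I_n) (x : 'rV[R]_n) : R :=
  partial i (christoffel g l j k) x - partial j (christoffel g l i k) x
  + \sum_(m < n) (christoffel g m j k x * christoffel g l i m x
                  - christoffel g m i k x * christoffel g l j m x).

Definition curvature (R : realType) (n : nat) (g : 'rV[R]_n -> 'M[R]_n)
    (x u v w : 'rV[R]_n) : 'rV[R]_n :=
  \row_(l < n) \sum_(i < n) \sum_(j < n) \sum_(k < n)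
    curvature_coef g l i j k x * u 0 i * v 0 j * w 0 k.

Definition sectional_curvature (R : realType) (n : nat)
    (g : 'rV[R]_n -> 'M[R]_n) (x u v : 'rV[R]_n) : R :=
  inner (g x) (curvature g x u v v) u /
  (inner (g x) u u * inner (g x) v v - inner (g x) u v ^+ 2).

(** |Sec_M| <= K (vacuous in dimension 1). *)
Definition sec_bounded (R : realType) (n : nat) (M : riemannianManifold R n)
    (K : R) :=
  forall c, atlas (s := M) c -> forall x, cod c x ->
  forall u v : 'rV[R]_n, row_free (col_mx u v) ->
    `|sectional_curvature (metric c) x u v| <= K.

Definition geodesic (R : realType) (n : nat) (M : riemannianManifold R n)
    (a b : R) (gamma : R -> M) :=
  forall t, t \in `]a, b[ ->
    {for t, continuous gamma} /\
    forall c, atlas (s := M) c -> dom c (gamma t) ->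
      let x := fwd c \o gamma in
      [/\ derivable x t 1, derivable (derive1 x) t 1 &
       forall k : 'I_n,
         derive1 (derive1 x) t 0 k +
         \sum_(i < n) \sum_(j < n) christoffel (metric c) k i j (x t) *
           derive1 x t 0 i * derive1 x t 0 j = 0].

(** exp_p(v) is defined and equal to [q]; tangent vectors at [p] are given by
    their components in [chart_at p]. *)
Definition is_exp (R : realType) (n : nat) (M : riemannianManifold R n)
    (p : M) (v : 'rV[R]_n) (q : M) :=
  exists (gamma : R -> M) (e : R),
    [/\ 0 < e, geodesic (- e) (1 + e) gamma, gamma 0 = p,
        derive1 (fwd (chart_at p) \o gamma) 0 = v & gamma 1 = q].

Definition tangent_ball (R : realType) (n : nat) (M : riemannianManifold R n)
    (p : M) (rho : R) : set 'rV[R]_n :=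
  [set v | inner (metric (chart_at p) (fwd (chart_at p) p)) v v < rho ^+ 2].

(** exp_p is defined on the open ball of radius [rho] of T_pM, and is a
    diffeomorphism from it onto an open subset of M. *)
Definition exp_diffeo (R : realType) (n : nat) (M : riemannianManifold R n)
    (p : M) (rho : R) :=
  let B := tangent_ball p rho in
  exists (e : 'rV[R]_n -> M) (f : M -> 'rV[R]_n),
    [/\ forall v, B v -> is_exp p v (e v),
        forall v, B v -> f (e v) = v,
        smooth_into B e,
        open (e @` B) &
        smooth_from (e @` B) f].

Definition inj_radius_at (R : realType) (n : nat) (M : riemannianManifold R n)
    (p : M) : \bar R :=
  ereal_sup [set rho%:E | rho in [set rho : R | 0 < rho /\ exp_diffeo p rho]].

Definition inj_radius (R : realType) (n : nat) (M : riemannianManifold R n) :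
    \bar R :=
  ereal_inf (range (@inj_radius_at R n M)).

Definition is_net (R : realType) (Y : Type) (d : Y -> Y -> R) (eps : R)
    (S : set Y) :=
  forall y, exists2 s, S s & d y s <= eps.

(* Main.v *)
(** Any manifold compatible with the data may serve as the reconstruction; taking
    one whose injectivity radius is almost maximal leaves only (1) to be proved,
    i.e. that two manifolds [M], [N] compatible with the same data are close.  In
    units of [r] both have curvature [O(eps)], where [eps = K r^2 = delta / r], on
    normal balls of radius 2, so by the Riccati equation along rays the functions
    [d(x_j, .)^2 / 2] are almost quadratic.  For [y] in [M] let [F y] be the critical
    point, near the corresponding net points, of the weighted sum over a separated
    subnet of the squares of [d(x_j, .)^2 / 2] in [N] minus its value at [y] in [M].
    It is smooth by the implicit function theorem.  By the law of cosines, the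
    gradients on the two sides have almost equal Gram matrices, which makes [dF]
    an isometry up to a factor [1 + O(eps)]. *)

(* The injectivity radius cannot be maximized outright: the supremum over the compatible manifolds
   may be infinite or not attained. The cap and the factor slightly below 1 in (3) are the price of
   an almost maximal choice, and [C9 = 1] works because the chosen manifold is itself compatible
   with the data. The obstacle in (1) is a loss of order [sqrt eps]: functions known up to [eps]
   with bounded Hessians have gradients known only up to [sqrt eps]. Least squares avoid it. In the
   differentiated critical equation the Hessians and the derivatives of the weights are multiplied
   by differences of values, which are already [O(eps)], so crude bounds on them suffice; the
   remaining term contains the gradients, whose inner products are determined by distances up to
   [O(eps)]. The weights depend on the point of M alone, are bounded below near it and vanish at
   distance [r / 4]. Hence the number of active terms is bounded in terms of n, while every
   direction is seen by one of them, and all constants depend on n only. *)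
From HB Require Import structures.
Require Import Defs.
From mathcomp Require Import all_boot all_order all_algebra.
From mathcomp Require Import all_classical all_reals all_analysis.
From mathcomp Require Import ring lra.
Import Order.TTheory GRing.Theory Num.Theory.
Import numFieldNormedType.Exports.

Set Implicit Arguments.
Unset Strict Implicit.
Unset Printing Implicit Defensive.

Local Open Scope classical_set_scope.
Local Open Scope ring_scope.

Implicit Types (R : realType) (n : nat).

(* The standard [done] also tries [discriminate] and [contradiction] on every
   hypothesis; head-normalizing equations between derivatives takes seconds. *)
Ltac done := trivial; hnf; intros; solve
  [ do ![solve [trivial | simple refine (@sym_equal _ _ _ _); trivial] | split]
  | match goal with
    | H : ~ _ |- _ => solve [case H; trivial]
    | H : is_true _ |- _ => discriminate H
    | H : False |- _ => case H
    end ].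

Ltac itv_lra := apply/andP; split; lra.

(** * Calculus in R^n *)

Section Euclid.
Context R n.
Implicit Types u v w : 'rV[R]_n.

Definition dot u v : R := \sum_i u 0 i * v 0 i.
(** On row vectors [|u|] is the maximum norm, in which limits and differentials are expressed; the
    geometry needs the Euclidean norm. [norm_le_enorm] and [enorm_le_norm] pass from one to the
    other. *)
Definition enorm u : R := Num.sqrt (dot u u).

Lemma dotC u v : dot u v = dot v u.
Proof. by apply: eq_bigr => i _; rewrite mulrC. Qed.

Lemma dotDl u v w : dot (u + v) w = dot u w + dot v w.
Proof. by rewrite -big_split; apply: eq_bigr => i _; rewrite mxE mulrDl. Qed.

Lemma dotZl a u v : dot (a *: u) v = a * dot u v.
Proof. by rewrite mulr_sumr; apply: eq_bigr => i _; rewrite mxE mulrA. Qed.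

Lemma dotNl u v : dot (- u) v = - dot u v.
Proof. by rewrite -scaleN1r dotZl mulN1r. Qed.

Lemma dotBl u v w : dot (u - v) w = dot u w - dot v w.
Proof. by rewrite dotDl dotNl. Qed.

Lemma dotDr u v w : dot w (u + v) = dot w u + dot w v.
Proof. by rewrite dotC dotDl !(dotC w). Qed.

Lemma dotZr a u v : dot v (a *: u) = a * dot v u.
Proof. by rewrite dotC dotZl (dotC v). Qed.

Lemma dotNr u v : dot v (- u) = - dot v u.
Proof. by rewrite dotC dotNl (dotC v). Qed.

Lemma dotBr u v w : dot w (u - v) = dot w u - dot w v.
Proof. by rewrite dotDr dotNr. Qed.

Lemma dot0l u : dot 0 u = 0.
Proof. by rewrite -(scale0r 0) dotZl mul0r. Qed.

Lemma dot0r u : dot u 0 = 0.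
Proof. by rewrite dotC dot0l. Qed.

Lemma dot_suml (I : Type) (r : seq I) (P : pred I) (F : I -> 'rV[R]_n) v :
  dot (\sum_(i <- r | P i) F i) v = \sum_(i <- r | P i) dot (F i) v.
Proof.
elim/big_rec2 : _ => [|i x y _ <-]; first by rewrite dot0l.
by rewrite dotDl.
Qed.

Lemma dot_sumr (I : Type) (r : seq I) (P : pred I) (F : I -> 'rV[R]_n) v :
  dot v (\sum_(i <- r | P i) F i) = \sum_(i <- r | P i) dot v (F i).
Proof. by rewrite dotC dot_suml; apply: eq_bigr => i _; rewrite dotC. Qed.

Lemma dot_ge0 u : 0 <= dot u u.
Proof. by apply: sumr_ge0 => i _; rewrite -expr2 sqr_ge0. Qed.

Lemma coord_sqr_le_dot u i : u 0 i ^+ 2 <= dot u u.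
Proof.
rewrite /dot (bigD1 i) //= -expr2 lerDl.
by apply: sumr_ge0 => j _; rewrite -expr2 sqr_ge0.
Qed.

Lemma dot_eq0 u : dot u u = 0 -> u = 0.
Proof.
move=> u0; apply/rowP => i; rewrite mxE; apply/eqP.
by rewrite -sqrf_eq0 eq_le sqr_ge0 andbT -u0 coord_sqr_le_dot.
Qed.

Lemma dot_gt0 u : u != 0 -> 0 < dot u u.
Proof.
by move=> u0; rewrite lt_def dot_ge0 andbT; apply: contra u0 => /eqP/dot_eq0 ->.
Qed.

Lemma enorm_ge0 u : 0 <= enorm u. Proof. exact: sqrtr_ge0. Qed.

Lemma sqr_enorm u : enorm u ^+ 2 = dot u u.
Proof. by rewrite sqr_sqrtr ?dot_ge0. Qed.

Lemma enorm0 : enorm 0 = 0.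
Proof. by rewrite /enorm dot0l sqrtr0. Qed.

Lemma enorm_eq0 u : enorm u = 0 -> u = 0.
Proof. by move=> u0; apply: dot_eq0; rewrite -sqr_enorm u0 expr0n. Qed.

Lemma enorm_gt0 u : u != 0 -> 0 < enorm u.
Proof. by move=> u0; rewrite sqrtr_gt0 dot_gt0. Qed.

Lemma enormZ a u : enorm (a *: u) = `|a| * enorm u.
Proof.
rewrite /enorm dotZl dotZr mulrA -expr2 sqrtrM ?sqr_ge0//.
by rewrite sqrtr_sqr.
Qed.

Lemma enormN u : enorm (- u) = enorm u.
Proof. by rewrite /enorm dotNl dotNr opprK. Qed.

Lemma abs_dot_le u v : `|dot u v| <= enorm u * enorm v.
Proof.
have [->|u0] := eqVneq u 0; first by rewrite dot0l enorm0 normr0 mul0r.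
have uu := dot_gt0 u0.
rewrite -(@ler_pXn2r _ 2) ?nnegrE ?mulr_ge0 ?enorm_ge0//.
rewrite real_normK ?num_real// exprMn !sqr_enorm.
have := dot_ge0 (dot u u *: v - dot u v *: u).
rewrite dotBl !dotBr !dotZl !dotZr (dotC v u) => h.
rewrite -(ler_pM2l uu).
nra.
Qed.

Lemma dot_le u v : dot u v <= enorm u * enorm v.
Proof. exact: le_trans (ler_norm _) (abs_dot_le _ _). Qed.

Lemma enormD u v : enorm (u + v) <= enorm u + enorm v.
Proof.
rewrite -(@ler_pXn2r _ 2) ?nnegrE ?addr_ge0 ?enorm_ge0//.
rewrite sqr_enorm dotDl !dotDr (dotC v u) sqrrD !sqr_enorm.
by have := dot_le u v; lra.
Qed.

Lemma enormBC u v : enorm (u - v) = enorm (v - u).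
Proof. by rewrite -enormN opprB. Qed.

Lemma coord_le_enorm u i : `|u 0 i| <= enorm u.
Proof.
rewrite -(@ler_pXn2r _ 2) ?nnegrE ?enorm_ge0//.
by rewrite real_normK ?num_real// sqr_enorm coord_sqr_le_dot.
Qed.

Lemma coord_le_norm u i : `|u 0 i| <= `|u|.
Proof.
rewrite [leRHS]/Num.Def.normr/= mx_normrE.
exact: (le_bigmax _ (fun p => `|u p.1 p.2|) (0, i)).
Qed.

Lemma norm_le_enorm u : `|u| <= enorm u.
Proof.
rewrite [leLHS]/Num.Def.normr/= mx_normrE.
apply: bigmax_le; first exact: enorm_ge0.
by move=> [i j] _; rewrite (ord1 i) coord_le_enorm.
Qed.

Lemma enorm_le_norm u : enorm u <= n%:R * `|u|.
Proof.
rewrite -(@ler_pXn2r _ 2) ?nnegrE ?mulr_ge0 ?enorm_ge0//.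
rewrite sqr_enorm exprMn.
apply: (@le_trans _ _ (\sum_(i < n) `|u| ^+ 2)).
  apply: ler_sum => i _; rewrite -expr2 -real_normK ?num_real//. by rewrite ler_pXn2r ?nnegrE// coord_le_norm.
rewrite sumr_const card_ord -[leLHS]mulr_natl ler_wpM2r ?sqr_ge0//.
by rewrite expr2 -natrM ler_nat; case: (n) => // m; rewrite leq_pmulr.
Qed.

Lemma continuous_coord (T : topologicalType) (f : T -> 'rV[R]_n) x i :
  {for x, continuous f} -> {for x, continuous (fun y => f y 0 i)}.
Proof.
move=> fx; apply: (@continuous_comp _ _ _ f (fun M : 'rV[R]_n => M 0 i)) => //.
exact: coord_continuous.
Qed.

Lemma continuous_sum (T : topologicalType) (I : Type) (r : seq I) (P : pred I)
    (F : I -> T -> R) x :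
  (forall i, P i -> {for x, continuous (F i)}) ->
  {for x, continuous (fun y => \sum_(i <- r | P i) F i y)}.
Proof.
by move=> H; apply: cvg_big => //; move=> [a b]; apply: (@add_continuous R).
Qed.

Lemma continuous_dot (T : topologicalType) (f g : T -> 'rV[R]_n) x :
  {for x, continuous f} -> {for x, continuous g} ->
  {for x, continuous (fun y => dot (f y) (g y))}.
Proof.
move=> fx gx; apply: continuous_sum => i _.
apply: continuousM; first exact: continuous_coord.
exact: continuous_coord.
Qed.

Lemma continuous_enorm (T : topologicalType) (f : T -> 'rV[R]_n) x :
  {for x, continuous f} -> {for x, continuous (fun y => enorm (f y))}.
Proof.
move=> fx; apply: continuous_comp (@sqrt_continuous R _).
exact: (continuous_dot fx fx).
Qed.

Lemma open_eball (p : 'rV[R]_n) (s : R) : open [set x | enorm (x - p) < s].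
Proof.
rewrite openE => x /= xs.
have c : {for x, continuous (fun y : 'rV[R]_n => enorm (y - p))}.
  apply: continuous_enorm; apply: (@continuousB R 'rV[R]_n 'rV[R]_n id (cst p)).
    exact: cvg_id.
  exact: cst_continuous.
near=> y; near: y.
by move/cvgr_lt : c => /(_ s xs).
Unshelve. all: by end_near.
Qed.

Lemma rV_sum_delta u : u = \sum_i u 0 i *: delta_mx 0 i.
Proof. exact: row_sum_delta. Qed.

Lemma dot_delta u i : dot u (delta_mx 0 i) = u 0 i.
Proof.
rewrite /dot (bigD1 i) //= mxE !eqxx mulr1 big1 ?addr0// => j ji.
by rewrite mxE (negbTE ji) andbF mulr0.
Qed.

End Euclid.

Section Line.
Variables (R : realType) (V W : normedModType R).

Lemma is_derive_line (f : V -> W) (y v : V) (s : R) :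
  derivable f (y + s *: v) v ->
  is_derive s 1 (fun t => f (y + t *: v)) ('D_v f (y + s *: v)).
Proof.
have e : (fun h : R => h^-1 *:
    (((fun t => f (y + t *: v)) \o shift s) (h *: 1) - f (y + s *: v))) =
  (fun h => h^-1 *: ((f \o shift (y + s *: v)) (h *: v) - f (y + s *: v))).
  apply/funext => h /=; congr (_ *: (f _ - _)). by rewrite [h%:A]mulr1 scalerDl addrCA.
by move=> df; apply: DeriveDef; rewrite /derivable /derive e.
Qed.
End Line.

Lemma is_diff_lin R (V W : normedModType R) (f : V -> W) (x : V)
    (L : {linear V -> W}) : continuous L ->
  (forall e, 0 < e -> \forall h \near (0 : V),
     `|f (h + x) - f x - L h| <= e * `|h|) ->
  is_diff x f L.
Proof.
move=> cL H.
have e : f \o shift x = cst (f x) + (L : _ -> _) +o_ 0 id.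
  apply/eqaddoP => e e0. near=> h. rewrite /= !fctE /= opprD addrA. by near: h; apply: H.
have de := diff_unique cL e.
by apply: DiffDef => //; apply/diff_locallyP; rewrite de.
Unshelve. all: by end_near. Qed.

Section FrechetRow.
Context R n.
Implicit Types (f : 'rV[R]_n -> R) (U : set 'rV[R]_n).

Lemma is_diff_row (f : 'rV[R]_n -> R) x (a : 'I_n -> R) :
  (forall e, 0 < e -> \forall h \near (0 : 'rV[R]_n),
     `|f (h + x) - f x - \sum_i h 0 i * a i| <= e * `|h|) ->
  is_diff x f (fun h => \sum_i h 0 i * a i).
Proof.
move=> H.
pose d (h : 'rV[R]_n) := \sum_i h 0 i * a i.
have lind : linear d.
  move=> c u v; rewrite /d /GRing.scale /= mulr_sumr -big_split /=. by apply: eq_bigr => i _; rewrite !mxE mulrDl mulrA.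
pose dM := GRing.isLinear.Build _ _ _ _ _ lind.
pose dL : {linear 'rV[R]_n -> R^o} := HB.pack d dM.
apply: (@is_diff_lin R 'rV[R]_n R^o f x dL _ H) => h.
apply: (@continuous_sum R 'rV[R]_n) => i _.
apply: (@continuousM R 'rV[R]_n); last exact: cst_continuous.
exact: coord_continuous.
Qed.

Lemma mvt_line f (y v : 'rV[R]_n) (c : R) :
  (forall s, `|s| <= `|c| -> derivable f (y + s *: v) v) ->
  exists2 s, `|s| <= `|c| & f (y + c *: v) - f y = c * 'D_v f (y + s *: v).
Proof.
move=> df.
pose g t := f (y + t *: v).
have dg (s : R) : `|s| <= `|c| -> is_derive s 1 g ('D_v f (y + s *: v)) by move=> sc; apply: is_derive_line; apply: df.
have [c0|c0] := leP 0 c.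
  have sc s : s \in `[0, c] -> `|s| <= `|c| by rewrite in_itv /= => /andP[s0 s1]; rewrite !ger0_norm.
  have := @MVT_segment R g (fun s => 'D_v f (y + s *: v)) 0 c c0. case.
  - by move=> s /subset_itv_oo_cc/sc; exact: dg.
  - by apply: derivable_within_continuous => s /sc/dg[].
  move=> s /sc ss; rewrite /g scale0r addr0 subr0 => ->. by exists s => //; rewrite mulrC.
have sc s : s \in `[c, 0] -> `|s| <= `|c| by rewrite in_itv /= => /andP[s0 s1]; rewrite !ler0_norm ?(ltW c0)// lerN2.
have := @MVT_segment R g (fun s => 'D_v f (y + s *: v)) c 0 (ltW c0).
case.
- by move=> s /subset_itv_oo_cc/sc; exact: dg.
- by apply: derivable_within_continuous => s /sc/dg[].
move=> s /sc ss; rewrite /g scale0r addr0 sub0r => e.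
by exists s => //; rewrite mulrC; move: e; lra.
Qed.

(** The vertices of the path from 0 to [h] along the coordinate axes; on each edge only one partial
    derivative enters. *)
Definition trunc_row (h : 'rV[R]_n) (k : nat) : 'rV[R]_n :=
  \row_i (if (i < k)%N then h 0 i else 0).

Lemma trunc_rowS (h : 'rV[R]_n) (k : 'I_n) :
  trunc_row h k.+1 = trunc_row h k + h 0 k *: delta_mx 0 k.
Proof.
apply/rowP => i; rewrite !mxE eqxx /= ltnS.
have [->|ik] := eqVneq i k; first by rewrite leqnn ltnn mulr1 add0r.
by rewrite mulr0 addr0 leq_eqVlt [_ == _](negbTE ik).
Qed.

Lemma norm_row_le (u : 'rV[R]_n) (e : R) : 0 <= e ->
  (forall i, `|u 0 i| <= e) -> `|u| <= e.
Proof.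
move=> e0 H; rewrite [leLHS]/Num.Def.normr/= mx_normrE.
by apply: bigmax_le => // -[i j] _; rewrite (ord1 i).
Qed.

Lemma trunc_row_between (h : 'rV[R]_n) (k : 'I_n) s : `|s| <= `|h 0 k| ->
  `|trunc_row h k + s *: delta_mx 0 k| <= `|h|.
Proof.
move=> sh; apply: norm_row_le => // i; rewrite !mxE eqxx /=.
have [->|ik] := eqVneq i k.
  by rewrite ltnn add0r mulr1 (le_trans sh)// coord_le_norm.
rewrite mulr0 addr0; case: ifP => _; last by rewrite normr0.
exact: coord_le_norm.
Qed.

(** The increment of [f] telescopes along the path [trunc_row]. The mean value theorem turns each
    edge into a partial derivative at a nearby point, and continuity replaces it by the value at
    [x]. *)
Lemma C1_is_diff U f x : open U -> U x -> Ck 1 U f ->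
  is_diff x f (fun h => \sum_i h 0 i * partial i f x).
Proof.
move=> oU Ux [_ C1]; apply: is_diff_row => e e0.
(* Each of the [n] edges gets the share [e / n%:R] of the error, so dimension 0 is treated apart. *)
have [n0|n_gt0] := posnP n.
  near=> h. have -> : h = 0 by apply/rowP => i; have := ltn_ord i; rewrite [X in (_ < X)%N]n0.
  rewrite add0r subrr add0r big1 ?normrN ?normr0 ?mulr0//. by move=> i _; rewrite mxE mul0r.
have n0 : 0 < (n%:R : R) by rewrite ltr0n.
have Unear : \forall y \near x, U y by apply: open_nbhs_nbhs.
have cnear : \forall y \near x, forall i : 'I_n, `|partial i f x - partial i f y| <= e / n%:R.
  apply: (@filter_forall _ _ (fun i y => `|partial i f x - partial i f y| <= e / n%:R) (nbhs x)) => i. have [_ [ci _]] := C1 i.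
  by have /cvgrPdist_le := ci x Ux; apply; rewrite divr_gt0.
have /nbhs_ballP[d /= d0 dP] : nbhs x
    [set y | U y /\ forall i, `|partial i f x - partial i f y| <= e / n%:R].
  by near=> y; split; [near: y|near: y].
have hd : \forall h \near (0 : 'rV[R]_n), `|h| < d.
  exact: nbhs0_lt.
near=> h.
have hlt : `|h| < d by near: h.
have seg (k : 'I_n) s : `|s| <= `|h 0 k| ->
    U (x + trunc_row h k + s *: delta_mx 0 k) /\ forall i,
    `|partial i f x - partial i f (x + trunc_row h k + s *: delta_mx 0 k)| <= e / n%:R.
  move=> sh; apply: dP; rewrite -ball_normE /= -!addrA opprD addNKr normrN. exact: le_lt_trans (trunc_row_between sh) hlt.
have step (k : 'I_n) : exists2 s, `|s| <= `|h 0 k| &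
    f (x + trunc_row h k.+1) - f (x + trunc_row h k) =
    h 0 k * partial k f (x + trunc_row h k + s *: delta_mx 0 k).
  rewrite trunc_rowS addrA; apply: mvt_line => s sh. by have [dk _] := C1 k; apply: dk; have [] := seg k s sh.
have tel : f (h + x) - f x = \sum_(k < n) (f (x + trunc_row h k.+1) - f (x + trunc_row h k)).
  rewrite -(big_mkord xpredT (fun k => f (x + trunc_row h k.+1) - f (x + trunc_row h k))).
  rewrite telescope_sumr//; congr (f _ - f _).
    by rewrite addrC; congr (_ + _); apply/rowP => i; rewrite mxE ltn_ord.
  by rewrite -[LHS]addr0; congr (_ + _); apply/rowP => i; rewrite !mxE.
rewrite tel -sumrB.
apply: le_trans (ler_norm_sum _ _ _) _.
apply: (@le_trans _ _ (\sum_(k < n) `|h| * (e / n%:R))).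
  apply: ler_sum => k _; have [s sh ->] := step k. rewrite -mulrBr normrM; apply: ler_pM => //; first exact: coord_le_norm.
  by rewrite distrC; have [_] := seg k s sh; apply.
rewrite sumr_const card_ord -[_ *+ n]mulr_natr.
by rewrite -!mulrA mulVf ?gt_eqF// mulr1 mulrC.
Unshelve. all: by end_near. Qed.

End FrechetRow.

Lemma continuous_near (T U : topologicalType) (f g : T -> U) x :
  (\near x, f x = g x) -> {for x, continuous f} -> {for x, continuous g}.
Proof.
move=> fg; rewrite /prop_for /continuous_at -(nbhs_singleton fg) => cf.
by apply: cvg_trans cf; apply: near_eq_cvg; apply: filterS fg => y.
Qed.

Local Notation mxfun R n m l := ('rV[R]_n -> 'M[R]_(m, l)).

(** * Closure properties of smooth functions *)

Section SmoothClosure.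
Variables (R : realType).

Section Row.
Variable n : nat.
Implicit Types (f g : 'rV[R]_n -> R) (U V : set 'rV[R]_n).

Lemma derive_row_sum f x v : differentiable f x ->
  'D_v f x = \sum_i v 0 i * partial i f x.
Proof.
move=> df; rewrite deriveE// [in LHS](rV_sum_delta v) linear_sum.
by apply: eq_bigr => i _; rewrite linearZ /= /partial deriveE.
Qed.

Lemma partial_near i f g x : (\near x, f x = g x) -> partial i f x = partial i g x.
Proof. exact: near_eq_derive. Qed.

Lemma differentiable_near f g x :
  (\near x, f x = g x) -> differentiable f x -> differentiable g x.
Proof.
move=> fg df.
have H e : 0 < e -> \forall h \near (0 : 'rV[R]_n), `|g (h + x) - g x - 'd f x h| <= e * `|h|.
  move=> e0. have gx : f x = g x by apply: (nbhs_singleton fg). have /eqaddoP/(_ _ e0) := diff_locally df.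
  have : \forall h \near (0 : 'rV[R]_n), f (h + x) = g (h + x) by move: fg; rewrite (near_shift 0) subr0. move=> h1 h2; near=> h.
  have -> : g (h + x) = f (h + x) by apply/esym; near: h. rewrite -gx -addrA -opprD. by near: h; exact: h2.
have [] // := @is_diff_lin R 'rV[R]_n R^o g x ('d f x) _ H.
by apply: diff_continuous.
Unshelve. all: by end_near. Qed.

Lemma open_eq_near U f g x : open U -> U x -> (forall y, U y -> f y = g y) ->
  \near x, f x = g x.
Proof.
move=> oU Ux fg; apply: (@filterS _ (nbhs x) _ U) => //.
exact: open_nbhs_nbhs.
Qed.

Lemma Ck_ext k U f g : open U -> (forall x, U x -> f x = g x) ->
  Ck k U f -> Ck k U g.
Proof.
move=> oU; elim: k f g => [|k IH] f g fg; move=> [cf].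
  split=> // x Ux; apply: continuous_near (cf x Ux). exact: open_eq_near fg.
move=> /= H; split.
  move=> x Ux; apply: continuous_near (cf x Ux). exact: open_eq_near fg.
move=> i; have [d c] := H i; split.
  move=> x Ux; apply: near_eq_derivable (d x Ux); exact: open_eq_near fg.
apply: IH c => x Ux; apply: partial_near; exact: open_eq_near fg.
Qed.

Lemma smooth_ext U f g : open U -> (forall x, U x -> f x = g x) ->
  smooth_fun U f -> smooth_fun U g.
Proof. by move=> oU fg sf k; apply: Ck_ext fg (sf k). Qed.

Lemma Ck_local k U f :
  (forall x, U x -> exists2 V, V x & Ck k V f) -> Ck k U f.
Proof.
elim: k f => [|k IH] f H.
  by split=> // x /H[V Vx [+ _]]; exact.
split; first by move=> x /H[V Vx [+ _]]; exact.
move=> i; split; first by move=> x /H[V Vx [_ /(_ i)[+ _]]]; exact.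
by apply: IH => x /H[V Vx [_ /(_ i)[_ c]]]; exists V.
Qed.

Lemma smooth_local U f :
  (forall x, U x -> exists2 V, V x & smooth_fun V f) -> smooth_fun U f.
Proof. by move=> H k; apply: Ck_local => x /H[V Vx sV]; exists V. Qed.

Lemma smooth_sub U V f : V `<=` U -> smooth_fun U f -> smooth_fun V f.
Proof. by move=> VU sf k; apply: Ck_local => x /VU Ux; exists U. Qed.

(** A class of differentiable functions that contains the partial derivatives of its members, up to
    equality on [U], consists of smooth functions: induction on the order, with all members treated
    at once. This replaces higher Leibniz and chain rules. *)
Lemma smooth_coind U (P : ('rV[R]_n -> R) -> Prop) : open U ->
  (forall f, P f -> (forall x, U x -> differentiable f x) /\
    forall i, exists2 g, P g & forall x, U x -> g x = partial i f x) ->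
  forall f, P f -> smooth_fun U f.
Proof.
move=> oU H f + k; elim: k f => [|k IH] f /H[df pf].
  by split=> // x Ux; apply: differentiable_continuous; exact: df.
split; first by move=> x Ux; apply: differentiable_continuous; exact: df.
move=> i; split; first by move=> x Ux; apply: diff_derivable; exact: df.
by have [g /IH Cg gE] := pf i; apply: Ck_ext gE Cg.
Qed.

Lemma smooth_diff U f x : open U -> smooth_fun U f -> U x ->
  differentiable f x.
Proof. by move=> oU sf Ux; have [] := C1_is_diff oU Ux (sf 1%N). Qed.

Lemma smooth_partial U f i : smooth_fun U f -> smooth_fun U (partial i f).
Proof. by move=> sf k; have [_ /(_ i)[]] := sf k.+1. Qed.

Lemma smooth_continuous U f x : smooth_fun U f -> U x -> {for x, continuous f}.
Proof. by move=> sf Ux; have [+ _] := sf 0%N; exact. Qed.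

End Row.

Lemma differentiable_rowP (V : normedModType R) m (h : V -> 'rV[R]_m) x :
  (forall k, differentiable (fun y => h y 0 k) x) -> differentiable h x.
Proof.
move=> dh; have -> : h = \sum_(k < m) (fun y => h y 0 k *: (delta_mx 0 k : 'rV[R]_m)).
  by apply/funext => y; rewrite [LHS]rV_sum_delta fct_sumE.
by apply: differentiable_sum => k; apply: differentiableZl.
Qed.

Lemma derive_comp_row (V : normedModType R) m (q : 'rV[R]_m -> R) (h : V -> 'rV[R]_m)
    x v : differentiable q (h x) -> differentiable h x ->
  'D_v (q \o h) x = \sum_k 'D_v (fun y => h y 0 k) x * partial k q (h x).
Proof.
move=> dq dh; rewrite deriveE; last exact: differentiable_comp.
rewrite diff_comp//= -[X in 'd q _ X]deriveE// -deriveE// derive_row_sum//.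
apply: eq_bigr => k _; congr (_ * _).
by rewrite derive_mx ?mxE//; exact: diff_derivable.
Qed.

(** Generated so as to be visibly closed under partial derivatives, hence an instance of
    [smooth_coind]. The composition constructor takes an arbitrary smooth outer function because the
    chain rule produces its partial derivatives composed with the same inner map. *)
Inductive sgen n (U : set 'rV[R]_n) : ('rV[R]_n -> R) -> Prop :=
| sgen_ext f g : (forall x, U x -> f x = g x) -> sgen U f -> sgen U g
| sgen_base f : smooth_fun U f -> sgen U f
| sgen_comp m (V : set 'rV[R]_m) q h : open V -> smooth_fun V q ->
    smooth_on U h -> (forall x, U x -> V (h x)) -> sgen U (q \o h)
| sgen_add f g : sgen U f -> sgen U g -> sgen U (f + g)
| sgen_mul f g : sgen U f -> sgen U g -> sgen U (f * g)
| sgen_inv f : (forall x, U x -> f x != 0) -> sgen U f -> sgen U (fun x => (f x)^-1).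

Section Gen.
Variables (n : nat) (U : set 'rV[R]_n).
Hypothesis oU : open U.
Implicit Types f g : 'rV[R]_n -> R.

Lemma smooth_cst a : smooth_fun U (cst a).
Proof.
apply: (@smooth_coind _ U (fun f => exists a, f = cst a)) => //; last by exists a.
move=> f [b ->]; split=> // i; exists (cst 0); first by exists 0.
by move=> x _; rewrite /partial derive_cst.
Qed.

Lemma smooth_coord i : smooth_fun U (fun x => x 0 i).
Proof.
apply: (@smooth_coind _ U (fun f => (exists i, f = fun x => x 0 i) \/ exists a, f = cst a)) => //; last by left; exists i.
move=> f [[j ->]|[b ->]]; split=> //.
- by move=> x _; exact: differentiable_coord.
- move=> k; exists (cst ((delta_mx 0 k : 'rV[R]_n) 0 j)); first by right; eexists.
  move=> x _; rewrite /partial. have := @derive_mx R _ _ _ (@id 'rV[R]_n) x (delta_mx 0 k) (@derivable_id _ _ _ _).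
  by rewrite derive_id => /(congr1 (fun M : 'rV[R]_n => M 0 j)) e; rewrite [RHS]mxE in e.
- by move=> k; exists (cst 0); [right; exists 0|move=> x _; rewrite /partial derive_cst].
Qed.

Lemma sgen_cst a : sgen U (cst a). Proof. exact/sgen_base/smooth_cst. Qed.

Lemma sgen_sum (I : Type) (r : seq I) (F : I -> 'rV[R]_n -> R) :
  (forall i, sgen U (F i)) -> sgen U (fun x => \sum_(i <- r) F i x).
Proof.
move=> H; elim: r => [|i r IH].
  by apply: sgen_ext (sgen_cst 0) => x _; rewrite big_nil.
by apply: sgen_ext (sgen_add (H i) IH) => x _; rewrite big_cons.
Qed.

Lemma sgen_step f : sgen U f -> (forall x, U x -> differentiable f x) /\
    forall i, exists2 g, sgen U g & forall x, U x -> g x = partial i f x.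
Proof.
elim=> {f}.
- move=> f g fg _ [df pf]; split.
    by move=> x Ux; apply: differentiable_near (df x Ux); exact: open_eq_near fg.
  move=> i; have [h sh hE] := pf i; exists h => // x Ux. by rewrite hE//; apply: partial_near; exact: open_eq_near fg.
- move=> f sf; split; first by move=> x; exact: smooth_diff.
  by move=> i; exists (partial i f) => //; apply/sgen_base/smooth_partial.
- move=> m V q h oV sq sh hV.
  have dh x : U x -> differentiable h x by move=> Ux; apply: differentiable_rowP => k; exact: smooth_diff (sh k) Ux.
  have dq x : U x -> differentiable q (h x) by move=> /hV; exact: smooth_diff.
  split; first by move=> x Ux; apply: differentiable_comp; [exact: dh|exact: dq].
  move=> i; exists (fun x => \sum_k partial i (fun y => h y 0 k) x * (partial k q \o h) x).
    apply: sgen_sum => k; apply: sgen_mul; first exact/sgen_base/smooth_partial/sh.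
    by apply: sgen_comp hV => //; exact: smooth_partial.
  by move=> x Ux; rewrite /partial derive_comp_row//; [exact: dq|exact: dh].
- move=> f g sf [df pf] sg [dg pg]; split.
    by move=> x Ux; apply: differentiableD; [exact: df|exact: dg].
  move=> i; have [f' sf' f'E] := pf i; have [g' sg' g'E] := pg i. exists (f' + g'); first exact: sgen_add.
  move=> x Ux; rewrite /partial deriveD ?fctE ?f'E ?g'E//.
    exact/diff_derivable/df.
  exact/diff_derivable/dg.
- move=> f g sf [df pf] sg [dg pg]; split.
    by move=> x Ux; apply: differentiableM; [exact: df|exact: dg].
  move=> i; have [f' sf' f'E] := pf i; have [g' sg' g'E] := pg i.
  exists (f * g' + g * f'); first by apply: sgen_add; exact: sgen_mul. move=> x Ux; rewrite /partial deriveM ?fctE ?f'E ?g'E//.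
    exact/diff_derivable/df.
  exact/diff_derivable/dg.
- move=> f f0 sf [df pf]; split.
    by move=> x Ux; apply: differentiableV; [exact: df|exact: f0].
  move=> i; have [f' sf' f'E] := pf i. exists (cst (-1) * (f' * ((fun x => (f x)^-1) * (fun x => (f x)^-1)))).
    apply: sgen_mul; first exact: sgen_cst. by apply: sgen_mul => //; apply: sgen_mul; exact: sgen_inv.
  move=> x Ux; rewrite /partial deriveV; last 2 first.
    exact: f0. exact/diff_derivable/df.
  rewrite !fctE f'E// -[in RHS]/(partial i f x) /GRing.scale /=. by rewrite mulN1r mulNr; congr (- _); rewrite expr2 invfM mulrC.
Qed.

Lemma sgen_smooth f : sgen U f -> smooth_fun U f.
Proof. exact: (smooth_coind oU sgen_step). Qed.

Lemma smooth_add f g : smooth_fun U f -> smooth_fun U g -> smooth_fun U (fun x => f x + g x).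
Proof. by move=> sf sg; apply/sgen_smooth/sgen_add; exact: sgen_base. Qed.

Lemma smooth_mul f g : smooth_fun U f -> smooth_fun U g -> smooth_fun U (fun x => f x * g x).
Proof. by move=> sf sg; apply/sgen_smooth/sgen_mul; exact: sgen_base. Qed.

Lemma smooth_inv f : smooth_fun U f -> (forall x, U x -> f x != 0) ->
  smooth_fun U (fun x => (f x)^-1).
Proof. by move=> sf f0; apply/sgen_smooth/sgen_inv => //; exact: sgen_base. Qed.

Lemma smooth_opp f : smooth_fun U f -> smooth_fun U (fun x => - f x).
Proof.
move=> sf; apply: (@smooth_ext _ _ (fun x => cst (-1) x * f x)) => //.
  by move=> x _; rewrite mulN1r.
by apply: smooth_mul => //; exact: smooth_cst.
Qed.

Lemma smooth_sub_fun f g : smooth_fun U f -> smooth_fun U g -> smooth_fun U (fun x => f x - g x).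
Proof. by move=> sf sg; apply: smooth_add => //; exact: smooth_opp. Qed.

Lemma smooth_sum (I : Type) (r : seq I) (F : I -> 'rV[R]_n -> R) :
  (forall i, smooth_fun U (F i)) -> smooth_fun U (fun x => \sum_(i <- r) F i x).
Proof. by move=> H; apply/sgen_smooth/sgen_sum => i; exact: sgen_base. Qed.

Lemma smooth_prod (I : Type) (r : seq I) (F : I -> 'rV[R]_n -> R) :
  (forall i, smooth_fun U (F i)) -> smooth_fun U (fun x => \prod_(i <- r) F i x).
Proof.
move=> H; elim: r => [|i r IH].
  by apply: smooth_ext (smooth_cst 1) => // x _; rewrite big_nil.
by apply: smooth_ext (smooth_mul (H i) IH) => // x _; rewrite big_cons.
Qed.

Lemma smooth_comp m (V : set 'rV[R]_m) q h : open V -> smooth_fun V q ->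
  smooth_on U h -> (forall x, U x -> V (h x)) -> smooth_fun U (fun x => q (h x)).
Proof. by move=> oV sq sh hV; apply/sgen_smooth/(@sgen_comp _ _ _ V). Qed.

Lemma smooth_on_differentiable m (h : 'rV[R]_n -> 'rV[R]_m) x : smooth_on U h -> U x ->
  differentiable h x.
Proof.
by move=> sh Ux; apply: differentiable_rowP => k; exact: smooth_diff (sh k) Ux.
Qed.

Definition smooth_mx m l (A : mxfun R n m l) :=
  forall i j, smooth_fun U (fun x => A x i j).

Lemma smooth_mulmx m l p (A : mxfun R n m l) (B : mxfun R n l p) :
  smooth_mx A -> smooth_mx B -> smooth_mx (fun x => A x *m B x).
Proof.
move=> sA sB i j; apply: (@smooth_ext _ _ (fun x => \sum_k A x i k * B x k j)) => //.
  by move=> x _; rewrite mxE.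
by apply: smooth_sum => k; apply: smooth_mul.
Qed.

Lemma smooth_trmx m l (A : mxfun R n m l) :
  smooth_mx A -> smooth_mx (fun x => (A x)^T).
Proof.
move=> sA i j; apply: (@smooth_ext _ _ (fun x => A x j i)) => //.
by move=> x _; rewrite mxE.
Qed.

Lemma smooth_det m (A : 'rV[R]_n -> 'M[R]_m) :
  smooth_mx A -> smooth_fun U (fun x => \det (A x)).
Proof.
move=> sA; apply: smooth_sum => s; apply: smooth_mul; first exact: smooth_cst.
by apply: smooth_prod => i; exact: sA.
Qed.

Lemma smooth_invmx m (A : 'rV[R]_n -> 'M[R]_m) :
  smooth_mx A -> (forall x, U x -> A x \in unitmx) ->
  smooth_mx (fun x => invmx (A x)).
Proof.
move=> sA uA i j.
apply: (@smooth_ext _ _ (fun x => (\det (A x))^-1 * cofactor (A x) j i)) => //.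
  by move=> x Ux; rewrite /invmx uA// !mxE.
apply: smooth_mul; first apply: smooth_inv.
- exact: smooth_det.
- by move=> x /uA; rewrite unitmxE unitfE.
apply: smooth_mul; first exact: smooth_cst.
apply: smooth_det => a b.
by apply: (@smooth_ext _ _ (fun x => A x (lift j a) (lift i b))) => // x _; rewrite !mxE.
Qed.

End Gen.
End SmoothClosure.

Lemma is_derive_shift_row R (V W : normedModType R) (f : V -> W) (y v w : V) :
  derivable f (y + w) v -> is_derive y v (fun z => f (z + w)) ('D_v f (y + w)).
Proof.
have e : (fun h : R => h^-1 *: (((fun z => f (z + w)) \o shift y) (h *: v) - f (y + w))) =
  (fun h => h^-1 *: ((f \o shift (y + w)) (h *: v) - f (y + w))).
  by apply/funext => h /=; rewrite addrA.
by move=> df; apply: DeriveDef; rewrite /derivable /derive e.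
Qed.

Lemma dist_le2 R (p q r a b : R) :
  `|p - r| <= a -> `|q - r| <= b -> `|p - q| <= a + b.
Proof.
by rewrite !ler_norml => /andP[? ?] /andP[? ?]; itv_lra.
Qed.

Section Schwarz.
Context R n.

(** The mean value theorem in direction [i], applied to the difference in direction [j], then in
    direction [j]. Exchanging [i] and [j] leaves the second difference unchanged, which is the
    source of the symmetry of second derivatives. *)
Lemma second_difference (U : set 'rV[R]_n) f x i j (s : R) : smooth_fun U f ->
  (forall a b : R, `|a| <= `|s| -> `|b| <= `|s| ->
     U (x + a *: delta_mx 0 i + b *: delta_mx 0 j)) ->
  exists a b : R, [/\ `|a| <= `|s|, `|b| <= `|s| &
    f (x + s *: delta_mx 0 i + s *: delta_mx 0 j) - f (x + s *: delta_mx 0 i)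
     - (f (x + s *: delta_mx 0 j) - f x) =
    s * (s * partial j (partial i f) (x + a *: delta_mx 0 i + b *: delta_mx 0 j))].
Proof.
move=> sf HU.
pose g (y : 'rV[R]_n) := f (y + s *: delta_mx 0 j) - f y.
have dfU k y : U y -> derivable f y (delta_mx 0 k) by move=> Uy; have [_ /(_ k)[+ _]] := sf 1%N; exact.
have U0 (a : R) : `|a| <= `|s| -> U (x + a *: delta_mx 0 i) by move=> ha; have := HU a 0 ha; rewrite scale0r addr0 normr0; exact.
have dg (a : R) : `|a| <= `|s| -> is_derive (x + a *: delta_mx 0 i) (delta_mx 0 i) g
   (partial i f (x + a *: delta_mx 0 i + s *: delta_mx 0 j)
     - partial i f (x + a *: delta_mx 0 i)).
  move=> sa; apply: is_deriveB.
    by apply: is_derive_shift_row; apply: dfU; exact: HU.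
  by apply/derivableP/dfU/U0.
have [a aS ga] : exists2 a : R, `|a| <= `|s| & g (x + s *: delta_mx 0 i) - g x =
    s * 'D_(delta_mx 0 i) g (x + a *: delta_mx 0 i).
  by apply: mvt_line => a /dg[].
have dpU y : U y -> derivable (partial i f) y (delta_mx 0 j).
  move=> Uy; have /(_ 1%N)[_ /(_ j)[+ _]] := smooth_partial i sf; exact.
have [b bS gb] : exists2 b : R, `|b| <= `|s| &
    partial i f (x + a *: delta_mx 0 i + s *: delta_mx 0 j)
     - partial i f (x + a *: delta_mx 0 i) =
    s * 'D_(delta_mx 0 j) (partial i f) (x + a *: delta_mx 0 i + b *: delta_mx 0 j).
  by apply: mvt_line => b bs; apply: dpU; exact: HU.
exists a, b; split => //.
have dgv := @derive_val _ _ _ _ _ _ _ (dg a aS).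
by move: ga; rewrite dgv gb.
Qed.

Lemma partial_comm (U : set 'rV[R]_n) f x i j : open U -> U x -> smooth_fun U f ->
  partial i (partial j f) x = partial j (partial i f) x.
Proof.
move=> oU Ux sf; apply/eqP; rewrite -subr_eq0 -normr_eq0 eq_le normr_ge0 andbT.
apply/ler_addgt0Pl => e e0; rewrite addr0.
have cij k l : \forall y \near x, `|partial k (partial l f) x - partial k (partial l f) y| <= e / 2.
  have /cvgrPdist_le : {for x, continuous (partial k (partial l f))} by apply: (@smooth_continuous _ _ U) => //; do 2!apply: smooth_partial.
  by apply; rewrite divr_gt0.
have Unear : \forall y \near x, U y by apply: open_nbhs_nbhs.
have /nbhs_ballP[d /= d0 dP] : nbhs x [set y | [/\ U y,
    `|partial i (partial j f) x - partial i (partial j f) y| <= e / 2 &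
    `|partial j (partial i f) x - partial j (partial i f) y| <= e / 2]].
  by apply: filterS3 Unear (cij i j) (cij j i) => y.
(* Two displacements of size [s] must stay inside the ball of radius [d]. *)
pose s := d / 3.
have s0 : 0 < s by rewrite divr_gt0.
have ball_s k l (a b : R) : `|a| <= `|s| -> `|b| <= `|s| ->
    ball x d (x + a *: delta_mx 0 k + b *: delta_mx 0 l).
  move=> ha hb; rewrite -ball_normE /= -addrA opprD addNKr normrN. apply: (@le_lt_trans _ _ (s + s)); last by rewrite /s; lra.
  rewrite -(gtr0_norm s0); apply: le_trans (ler_normD _ _) _.
  have hd (c : R) m : `|c| <= `|s| -> `|c *: (delta_mx 0 m : 'rV[R]_n)| <= `|s|.
    move=> hc; apply: norm_row_le => // r; rewrite !mxE eqxx /=. by case: eqP => _; rewrite ?mulr1// mulr0 normr0.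
  by apply: lerD; exact: hd.
have [a [b [ha hb E1]]] := second_difference sf (fun a b ha hb => let: And3 u _ _ := dP _ (ball_s i j a b ha hb) in u).
have [a' [b' [ha' hb' E2]]] := second_difference sf (fun a b ha hb => let: And3 u _ _ := dP _ (ball_s j i a b ha hb) in u).
have E : partial j (partial i f) (x + a *: delta_mx 0 i + b *: delta_mx 0 j) =
         partial i (partial j f) (x + a' *: delta_mx 0 j + b' *: delta_mx 0 i).
  apply: (mulfI (lt0r_neq0 s0)); apply: (mulfI (lt0r_neq0 s0)). have swap (p q r u : R) : p - q - (r - u) = p - r - (q - u) by ring.
  apply: etrans (esym E1) _; apply: etrans _ E2. by rewrite (addrAC x); exact: swap.
have [_ _ h1] := dP _ (ball_s i j a b ha hb).
have [_ h2 _] := dP _ (ball_s j i a' b' ha' hb').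
rewrite E in h1.
rewrite [e]splitr; exact: dist_le2 h2 h1.
Qed.
End Schwarz.

Section Curve.
Context R n.

Lemma derive1_coord (z : R -> 'rV[R]_n) t k : derivable z t 1 ->
  is_derive t 1 (fun s => z s 0 k) (derive1 z t 0 k).
Proof.
move=> dz; apply: DeriveDef; first by have /derivable_mxP := dz; exact.
by rewrite derive1E derive_mx// mxE.
Qed.

Lemma is_derive_comp_curve (q : 'rV[R]_n -> R) (z : R -> 'rV[R]_n) t :
  differentiable q (z t) -> derivable z t 1 ->
  is_derive t 1 (fun s => q (z s)) (\sum_k derive1 z t 0 k * partial k q (z t)).
Proof.
move=> dq /[dup] dz /derivable1_diffP dz'.
have dqz : derivable (q \o z) t 1 by apply/derivable1_diffP/differentiable_comp.
apply: DeriveDef => //.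
rewrite -[LHS]/('D_1 (q \o z) t) derive_comp_row//; apply: eq_bigr => k _; congr (_ * _).
by have [] := derive1_coord k dz.
Qed.

Lemma derivable_rowP (z : R -> 'rV[R]_n) t :
  (forall k, derivable (fun s => z s 0 k) t 1) -> derivable z t 1.
Proof. by move=> H; apply/derivable_mxP => i j; rewrite (ord1 i). Qed.

End Curve.

(* The matrix-valued derivatives are locked: otherwise unification unfolds them
   down to limits of difference quotients. *)
HB.lock Definition dmx R (n m l : nat) (i : 'I_n)
    (A : mxfun R n m l) (x : 'rV[R]_n) : 'M[R]_(m, l) :=
  \matrix_(a, b) partial i (fun y => A y a b) x.

(** The connection matrix in direction [i]: for row vectors, [w *m Gam g i x] is the zero order term
    of the covariant derivative of [w]. *)
HB.lock Definition Gam R n (g : 'rV[R]_n -> 'M[R]_n)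
    (i : 'I_n) (x : 'rV[R]_n) : 'M[R]_n :=
  \matrix_(j, k) christoffel g k i j x.

HB.lock Definition jac R (n m : nat) (h : 'rV[R]_n -> 'rV[R]_m)
    (x : 'rV[R]_n) : 'M[R]_(n, m) :=
  \matrix_(a, k) partial a (fun y => h y 0 k) x.

Lemma GamEE R n (g : 'rV[R]_n -> 'M[R]_n) (i j k : 'I_n) x :
  Gam g i x j k = christoffel g k i j x.
Proof. by rewrite Gam.unlock mxE. Qed.

Lemma jacE R (n m : nat) (h : 'rV[R]_n -> 'rV[R]_m) x a k :
  jac h x a k = partial a (fun y => h y 0 k) x.
Proof. by rewrite jac.unlock mxE. Qed.

Section MatrixPartials.
Context R n.

Lemma dmxE m l (i : 'I_n) (A : mxfun R n m l) x a b :
  dmx i A x a b = partial i (fun y => A y a b) x.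
Proof. by rewrite dmx.unlock mxE. Qed.

Variable U : set 'rV[R]_n.
Hypothesis oU : open U.

Lemma partialM (f g : 'rV[R]_n -> R) x i : differentiable f x -> differentiable g x ->
  partial i (fun y => f y * g y) x = partial i f x * g x + f x * partial i g x.
Proof.
move=> df dg; rewrite /partial.
rewrite (_ : (fun y => f y * g y) = f * g)// deriveM; try exact: diff_derivable.
by rewrite /GRing.scale /=; ring.
Qed.

Lemma partialD (f g : 'rV[R]_n -> R) x i : differentiable f x -> differentiable g x ->
  partial i (fun y => f y + g y) x = partial i f x + partial i g x.
Proof.
move=> df dg; rewrite /partial.
by rewrite (_ : (fun y => f y + g y) = f + g)// deriveD; try exact: diff_derivable.
Qed.

Lemma differentiable_sum_fun (I : Type) (r : seq I) (F : I -> 'rV[R]_n -> R) x :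
  (forall k, differentiable (F k) x) ->
  differentiable (fun y => \sum_(k <- r) F k y) x.
Proof.
move=> H; elim: r => [|k r IH].
  rewrite (_ : (fun y => _) = cst 0)//; apply/funext => y; exact: big_nil.
rewrite (_ : (fun y => _) = F k + (fun y => \sum_(k <- r) F k y)); last first.
  by apply/funext => y; rewrite big_cons.
exact: differentiableD.
Qed.

Lemma partial_sum (I : Type) (r : seq I) (F : I -> 'rV[R]_n -> R) x i :
  (forall k, differentiable (F k) x) ->
  partial i (fun y => \sum_(k <- r) F k y) x = \sum_(k <- r) partial i (F k) x.
Proof.
move=> H; elim: r => [|k r IH].
  rewrite big_nil (_ : (fun y => _) = cst 0); first by rewrite /partial derive_cst. by apply/funext => y; exact: big_nil.
rewrite big_cons -IH -partialD//; last exact: differentiable_sum_fun.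
by congr (partial i _ x); apply/funext => y; rewrite big_cons.
Qed.

Lemma smooth_mx_diff m l (A : mxfun R n m l) x a b : smooth_mx U A -> U x ->
  differentiable (fun y => A y a b) x.
Proof. by move=> sA Ux; exact: smooth_diff (sA a b) Ux. Qed.

Lemma smooth_mx_eq m l (A B : mxfun R n m l) :
  (forall x, U x -> A x = B x) -> smooth_mx U A -> smooth_mx U B.
Proof.
by move=> AB sA i j; apply: smooth_ext (sA i j) => // x Ux; rewrite AB.
Qed.

Lemma smooth_dmx m l (A : mxfun R n m l) i : smooth_mx U A -> smooth_mx U (dmx i A).
Proof.
move=> sA a b; rewrite (_ : (fun x => _) = partial i (fun y => A y a b)).
  exact: smooth_partial.
by apply/funext => x; rewrite dmxE.
Qed.

Lemma dmx_eq m l (A B : mxfun R n m l) i x : U x ->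
  (forall y, U y -> A y = B y) -> dmx i A x = dmx i B x.
Proof.
move=> Ux AB; apply/matrixP => a b; rewrite !dmxE; apply: partial_near.
by apply: open_eq_near oU Ux _ => y /AB ->.
Qed.

Lemma dmxM m l p (A : mxfun R n m l) (B : mxfun R n l p) i x :
  smooth_mx U A -> smooth_mx U B -> U x ->
  dmx i (fun y => A y *m B y) x = dmx i A x *m B x + A x *m dmx i B x.
Proof.
move=> sA sB Ux; apply/matrixP => a b; rewrite dmxE !mxE -big_split /=.
rewrite (_ : (fun y => _) = (fun y => \sum_k A y a k * B y k b)); last first.
  by apply/funext => y; rewrite mxE.
rewrite partial_sum; last first.
  by move=> k; apply: differentiableM; exact: smooth_mx_diff.
apply: eq_bigr => k _; rewrite partialM ?dmxE//; exact: smooth_mx_diff.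
Qed.

Lemma dmxD m l (A B : mxfun R n m l) i x :
  smooth_mx U A -> smooth_mx U B -> U x ->
  dmx i (fun y => A y + B y) x = dmx i A x + dmx i B x.
Proof.
move=> sA sB Ux; apply/matrixP => a b; rewrite !(dmxE, mxE).
rewrite (_ : (fun y => _) = (fun y => A y a b + B y a b)).
  rewrite partialD//; exact: smooth_mx_diff.
by apply/funext => y; rewrite mxE.
Qed.

Lemma dmxZ m l (f : 'rV[R]_n -> R) (A : mxfun R n m l) i x :
  differentiable f x -> smooth_mx U A -> U x ->
  dmx i (fun y => f y *: A y) x = partial i f x *: A x + f x *: dmx i A x.
Proof.
move=> df sA Ux; apply/matrixP => a b; rewrite !(dmxE, mxE).
rewrite (_ : (fun y => _) = (fun y => f y * A y a b)).
  rewrite partialM//; exact: smooth_mx_diff.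
by apply/funext => y; rewrite mxE.
Qed.

Lemma smooth_mxZ m l (f : 'rV[R]_n -> R) (A : mxfun R n m l) :
  smooth_fun U f -> smooth_mx U A -> smooth_mx U (fun y => f y *: A y).
Proof.
move=> sf sA a b; apply: (@smooth_ext _ _ _ (fun y => f y * A y a b)) => //.
  by move=> x _; rewrite mxE.
exact: smooth_mul.
Qed.

Lemma smooth_mx_sum m l (I : Type) (r : seq I) (F : I -> mxfun R n m l) :
  (forall i, smooth_mx U (F i)) -> smooth_mx U (fun y => \sum_(i <- r) F i y).
Proof.
move=> sF a b; apply: (@smooth_ext _ _ _ (fun y => \sum_(i <- r) F i y a b)) => //.
  by move=> x _; rewrite summxE.
by apply: smooth_sum => // i; exact: sF.
Qed.

Lemma dmx_sum m l (I : Type) (r : seq I) (F : I -> mxfun R n m l) i x :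
  (forall k, smooth_mx U (F k)) -> U x ->
  dmx i (fun y => \sum_(k <- r) F k y) x = \sum_(k <- r) dmx i (F k) x.
Proof.
move=> sF Ux; apply/matrixP => a b; rewrite summxE dmxE.
rewrite (_ : (fun y => _) = (fun y => \sum_(k <- r) F k y a b)).
  rewrite partial_sum; first by apply: eq_bigr => k _; rewrite dmxE. by move=> k; apply: smooth_mx_diff.
by apply/funext => y; rewrite summxE.
Qed.

Lemma dmx_tr m l (A : mxfun R n m l) i x :
  dmx i (fun y => (A y)^T) x = (dmx i A x)^T.
Proof.
apply/matrixP => a b; rewrite !(dmxE, mxE).
by congr (partial i _ x); apply/funext => y; rewrite mxE.
Qed.

Lemma smooth_mx_cst m l (A : 'M[R]_(m, l)) : smooth_mx U (fun=> A).
Proof. by move=> a b; exact: smooth_cst. Qed.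

Lemma dmx_cst m l (A : 'M[R]_(m, l)) i (x : 'rV[R]_n) : dmx i (fun=> A) x = 0.
Proof.
apply/matrixP => a b; rewrite dmxE mxE /partial.
by rewrite (_ : (fun y => _) = cst (A a b))// derive_cst.
Qed.

Lemma dmx_comm m l (A : mxfun R n m l) i j x : smooth_mx U A -> U x ->
  dmx i (dmx j A) x = dmx j (dmx i A) x.
Proof.
move=> sA Ux; apply/matrixP => a b; rewrite [LHS]dmxE [RHS]dmxE.
transitivity (partial i (partial j (fun y => A y a b)) x).
  by congr (partial i _ x); apply/funext => y; rewrite dmxE.
rewrite (partial_comm _ _ oU Ux (sA a b)).
by congr (partial j _ x); apply/funext => y; rewrite dmxE.
Qed.

End MatrixPartials.

(** * Connection and curvature in coordinates *)

Section Christoffel.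
Context R n.
Implicit Types (g : 'rV[R]_n -> 'M[R]_n) (x u v w : 'rV[R]_n).

(** The Christoffel symbols of the first kind, for which products with [g] replace the inverse
    matrix. *)
Definition lowmx g (i : 'I_n) x : 'M[R]_n := \matrix_(j, l)
  (2^-1 * (dmx i g x j l + dmx j g x i l - dmx l g x i j)).

Lemma lowmxE g i x j l :
  lowmx g i x j l = 2^-1 * (dmx i g x j l + dmx j g x i l - dmx l g x i j).
Proof. by rewrite mxE. Qed.

Lemma innerE (A : 'M[R]_n) u v : inner A u v = dot (u *m A) v.
Proof.
rewrite /inner mxE; apply: eq_bigr => k _; by rewrite [in RHS]mxE mxE [v^T _ _]mxE.
Qed.

Lemma GamE g i x : (g x)^T = g x -> Gam g i x = lowmx g i x *m invmx (g x).
Proof.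
move=> gs; rewrite -[in invmx _]gs -trmx_inv; apply/matrixP => j k; rewrite GamEE mxE /christoffel.
rewrite mulr_sumr; apply: eq_bigr => l _; rewrite lowmxE [(invmx _)^T _ _]mxE !dmxE.
move: (invmx _ _ _) (partial _ _ _) (partial _ _ _) (partial _ _ _) => a b c d; ring.
Qed.

Lemma Gam_mul g i x : (g x)^T = g x -> g x \in unitmx -> Gam g i x *m g x = lowmx g i x.
Proof. by move=> gs gu; rewrite GamE// mulmxKV. Qed.

Lemma Gam_sym (U : set 'rV[R]_n) g x i j k : open U -> U x -> (forall y, U y -> (g y)^T = g y) ->
  Gam g i x j k = Gam g j x i k.
Proof.
move=> oU Ux gs; rewrite !GamEE /christoffel; congr (_ * _); apply: eq_bigr => l _; congr (_ * _).
rewrite (addrC (partial i _ x)); congr (_ - _); apply: partial_near.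
by apply: open_eq_near oU Ux _ => y /gs {1}<-; rewrite mxE.
Qed.

(** The curvature of the connection matrices. They act on row vectors from the right, which reverses
    the products in the usual commutator. *)
Definition Fc g (i j : 'I_n) x : 'M[R]_n :=
  dmx i (Gam g j) x - dmx j (Gam g i) x + Gam g j x *m Gam g i x - Gam g i x *m Gam g j x.

Lemma curvature_coefE g l i j k x : curvature_coef g l i j k x = Fc g i j x k l.
Proof.
rewrite /curvature_coef /Fc !mxE !dmxE -addrA; congr (_ + _).
  congr (partial i _ x - partial j _ x); apply/funext => y; by rewrite GamEE.
by rewrite -sumrB; apply: eq_bigr => m _; rewrite !GamEE.
Qed.

Definition Fuv g u v x : 'M[R]_n := \sum_i \sum_j (u 0 i * v 0 j) *: Fc g i j x.

Lemma curvatureE g x u v w : curvature g x u v w = w *m Fuv g u v x.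
Proof.
apply/rowP => l; rewrite !mxE.
transitivity (\sum_k \sum_i \sum_j w 0 k * (u 0 i * v 0 j * Fc g i j x k l)).
  rewrite [RHS]exchange_big /=; apply: eq_bigr => i _. rewrite [RHS]exchange_big /=; apply: eq_bigr => j _; apply: eq_bigr => k _.
  by rewrite curvature_coefE; ring.
apply: eq_bigr => k _; rewrite /Fuv summxE mulr_sumr; apply: eq_bigr => i _.
by rewrite summxE mulr_sumr; apply: eq_bigr => j _; rewrite [in RHS]mxE.
Qed.

(** The quadratic term of the geodesic equation, which reads [x'' + chr g x x' = 0]. *)
Definition chr g x v : 'rV[R]_n := v *m (\sum_i v 0 i *: Gam g i x).

Lemma chrE g x v k : chr g x v 0 k = \sum_i \sum_j christoffel g k i j x * v 0 i * v 0 j.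
Proof.
rewrite mxE exchange_big /=; apply: eq_bigr => j _; rewrite summxE mulr_sumr.
by apply: eq_bigr => i _; rewrite mxE GamEE; ring.
Qed.

End Christoffel.

Section PullBack.
Context R n (U V : set 'rV[R]_n) (g : 'rV[R]_n -> 'M[R]_n)
  (h : 'rV[R]_n -> 'rV[R]_n).

Local Notation jac := (jac h).
Definition pullmx (x : 'rV[R]_n) : 'M[R]_n := jac x *m g (h x) *m (jac x)^T.

Hypothesis oU : open U.
Hypothesis oV : open V.
Hypothesis sh : smooth_on U h.
Hypothesis hV : forall x, U x -> V (h x).
Hypothesis sg : smooth_mx V g.
Hypothesis gsym : forall y, V y -> (g y)^T = g y.
Hypothesis gunit : forall y, V y -> g y \in unitmx.
Hypothesis junit : forall x, U x -> jac x \in unitmx.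

Local Notation G := pullmx.

Lemma smooth_jac : smooth_mx U jac.
Proof.
move=> a k; rewrite (_ : (fun x => _) = partial a (fun y => h y 0 k)).
  by apply: smooth_partial; exact: sh.
by apply/funext => x; rewrite jacE.
Qed.

Lemma smooth_compmx m l (A : mxfun R n m l) : smooth_mx V A -> smooth_mx U (fun x => A (h x)).
Proof. by move=> sA a b; apply: (smooth_comp oU oV (sA a b)). Qed.

Lemma dmx_comp m l (A : mxfun R n m l) a x : smooth_mx V A -> U x ->
  dmx a (fun y => A (h y)) x = \sum_i jac x a i *: dmx i A (h x).
Proof.
move=> sA Ux; apply/matrixP => b c; rewrite summxE dmxE.
transitivity ('D_(delta_mx 0 a) ((fun y => A y b c) \o h) x); first by [].
rewrite derive_comp_row; first by apply: eq_bigr => i _; rewrite [RHS]mxE jacE dmxE.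
  by apply: smooth_mx_diff oV _ _ _ _ _ _ sA (hV Ux).
exact: smooth_on_differentiable sh Ux.
Qed.

Lemma pull_sym x : U x -> (G x)^T = G x.
Proof. by move=> Ux; rewrite !trmx_mul trmxK gsym ?mulmxA//; exact: hV. Qed.

Lemma pull_unit x : U x -> G x \in unitmx.
Proof.
by move=> Ux; rewrite !unitmx_mul unitmx_tr !junit ?gunit//; exact: hV.
Qed.

Lemma smooth_pull : smooth_mx U G.
Proof.
apply: smooth_mulmx => //; last by apply: smooth_trmx => //; exact: smooth_jac.
by apply: smooth_mulmx => //; [exact: smooth_jac|exact: smooth_compmx].
Qed.

Lemma dmx_jac_sym x a b k : U x -> dmx a jac x b k = dmx b jac x a k.
Proof.
move=> Ux; rewrite [LHS]dmxE [RHS]dmxE.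
transitivity (partial a (partial b (fun y => h y 0 k)) x).
  by congr (partial a _ x); apply/funext => y; rewrite jacE.
rewrite (partial_comm _ _ oU Ux (sh k)).
by congr (partial b _ x); apply/funext => y; rewrite jacE.
Qed.

(** The part of the derivative of [G] in which the metric, and not the Jacobian, is
    differentiated. *)
Let T x a b l := \sum_i \sum_p \sum_q jac x a i * jac x b p * jac x l q * dmx i g (h x) p q.
Let B x (u w : 'rV[R]_n) := inner (g (h x)) u w.

Lemma inner_tripleE (A : 'M[R]_n) (P Q : 'M[R]_n) b l :
  (P *m A *m Q^T) b l = inner A (row b P) (row l Q).
Proof.
rewrite innerE /dot mxE; apply: eq_bigr => k _.
by rewrite -row_mul [X in _ = X * _]mxE [X in _ = _ * X]mxE [X in _ * X = _]mxE.
Qed.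

Lemma inner_rowE (A : 'M[R]_n) (P Q : 'M[R]_n) b l :
  inner A (row b P) (row l Q) = \sum_p \sum_q P b p * Q l q * A p q.
Proof.
rewrite innerE /dot exchange_big /=; apply: eq_bigr => q _.
rewrite [X in X * _]mxE [X in _ * X]mxE mulr_suml; apply: eq_bigr => p _.
by rewrite [X in X * _ * _]mxE; ring.
Qed.

Lemma dmx_pullE x a b l : U x -> dmx a G x b l =
  B x (row b (dmx a jac x)) (row l (jac x)) + T x a b l
   + B x (row b (jac x)) (row l (dmx a jac x)).
Proof.
move=> Ux.
have sJ := smooth_jac; have sgh := smooth_compmx sg.
have sJg := smooth_mulmx oU sJ sgh.
rewrite (dmxM oU a sJg (smooth_trmx oU sJ) Ux) (dmxM oU a sJ sgh Ux) dmx_tr.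
rewrite mulmxDl mxE [X in X + _]mxE inner_tripleE [X in _ + X]inner_tripleE.
congr (_ + _ + _).
rewrite dmx_comp// mulmx_sumr mulmx_suml summxE; apply: eq_bigr => i _.
rewrite -scalemxAr -scalemxAl [LHS]mxE inner_tripleE inner_rowE mulr_sumr.
apply: eq_bigr => p _; rewrite mulr_sumr; apply: eq_bigr => q _; ring.
Qed.

Lemma inner_sym (A : 'M[R]_n) u w : A^T = A -> inner A u w = inner A w u.
Proof.
move=> sA; rewrite /inner -[LHS]/((u *m A *m w^T) 0 0).
have -> : w *m A *m u^T = (u *m A *m w^T)^T by rewrite !trmx_mul !trmxK sA mulmxA.
by rewrite [RHS]mxE.
Qed.

(** The three derivatives of [G] contain six terms with second derivatives of [h]. By symmetry of
    these, four cancel in the combination defining [lowmx] and the other two coincide. *)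
Lemma lowmx_pull x a : U x -> lowmx G a x =
  (dmx a jac x + \sum_i jac x a i *: (jac x *m Gam g i (h x))) *m g (h x) *m (jac x)^T.
Proof.
move=> Ux; have gs := gsym (hV Ux).
rewrite !mulmxDl; apply/matrixP => b l; rewrite lowmxE [RHS]mxE.
rewrite (dmx_pullE a b l Ux) (dmx_pullE b a l Ux) (dmx_pullE l a b Ux).
rewrite inner_tripleE -/(B _ _ _).
have rs c d : row c (dmx d jac x) = row d (dmx c jac x) by apply/rowP => k; rewrite [LHS]mxE [RHS]mxE dmx_jac_sym.
rewrite (rs b a) (rs a b) (rs b l) (rs a l).
rewrite -(rs a b) (rs l a).
rewrite /B (inner_sym (row b (jac x)) (row a (dmx l jac x)) gs).
have -> : ((\sum_i jac x a i *: (jac x *m Gam g i (h x))) *m g (h x) *m (jac x)^T) b l =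
   2^-1 * (T x a b l + T x b a l - T x l a b).
  rewrite mulmx_suml mulmx_suml summxE.
  transitivity (\sum_i \sum_p \sum_q jac x a i * jac x b p * jac x l q *
     (2^-1 * (dmx i g (h x) p q + dmx p g (h x) i q - dmx q g (h x) i p))).
    apply: eq_bigr => i _. rewrite -!scalemxAl [LHS]mxE -(mulmxA (jac x)) Gam_mul//; last exact/gunit/hV.
    rewrite inner_tripleE inner_rowE mulr_sumr; apply: eq_bigr => p _.
    rewrite mulr_sumr; apply: eq_bigr => q _; rewrite lowmxE; ring.
  have -> : T x b a l = \sum_i \sum_p \sum_q jac x a i * jac x b p * jac x l q * dmx p g (h x) i q.
    rewrite /T exchange_big /=; apply: eq_bigr => i _; apply: eq_bigr => p _. by apply: eq_bigr => q _; ring.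
  have -> : T x l a b = \sum_i \sum_p \sum_q jac x a i * jac x b p * jac x l q * dmx q g (h x) i p.
    rewrite /T exchange_big /=; apply: eq_bigr => i _; rewrite exchange_big /=. apply: eq_bigr => p _; apply: eq_bigr => q _; ring.
  rewrite /T -big_split -sumrB mulr_sumr; apply: eq_bigr => i _ /=. rewrite -big_split -sumrB mulr_sumr; apply: eq_bigr => p _ /=.
  rewrite -big_split -sumrB mulr_sumr; apply: eq_bigr => q _ /=. ring.
lra.
Qed.

(** The transformation law of the Christoffel symbols with its inhomogeneous term [dmx a jac x]; it
    is [lowmx_pull] with the invertible factor [g (h x) *m (jac x)^T] cancelled. *)
Theorem Gam_pull x a : U x -> Gam G a x *m jac x =
  dmx a jac x + jac x *m \sum_i jac x a i *: Gam g i (h x).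
Proof.
move=> Ux.
have gJu : g (h x) *m (jac x)^T \in unitmx by rewrite unitmx_mul unitmx_tr junit// gunit//; exact: hV.
apply: (can_inj (mulmxK gJu)).
have := Gam_mul a (pull_sym Ux) (pull_unit Ux).
rewrite lowmx_pull// /pullmx !mulmxA => ->; do 2!congr (_ *m _); congr (_ + _).
by rewrite mulmx_sumr; apply: eq_bigr => i _; rewrite -scalemxAr.
Qed.

Let Gh a x := \sum_i jac x a i *: Gam g i (h x).

Lemma smooth_Gam (W : set 'rV[R]_n) (k : 'rV[R]_n -> 'M[R]_n) i : open W -> smooth_mx W k ->
  (forall x, W x -> (k x)^T = k x) -> (forall x, W x -> k x \in unitmx) ->
  smooth_mx W (Gam k i).
Proof.
move=> oW sk ks ku.
have sl : smooth_mx W (lowmx k i).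
  move=> j l. apply: (@smooth_ext _ _ _ (fun x => cst (2^-1) x * (dmx i k x j l + dmx j k x i l - dmx l k x i j))) => //.
    by move=> x _; rewrite lowmxE.
  apply: smooth_mul => //; first exact: smooth_cst. apply: smooth_sub_fun => //; first apply: smooth_add => //; exact: smooth_dmx.
apply: smooth_mx_eq (smooth_mulmx oW sl (smooth_invmx oW sk ku)) => // x Wx.
by rewrite GamE// ks.
Qed.

Let sGh a : smooth_mx U (Gh a).
Proof.
apply: smooth_mx_sum => // i; apply: smooth_mxZ => //; first exact: smooth_jac.
by apply: smooth_compmx; apply: smooth_Gam.
Qed.

Let Gam_diff x a b : U x -> dmx b (Gam G a) x *m jac x =
  dmx b (dmx a jac) x + dmx b jac x *m Gh a x + jac x *m dmx b (Gh a) x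
   - Gam G a x *m dmx b jac x.
Proof.
move=> Ux.
have sJ := smooth_jac.
have sG : smooth_mx U (Gam G a) by apply: smooth_Gam => //; [exact: smooth_pull|exact: pull_sym|exact: pull_unit].
apply/eqP; rewrite eq_sym subr_eq; apply/eqP.
rewrite -(dmxM oU b sG sJ Ux).
rewrite (dmx_eq oU b Ux (fun y Uy => Gam_pull a Uy)).
rewrite (dmxD oU b (smooth_dmx a sJ) (smooth_mulmx oU sJ (sGh a)) Ux).
by rewrite (dmxM oU b sJ (sGh a) Ux) addrA.
Qed.

Let dmx_Gh x a b : U x -> dmx b (Gh a) x =
  \sum_i (dmx b jac x a i *: Gam g i (h x)
          + jac x a i *: \sum_j jac x b j *: dmx j (Gam g i) (h x)).
Proof.
move=> Ux.
have sgi i : smooth_mx V (Gam g i) by apply: smooth_Gam.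
rewrite (dmx_sum oU).
- apply: eq_bigr => i _; rewrite (dmxZ oU).
  + by rewrite dmx_comp// dmxE.
  + exact: smooth_mx_diff oU _ _ _ _ _ _ smooth_jac Ux.
  + exact: smooth_compmx.
  + by [].
- by move=> i; apply: smooth_mxZ => //; [exact: smooth_jac|exact: smooth_compmx].
- by [].
Qed.

(** Differentiating [Gam_pull] and antisymmetrizing in [a] and [b]: the second derivatives of the
    Jacobian cancel by symmetry, its first derivatives cancel in pairs, and what remains is the
    curvature of the matrices [Gh]. *)
Theorem Fc_pull x a b : U x -> Fc G b a x *m jac x =
  jac x *m \sum_j \sum_i (jac x b j * jac x a i) *: Fc g j i (h x).
Proof.
move=> Ux.
have eG c d : Gam G c x *m Gam G d x *m jac x =
    Gam G c x *m dmx d jac x + dmx c jac x *m Gh d x + jac x *m (Gh c x *m Gh d x).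
  rewrite -mulmxA Gam_pull// mulmxDr mulmxA Gam_pull// -/(Gh _ _) mulmxDl. by rewrite addrA mulmxA.
have step : Fc G b a x *m jac x =
    jac x *m (dmx b (Gh a) x - dmx a (Gh b) x + Gh a x *m Gh b x - Gh b x *m Gh a x).
  rewrite /Fc mulmxBl mulmxDl mulmxBl !Gam_diff// !eG (dmx_comm oU a b smooth_jac Ux). rewrite mulmxBr mulmxDr mulmxBr.
  move: (dmx b (dmx a jac) x) (dmx b jac x *m Gh a x) (jac x *m dmx b (Gh a) x)
    (Gam G a x *m dmx b jac x) (dmx a jac x *m Gh b x) (jac x *m dmx a (Gh b) x)
    (Gam G b x *m dmx a jac x) (jac x *m (Gh a x *m Gh b x)) (jac x *m (Gh b x *m Gh a x)).
  move=> X1 X2 X3 X4 X5 X6 X7 X8 X9. apply/matrixP => p q; rewrite !mxE. ring.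
rewrite step; congr (_ *m _).
rewrite !dmx_Gh// !big_split /=.
have -> : \sum_i dmx a jac x b i *: Gam g i (h x) = \sum_i dmx b jac x a i *: Gam g i (h x) by apply: eq_bigr => i _; rewrite dmx_jac_sym.
rewrite opprD addrACA subrr add0r.
have e1 : \sum_i jac x a i *: (\sum_j jac x b j *: dmx j (Gam g i) (h x)) =
   \sum_j \sum_i (jac x b j * jac x a i) *: dmx j (Gam g i) (h x).
  rewrite exchange_big /=; apply: eq_bigr => i _; rewrite scaler_sumr. by apply: eq_bigr => j _; rewrite scalerA mulrC.
have e2 : \sum_i jac x b i *: (\sum_j jac x a j *: dmx j (Gam g i) (h x)) =
   \sum_j \sum_i (jac x b j * jac x a i) *: dmx i (Gam g j) (h x).
  by apply: eq_bigr => i _; rewrite scaler_sumr; apply: eq_bigr => j _; rewrite scalerA.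
have e3 : Gh a x *m Gh b x =
   \sum_j \sum_i (jac x b j * jac x a i) *: (Gam g i (h x) *m Gam g j (h x)).
  rewrite /Gh mulmx_suml exchange_big /=; apply: eq_bigr => i _. rewrite mulmx_sumr; apply: eq_bigr => j _.
  by rewrite -scalemxAl -scalemxAr scalerA mulrC.
have e4 : Gh b x *m Gh a x =
   \sum_j \sum_i (jac x b j * jac x a i) *: (Gam g j (h x) *m Gam g i (h x)).
  rewrite /Gh mulmx_suml; apply: eq_bigr => i _. rewrite mulmx_sumr; apply: eq_bigr => j _.
  by rewrite -scalemxAl -scalemxAr scalerA.
rewrite e1 e2 e3 e4 -sumrB -big_split -sumrB /=; apply: eq_bigr => j _.
rewrite -sumrB -big_split -sumrB /=; apply: eq_bigr => i _.
by rewrite /Fc -scalerBr -scalerDr -scalerBr.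
Qed.

Lemma Fuv_pull x u v : U x ->
  Fuv G u v x *m jac x = jac x *m Fuv g (u *m jac x) (v *m jac x) (h x).
Proof.
move=> Ux.
transitivity (\sum_b \sum_a (u 0 b * v 0 a) *: (jac x *m
   \sum_j \sum_i (jac x b j * jac x a i) *: Fc g j i (h x))).
  rewrite /Fuv mulmx_suml; apply: eq_bigr => b _; rewrite mulmx_suml. by apply: eq_bigr => a _; rewrite -scalemxAl Fc_pull.
rewrite /Fuv.
transitivity (jac x *m \sum_j \sum_i \sum_b \sum_a
    (u 0 b * v 0 a * (jac x b j * jac x a i)) *: Fc g j i (h x)).
  under eq_bigr do under eq_bigr do rewrite scalemxAr. under eq_bigr do rewrite -mulmx_sumr. rewrite -mulmx_sumr; congr (_ *m _).
  rewrite [RHS](eq_bigr _ (fun j _ => exchange_big _ _ _ _ _ _)) /=. rewrite [RHS]exchange_big /=; apply: eq_bigr => b _.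
  rewrite [RHS](eq_bigr _ (fun j _ => eq_bigr _ (fun i _ => erefl))). under [RHS]eq_bigr do rewrite exchange_big /=.
  rewrite [RHS]exchange_big /=; apply: eq_bigr => a _. rewrite scaler_sumr; apply: eq_bigr => j _; rewrite scaler_sumr.
  by apply: eq_bigr => i _; rewrite scalerA.
congr (_ *m _); apply: eq_bigr => j _; apply: eq_bigr => i _.
rewrite !mxE mulr_suml scaler_suml; apply: eq_bigr => b _.
rewrite mulr_sumr scaler_suml; apply: eq_bigr => a _.
by congr (_ *: _); ring.
Qed.

Lemma inner_pull x u v : inner (G x) u v = inner (g (h x)) (u *m jac x) (v *m jac x).
Proof. by rewrite /inner /pullmx trmx_mul !mulmxA. Qed.

Theorem curvature_pull x u v w : U x ->
  curvature G x u v w *m jac x = curvature g (h x) (u *m jac x) (v *m jac x) (w *m jac x).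
Proof. by move=> Ux; rewrite !curvatureE -mulmxA Fuv_pull// mulmxA. Qed.

(** The extra term is the second derivative of [h] applied twice to [v]. The chain rule adds the
    same term to the acceleration of [h \o x], and so geodesics are mapped to geodesics in
    [geo_eq_push]. *)
Theorem chr_pull x v : U x ->
  chr G x v *m jac x = v *m (\sum_a v 0 a *: dmx a jac x) + chr g (h x) (v *m jac x).
Proof.
move=> Ux; rewrite /chr -mulmxA mulmx_suml.
transitivity (v *m \sum_a v 0 a *: (dmx a jac x + jac x *m \sum_i jac x a i *: Gam g i (h x))).
  by congr (_ *m _); apply: eq_bigr => a _; rewrite -scalemxAl Gam_pull.
under eq_bigr do rewrite scalerDr.
rewrite big_split mulmxDr; congr (_ + _); rewrite -mulmxA; congr (_ *m _).
under eq_bigr do rewrite scalemxAr.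
rewrite -mulmx_sumr; congr (_ *m _).
under eq_bigr do rewrite scaler_sumr.
rewrite exchange_big /=; apply: eq_bigr => i _.
by rewrite mxE scaler_suml; apply: eq_bigr => a _; rewrite scalerA.
Qed.

End PullBack.

(** * Continuity induction and matrix estimates *)

(** Continuity induction: at the infimum of the failures [P] holds by the step, and then on an
    interval beyond it, so there is no failure. It serves both a priori bounds along rays and the
    uniqueness of geodesics. *)
Lemma real_bootstrap R (T e : R) (P : R -> Prop) : 0 < e ->
  (forall t, 0 < t < e -> P t) ->
  (forall t, 0 < t < T -> (forall s, 0 < s < t -> P s) ->
     P t /\ exists2 d, 0 < d & forall s, t < s < t + d -> P s) ->
  forall t, 0 < t < T -> P t.
Proof.
move=> e0 Pe step t /andP[t0 tT]; apply: contrapT => nPt.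
pose A := [set s | 0 < s < T /\ ~ P s].
have At : A t by split => //; rewrite t0.
have lbA : has_lbound A by exists 0 => s [/andP[s0 _] _]; exact: ltW.
pose a := inf A.
have aT : a < T by apply: le_lt_trans tT; exact: ge_inf.
have ea : e <= a.
  apply: lb_le_inf => [|s [/andP[s0 sT] nPs]]; first by exists t.
  by rewrite leNgt; apply/negP => se; apply: nPs; apply: Pe; rewrite s0.
have a0 : 0 < a by exact: lt_le_trans ea.
have below s : 0 < s < a -> P s.
  move=> /andP[s0 sa]; apply: contrapT => nPs. have : a <= s by apply: ge_inf => //; split => //; rewrite s0 (lt_trans sa).
  by rewrite leNgt sa.
have [|Pa [d d0 Pd]] := step a _ below; first by rewrite a0.
have : a + d <= a.
  apply: lb_le_inf => [|s [/andP[s0 sT] nPs]]; first by exists t. rewrite leNgt; apply/negP => sad; apply: nPs.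
  have [sa|sa|->//] := ltgtP s a; first by apply: below; rewrite s0. by apply: Pd; rewrite sa.
by rewrite -lerBrDl subrr leNgt d0.
Qed.

Lemma at_right_ex R (x : R) (Q : R -> Prop) :
  (\forall t \near x^'+, Q t) -> exists2 e, 0 < e & forall t, x < t < x + e -> Q t.
Proof.
move=> /nbhs_ballP[e /= e0 He]; exists e => // t /andP[xt te].
apply: He => //; rewrite /ball /= ltr_norml; itv_lra.
Qed.

Lemma near_right_ex R (x : R) (Q : R -> Prop) :
  (\forall t \near x, Q t) -> exists2 e, 0 < e & forall t, x < t < x + e -> Q t.
Proof. by move=> H; apply: at_right_ex; apply: cvg_within. Qed.

Lemma continuous_pos_near R (f : R -> R) (x : R) :
  {for x, continuous f} -> 0 < f x -> \forall t \near x, 0 < f t.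
Proof.
move=> /cvgrPdist_lt cf fx; move: (cf _ fx); apply: filterS => t.
by rewrite ltr_norml => /andP[_]; rewrite ltrBlDr ltrDl.
Qed.

Section MatrixNorm.
Variables (R : realType).

Lemma mx_entry_le m l (A : 'M[R]_(m, l)) i j : `|A i j| <= `|A|.
Proof.
rewrite [leRHS]/Num.Def.normr/= mx_normrE.
exact: (le_bigmax _ (fun p => `|A p.1 p.2|) (i, j)).
Qed.

Lemma mx_norm_le m l (A : 'M[R]_(m, l)) (e : R) : 0 <= e ->
  (forall i j, `|A i j| <= e) -> `|A| <= e.
Proof.
move=> e0 H; rewrite [leLHS]/Num.Def.normr/= mx_normrE.
by apply: bigmax_le => // -[i j] _; exact: H.
Qed.

Lemma mx_norm_mul m l p (A : 'M[R]_(m, l)) (B : 'M[R]_(l, p)) :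
  `|A *m B| <= l%:R * `|A| * `|B|.
Proof.
apply: mx_norm_le => [|i j]; first by rewrite !mulr_ge0.
rewrite mxE; apply: le_trans (ler_norm_sum _ _ _) _.
apply: (@le_trans _ _ (\sum_(k < l) `|A| * `|B|)).
  by apply: ler_sum => k _; rewrite normrM ler_pM// mx_entry_le.
by rewrite sumr_const card_ord -[_ *+ l]mulr_natl mulrA.
Qed.

(** One step of the Neumann series, [A^-1 = 1 - (A - 1) A^-1]: half of the unknown norm is absorbed
    on the left. *)
Lemma invmx_norm_le n (A : 'M[R]_n) : A \in unitmx -> n%:R * `|A - 1%:M| <= 2^-1 ->
  `|invmx A| <= 2.
Proof.
move=> uA An.
have e : invmx A = 1%:M - (A - 1%:M) *m invmx A by rewrite mulmxBl mulmxV// mul1mx opprB addrC subrK.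
have h1 : `|(1%:M : 'M[R]_n)| <= 1 by apply: mx_norm_le => // i j; rewrite mxE; case: eqP => _; rewrite ?normr1 ?normr0.
have h2 := mx_norm_mul (A - 1%:M) (invmx A).
have h3 : n%:R * `|A - 1%:M| * `|invmx A| <= 2^-1 * `|invmx A| by rewrite ler_wpM2r.
have h4 : `|invmx A| <= `|(1%:M : 'M[R]_n)| + `|(A - 1%:M) *m invmx A| by rewrite [in leLHS]e; exact: ler_normB.
lra.
Qed.

Lemma posdef_unitmx n (A : 'M[R]_n) :
  (forall v, v != 0 -> 0 < inner A v v) -> A \in unitmx.
Proof.
move=> Ap; rewrite -row_free_unit -kermx_eq0; apply/eqP/row_matrixP => i.
rewrite row0; apply/eqP/negPn/negP => /Ap.
have -> : inner A (row i (kermx A)) (row i (kermx A)) = 0 by rewrite /inner -row_mul mulmx_ker row0 mul0mx mxE.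
by rewrite ltxx.
Qed.

End MatrixNorm.

Section InnerAlgebra.
Context R n (A : 'M[R]_n).

Lemma innerDl u v w : inner A (u + v) w = inner A u w + inner A v w.
Proof. by rewrite !innerE mulmxDl dotDl. Qed.

Lemma innerDr u v w : inner A w (u + v) = inner A w u + inner A w v.
Proof. by rewrite !innerE dotDr. Qed.

Lemma innerZl a u w : inner A (a *: u) w = a * inner A u w.
Proof. by rewrite !innerE -scalemxAl dotZl. Qed.

Lemma innerZr a u w : inner A w (a *: u) = a * inner A w u.
Proof. by rewrite !innerE dotZr. Qed.

Lemma inner_delta i j : inner A (delta_mx 0 i) (delta_mx 0 j) = A i j.
Proof. by rewrite innerE dot_delta -rowE mxE. Qed.

(** Polarization: twice an off-diagonal entry is the value of the form at the sum of two basis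
    vectors minus the two diagonal entries. *)
Lemma quad_entry_le (a b : R) : A^T = A ->
  (forall i, `|inner A (delta_mx 0 i) (delta_mx 0 i)| <= a) ->
  (forall i j, `|inner A (delta_mx 0 i + delta_mx 0 j) (delta_mx 0 i + delta_mx 0 j)| <= b) ->
  forall i j, `|A i j| <= a + b / 2.
Proof.
move=> As Ha Hb i j.
have := Hb i j; have := Ha i; have := Ha j.
have e : A j i = A i j by rewrite -{1}As mxE.
rewrite !innerDl !innerDr !inner_delta e !ler_norml.
move: (A i i) (A j j) (A i j) => p q r /andP[? ?] /andP[? ?] /andP[? ?].
by itv_lra.
Qed.

End InnerAlgebra.

Lemma mvt_bound R (f h f' h' : R -> R) (t : R) : 0 <= t ->
  (forall s, 0 < s < t -> is_derive s 1 f (f' s)) ->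
  (forall s, 0 < s < t -> is_derive s 1 h (h' s)) ->
  (forall s, 0 <= s <= t -> {for s, continuous f}) ->
  (forall s, 0 <= s <= t -> {for s, continuous h}) ->
  (forall s, 0 < s < t -> `|f' s| <= h' s) ->
  `|f t - f 0| <= h t - h 0.
Proof.
move=> t0 df dh cf ch fh.
have within (g : R -> R) : (forall s, 0 <= s <= t -> {for s, continuous g}) ->
    {within `[0, t], continuous g}.
  by move=> cg; apply: continuous_in_subspaceT => x; rewrite inE /= in_itv; exact: cg.
have key (g g' : R -> R) : (forall s, 0 < s < t -> is_derive s 1 g (g' s)) ->
    (forall s, 0 <= s <= t -> {for s, continuous g}) ->
    (forall s, 0 < s < t -> 0 <= g' s) -> g 0 <= g t.
  move=> dg cg g0. apply: (@ger0_derive1_le_cc _ g 0 t) => //.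
  - by move=> x; rewrite in_itv => /dg[].
  - by move=> x; rewrite in_itv => /[dup] xt /dg dgx; rewrite derive1E derive_val g0.
  - exact: within.
  - by rewrite in_itv /= lexx.
  - by rewrite in_itv /= lexx t0.
have h1 : (h - f) 0 <= (h - f) t.
  apply: (key _ (fun s => h' s - f' s)) => s hs.
  - by apply: is_deriveB; [exact: dh|exact: df].
  - by apply: continuousB; [exact: ch|exact: cf].
  - by have := fh s hs; rewrite ler_norml => /andP[_]; rewrite subr_ge0.
have h2 : (h + f) 0 <= (h + f) t.
  apply: (key _ (fun s => h' s + f' s)) => s hs.
  - by apply: is_deriveD; [exact: dh|exact: df].
  - by apply: continuousD; [exact: ch|exact: cf].
  - by have := fh s hs; rewrite ler_norml => /andP[+ _]; rewrite lerNl -subr_ge0 opprK addrC.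
move: h1 h2; rewrite !fctE ler_norml.
move: (h 0) (f 0) (h t) (f t) => p q r u h1 h2; itv_lra.
Qed.

Lemma derivable_continuous R (V : normedModType R) (f : R -> V) t :
  derivable f t 1 -> {for t, continuous f}.
Proof. by move=> df; exact/differentiable_continuous/derivable1_diffP. Qed.


Section Radial.
Context R n.

(** The derivative along the radial field: on the ray [t *: v] it is [t] times the derivative in
    [t], as [is_derive_ray_Dr] records. *)
Definition Dr m l (A : mxfun R n m l) (x : 'rV[R]_n) : 'M[R]_(m, l) :=
  \sum_k x 0 k *: dmx k A x.

Lemma dmx_id i (x : 'rV[R]_n) : dmx i (fun y : 'rV[R]_n => y) x = delta_mx 0 i.
Proof.
apply/rowP => j; rewrite dmxE /partial.
have := @derive_mx R _ _ _ (@id 'rV[R]_n) x (delta_mx 0 i) (@derivable_id _ _ _ _).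
by rewrite derive_id => /(congr1 (fun M : 'rV[R]_n => M 0 j)) e; rewrite [RHS]mxE in e.
Qed.

Variable U : set 'rV[R]_n.
Hypothesis oU : open U.

Lemma smooth_mx_id : smooth_mx U (fun x : 'rV[R]_n => x).
Proof. by move=> i j; rewrite (ord1 i); exact: smooth_coord. Qed.

Lemma DrM m l p (A : mxfun R n m l) (B : mxfun R n l p) x :
  smooth_mx U A -> smooth_mx U B -> U x ->
  Dr (fun y => A y *m B y) x = Dr A x *m B x + A x *m Dr B x.
Proof.
move=> sA sB Ux; rewrite /Dr mulmx_suml mulmx_sumr -big_split /=.
by apply: eq_bigr => k _; rewrite (dmxM oU k sA sB Ux) scalerDr scalemxAl scalemxAr.
Qed.

Lemma Dr_eq m l (A B : mxfun R n m l) x : U x ->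
  (forall y, U y -> A y = B y) -> Dr A x = Dr B x.
Proof. by move=> Ux AB; apply: eq_bigr => k _; rewrite (dmx_eq oU k Ux AB). Qed.

Lemma Dr_tr m l (A : mxfun R n m l) x : Dr (fun y => (A y)^T) x = (Dr A x)^T.
Proof. by rewrite /Dr linear_sum; apply: eq_bigr => k _; rewrite dmx_tr linearZ. Qed.

Lemma Dr_id x : Dr (fun y : 'rV[R]_n => y) x = x.
Proof.
rewrite /Dr [RHS]rV_sum_delta; apply: eq_bigr => k _; by rewrite dmx_id.
Qed.

Lemma is_derive_ray m l (A : mxfun R n m l) (v : 'rV[R]_n) t i j : smooth_mx U A ->
  U (t *: v) -> is_derive t 1 (fun s => A (s *: v) i j)
    ((\sum_k v 0 k *: dmx k A (t *: v)) i j).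
Proof.
move=> sA Utv.
have df : differentiable (fun y => A y i j) (t *: v) by exact: smooth_mx_diff oU _ _ _ _ _ _ sA Utv.
have := @is_derive_line R _ _ (fun y => A y i j) 0 v t.
rewrite add0r => /(_ (diff_derivable (v := v) df)).
rewrite derive_row_sum// => H.
have -> : (fun s => A (s *: v) i j) = (fun s => A (0 + s *: v) i j) by apply/funext => s; rewrite add0r.
apply: is_derive_eq; rewrite summxE; apply: eq_bigr => k _.
by rewrite mxE dmxE.
Qed.

Lemma is_derive_ray_Dr m l (A : mxfun R n m l) (v : 'rV[R]_n) t i j : smooth_mx U A ->
  U (t *: v) -> t != 0 -> is_derive t 1 (fun s => A (s *: v) i j)
    (t^-1 * Dr A (t *: v) i j).
Proof.
move=> sA Utv t0.
have := is_derive_ray i j sA Utv.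
have -> // : (\sum_k v 0 k *: dmx k A (t *: v)) i j = t^-1 * Dr A (t *: v) i j.
rewrite /Dr !summxE mulr_sumr; apply: eq_bigr => k _.
by rewrite !mxE !mulrA mulVf// mul1r.
Qed.

Lemma continuous_ray m l (A : mxfun R n m l) (v : 'rV[R]_n) (t : R) i j : smooth_mx U A ->
  U (t *: v) -> {for t, continuous (fun s : R => A (s *: v) i j)}.
Proof.
move=> sA Utv; have [d _] := is_derive_ray i j sA Utv.
exact: derivable_continuous.
Qed.

End Radial.

Lemma is_derive0_eq R (f : R -> R) (a b : R) : a <= b ->
  (forall t, a < t < b -> is_derive t 1 f 0) ->
  (forall t, a <= t <= b -> {for t, continuous f}) -> f a = f b.
Proof.
move=> ab df cf.
have [c _ e] : exists2 c, c \in `[a, b] & f b - f a = 0 * (b - a).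
  apply: (@MVT_segment R f (fun=> 0) a b ab).
    by apply: continuous_in_subspaceT => x; rewrite inE /= in_itv; exact: cf.
by apply/esym/eqP; rewrite -subr_eq0 e mul0r.
Qed.

Definition eball R n (rho : R) : set 'rV[R]_n :=
  [set x | enorm x < rho].

Lemma open_eball0 R n (rho : R) : open (@eball R n rho).
Proof.
have := @open_eball R n 0 rho.
by rewrite (_ : [set x | _] = eball rho)//; apply/funext => x /=; rewrite subr0.
Qed.

Lemma mulmx_trE R n (u v : 'rV[R]_n) : (u *m v^T) 0 0 = dot u v.
Proof. by rewrite mxE; apply: eq_bigr => k _; rewrite [in LHS]mxE. Qed.

(** * Normal coordinates *)

Section NormalCoordinates.
Context R n (G : 'rV[R]_n -> 'M[R]_n) (rho kappa : R).
Local Notation B := (@eball R n rho).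
Hypothesis rho0 : 0 < rho.
Hypothesis sG : smooth_mx B G.
Hypothesis Gsym : forall x, B x -> (G x)^T = G x.
Hypothesis Gpos : forall x, B x -> forall v, v != 0 -> 0 < inner (G x) v v.
Hypothesis G0 : G 0 = 1%:M.
(** This says that the rays from the origin are geodesics: [t *: v] has no acceleration, and [chr]
    is quadratic in its vector argument. *)
Hypothesis Ggeo : forall x, B x -> chr G x x = 0.

Let oB : open B := @open_eball0 R n rho.

Lemma Gunit x : B x -> G x \in unitmx.
Proof. by move=> /Gpos; exact: posdef_unitmx. Qed.

Lemma B_ray (v : 'rV[R]_n) (t : R) : B v -> `|t| <= 1 -> B (t *: v).
Proof.
rewrite /eball /= enormZ => vr t1; apply: le_lt_trans vr.
by rewrite ler_piMl ?enorm_ge0.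
Qed.

Lemma B0 : B (0 : 'rV[R]_n). Proof. by rewrite /eball /= enorm0. Qed.

Lemma smooth_GamG i : smooth_mx B (Gam G i).
Proof. by apply: smooth_Gam => //; exact: Gunit. Qed.

(** The hypothesis [Ggeo] with the index lowered, where only the symbols of the first kind
    appear. *)
Lemma radial_lowered x l : B x -> (x *m Dr G x) 0 l = 2^-1 * (x *m dmx l G x *m x^T) 0 0.
Proof.
move=> Bx.
have : chr G x x *m G x = 0 by rewrite Ggeo// mul0mx.
rewrite /chr -mulmxA mulmx_suml.
under eq_bigr do rewrite -scalemxAl Gam_mul ?Gsym ?Gunit//.
rewrite mulmx_sumr => /(congr1 (fun M : 'rV[R]_n => M 0 l)); rewrite summxE [RHS]mxE.
have -> : (x *m Dr G x) 0 l = \sum_j \sum_i x 0 i * x 0 j * dmx i G x j l.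
  rewrite mxE; apply: eq_bigr => j _; rewrite summxE mulr_sumr; apply: eq_bigr => i _. by rewrite mxE; ring.
have -> : (x *m dmx l G x *m x^T) 0 0 = \sum_j \sum_i x 0 i * x 0 j * dmx l G x i j.
  rewrite mxE; apply: eq_bigr => j _; rewrite mxE mulr_suml; apply: eq_bigr => i _. by rewrite [x^T _ _]mxE; ring.
have -> : \sum_i (x *m (x 0 i *: lowmx G i x)) 0 l =
  2^-1 * (\sum_j \sum_i x 0 i * x 0 j * dmx i G x j l + \sum_j \sum_i x 0 i * x 0 j * dmx i G x j l
   - \sum_j \sum_i x 0 i * x 0 j * dmx l G x i j).
  rewrite [X in X + _ - _]exchange_big [X in _ + _ - X]exchange_big /= -big_split -sumrB mulr_sumr.
  apply: eq_bigr => j _ /=; rewrite -big_split -sumrB mulr_sumr mxE; apply: eq_bigr => i _ /=. by rewrite mxE lowmxE; ring.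
move: (\sum_j _) (\sum_j _) => p q; lra.
Qed.

(** Contracting [radial_lowered] with [x] turns its right side into half of the left side, so both
    vanish. *)
Lemma radial_quad x : B x -> inner (Dr G x) x x = 0.
Proof.
move=> Bx.
have e : inner (Dr G x) x x = 2^-1 * inner (Dr G x) x x.
  rewrite {1}/inner mxE. under eq_bigr => l _ do rewrite radial_lowered//.
  rewrite /inner [in RHS]/Dr mulmx_sumr mulmx_suml summxE mulr_sumr.
  apply: eq_bigr => l _; rewrite -scalemxAr -scalemxAl [in RHS]mxE [x^T _ _]mxE. by ring.
by move: e; move: (inner _ _ _) => p; lra.
Qed.

Lemma inner_radial x : B x -> inner (G x) x x = dot x x.
Proof.
move=> Bx.
pose P (y : 'rV[R]_n) : 'M[R]_1 := x *m G y *m x^T.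
have sP : smooth_mx B P.
  apply: smooth_mulmx => //; last exact: smooth_mx_cst oB _ _ _. by apply: smooth_mulmx => //; exact: smooth_mx_cst oB _ _ _.
have DP y : B y -> Dr P y = x *m Dr G y *m x^T.
  move=> By; rewrite /Dr mulmx_sumr mulmx_suml; apply: eq_bigr => k _.
  have cx m l (A : 'M[R]_(m, l)) : smooth_mx B (fun=> A) by exact: (@smooth_mx_cst R n B oB m l A).
  rewrite (dmxM oB k (smooth_mulmx oB (cx _ _ x) sG) (cx _ _ x^T) By).
  rewrite (dmxM oB k (cx _ _ x) sG By) !dmx_cst mul0mx add0r mulmx0 addr0. by rewrite -scalemxAr -scalemxAl.
have : P (0 *: x) 0 0 = P (1 *: x) 0 0.
  apply: (@is_derive0_eq R (fun t => P (t *: x) 0 0) 0 1) => //.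
    move=> t /andP[t0 t1]. have Btx : B (t *: x) by apply: B_ray => //; rewrite ger0_norm ltW.
    have := is_derive_ray_Dr oB 0 0 sP Btx (lt0r_neq0 t0). rewrite DP//.
    have -> : (x *m Dr G (t *: x) *m x^T) 0 0 = t^-1 * (t^-1 * inner (Dr G (t *: x)) (t *: x) (t *: x)).
      rewrite /inner !linearZ /= -!scalemxAl [in RHS]mxE [(_ *: (_ *m x^T)) _ _]mxE. by rewrite mulKf ?lt0r_neq0// mulKf ?lt0r_neq0.
    by rewrite radial_quad// !mulr0.
  move=> t /andP[t0 t1]; apply: (continuous_ray oB) => //. by apply: B_ray => //; rewrite ger0_norm.
rewrite scale0r scale1r /P G0 mulmx1 => e.
rewrite /inner -e mxE; apply: eq_bigr => k _; by rewrite [x^T _ _]mxE.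
Qed.

(* The Gauss lemma: rays are orthogonal to the spheres around the origin. *)
Lemma gauss x : B x -> x *m G x = x.
Proof.
move=> Bx.
pose P (y : 'rV[R]_n) : 'rV[R]_n := y *m G y.
have sid := @smooth_mx_id R n B oB.
have sP : smooth_mx B P by apply: smooth_mulmx.
(* Differentiating [inner_radial] in direction [l] gives [2 (y G)_l + y (dmx l G) y^T = 2 y_l].
   Together with [radial_lowered] this identifies the radial derivative of [y *m G y]. *)
have DrP y : B y -> Dr P y = y.
  move=> By; rewrite (DrM oB sid sG By) Dr_id; apply/rowP => l; rewrite mxE radial_lowered//.
  have e1 : dmx l (fun z : 'rV[R]_n => P z *m z^T) y = dmx l (fun z : 'rV[R]_n => z *m z^T) y.
    apply: (dmx_eq oB l By) => z Bz; apply/matrixP => a b; rewrite !ord1.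
    rewrite -[LHS]/(inner (G z) z z) inner_radial// /dot [RHS]mxE. by apply: eq_bigr => k _; rewrite [z^T _ _]mxE.
  move: e1. rewrite (dmxM oB l sP (smooth_trmx oB sid) By) (dmxM oB l sid (smooth_trmx oB sid) By).
  rewrite (dmxM oB l sid sG By) dmx_tr dmx_id mulmxDl. move=> /(congr1 (fun M : 'M[R]_1 => M 0 0)).
  have ee (w : 'rV[R]_n) : (w *m (delta_mx 0 l : 'rV[R]_n)^T) 0 0 = w 0 l by rewrite mulmx_trE dot_delta.
  have ee' : ((delta_mx 0 l : 'rV[R]_n) *m G y *m y^T) 0 0 = (y *m G y) 0 l.
    have := inner_sym (delta_mx 0 l) y (Gsym By); rewrite /inner ee => ->//.
  have ee'' : ((delta_mx 0 l : 'rV[R]_n) *m y^T) 0 0 = y 0 l by rewrite mulmx_trE dotC dot_delta.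
  rewrite mxE [X in X + _ = _]mxE ee ee' [RHS]mxE ee ee''.
  rewrite -/(P y); move: (P y 0 l) (y 0 l) ((y *m _ *m _) 0 0) => p q s h; lra.
apply/rowP => l.
pose Q (y : 'rV[R]_n) : 'rV[R]_n := x *m G y.
have sQ : smooth_mx B Q by apply: smooth_mulmx => //; exact: smooth_mx_cst oB _ _ _.
have DrQ t : 0 < t <= 1 -> t *: (Dr Q (t *: x)) = t *: x - t *: Q (t *: x).
  move=> /andP[t0 t1]. have Btx : B (t *: x) by apply: B_ray => //; rewrite ger0_norm// ltW.
  have -> : t *: Dr Q (t *: x) = t *: x *m Dr G (t *: x).
    rewrite -scalemxAl; congr (_ *: _); rewrite /Dr mulmx_sumr; apply: eq_bigr => k _.
    rewrite (dmxM oB k (smooth_mx_cst oB x) sG Btx) dmx_cst mul0mx add0r. by rewrite -scalemxAr.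
  have := DrP _ Btx; rewrite (DrM oB sid sG Btx) Dr_id. by move=> /(canRL (addKr _)) ->; rewrite /Q scalemxAl addrC.
(* By [DrQ] the function [t * (Q (t *: x) - x)] has derivative 0 along the ray, and at [t = 0] it is
   0. *)
have : 0 * (Q (0 *: x) 0 l - x 0 l) = 1 * (Q (1 *: x) 0 l - x 0 l).
  apply: (@is_derive0_eq R (fun t => t * (Q (t *: x) 0 l - x 0 l)) 0 1) => //.
    move=> t /andP[t0 t1]. have Btx : B (t *: x) by apply: B_ray => //; rewrite ger0_norm ltW.
    have dQ := is_derive_ray_Dr oB 0 l sQ Btx (lt0r_neq0 t0). have tle : 0 < t <= 1 by rewrite t0 ltW.
    have /(congr1 (fun M : 'rV[R]_n => M 0 l)) := DrQ t tle. rewrite !mxE -[\sum_j x 0 j * G (t *: x) j l]/(_) => hD.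
    apply: is_derive_eq. rewrite /GRing.scale /= subr0 mulr1 mulrA mulfV ?lt0r_neq0// mul1r.
    apply: (mulfI (lt0r_neq0 t0)); rewrite mulr0 mulrDr hD. rewrite -[scalemx t x]/(t *: x) [Q _ 0 l]mxE.
    by move: (\sum_j _) (x 0 l) => p q; ring.
  move=> t /andP[t0 t1]; apply: (@continuousM R R); first exact: cvg_id. apply: (@continuousB R R R); last exact: cst_continuous.
  by apply: (continuous_ray oB) => //; apply: B_ray => //; rewrite ger0_norm.
rewrite mul0r mul1r scale1r => /esym/eqP; rewrite subr_eq0 => /eqP; by [].
Qed.

(** [1 + Emx] is the covariant derivative of the radial field, that is, the Hessian of half the
    squared distance to the origin with one index raised. In flat space [Emx] vanishes, so it is the
    quantity to be estimated. *)
Definition Emx (x : 'rV[R]_n) : 'M[R]_n := \sum_b x 0 b *: Gam G b x.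

Lemma smooth_Emx : smooth_mx B Emx.
Proof.
apply: smooth_mx_sum => // i; apply: smooth_mxZ => //; first exact: smooth_coord.
exact: smooth_GamG.
Qed.

Lemma mul_Emx x : B x -> x *m Emx x = 0.
Proof. exact: Ggeo. Qed.

Lemma mul_Gam x i : B x -> x *m Gam G i x = row i (Emx x).
Proof.
move=> Bx; apply/rowP => k; rewrite !mxE summxE; apply: eq_bigr => j _.
by rewrite mxE (Gam_sym _ _ _ oB Bx Gsym).
Qed.

(** Differentiating the Gauss lemma shows that [\sum_b x 0 b * dmx c G x b d] is symmetric in [c]
    and [d]; in the lowered symbols contracted with [x] these two terms cancel. *)
Lemma Emx_mulG x : B x -> Emx x *m G x = 2^-1 *: Dr G x.
Proof.
move=> Bx; rewrite /Emx mulmx_suml.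
under eq_bigr do rewrite -scalemxAl Gam_mul ?Gsym ?Gunit//.
apply/matrixP => a l; rewrite summxE [RHS]mxE.
have sid := @smooth_mx_id R n B oB.
have H c d : \sum_b x 0 b * dmx c G x b d = (c == d)%:R - G x c d.
  have : dmx c (fun y : 'rV[R]_n => y *m G y) x = dmx c (fun y : 'rV[R]_n => y) x by apply: (dmx_eq oB c Bx) => y By; rewrite gauss.
  rewrite (dmxM oB c sid sG Bx) dmx_id => /(congr1 (fun M : 'rV[R]_n => M 0 d)).
  rewrite mxE [(x *m _) _ _]mxE [RHS]mxE eqxx /= -rowE [row _ _ _ _]mxE (eq_sym d) => <-. by rewrite addrC addrK.
rewrite /Dr summxE.
have -> : \sum_i (x 0 i *: lowmx G i x) a l = 2^-1 * (\sum_b (x 0 b *: dmx b G x) a l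
   + \sum_b x 0 b * dmx a G x b l - \sum_b x 0 b * dmx l G x b a).
  rewrite -big_split -sumrB mulr_sumr; apply: eq_bigr => b _ /=. by rewrite mxE lowmxE [X in _ = _ * (X + _ - _)]mxE; ring.
rewrite !H (eq_sym l) -[in G x l a](Gsym Bx) [(G x)^T l a]mxE.
by rewrite addrK.
Qed.

(* [u *m Rmx x] is the value R(u, x)x of the curvature operator of the ray through [x]. *)
Definition Rmx (x : 'rV[R]_n) : 'M[R]_n := \matrix_(i, j) curvature G x (delta_mx 0 i) x x 0 j.

Lemma mul_Rmx x u : u *m Rmx x = curvature G x u x x.
Proof.
have rw i : row i (Rmx x) = x *m \sum_j x 0 j *: Fc G i j x.
  apply/rowP => k; rewrite mxE mxE curvatureE; congr ((x *m _) 0 k). rewrite /Fuv (bigD1 i) //= [X in _ + X]big1 ?addr0.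
    by apply: eq_bigr => j _; rewrite mxE !eqxx mul1r.
  by move=> a ai; rewrite big1// => b _; rewrite mxE (negbTE ai) andbF mul0r scale0r.
rewrite [u in u *m _]rV_sum_delta mulmx_suml curvatureE /Fuv mulmx_sumr.
apply: eq_bigr => i _; rewrite -scalemxAl -rowE rw scalemxAr scaler_sumr.
by congr (_ *m _); apply: eq_bigr => j _; rewrite scalerA.
Qed.

(** For the shape operator [S = (1 + Emx) / t] of the distance spheres this is the usual
    [S' + S^2 + R = 0]. It comes from contracting [Fc] with [x], using [x *m Emx x = 0], the
    identity [mul_Gam] and the derivatives of both. *)
Lemma riccati x : B x -> Rmx x = - Emx x - Dr Emx x - Emx x *m Emx x.
Proof.
move=> Bx; apply/row_matrixP => i.
have sE := smooth_Emx; have sid := @smooth_mx_id R n B oB.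
have e0 : row i (Emx x) + x *m dmx i Emx x = 0.
  have : dmx i (fun y : 'rV[R]_n => y *m Emx y) x = dmx i (fun=> 0) x by apply: (dmx_eq oB i Bx) => y; exact: mul_Emx.
  by rewrite (dmxM oB i sid sE Bx) dmx_id dmx_cst -rowE.
have e1 : x *m (\sum_j x 0 j *: dmx i (Gam G j) x) = - (row i (Emx x) *+ 2).
  have -> : \sum_j x 0 j *: dmx i (Gam G j) x = dmx i Emx x - Gam G i x.
    rewrite /Emx (dmx_sum oB).
    - apply/esym/eqP; rewrite subr_eq; apply/eqP.
      rewrite (eq_bigr (fun j => partial i (fun y => y 0 j) x *: Gam G j x + x 0 j *: dmx i (Gam G j) x)).
        rewrite big_split /= addrC; congr (_ + _). rewrite (bigD1 i) //= [X in _ + X]big1 ?addr0.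
          by have := dmxE i (fun y : 'rV[R]_n => y) x 0 i; rewrite dmx_id mxE !eqxx => <-; rewrite scale1r.
        move=> j ji; have := dmxE i (fun y : 'rV[R]_n => y) x 0 j. by rewrite dmx_id mxE (negbTE ji) andbF => <-; rewrite scale0r.
      move=> j _; rewrite (dmxZ oB)//; last exact: smooth_GamG. exact: differentiable_coord.
    - by move=> j; apply: smooth_mxZ => //; exact: smooth_GamG.
    - exact: Bx.
  rewrite mulmxBr mul_Gam//; apply/eqP; rewrite mulr2n opprD eq_sym.
  by rewrite -[X in _ + X == _]add0r -e0 addrAC subrr add0r ?addrA; apply/eqP; rewrite (canRL (addKr _) e0) addr0.
have e2 : x *m (\sum_j x 0 j *: dmx j (Gam G i) x) = row i (Dr Emx x) - row i (Emx x).
  apply/eqP; rewrite eq_sym subr_eq; apply/eqP.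
  have : Dr (fun y : 'rV[R]_n => y *m Gam G i y) x = Dr (fun y => row i (Emx y)) x by apply: (Dr_eq oB Bx) => y; exact: mul_Gam.
  rewrite (DrM oB sid (smooth_GamG i) Bx) Dr_id mul_Gam// addrC => ->.
  rewrite /Dr linear_sum; apply: eq_bigr => k _; rewrite linearZ; congr (_ *: _).
  apply/rowP => j; rewrite [RHS]dmxE [LHS]mxE dmxE; congr (partial k _ x). by apply/funext => y; rewrite mxE.
have e3 : x *m (\sum_j x 0 j *: (Gam G j x *m Gam G i x)) = 0.
  under eq_bigr do rewrite scalemxAl. by rewrite -mulmx_suml mulmxA -/(Emx x) mul_Emx// mul0mx.
have e4 : x *m (\sum_j x 0 j *: (Gam G i x *m Gam G j x)) = row i (Emx x *m Emx x).
  under eq_bigr do rewrite scalemxAr. by rewrite -mulmx_sumr mulmxA -/(Emx x) mul_Gam// row_mul.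
have -> : row i (Rmx x) = x *m \sum_j x 0 j *: Fc G i j x.
  rewrite rowE mul_Rmx curvatureE; congr (x *m _). rewrite /Fuv (bigD1 i) //= [X in _ + X]big1 ?addr0.
    by apply: eq_bigr => j _; rewrite mxE !eqxx mul1r.
  by move=> a ai; rewrite big1// => b _; rewrite mxE (negbTE ai) andbF mul0r scale0r.
have -> : \sum_j x 0 j *: Fc G i j x = \sum_j x 0 j *: dmx i (Gam G j) x
   - \sum_j x 0 j *: dmx j (Gam G i) x + \sum_j x 0 j *: (Gam G j x *m Gam G i x)
   - \sum_j x 0 j *: (Gam G i x *m Gam G j x).
  rewrite -sumrB -big_split -sumrB; apply: eq_bigr => j _ /=. by rewrite /Fc scalerBr scalerDr scalerBr.
rewrite mulmxBr mulmxDr mulmxBr e1 e2 e3 e4.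
move: (Emx x *m Emx x) => Z.
apply/rowP => k; rewrite !mxE.
move: (Emx x i k) (Dr _ _ _ _) (Z i k) => p q r; ring.
Qed.

(** Read off the Riccati equation: [Emx G] is half of [Dr G], hence symmetric,
    [Emx Emx G = Emx G Emx^T] is symmetric too, and so is the radial derivative of [Emx G]. *)
Lemma RmxG_sym x : B x -> (Rmx x *m G x)^T = Rmx x *m G x.
Proof.
move=> Bx; have sE := smooth_Emx.
have symEG y : B y -> (Emx y *m G y)^T = Emx y *m G y.
  move=> By; rewrite Emx_mulG// linearZ; congr (_ *: _) => /=. by rewrite -Dr_tr; apply: (Dr_eq oB By) => z; exact: Gsym.
have symEEG : (Emx x *m (Emx x *m G x))^T = Emx x *m (Emx x *m G x).
  by rewrite trmx_mul symEG// -mulmxA; congr (_ *m _); rewrite -[RHS]symEG// trmx_mul Gsym.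
have DE : Dr Emx x *m G x = Dr (fun y => Emx y *m G y) x - 2 *: (Emx x *m (Emx x *m G x)).
  rewrite (DrM oB sE sG Bx) Emx_mulG// -scalemxAr scalerA mulfV ?pnatr_eq0// scale1r. by rewrite addrK.
rewrite riccati// !mulmxBl mulNmx DE -mulmxA.
have symDEG : (Dr (fun y => Emx y *m G y) x)^T = Dr (fun y => Emx y *m G y) x by rewrite -Dr_tr; apply: (Dr_eq oB Bx) => y; exact: symEG.
have tr (m : nat) (A : 'M[R]_m) : A^T = A -> forall a b, A a b = A b a by move=> {2}<- a b; rewrite mxE.
apply/matrixP => a b; rewrite mxE.
have := tr _ _ (symEG _ Bx) a b; have := tr _ _ symEEG a b; have := tr _ _ symDEG a b.
move: (Emx x *m G x) (Emx x *m (Emx x *m G x)) (Dr _ x) => X Y Z hZ hY hX.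
by rewrite !mxE hX hY hZ.
Qed.

Lemma chr_ray v t : B (t *: v) -> t != 0 -> chr G (t *: v) v = 0.
Proof.
move=> Btv t0.
have := Ggeo Btv; rewrite /chr => /eqP.
have -> : \sum_i (t *: v) 0 i *: Gam G i (t *: v) = t *: \sum_i v 0 i *: Gam G i (t *: v).
  by rewrite scaler_sumr; apply: eq_bigr => i _; rewrite mxE scalerA.
rewrite -scalemxAr -scalemxAl scalerA scaler_eq0 mulf_eq0 (negbTE t0) /=.
by move/eqP.
Qed.

Lemma small_ray (v : 'rV[R]_n) : exists2 e, 0 < e & forall t, `|t| < e -> B (t *: v).
Proof.
exists (rho / (1 + enorm v)); first by rewrite divr_gt0// ltr_pwDl// enorm_ge0.
move=> t; rewrite ltr_pdivlMr ?ltr_pwDl ?enorm_ge0// => h.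
rewrite /eball /= enormZ; apply: le_lt_trans h.
by rewrite mulrDr mulr1 lerDr.
Qed.

(** On every ray [chr G (t *: v) v = 0] for small nonzero [t]; continuity gives it at the origin for
    all [v], and polarization with the symmetry of the symbols kills each of them. *)
Lemma Gam0 b : Gam G b 0 = 0.
Proof.
have chr0 v : chr G 0 v = 0.
  apply/rowP => k; rewrite [RHS]mxE. pose f (t : R) : R := chr G (t *: v) v 0 k. have cf : {for 0, continuous f}.
    pose A (x : 'rV[R]_n) : 'rV[R]_n := chr G x v. have sA : smooth_mx B A.
      apply: smooth_mulmx => //; first exact: smooth_mx_cst.
      apply: smooth_mx_sum => // i; apply: smooth_mxZ => //; first exact: smooth_cst. exact: smooth_GamG.
    have := @continuous_ray R n B oB _ _ A v 0 0 k sA; apply. by rewrite scale0r; exact: B0.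
  have [e e0 He] := small_ray v. apply/eqP/negPn/negP => fn0. have f0 : f 0 != 0 by rewrite /f scale0r.
  have : \forall t \near 0^', f t != 0.
    have f00 : 0 < `|f 0| by rewrite normr_gt0. apply: cvg_within; move/cvgrPdist_lt : cf => /(_ _ f00).
    by apply: filterS => t; apply: contraTN => /eqP ->; rewrite subr0 ltxx.
  have : \forall t \near (0 : R)^', `|t| < e.
    exact: dnbhs0_lt.
  move=> h1 h2. have [t [ht [ft tn]]] : exists t, `|t| < e /\ (f t != 0 /\ t != 0).
    apply: (@filter_ex _ (0 : R)^'). near=> t; split; first by near: t. by split; near: t => //; exact: nbhs_dnbhs_neq.
  by move: ft; rewrite /f chr_ray ?mxE ?eqxx//; exact: He.
have q i j k : christoffel G k i j 0 + christoffel G k j i 0 = 0.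
  have := chr0 (delta_mx 0 i + delta_mx 0 j). have := chr0 (delta_mx 0 i); have := chr0 (delta_mx 0 j).
  have E u : chr G 0 u = \row_k inner (\matrix_(a, b) christoffel G k a b 0) u u.
    apply/rowP => l; rewrite chrE mxE innerE /dot exchange_big /=; apply: eq_bigr => c _.
    by rewrite mxE mulr_suml; apply: eq_bigr => a _; rewrite mxE; ring.
  rewrite !E => /(congr1 (fun M : 'rV[R]_n => M 0 k)) + /(congr1 (fun M : 'rV[R]_n => M 0 k)) + /(congr1 (fun M : 'rV[R]_n => M 0 k)).
  rewrite [LHS]mxE [RHS]mxE inner_delta mxE => h1. rewrite [LHS]mxE [RHS]mxE inner_delta mxE => h2.
  rewrite [LHS]mxE [RHS]mxE !innerDl !innerDr !inner_delta !mxE h1 h2. by rewrite add0r addr0.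
apply/matrixP => j k; rewrite GamEE [RHS]mxE.
have := q b j k; have := Gam_sym j b k oB B0 Gsym; rewrite !GamEE => ->.
by move: (christoffel _ _ _ _ _) => p; lra.
Unshelve. all: by end_near. Qed.

Hypothesis kappa0 : 0 <= kappa.
Hypothesis Gcurv : forall x, B x -> forall u,
  `|inner (G x) (curvature G x u x x) u| <= kappa * dot x x * inner (G x) u u.

(** The entries of [G] are at most 2, so the quadratic form of the symmetric matrix [Rmx G] is at
    most [2 kappa |x|^2] on basis vectors and [8 kappa |x|^2] on their sums. Polarization gives
    entries at most [6 kappa |x|^2]; the inverse of [G] contributes 2 and the matrix product [n]. *)
Lemma Rmx_le x : B x -> n%:R * `|G x - 1%:M| <= 2^-1 ->
  `|Rmx x| <= 12 * n%:R * kappa * dot x x.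
Proof.
move=> Bx Gx.
have d0 := dot_ge0 x.
have G2 i j : `|G x i j| <= 2.
  have n1 : 1 <= (n%:R : R) by rewrite ler1n; case: (n) i => [[]|]. have h : `|(G x - 1%:M) i j| <= 2^-1.
    apply: le_trans Gx; apply: le_trans (mx_entry_le _ i j) _. by rewrite ler_peMl.
  move: h; rewrite !mxE; case: eqP => _ /=; rewrite ?mulr1n ?mulr0n !ler_norml => /andP[? ?]; itv_lra.
pose Q := Rmx x *m G x.
have Qin u : inner Q u u = inner (G x) (curvature G x u x x) u by rewrite /inner -mul_Rmx !mulmxA.
have kd : 0 <= kappa * dot x x by rewrite mulr_ge0.
have Q1 i : `|inner Q (delta_mx 0 i) (delta_mx 0 i)| <= 2 * (kappa * dot x x).
  rewrite Qin; apply: le_trans (Gcurv Bx _) _; rewrite inner_delta mulrC ler_wpM2r//. exact: le_trans (ler_norm _) (G2 _ _).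
have Q2 i j : `|inner Q (delta_mx 0 i + delta_mx 0 j) (delta_mx 0 i + delta_mx 0 j)| <= 8 * (kappa * dot x x).
  rewrite Qin; apply: le_trans (Gcurv Bx _) _; rewrite mulrC ler_wpM2r//. rewrite !innerDl !innerDr !inner_delta.
  have h a b := le_trans (ler_norm _) (G2 a b). by have := h i i; have := h i j; have := h j i; have := h j j; lra.
have Qle : `|Q| <= 6 * (kappa * dot x x).
  apply: mx_norm_le => [|i j]; first by rewrite mulr_ge0. apply: le_trans (quad_entry_le (RmxG_sym Bx) Q1 Q2 i j) _.
  by move: (kappa * _) => p; lra.
have -> : Rmx x = Q *m invmx (G x) by rewrite /Q mulmxK// Gunit.
apply: le_trans (mx_norm_mul _ _) _.
have iG := invmx_norm_le (Gunit Bx) Gx.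
apply: (@le_trans _ _ (n%:R * (6 * (kappa * dot x x)) * 2)).
  by rewrite ler_pM ?mulr_ge0// ler_wpM2l.
by rewrite le_eqVlt; apply/orP; left; apply/eqP; ring.
Qed.

Hypothesis small : 128 * n%:R ^+ 3 * kappa * rho ^+ 2 <= 1.

(** [Emx (t *: v)] is [t] times a function of [t] that is continuous and vanishes at 0 by [Gam0].
    This starts the bootstrap along the ray. *)
Lemma Emx_small v (eta : R) i j : 0 < eta ->
  \forall t \near (0 : R)^'+, `|Emx (t *: v) i j| < eta * t.
Proof.
move=> eta0.
pose g (t : R) : R := (\sum_b v 0 b *: Gam G b (t *: v)) i j.
have cg : {for 0, continuous g}.
  have sA : smooth_mx B (fun x => \sum_b v 0 b *: Gam G b x).
    apply: smooth_mx_sum => // b; apply: smooth_mxZ => //; first exact: smooth_cst. exact: smooth_GamG.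
  have := @continuous_ray R n B oB _ _ _ v 0 i j sA; apply. by rewrite scale0r; exact: B0.
have g0 : g 0 = 0.
  rewrite /g scale0r summxE big1// => b _; by rewrite Gam0 scaler0 mxE.
have gs : \forall t \near (0 : R)^'+, `|g t| < eta.
  apply: cvg_within; move/cvgrPdist_lt : cg => /(_ _ eta0); rewrite g0. by apply: filterS => t; rewrite sub0r normrN.
near=> t.
have -> : Emx (t *: v) i j = t * g t.
  rewrite /Emx /g !summxE mulr_sumr; apply: eq_bigr => b _. by rewrite !mxE mulrA.
rewrite normrM gtr0_norm// mulrC ltr_pM2r//.
by near: t.
Unshelve. all: by end_near. Qed.

Section Ray.
Variables (v : 'rV[R]_n) (eta : R).
Hypothesis v1 : enorm v = 1.
Hypothesis eta0 : 0 < eta.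
Hypothesis eta1 : 16 * n%:R ^+ 2 * eta * rho <= 1.
Hypothesis n_gt0 : (0 < n)%N.

(** The bootstrap needs strict inequalities that already hold for small [t]; the term [eta * t]
    provides them, and [eta] is sent to 0 in [Emx_le]. The bound on [G] travels along because
    [Rmx_le] presupposes it. *)
Let P (t : R) := (forall i j, `|Emx (t *: v) i j| < 8 * n%:R * kappa * t ^+ 2 + eta * t) /\
  (forall i j, n%:R * `|(G (t *: v) - 1%:M) i j| < 2^-1).

Let Brho t : 0 <= t < rho -> B (t *: v).
Proof. by move=> /andP[t0 t1]; rewrite /eball /= enormZ v1 mulr1 ger0_norm. Qed.

Let eta0' : 0 <= eta. Proof. exact: ltW. Qed.
Let rho0' : 0 <= rho. Proof. exact: ltW. Qed.

Let n1 : 1 <= (n%:R : R). Proof. by rewrite ler1n. Qed.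

Let arith1 s : 0 < s < rho -> n%:R * (8 * n%:R * kappa * s ^+ 2 + eta * s) <= 2^-1.
Proof.
move=> /andP[s0 s1].
have srho2 : s ^+ 2 <= rho ^+ 2 by rewrite ler_pXn2r ?nnegrE ?ltW.
have ks : 0 <= kappa * s ^+ 2 by rewrite mulr_ge0 ?sqr_ge0.
have n23 : (n%:R : R) ^+ 2 <= n%:R ^+ 3 by apply: ler_weXn2l.
have h1 : n%:R ^+ 2 * (kappa * s ^+ 2) <= n%:R ^+ 3 * (kappa * rho ^+ 2) by apply: ler_pM => //; exact: ler_wpM2l.
have h2 : n%:R * (eta * s) <= n%:R ^+ 2 * (eta * rho).
  apply: ler_pM => //; first by rewrite mulr_ge0// ltW.
    by rewrite -[leLHS]expr1; apply: ler_weXn2l.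
  by rewrite ler_pM2l// ltW.
have h3 : 128 * (n%:R ^+ 3 * (kappa * rho ^+ 2)) <= 1.
  by have -> : 128 * (n%:R ^+ 3 * (kappa * rho ^+ 2)) = 128 * n%:R ^+ 3 * kappa * rho ^+ 2 by ring.
have h4 : 16 * (n%:R ^+ 2 * (eta * rho)) <= 1 by have -> : 16 * (n%:R ^+ 2 * (eta * rho)) = 16 * n%:R ^+ 2 * eta * rho by ring.
have -> : n%:R * (8 * n%:R * kappa * s ^+ 2 + eta * s) =
   8 * (n%:R ^+ 2 * (kappa * s ^+ 2)) + n%:R * (eta * s) by ring.
move: (_ ^+ 3 * _) (_ ^+ 2 * _) h1 h3 (_ ^+ 2 * _) (_ * (_ * s)) h2 h4 => p q h1 h3 u w h2 h4.
lra.
Qed.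

(** By the Riccati equation [(s Emx)' = - Emx^2 - Rmx]. By [arith1] the square is at most half of
    the assumed bound, and with [Rmx_le] the derivative is at most [16 n kappa s^2 + eta s / 2].
    Integrating and dividing by [t] gives [16/3] and [1/4] in place of 8 and 1, a strict gain. *)
Let step_E t i j : 0 < t < rho -> (forall s, 0 < s < t -> P s) ->
  `|Emx (t *: v) i j| < 8 * n%:R * kappa * t ^+ 2 + eta * t.
Proof.
move=> /andP[t0 trho] Ps.
have sE := smooth_Emx.
have HB s : 0 <= s <= t -> B (s *: v) by move=> /andP[s0 st]; apply: Brho; rewrite s0 (le_lt_trans st).
have := @mvt_bound R (fun s => s * Emx (s *: v) i j)
  (fun s => 16 / 3 * n%:R * kappa * s ^+ 3 + eta / 4 * s ^+ 2)
  (fun s => Emx (s *: v) i j + Dr Emx (s *: v) i j)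
  (fun s => 16 * n%:R * kappa * s ^+ 2 + eta / 2 * s) t (ltW t0).
rewrite mul0r subr0 !expr0n /= !mulr0 addr0 subr0 => H.
have : `|t * Emx (t *: v) i j| <= 16 / 3 * n%:R * kappa * t ^+ 3 + eta / 4 * t ^+ 2.
  apply: H.
  - move=> s /andP[s0 st].
    have Bs : B (s *: v) by apply: HB; rewrite !ltW. have dE := is_derive_ray_Dr oB i j sE Bs (lt0r_neq0 s0). apply: is_derive_eq.
    rewrite /GRing.scale /= mulr1 addrC mulrA mulfV ?lt0r_neq0// mul1r. by [].
  - move=> s _; apply: is_derive_eq.
    by rewrite /GRing.scale /=; field.
  - move=> s hs; apply: (@continuousM R R); first exact: cvg_id.
    by apply: (continuous_ray oB) => //; exact: HB.
  - move=> s _; apply: derivable_continuous.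
    by [].
  - move=> s /andP[s0 st].
    have Bs : B (s *: v) by apply: HB; rewrite !ltW. have sst : 0 < s < t by rewrite s0. have [PE PG] := Ps s sst.
    have ss : 0 < s < rho by rewrite s0 (lt_trans st).
    have -> : Emx (s *: v) i j + Dr Emx (s *: v) i j = - (Emx (s *: v) *m Emx (s *: v)) i j - Rmx (s *: v) i j.
      rewrite riccati//; move: (Emx _) (Dr _ _) => X Y; move: (X *m X) => Z.
      by rewrite !mxE; move: (X i j) (Y i j) (Z i j) => p q r; ring.
    pose b := 8 * n%:R * kappa * s ^+ 2 + eta * s. have b0 : 0 <= b by rewrite addr_ge0 ?mulr_ge0 ?sqr_ge0// ltW.
    have EE : `|Emx (s *: v)| <= b by apply: mx_norm_le => // k l; exact: ltW. have GG : n%:R * `|G (s *: v) - 1%:M| <= 2^-1.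
      rewrite mulrC -ler_pdivlMr ?ltr0n//; apply: mx_norm_le => [|k l].
        by rewrite divr_ge0.
      by rewrite ler_pdivlMr ?ltr0n// mulrC ltW.
    have RR := Rmx_le Bs GG. rewrite dotZl dotZr -sqr_enorm v1 expr1n mulr1 -expr2 in RR.
    apply: le_trans (ler_normB _ _) _; rewrite normrN. have h1 : `|(Emx (s *: v) *m Emx (s *: v)) i j| <= 2^-1 * b.
      apply: le_trans (mx_entry_le _ _ _) _; apply: le_trans (mx_norm_mul _ _) _. apply: (@le_trans _ _ (n%:R * b * b)).
        by rewrite ler_pM ?mulr_ge0// ler_wpM2l.
      by rewrite ler_wpM2r// arith1.
    have h2 := le_trans (mx_entry_le (Rmx (s *: v)) i j) RR. apply: le_trans (lerD h1 h2) _; rewrite /b.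
    by move: (n%:R) kappa eta (s) => p q r u; rewrite le_eqVlt; apply/orP; left; apply/eqP; field.
rewrite normrM gtr0_norm// => h.
rewrite -(ltr_pM2l t0); apply: le_lt_trans h _.
have k0 : 0 <= n%:R * kappa * t ^+ 3 by rewrite !mulr_ge0 ?exprn_ge0// ltW.
have e2 : 0 < eta * t ^+ 2 by rewrite mulr_gt0// exprn_gt0.
rewrite -!mulrA (mulrA n%:R) mulrDr.
have -> : t * (8 * (n%:R * (kappa * t ^+ 2))) = 8 * (n%:R * kappa * t ^+ 3) by ring.
have -> : t * (eta * t) = eta * t ^+ 2 by ring.
have -> : eta * (4^-1 * t ^+ 2) = 4^-1 * (eta * t ^+ 2) by ring.
move: (n%:R * kappa * _) (eta * _) k0 e2 => p q; lra.
Qed.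

(** The derivative of [G] along the ray is [2 Emx G / s], so the bound on [Emx] is integrated once
    more. The parameter [e0] is kept apart from [eta] so that the lemma applies again with [e0 = 0]
    once [eta] has been eliminated from the bound on [Emx]. *)
Let G_bound (e0 : R) t i j : 0 <= e0 -> 0 <= t < rho ->
  (forall s, 0 < s < t -> `|Emx (s *: v)| <= 8 * n%:R * kappa * s ^+ 2 + e0 * s /\
     n%:R * `|G (s *: v) - 1%:M| <= 2^-1) ->
  `|(G (t *: v) - 1%:M) i j| <= 16 * n%:R ^+ 2 * kappa * t ^+ 2 + 4 * n%:R * e0 * t.
Proof.
move=> e00 /andP[t0 trho] Ps.
have HB s : 0 <= s <= t -> B (s *: v) by move=> /andP[s0 st]; apply: Brho; rewrite s0 (le_lt_trans st).
have := @mvt_bound R (fun s => G (s *: v) i j)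
  (fun s => 16 * n%:R ^+ 2 * kappa * s ^+ 2 + 4 * n%:R * e0 * s)
  (fun s => s^-1 * Dr G (s *: v) i j)
  (fun s => 32 * n%:R ^+ 2 * kappa * s + 4 * n%:R * e0) t t0.
rewrite scale0r G0 expr0n /= !mulr0 addr0 subr0 => H.
have -> : (G (t *: v) - 1%:M) i j = G (t *: v) i j - (1%:M : 'M[R]_n) i j by rewrite !mxE.
apply: H.
- move=> s /andP[s0 st].
  by apply: (is_derive_ray_Dr oB) => //; [apply: HB; rewrite !ltW|exact: lt0r_neq0].
- move=> s _; apply: is_derive_eq.
  by rewrite /GRing.scale /=; ring.
- by move=> s hs; apply: (continuous_ray oB) => //; exact: HB.
- by move=> s _; apply: derivable_continuous.
move=> s /[dup] /Ps [PE PG] /andP[s0 st].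
have Bs : B (s *: v) by apply: HB; rewrite !ltW.
rewrite normrM gtr0_norm ?invr_gt0// ler_pdivrMl//.
have -> : Dr G (s *: v) = 2 *: (Emx (s *: v) *m G (s *: v)) by rewrite Emx_mulG// scalerA mulfV ?pnatr_eq0// scale1r.
rewrite mxE normrM ger0_norm//.
have G2 : `|G (s *: v)| <= 2.
  rewrite -[G _](subrK 1%:M); apply: le_trans (ler_normD _ _) _.
  have h1 : `|(1%:M : 'M[R]_n)| <= 1 by apply: mx_norm_le => // k l; rewrite mxE; case: eqP => _; rewrite ?normr1 ?normr0.
  have h2 : `|G (s *: v) - 1%:M| <= 2^-1 by apply: le_trans PG; rewrite ler_peMl. by move: h1 h2; move: (`|_|) (`|_|) => p q; lra.
have h := le_trans (mx_entry_le (Emx (s *: v) *m G (s *: v)) i j) (mx_norm_mul _ _).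
have b0 : 0 <= 8 * n%:R * kappa * s ^+ 2 + e0 * s.
  exact: le_trans PE.
have h' : n%:R * `|Emx (s *: v)| * `|G (s *: v)| <= n%:R * (8 * n%:R * kappa * s ^+ 2 + e0 * s) * 2.
  by apply: ler_pM => //; rewrite ?mulr_ge0// ler_wpM2l.
apply: (@le_trans _ _ (2 * (n%:R * (8 * n%:R * kappa * s ^+ 2 + e0 * s) * 2))).
  by rewrite ler_wpM2l// (le_trans h).
by move: (n%:R) => p; rewrite le_eqVlt; apply/orP; left; apply/eqP; ring.
Qed.

Let P_norm t : 0 < t < rho -> P t -> `|Emx (t *: v)| <= 8 * n%:R * kappa * t ^+ 2 + eta * t /\
     n%:R * `|G (t *: v) - 1%:M| <= 2^-1.
Proof.
move=> /andP[t0 tr] [PE PG]; split.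
  apply: mx_norm_le => [|k l]; last exact: ltW. by rewrite addr_ge0 ?mulr_ge0 ?sqr_ge0// ltW.
rewrite mulrC -ler_pdivlMr ?ltr0n//; apply: mx_norm_le => [|k l].
  by rewrite divr_ge0.
by rewrite ler_pdivlMr ?ltr0n// mulrC ltW.
Qed.

Let arith2 t : 0 < t < rho ->
  n%:R * (16 * n%:R ^+ 2 * kappa * t ^+ 2 + 4 * n%:R * eta * t) < 2^-1.
Proof.
move=> /andP[s0 s1].
have srho2 : t ^+ 2 <= rho ^+ 2 by rewrite ler_pXn2r ?nnegrE ?ltW.
have h1 : n%:R ^+ 3 * kappa * t ^+ 2 <= n%:R ^+ 3 * kappa * rho ^+ 2 by rewrite ler_wpM2l// mulr_ge0// exprn_ge0.
have h2 : n%:R ^+ 2 * eta * t <= n%:R ^+ 2 * eta * rho by rewrite ler_wpM2l ?mulr_ge0 ?sqr_ge0// ltW.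
have -> : n%:R * (16 * n%:R ^+ 2 * kappa * t ^+ 2 + 4 * n%:R * eta * t) =
  16 * (n%:R ^+ 3 * kappa * t ^+ 2) + 4 * (n%:R ^+ 2 * eta * t) by ring.
move: small eta1; rewrite -!(mulrA 128) -!(mulrA 16).
move: (_ * t ^+ 2) (_ * rho ^+ 2) h1 (_ * t) (_ * rho) h2 => p q h1 r u h2; lra.
Qed.

Let ray_P t : 0 < t < rho -> P t.
Proof.
move: t; have [e e0 He] : exists2 e, 0 < e & forall t, 0 < t < e -> P t.
  have nearE : \forall t \near (0 : R)^'+, forall ij : 'I_n * 'I_n, `|Emx (t *: v) ij.1 ij.2| < eta * t.
    by apply: filter_forall => ij; exact: Emx_small.
  have nearG : \forall t \near (0 : R)^'+, forall ij : 'I_n * 'I_n, 0 < 2^-1 - n%:R * `|G (t *: v) ij.1 ij.2 - (1%:M : 'M[R]_n) ij.1 ij.2|.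
    apply: filter_forall => -[i j] /=; apply: cvg_within.
    apply: continuous_pos_near; last by rewrite scale0r G0 subrr normr0 mulr0 subr0.
    apply: (@continuousB R R R); first exact: cst_continuous. apply: (@continuousM R R); first exact: cst_continuous.
    apply: (@continuous_comp R R R _ Num.norm); last exact: norm_continuous.
    apply: (@continuousB R R R); last exact: cst_continuous.
    by have := @continuous_ray R n B oB _ _ G v 0 i j sG; apply; rewrite scale0r; exact: B0.
  have : \forall t \near (0 : R)^'+, P t.
    apply: filterS3 (nbhs_right_gt (0 : R)) nearE nearG => t t0 hE hG; split=> i j.
      apply: lt_le_trans (hE (i, j)) _; rewrite lerDr. by apply: mulr_ge0; [rewrite !mulr_ge0|exact: sqr_ge0].
    by have := hG (i, j); rewrite subr_gt0 !mxE.
  by move=> /at_right_ex[e e0 He]; exists e => // s; rewrite -{1}(add0r e); exact: He.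
apply: (real_bootstrap e0 He) => t ht Ps.
have Pt : P t.
  split=> i j; first exact: step_E. have /andP[t0 tr] := ht.
  have := @G_bound eta t i j (ltW eta0); rewrite (ltW t0) tr => /(_ isT) H.
  apply: le_lt_trans (arith2 ht); rewrite ler_wpM2l//; apply: H => s hs. apply: P_norm; last exact: Ps.
  by have /andP[-> h] := hs; rewrite (lt_trans h).
split=> //.
have Bt : B (t *: v) by apply: Brho; have /andP[t0 ->] := ht; rewrite ltW.
have nearE : \forall s \near t, forall ij : 'I_n * 'I_n,
    0 < 8 * n%:R * kappa * s ^+ 2 + eta * s - `|Emx (s *: v) ij.1 ij.2|.
  apply: (@filter_forall _ _ (fun (ij : 'I_n * 'I_n) (s : R) =>
    0 < 8 * n%:R * kappa * s ^+ 2 + eta * s - `|Emx (s *: v) ij.1 ij.2|) (nbhs t)) => -[i j] /=.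
  apply: continuous_pos_near; last by rewrite subr_gt0; apply: Pt.1.
  apply: (@continuousB R R R); first by apply: derivable_continuous.
  apply: (@continuous_comp R R R _ Num.norm); last exact: norm_continuous.
  by have := @continuous_ray R n B oB _ _ Emx v t i j smooth_Emx; apply.
have nearG : \forall s \near t, forall ij : 'I_n * 'I_n, 0 < 2^-1 - n%:R * `|G (s *: v) ij.1 ij.2 - (1%:M : 'M[R]_n) ij.1 ij.2|.
  apply: (@filter_forall _ _ (fun (ij : 'I_n * 'I_n) (s : R) =>
    0 < 2^-1 - n%:R * `|G (s *: v) ij.1 ij.2 - (1%:M : 'M[R]_n) ij.1 ij.2|) (nbhs t)) => -[i j] /=.
  apply: continuous_pos_near; last first.
    by have := Pt.2 i j; rewrite !mxE subr_gt0.
  apply: (@continuousB R R R); first exact: cst_continuous. apply: (@continuousM R R); first exact: cst_continuous.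
  apply: (@continuous_comp R R R _ Num.norm); last exact: norm_continuous. apply: (@continuousB R R R); last exact: cst_continuous.
  by have := @continuous_ray R n B oB _ _ G v t i j sG; apply.
apply: near_right_ex; apply: filterS2 nearE nearG => s hE hG; split=> i j.
  by have := hE (i, j); rewrite subr_gt0.
by have := hG (i, j); rewrite subr_gt0 !mxE.
Qed.

Lemma ray_E_le t : 0 < t < rho -> `|Emx (t *: v)| <= 8 * n%:R * kappa * t ^+ 2 + eta * t.
Proof. by move=> ht; have [] := P_norm ht (ray_P ht). Qed.

Lemma ray_G_le t : 0 < t < rho -> n%:R * `|G (t *: v) - 1%:M| <= 2^-1.
Proof. by move=> ht; have [] := P_norm ht (ray_P ht). Qed.

Lemma ray_G_E (e0 : R) t : 0 <= e0 -> 0 <= t < rho ->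
  (forall s, 0 < s < t -> `|Emx (s *: v)| <= 8 * n%:R * kappa * s ^+ 2 + e0 * s) ->
  `|G (t *: v) - 1%:M| <= 16 * n%:R ^+ 2 * kappa * t ^+ 2 + 4 * n%:R * e0 * t.
Proof.
move=> h0 /[dup] /andP[t0 tr] ht H; apply: mx_norm_le => [|i j].
  by rewrite addr_ge0 ?mulr_ge0 ?sqr_ge0.
apply: G_bound => // s /[dup] /H hs /andP[s0 st]; split => //.
by apply: ray_G_le; rewrite s0 (lt_trans st).
Qed.

End Ray.

Lemma Emx_le x : B x -> `|Emx x| <= 8 * n%:R * kappa * dot x x.
Proof.
move=> Bx; have [->|x0] := eqVneq x 0.
  rewrite dot0l mulr0 (_ : Emx 0 = 0) ?normr0//. by rewrite /Emx big1// => b _; rewrite mxE scale0r.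
have n_gt0 : (0 < n)%N by rewrite lt0n; apply: contra x0 => /eqP n0; apply/eqP/rowP => i; have := ltn_ord i; rewrite {2}n0.
pose t := enorm x; pose v := t^-1 *: x.
have t0 : 0 < t by exact: enorm_gt0.
have v1 : enorm v = 1 by rewrite enormZ gtr0_norm ?invr_gt0// mulVf// lt0r_neq0.
have xE : x = t *: v by rewrite scalerA mulfV ?scale1r// lt0r_neq0.
have tr : 0 < t < rho by rewrite t0.
rewrite -sqr_enorm -/t {1}xE; apply/ler_addgt0Pl => e e0.
(* With [eta <= D^-1] the smallness condition [eta1] holds, and with [eta <= e / t] the surplus
   [eta * t] is at most [e]. *)
pose D := 1 + 16 * n%:R ^+ 2 * rho.
have D0 : 0 < D by rewrite ltr_pwDl// !mulr_ge0 ?sqr_ge0// ltW.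
pose eta := Num.min (e / t) (D^-1).
have eta0 : 0 < eta by rewrite lt_min divr_gt0//= invr_gt0.
have eta1 : 16 * n%:R ^+ 2 * eta * rho <= 1.
  have h : eta <= D^-1 by rewrite ge_min lexx orbT. have h2 : D * eta <= 1 by rewrite -(mulfV (lt0r_neq0 D0)) ler_pM2l.
  have h3 : 16 * n%:R ^+ 2 * eta * rho = (D - 1) * eta by rewrite /D; ring.
  by rewrite h3 mulrBl mul1r; have := eta0; move: h2; move: (D * eta) => p; lra.
apply: le_trans (ray_E_le v1 eta0 eta1 n_gt0 tr) _; rewrite addrC lerD2r.
by rewrite -ler_pdivlMr// ge_min lexx.
Qed.

Lemma metric_le x : B x -> `|G x - 1%:M| <= 16 * n%:R ^+ 2 * kappa * dot x x.
Proof.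
move=> Bx; have [->|x0] := eqVneq x 0.
  by rewrite dot0l mulr0 G0 subrr normr0.
have n_gt0 : (0 < n)%N by rewrite lt0n; apply: contra x0 => /eqP n0; apply/eqP/rowP => i; have := ltn_ord i; rewrite {2}n0.
pose t := enorm x; pose v := t^-1 *: x.
have t0 : 0 < t by exact: enorm_gt0.
have v1 : enorm v = 1 by rewrite enormZ gtr0_norm ?invr_gt0// mulVf// lt0r_neq0.
have xE : x = t *: v by rewrite scalerA mulfV ?scale1r// lt0r_neq0.
have D0 : 0 < 16 * n%:R ^+ 2 * rho by apply: mulr_gt0 => //; apply: mulr_gt0 => //; rewrite exprn_gt0// ltr0n.
have eta1 : 16 * n%:R ^+ 2 * (16 * n%:R ^+ 2 * rho)^-1 * rho <= 1 by rewrite mulrAC mulfV// lt0r_neq0.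
have eta0 : 0 < (16 * n%:R ^+ 2 * rho)^-1 by rewrite invr_gt0.
rewrite -sqr_enorm -/t {1}xE.
have := @ray_G_E v _ v1 eta0 eta1 n_gt0 0 t (lexx _).
rewrite mulr0 mul0r addr0 (ltW t0) => -> //.
move=> s /andP[s0 st]; rewrite mul0r addr0.
have Bs : B (s *: v) by rewrite /eball /= enormZ v1 mulr1 gtr0_norm// (lt_trans st).
by apply: le_trans (Emx_le Bs) _; rewrite dotZl dotZr -sqr_enorm v1 expr1n mulr1 -expr2.
Qed.

End NormalCoordinates.

Lemma mvt_bound_itv R (f f' : R -> R) (a b L : R) : a <= b ->
  (forall s, a < s < b -> is_derive s 1 f (f' s)) ->
  (forall s, a <= s <= b -> {for s, continuous f}) ->
  (forall s, a < s < b -> `|f' s| <= L) ->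
  `|f b - f a| <= L * (b - a).
Proof.
move=> ab df cf fL.
have [c cab ->] : exists2 c, c \in `[a, b] & f b - f a = (if a < c < b then f' c else 0) * (b - a).
  have [e|anb] := eqVneq a b.
    by exists a; rewrite ?in_itv /= ?e ?lexx// subrr subrr mulr0.
  have altb : a < b by rewrite lt_def eq_sym anb. have [c cab e] : exists2 c, c \in `]a, b[ & f b - f a = f' c * (b - a).
    apply: (@MVT R f f' a b altb). by apply: continuous_in_subspaceT => x; rewrite inE /= in_itv; exact: cf.
  exists c; first exact: subset_itv_oo_cc cab. by move: cab; rewrite in_itv /= => ->.
rewrite normrM (ger0_norm (_ : 0 <= b - a)) ?subr_ge0//.
case: ifP => [|_]; first by move=> /fL h; rewrite ler_wpM2r ?subr_ge0.
rewrite normr0 mul0r; have [->|anb] := eqVneq a b; first by rewrite subrr mulr0.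
rewrite mulr_ge0 ?subr_ge0//; apply: le_trans (fL ((a + b) / 2) _); first exact: normr_ge0.
by itv_lra.
Qed.

(** The reciprocal of [1 + \sum (d i)^-1] is a positive lower bound also when the index type is
    empty. *)
Lemma fin_pos_lb R (I : finType) (d : I -> R) :
  (forall i, 0 < d i) -> exists2 e, 0 < e & forall i, e <= d i.
Proof.
move=> d0; exists (1 + \sum_i (d i)^-1)^-1.
  by rewrite invr_gt0 ltr_pwDl// sumr_ge0// => i _; rewrite invr_ge0 ltW.
move=> i; rewrite -[leRHS]invrK lef_pV2 ?posrE ?invr_gt0//; last first.
  by rewrite ltr_pwDl// sumr_ge0// => j _; rewrite invr_ge0 ltW.
rewrite (bigD1 i)//= addrCA lerDl addr_ge0// sumr_ge0// => j _.
by rewrite invr_ge0 ltW.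
Qed.

Section LocalLipschitz.
Context R n.

Lemma smooth_lipschitz (V : set 'rV[R]_n) f y0 : open V -> smooth_fun V f -> V y0 ->
  exists d L, [/\ 0 < d, 0 <= L & forall y z, ball y0 d y -> ball y0 d z ->
    [/\ V y, `|f y| <= L & `|f y - f z| <= L * `|y - z|]].
Proof.
move=> oV sf Vy0.
pose M := 1 + \sum_(i < n) `|partial i f y0|.
have M0 : 0 < M by rewrite ltr_pwDl// sumr_ge0.
have np : \forall y \near y0, forall i : 'I_n, `|partial i f y| <= M.
  apply: (@filter_forall _ _ (fun i y => `|partial i f y| <= M) (nbhs y0)) => i.
  have /cvgrPdist_le/(_ 1 ltr01) := smooth_continuous (smooth_partial i sf) Vy0.
  apply: filterS => y h; rewrite -(subrK (partial i f y0) (partial i f y)).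
  apply: le_trans (ler_normD _ _) _; apply: lerD; first by rewrite distrC. by rewrite (bigD1 i)//= lerDl sumr_ge0.
have nf : \forall y \near y0, `|f y| <= 1 + `|f y0|.
  have /cvgrPdist_le/(_ 1 ltr01) := smooth_continuous sf Vy0. apply: filterS => y h; rewrite -(subrK (f y0) (f y)).
  by apply: le_trans (ler_normD _ _) _; apply: lerD => //; rewrite distrC.
have nV : \forall y \near y0, V y by apply: open_nbhs_nbhs.
have : nbhs y0 [set y | V y /\ `|f y| <= 1 + `|f y0| /\ forall i : 'I_n, `|partial i f y| <= M] by apply: filterS3 nV nf np => y.
move=> /nbhs_ballP[d /= d0 dP].
exists d, (n%:R * M + (1 + `|f y0|)); split => //.
  by rewrite addr_ge0 ?addr_ge0// mulr_ge0// ltW.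
move=> y z yB zB; have [Vy [fy py]] := dP _ yB.
split => //; first by apply: le_trans fy _; rewrite lerDr mulr_ge0// ltW.
have seg s : 0 <= s <= 1 -> ball y0 d (z + s *: (y - z)).
  move=> /andP[s0 s1]; move: yB zB; rewrite -ball_normE /= => yB zB.
  have -> : y0 - (z + s *: (y - z)) = s *: (y0 - y) + (1 - s) *: (y0 - z) by apply/rowP => i; rewrite !mxE; ring.
  apply: le_lt_trans (ler_normD _ _) _; rewrite !normrZ (ger0_norm s0) ger0_norm ?subr_ge0//.
  have [s00|sn0] := eqVneq s 0; first by rewrite s00 mul0r add0r subr0 mul1r. have sp : 0 < s by rewrite lt_def sn0.
  have h1 : s * `|y0 - y| < s * d by rewrite ltr_pM2l.
  have h2 : (1 - s) * `|y0 - z| <= (1 - s) * d by rewrite ler_wpM2l ?subr_ge0// ltW.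
  apply: lt_le_trans (ltr_leD h1 h2) _; by rewrite -mulrDl addrC subrK mul1r.
pose g (s : R) := f (z + s *: (y - z)).
have dg (s : R) : 0 <= s <= 1 -> is_derive s 1 g (\sum_i (y - z) 0 i * partial i f (z + s *: (y - z))).
  move=> /seg sB; have [Vs _] := dP _ sB. have df := smooth_diff oV sf Vs.
  by rewrite -derive_row_sum//; apply: is_derive_line; exact: diff_derivable.
have : `|g 1 - g 0| <= n%:R * M * `|y - z| * (1 - 0).
  apply: (@mvt_bound_itv R g (fun s => \sum_i (y - z) 0 i * partial i f (z + s *: (y - z)))) => //.
  - by move=> s /andP[s0 s1]; apply: dg; rewrite !ltW.
  - by move=> s /dg[d1 _]; exact: derivable_continuous.
  move=> s /andP[s0 s1]; have ss : 0 <= s <= 1 by rewrite !ltW. have [_ [_ ps]] := dP _ (seg s ss).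
  apply: le_trans (ler_norm_sum _ _ _) _. apply: (@le_trans _ _ (\sum_(i < n) `|y - z| * M)).
    by apply: ler_sum => i _; rewrite normrM ler_pM// coord_le_norm.
  by rewrite sumr_const card_ord -[_ *+ n]mulr_natl mulrA mulrAC.
rewrite /g scale1r scale0r addr0 (_ : z + (y - z) = y) ?(addrC z) ?subrK// subr0 mulr1 => h.
apply: le_trans h _; rewrite ler_wpM2r// lerDl.
by rewrite addr_ge0.
Qed.

Lemma norm_sqr_le_dot (u : 'rV[R]_n) : `|u| ^+ 2 <= dot u u.
Proof. by rewrite -sqr_enorm ler_pXn2r ?nnegrE ?enorm_ge0// norm_le_enorm. Qed.

Lemma dot_norm_le (u v : 'rV[R]_n) : `|dot u v| <= n%:R * (`|u| * `|v|).
Proof.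
rewrite /dot; apply: le_trans (ler_norm_sum _ _ _) _.
apply: (@le_trans _ _ (\sum_(i < n) `|u| * `|v|)).
  by apply: ler_sum => i _; rewrite normrM ler_pM// coord_le_norm.
by rewrite sumr_const card_ord -[_ *+ n]mulr_natl.
Qed.

End LocalLipschitz.

(** The function [q s * expR (- C * s)] is nonincreasing, starts at 0 and is nonnegative. *)
Lemma gronwall0 R (q q' : R -> R) (a b C : R) :
  (forall t, 0 <= q t) -> q a = 0 ->
  (forall t, a <= t < b -> {for t, continuous q}) ->
  (forall t, a < t < b -> is_derive t 1 q (q' t)) ->
  (forall t, a < t < b -> q' t <= C * q t) ->
  forall t, a <= t < b -> q t = 0.
Proof.
move=> q0 qa cq dq H t /andP[at_ tb].
pose p s := q s * expR (- C * s).
have dp s : a < s < b -> is_derive s 1 p ((q' s - C * q s) * expR (- C * s)).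
  move=> /dq dqs. have de : is_derive s 1 (fun s => expR (- C * s)) (- C * expR (- C * s)).
    have d1 : is_derive s (1 : R) (fun s : R => - C * s) (- C) by apply: is_derive_eq; rewrite /GRing.scale /= mulr1.
    by apply: is_derive_eq; rewrite /GRing.scale /= mulrC.
  apply: is_derive_eq; rewrite /GRing.scale /=. by move: (expR _) (q s) (q' s) => u v w; ring.
have : p t <= p a.
  apply: (@ler0_derive1_le_cc R p a t) => //.
  - move=> s; rewrite in_itv /= => /andP[as_ st].
    have hs : a < s < b by rewrite as_ (lt_trans st). by have [] := dp s hs.
  - move=> s; rewrite in_itv /= => /andP[as_ st].
    have hs : a < s < b by rewrite as_ (lt_trans st). have dps := dp s hs; rewrite derive1E derive_val.
    by rewrite pmulr_lle0 ?expR_gt0// subr_le0 H.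
  - apply: continuous_in_subspaceT => s; rewrite inE /= in_itv /= => /andP[as_ st].
    apply: (@continuousM R R q (fun s => expR (- C * s))).
      by apply: cq; rewrite as_ (le_lt_trans st).
    apply: (@continuous_comp R R R (fun s => - C * s) expR).
      apply: (@continuousM R R); [exact: cst_continuous|exact: cvg_id].
    exact: continuous_expR.
  - by rewrite in_itv /= at_ lexx.
  - by rewrite in_itv /= lexx.
rewrite /p qa mul0r pmulr_lle0 ?expR_gt0// => h.
by apply/eqP; rewrite eq_le h q0.
Qed.

(** * Geodesics *)

Section GeodesicEquation.
Context R n.
Implicit Types (g : 'rV[R]_n -> 'M[R]_n) (x : R -> 'rV[R]_n).

Definition geo_eq g x t := [/\ derivable x t 1, derivable (derive1 x) t 1 &
  derive1 (derive1 x) t + chr g (x t) (derive1 x t) = 0].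

Lemma is_derive_dot (u v : R -> 'rV[R]_n) t : derivable u t 1 -> derivable v t 1 ->
  is_derive t 1 (fun s => dot (u s) (v s)) (dot (derive1 u t) (v t) + dot (u t) (derive1 v t)).
Proof.
move=> du dv.
have d k : is_derive t 1 (fun s => u s 0 k * v s 0 k)
    (derive1 u t 0 k * v t 0 k + u t 0 k * derive1 v t 0 k).
  have h1 := derive1_coord k du; have h2 := derive1_coord k dv. by apply: is_derive_eq; rewrite /GRing.scale /= addrC mulrC.
have -> : (fun s => dot (u s) (v s)) = \sum_(k < n) (fun s => u s 0 k * v s 0 k) by apply/funext => s; rewrite fct_sumE.
by apply: is_derive_eq; rewrite big_split.
Qed.

Lemma row_subE (u v : 'rV[R]_n) k : (u - v) 0 k = u 0 k - v 0 k.
Proof. by rewrite !mxE. Qed.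

Lemma derive1_row_sub (x1 x2 : R -> 'rV[R]_n) t : derivable x1 t 1 -> derivable x2 t 1 ->
  derivable (fun s => x1 s - x2 s) t 1 /\
  derive1 (fun s => x1 s - x2 s) t = derive1 x1 t - derive1 x2 t.
Proof.
move=> d1 d2.
have d k : is_derive t 1 (fun s => (x1 s - x2 s) 0 k) (derive1 x1 t 0 k - derive1 x2 t 0 k).
  have h1 := derive1_coord k d1; have h2 := derive1_coord k d2.
  rewrite (_ : (fun s => _) = (fun s => x1 s 0 k) - (fun s => x2 s 0 k)).
    exact: is_deriveB.
  by apply/funext => s; rewrite row_subE.
have dd : derivable (fun s => x1 s - x2 s) t 1 by apply: derivable_rowP => k; have [] := d k.
split => //; apply/rowP => k; have [_] := derive1_coord k dd; have [_ ->] := d k.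
by rewrite row_subE.
Qed.

(** The Lipschitz property of the geodesic equation as a first order system. The equation is
    quadratic in the velocity, hence the bound [M] on the velocities. *)
Lemma chr_lipschitz (V : set 'rV[R]_n) g y0 (M : R) : open V -> (forall i, smooth_mx V (Gam g i)) ->
  V y0 -> exists d C, [/\ 0 < d, 0 <= C & forall y z v w, ball y0 d y -> ball y0 d z ->
    `|v| <= M -> `|w| <= M -> `|chr g y v - chr g z w| <= C * (`|y - z| + `|v - w|)].
Proof.
move=> oV sGam Vy0.
have [n0|n_gt0] := posnP n.
  exists 1, 0; split => // y z v w _ _ _ _; rewrite mul0r normr_le0; apply/eqP/rowP => i. by have := ltn_ord i; rewrite {2}n0.
have M0 : 0 <= Num.max M 0 by rewrite le_max lexx orbT.
pose D (p : 'I_n * 'I_n * 'I_n) := smooth_lipschitz oV (sGam p.1.1 p.1.2 p.2) Vy0.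
pose d p := projT1 (cid (D p)); pose L p := projT1 (cid (projT2 (cid (D p)))).
have dL p : [/\ 0 < d p, 0 <= L p & forall y z, ball y0 (d p) y -> ball y0 (d p) z ->
    [/\ V y, `|Gam g p.1.1 y p.1.2 p.2| <= L p &
     `|Gam g p.1.1 y p.1.2 p.2 - Gam g p.1.1 z p.1.2 p.2| <= L p * `|y - z|]].
  exact: projT2 (cid (projT2 (cid (D p)))).
have [d0 d00 d0p] : exists2 d0, 0 < d0 & forall p, d0 <= d p by apply: fin_pos_lb => p; have [] := dL p.
pose LL := \sum_p L p.
have LL0 : 0 <= LL by apply: sumr_ge0 => p _; have [] := dL p.
have LLp p : L p <= LL by rewrite /LL (bigD1 p)//= lerDl; apply: sumr_ge0 => q _; have [] := dL q.
pose m := Num.max M 0.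
exists d0, (n%:R * n%:R * (LL * (m * m + m + m))); split => //.
  by rewrite !mulr_ge0// addr_ge0// addr_ge0// mulr_ge0.
move=> y z v w yB zB vM wM.
have vm : `|v| <= m by rewrite le_max vM.
have wm : `|w| <= m by rewrite le_max wM.
have C0 : 0 <= n%:R * n%:R * (LL * (m * m + m + m)) * (`|y - z| + `|v - w|).
  by rewrite mulr_ge0 ?addr_ge0// !mulr_ge0// addr_ge0// addr_ge0// mulr_ge0.
apply: norm_row_le => // k; rewrite row_subE !chrE -sumrB.
apply: le_trans (ler_norm_sum _ _ _) _.
rewrite -!mulrA; rewrite !mulrA -(mulrA n%:R).
apply: (@le_trans _ _ (\sum_(i < n) n%:R * (LL * (m * m + m + m) * (`|y - z| + `|v - w|)))); last first.
  by rewrite sumr_const card_ord -[_ *+ n]mulr_natl !mulrA.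
apply: ler_sum => i _; rewrite -sumrB; apply: le_trans (ler_norm_sum _ _ _) _.
apply: (@le_trans _ _ (\sum_(j < n) (LL * (m * m + m + m) * (`|y - z| + `|v - w|)))); last first.
  by rewrite sumr_const card_ord -[_ *+ n]mulr_natl.
apply: ler_sum => j _.
have [_ _ /(_ y z)] := dL (i, j, k).
have sub p : ball y0 d0 p -> ball y0 (d (i, j, k)) p by apply: le_ball.
move=> /(_ (sub _ yB) (sub _ zB))[_ /= Gy Gyz]; rewrite !GamEE in Gy Gyz.
have {}Gy := le_trans Gy (LLp _).
have {}Gyz : `|christoffel g k i j y - christoffel g k i j z| <= LL * `|y - z| by apply: le_trans Gyz _; rewrite ler_wpM2r.
have -> : christoffel g k i j y * v 0 i * v 0 j - christoffel g k i j z * w 0 i * w 0 j =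
  (christoffel g k i j y - christoffel g k i j z) * (w 0 i * w 0 j) +
  christoffel g k i j y * ((v 0 i - w 0 i) * v 0 j) + christoffel g k i j y * (w 0 i * (v 0 j - w 0 j)).
  by move: (christoffel _ _ _ _ y) (christoffel _ _ _ _ z) => p q; ring.
have vi a := le_trans (coord_le_norm v a) vm.
have wi a := le_trans (coord_le_norm w a) wm.
have vwi a : `|v 0 a - w 0 a| <= `|v - w| by have := coord_le_norm (v - w) a; rewrite !mxE.
have h1 : `|(christoffel g k i j y - christoffel g k i j z) * (w 0 i * w 0 j)| <= LL * `|y - z| * (m * m) by rewrite normrM ler_pM// normrM ler_pM.
have h2 : `|christoffel g k i j y * ((v 0 i - w 0 i) * v 0 j)| <= LL * (`|v - w| * m) by rewrite normrM ler_pM// normrM ler_pM.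
have h3 : `|christoffel g k i j y * (w 0 i * (v 0 j - w 0 j))| <= LL * (m * `|v - w|) by rewrite normrM ler_pM// normrM ler_pM.
apply: le_trans (ler_normD _ _) _; apply: le_trans (lerD (ler_normD _ _) (lexx _)) _.
apply: le_trans (lerD (lerD h1 h2) h3) _.
rewrite -subr_ge0.
have -> : LL * (m * m + m + m) * (`|y - z| + `|v - w|) - (LL * `|y - z| * (m * m) + LL * (`|v - w| * m) + LL * (m * `|v - w|))
  = LL * ((m + m) * `|y - z|) + LL * (m * m * `|v - w|) by ring.
by rewrite addr_ge0// !mulr_ge0// addr_ge0.
Qed.

(** [gronwall0] for the squared distance of the two solutions in position and velocity. The
    statement looks forward in time only, which is what the continuity induction in
    [geodesic_unique] consumes. *)
Lemma geodesic_local_unique (V : set 'rV[R]_n) g (x1 x2 : R -> 'rV[R]_n) t0 (e : R) : open V ->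
  (forall i, smooth_mx V (Gam g i)) -> 0 < e ->
  (forall t, t0 <= t < t0 + e -> geo_eq g x1 t) ->
  (forall t, t0 <= t < t0 + e -> geo_eq g x2 t) ->
  V (x1 t0) -> x1 t0 = x2 t0 -> derive1 x1 t0 = derive1 x2 t0 ->
  exists2 d, 0 < d & forall t, t0 <= t < t0 + d -> x1 t = x2 t.
Proof.
move=> oV sGam e0 g1 g2 Vx x12 v12.
have t0e : t0 <= t0 < t0 + e by rewrite lexx ltrDl.
have [dx1 dv1 _] := g1 _ t0e; have [dx2 dv2 _] := g2 _ t0e.
pose M := 1 + `|derive1 x1 t0|.
have [d [C [d0 C0 H]]] := chr_lipschitz M oV sGam Vx.
have contx (x : R -> 'rV[R]_n) t : derivable x t 1 -> {for t, continuous x}.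
  exact: derivable_continuous.
have nb1 : \forall t \near t0, ball (x1 t0) d (x1 t).
  have /cvg_ballP := contx _ _ dx1; exact.
have nb2 : \forall t \near t0, ball (x1 t0) d (x2 t).
  rewrite x12; have /cvg_ballP := contx _ _ dx2; exact.
have nv (x : R -> 'rV[R]_n) : derive1 x t0 = derive1 x1 t0 -> derivable (derive1 x) t0 1 ->
    \forall t \near t0, `|derive1 x t| <= M.
  move=> xx dv; have /cvgrPdist_le/(_ 1 ltr01) := contx _ _ dv.
  apply: filterS => t h; rewrite -(subrK (derive1 x t0) (derive1 x t)).
  apply: le_trans (ler_normD _ _) _; apply: lerD; first by rewrite distrC. by rewrite xx.
have [r r0 Hr] := near_right_ex (filterI (filterI nb1 nb2) (filterI (nv x1 erefl dv1) (nv x2 (esym v12) dv2))).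
pose b := t0 + Num.min r e.
exists (Num.min r e); first by rewrite lt_min r0.
have hb t : t0 < t < b -> t0 < t < t0 + r /\ t0 <= t < t0 + e.
  move=> /andP[t0t tb]; rewrite t0t (ltW t0t) /=. by split; apply: lt_le_trans tb _; rewrite lerD2l ge_min lexx ?orbT.
have hb' t : t0 <= t < b -> t0 <= t < t0 + e.
  move=> /andP[t0t tb]; rewrite t0t /=. by apply: lt_le_trans tb _; rewrite lerD2l ge_min lexx ?orbT.
pose w s := x1 s - x2 s; pose w' s := derive1 x1 s - derive1 x2 s.
pose q t := dot (w t) (w t) + dot (w' t) (w' t).
have dw t : t0 <= t < t0 + e -> [/\ derivable w t 1, derive1 w t = w' t, derivable w' t 1 &
    derive1 w' t = - (chr g (x1 t) (derive1 x1 t) - chr g (x2 t) (derive1 x2 t))].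
  move=> ht; have [d1 d1' e1] := g1 _ ht; have [d2 d2' e2] := g2 _ ht.
  have [dw ew] := derive1_row_sub d1 d2; have [dw' ew'] := derive1_row_sub d1' d2'.
  have ab (A B E F : 'rV[R]_n) : A + E = 0 -> B + F = 0 -> A - B = - (E - F).
    by move=> /eqP + /eqP; rewrite !addr_eq0 => /eqP -> /eqP ->; rewrite opprD.
  split; [exact: dw|exact: ew|exact: dw'|]. by apply: etrans ew' _; apply: ab; [exact: e1|exact: e2].
have dq t : t0 <= t < t0 + e -> is_derive t 1 q
    (dot (w' t) (w t) + dot (w t) (w' t) + (dot (derive1 w' t) (w' t) + dot (w' t) (derive1 w' t))).
  move=> /dw[d1 e1 d2 e2]. have := is_derive_dot d1 d1; rewrite e1 => h1; have h2 := is_derive_dot d2 d2. exact: is_deriveD.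
have qz t : t0 <= t < b -> q t = 0.
  apply: (@gronwall0 R q (fun t => dot (w' t) (w t) + dot (w t) (w' t) + (dot (derive1 w' t) (w' t) + dot (w' t) (derive1 w' t)))
     t0 b (2 * n%:R + 4 * n%:R * C)).
  - by move=> s; rewrite addr_ge0// dot_ge0.
  - by rewrite /q /w /w' x12 v12 !subrr !dot0l addr0.
  - by move=> s /hb'/dq[ds _]; exact: derivable_continuous.
  - by move=> s /hb[_ /dq].
  move=> s /hb[sr se]; have [[b1 b2] [v1 v2]] := Hr _ sr. have [_ _ _ ->] := dw _ se. have := H _ _ _ _ b1 b2 v1 v2.
  rewrite -[x1 s - x2 s]/(w s) -[derive1 x1 s - derive1 x2 s]/(w' s). move: (chr _ _ _ - chr _ _ _) => F FC.
  rewrite (dotC (w' s) (w s)) (dotC (- F)) dotNr. have h1 := le_trans (ler_norm _) (dot_norm_le (w s) (w' s)).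
  have h2 : - dot (w' s) F <= n%:R * (`|w' s| * `|F|) by apply: le_trans (dot_norm_le _ _); rewrite -normrN ler_norm.
  have h3 : n%:R * (`|w' s| * `|F|) <= n%:R * (`|w' s| * (C * (`|w s| + `|w' s|))) by rewrite ler_wpM2l// ler_wpM2l.
  have q1 := norm_sqr_le_dot (w s); have q2 := norm_sqr_le_dot (w' s). have ab : `|w s| * `|w' s| <= q s.
    have := sqr_ge0 (`|w s| - `|w' s|); rewrite /q sqrrB. have := mulr_ge0 (normr_ge0 (w s)) (normr_ge0 (w' s)).
    move: q1 q2; move: (`|w s|) (`|w' s|) (dot _ _) (dot _ _) => a c u v; rewrite mulr2n; clear -a; lra.
  have bb : `|w' s| ^+ 2 <= q s by apply: le_trans q2 _; rewrite lerDr dot_ge0.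
  have h4 : n%:R * (`|w s| * `|w' s|) <= n%:R * q s by rewrite ler_wpM2l.
  have h5 : n%:R * (`|w' s| * (C * (`|w s| + `|w' s|))) <= n%:R * (C * (2 * q s)).
    rewrite ler_wpM2l//. have -> : `|w' s| * (C * (`|w s| + `|w' s|)) = C * (`|w s| * `|w' s| + `|w' s| ^+ 2) by ring.
    by rewrite ler_wpM2l// mulr_natl mulr2n lerD.
  have -> : (2 * n%:R + 4 * n%:R * C) * q s = 2 * (n%:R * q s) + 2 * (n%:R * (C * (2 * q s))) by ring. move: h1 h2 h3 h4 h5.
  move: (dot (w s) (w' s)) (dot (w' s) F) (n%:R * (_ * `|F|)) (n%:R * (_ * (C * _))) (n%:R * (`|w s| * _)) (n%:R * q s) (n%:R * (C * _)).
  move=> p1 p2 p3 p4 p5 p6 p7; clear -p1; lra.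
move=> t ht; have := qz t ht; rewrite /q => /eqP.
rewrite paddr_eq0 ?dot_ge0// => /andP[/eqP/dot_eq0 w0 _].
by apply/eqP; rewrite -subr_eq0 -[x1 t - x2 t]/(w t) w0.
Qed.

Lemma chr_eq (U : set 'rV[R]_n) (g1 g2 : 'rV[R]_n -> 'M[R]_n) y v : open U -> U y ->
  (forall z, U z -> g1 z = g2 z) -> chr g1 y v = chr g2 y v.
Proof.
move=> oU Uy e.
have pe i j l : partial i (fun z => g1 z j l) y = partial i (fun z => g2 z j l) y.
  by apply: partial_near; apply: (open_eq_near oU Uy) => z Uz; rewrite e.
have ce k i j : christoffel g1 k i j y = christoffel g2 k i j y by rewrite /christoffel (e _ Uy); congr (_ * _); apply: eq_bigr => l _; rewrite !pe.
by apply/rowP => k; rewrite !chrE; apply: eq_bigr => i _; apply: eq_bigr => j _; rewrite ce.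
Qed.

Lemma derive1_comp_smooth (U : set 'rV[R]_n) m (h : 'rV[R]_n -> 'rV[R]_m) (x : R -> 'rV[R]_n) t :
  open U -> smooth_on U h -> derivable x t 1 -> U (x t) ->
  derivable (h \o x) t 1 /\ derive1 (h \o x) t = derive1 x t *m jac h (x t).
Proof.
move=> oU sh dx Ux.
have d k : is_derive t 1 (fun s => (h \o x) s 0 k) ((derive1 x t *m jac h (x t)) 0 k).
  have := is_derive_comp_curve (smooth_diff oU (sh k) Ux) dx.
  suff -> : (derive1 x t *m jac h (x t)) 0 k =
    \sum_j derive1 x t 0 j * partial j (fun y => h y 0 k) (x t) by [].
  by rewrite mxE; apply: eq_bigr => j _; rewrite jacE.
have dhx : derivable (h \o x) t 1 by apply: derivable_rowP => k; have [] := d k.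
split => //; apply/rowP => k; have [_ <-] := d k.
by have [_ <-] := derive1_coord k dhx.
Qed.

Lemma geo_eq_push (U V : set 'rV[R]_n) g h (x : R -> 'rV[R]_n) t :
  open U -> open V -> smooth_on U h -> (forall y, U y -> V (h y)) -> smooth_mx V g ->
  (forall y, V y -> (g y)^T = g y) -> (forall y, V y -> g y \in unitmx) ->
  (forall y, U y -> jac h y \in unitmx) -> U (x t) ->
  (\forall s \near t, geo_eq (pullmx g h) x s) -> geo_eq g (h \o x) t.
Proof.
move=> oU oV sh hV sg gs gu ju Ux nx.
have [dx dv ex] := nbhs_singleton nx.
have nU : \forall s \near t, U (x s).
  have cx : {for t, continuous x} := derivable_continuous dx. by apply: cx; apply: open_nbhs_nbhs.
have [dz ez] := derive1_comp_smooth oU sh dx Ux.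
have nz : \forall s \near t, derive1 x s *m jac h (x s) = derive1 (h \o x) s.
  apply: filterS2 nU nx => s Us [dxs _ _]. by have [_ ->] := derive1_comp_smooth oU sh dxs Us.
have sJ := smooth_jac sh.
have d k : is_derive t 1 (fun s => (derive1 x s *m jac h (x s)) 0 k)
   ((derive1 (derive1 x) t *m jac h (x t) + derive1 x t *m \sum_a derive1 x t 0 a *: dmx a (jac h) (x t)) 0 k).
  have -> : (fun s => (derive1 x s *m jac h (x s)) 0 k) =
      \sum_(j < n) (fun s => derive1 x s 0 j * jac h (x s) j k).
    by apply/funext => s; rewrite mxE fct_sumE.
  have dj j : is_derive t 1 (fun s => derive1 x s 0 j * jac h (x s) j k)
     (derive1 (derive1 x) t 0 j * jac h (x t) j k + derive1 x t 0 j * \sum_a derive1 x t 0 a * dmx a (jac h) (x t) j k).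
    have h1 := derive1_coord j dv. have h2 := is_derive_comp_curve (smooth_mx_diff oU j k sJ Ux) dx.
    apply: is_derive_eq; rewrite /GRing.scale /= addrC; congr (_ + _); first by rewrite mulrC.
    by congr (_ * _); apply: eq_bigr => a _; rewrite dmxE.
  apply: is_derive_eq; rewrite big_split mxE /= [in RHS]mxE; congr (_ + _).
  rewrite mxE; apply: eq_bigr => j _; congr (_ * _); rewrite summxE; apply: eq_bigr => a _. by rewrite mxE.
have dv2 : derivable (fun s => derive1 x s *m jac h (x s)) t 1 by apply: derivable_rowP => k; have [] := d k.
have e2 : derive1 (fun s => derive1 x s *m jac h (x s)) t =
  derive1 (derive1 x) t *m jac h (x t) + derive1 x t *m \sum_a derive1 x t 0 a *: dmx a (jac h) (x t).
  apply/rowP => k; have [_ <-] := d k. by have [_ <-] := derive1_coord k dv2.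
split; [exact: dz|exact: near_eq_derivable nz dv2|].
have -> : derive1 (derive1 (h \o x)) t = derive1 (fun s => derive1 x s *m jac h (x s)) t by rewrite !derive1E; apply/esym/near_eq_derive.
rewrite e2 ez /=.
have := chr_pull oU oV sh hV sg gs gu ju (derive1 x t) Ux.
move/eqP: ex; rewrite addr_eq0 => /eqP ->; rewrite mulNmx => ->.
by rewrite -addrA addNr.
Qed.

End GeodesicEquation.

(** * Local parametrizations and the metric in them *)

Lemma open_preimage_on (T U : topologicalType) (A : set T) (B : set U) (f : T -> U) :
  open A -> continuous_on A f -> open B -> open (A `&` f @^-1` B).
Proof.
move=> oA cf oB; rewrite openE => x [Ax Bfx]; apply: filterI.
  exact: open_nbhs_nbhs.
by apply: cf => //; exact: open_nbhs_nbhs.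
Qed.

Section JacobianCalculus.
Context R n.

Lemma jac_comp m l (h : 'rV[R]_n -> 'rV[R]_m) (q : 'rV[R]_m -> 'rV[R]_l) x :
  differentiable h x -> (forall k, differentiable (fun y => q y 0 k) (h x)) ->
  jac (q \o h) x = jac h x *m jac q (h x).
Proof.
move=> dh dq; apply/matrixP => a k; rewrite jacE mxE.
rewrite [LHS](@derive_comp_row _ _ _ (fun y => q y 0 k) h x)//.
by apply: eq_bigr => i _; rewrite !jacE.
Qed.

Lemma jac_near m (f h : 'rV[R]_n -> 'rV[R]_m) x :
  (\forall y \near x, f y = h y) -> jac f x = jac h x.
Proof.
move=> fh; apply/matrixP => a k; rewrite !jacE; apply: partial_near.
by apply: filterS fh => y ->.
Qed.

Lemma jac_eq_on m (U : set 'rV[R]_n) (f h : 'rV[R]_n -> 'rV[R]_m) x : open U -> U x ->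
  (forall y, U y -> f y = h y) -> jac f x = jac h x.
Proof.
move=> oU Ux fh; apply: jac_near; apply: (@filterS _ (nbhs x) _ U) => //.
exact: open_nbhs_nbhs.
Qed.

Lemma jac_lin m (A : 'M[R]_(n, m)) x : jac (fun y : 'rV[R]_n => y *m A) x = A.
Proof.
apply/matrixP => i k; rewrite jacE.
have -> : (fun y : 'rV[R]_n => (y *m A) 0 k) = (fun y => dot y (col k A)^T) by apply/funext => y; rewrite mxE; apply: eq_bigr => j _; rewrite !mxE.
have df : differentiable (fun y : 'rV[R]_n => dot y (col k A)^T) x.
  apply: (@smooth_diff _ _ setT) => //; first exact: openT. apply: (smooth_sum (@openT _)) => j.
  by apply: (smooth_mul (@openT _)); [exact: smooth_coord (@openT _) _|exact: smooth_cst (@openT _) _].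
have -> : A i k = dot (delta_mx 0 i : 'rV[R]_n) (col k A)^T by rewrite dotC dot_delta !mxE.
rewrite /partial /derive; apply/cvg_lim => //.
apply: (@cvg_trans _ ((cst (dot (delta_mx 0 i : 'rV[R]_n) (col k A)^T)) @ (0 : R)^')); last exact: cvg_cst.
apply: near_eq_cvg; near=> t => /=.
rewrite dotDl dotZl addrK /GRing.scale /= mulKf//; near: t; exact: nbhs_dnbhs_neq.
Unshelve. all: by end_near. Qed.

Lemma jac_id x : jac (fun y : 'rV[R]_n => y) x = 1%:M.
Proof.
rewrite -[RHS](jac_lin 1%:M x); congr (jac _ x).
by apply/funext => y; rewrite mulmx1.
Qed.

Lemma jacobian_jac m (h : 'rV[R]_n -> 'rV[R]_m) x : differentiable h x ->
  jacobian h x = jac h x.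
Proof.
move=> dh; apply/matrixP => a k; rewrite jacE mxE.
rewrite -deriveE// derive_mx ?mxE//.
exact: diff_derivable.
Qed.

End JacobianCalculus.

(** Normal coordinates need not belong to the atlas. A parametrization has just the smoothness that
    [exp_diffeo] provides, and charts of the atlas are the special case [cpar]; all coordinate
    changes are then treated alike by [tr]. *)
Record param R n (M : smoothManifold R n) := Param {
  pdom : set 'rV[R]_n;
  ppar : 'rV[R]_n -> M;
  pchart : M -> 'rV[R]_n;
  open_pdom : open pdom;
  open_pimage : open (ppar @` pdom);
  ppar_smooth : smooth_into pdom ppar;
  pchart_smooth : smooth_from (ppar @` pdom) pchart;
  pparK : forall x, pdom x -> pchart (ppar x) = x }.

Arguments open_pdom {R n M} p : rename.
Arguments open_pimage {R n M} p : rename.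
Arguments ppar_smooth {R n M} p : rename.
Arguments pchart_smooth {R n M} p : rename.
Arguments pparK {R n M p} x : rename.

Section Params.
Context R n (M : smoothManifold R n).
Implicit Types (P Q S : param M) (c : chart R n M).

Definition pran P : set M := ppar P @` pdom P.
Lemma open_pran P : open (pran P). Proof. exact: open_pimage. Qed.

Lemma pchart_dom P p : pran P p -> pdom P (pchart P p).
Proof. by move=> [x Px <-]; rewrite pparK. Qed.

Lemma pchartK P p : pran P p -> ppar P (pchart P p) = p.
Proof. by move=> [x Px <-]; rewrite pparK. Qed.

Lemma ppar_ran P x : pdom P x -> pran P (ppar P x). Proof. by exists x. Qed.

Lemma chart_img c : bwd c @` cod c = dom c.
Proof.
apply/seteqP; split => [_ [x cx <-]|p dp]; first exact: bwd_dom.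
by exists (fwd c p); [exact: fwd_cod|exact: fwdK].
Qed.

Lemma chart_smooth_into c : atlas c -> smooth_into (N := M) (cod c) (bwd c).
Proof.
move=> ac; split; first exact: bwd_continuous.
by move=> c' ac'; exact: (atlas_smooth ac ac').
Qed.

Lemma chart_smooth_from c : atlas c -> smooth_from (M := M) (bwd c @` cod c) (fwd c).
Proof. by move=> ac c' ac'; rewrite chart_img; exact: (atlas_smooth ac' ac). Qed.

Lemma open_chart_img c : open (bwd c @` cod c).
Proof. by rewrite chart_img; exact: open_dom. Qed.

Definition cpar c (ac : atlas c) : param M :=
  Param (@open_cod _ _ _ c) (@open_chart_img c) (chart_smooth_into ac) (chart_smooth_from ac) (@bwdK _ _ _ c).

Lemma cpar_ran c (ac : atlas c) : pran (cpar ac) = dom c. Proof. exact: chart_img. Qed.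

Lemma chart_atP (p : M) : atlas (chart_at p) /\ dom (chart_at p) p.
Proof. by rewrite /chart_at; case: (cid2 _). Qed.

Definition tr P Q := pchart Q \o ppar P.
Definition trdom P Q := pdom P `&` ppar P @^-1` pran Q.

Lemma open_trdom P Q : open (trdom P Q).
Proof.
apply: open_preimage_on; [exact: open_pdom| |exact: open_pran].
by have [] := ppar_smooth P.
Qed.

Lemma smooth_ppar_chart P c : atlas c ->
  smooth_on (pdom P `&` ppar P @^-1` dom c) (fwd c \o ppar P).
Proof. by move=> ac; have [_] := ppar_smooth P; apply. Qed.

Lemma smooth_tr P Q : smooth_on (trdom P Q) (tr P Q).
Proof.
move=> j; apply: smooth_local => x [Px Qx].
have [ac dc] := chart_atP (ppar P x); set c := chart_at _ in ac dc *.
pose V := trdom P Q `&` (pdom P `&` ppar P @^-1` dom c).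
have oV : open V.
  apply: openI; first exact: open_trdom. by have := @open_trdom P (cpar ac); rewrite /trdom cpar_ran.
exists V; first by [].
pose W := cod c `&` bwd c @^-1` pran Q.
have oW : open W by apply: open_preimage_on; [exact: open_cod|exact: bwd_continuous|exact: open_pran].
apply: (@smooth_ext _ _ _ (fun y => (pchart Q \o bwd c) ((fwd c \o ppar P) y) 0 j)) => //.
  by move=> y [_ [_ dy]]; rewrite /= fwdK.
apply: (@smooth_comp _ _ _ oV _ W (fun y => (pchart Q \o bwd c) y 0 j)) => //.
- exact: pchart_smooth.
- move=> k; have h := @smooth_ppar_chart P c ac k.
  by apply: (@smooth_sub _ _ _ V _ _ h) => y [].
- move=> y [[_ Qy] [_ dy]]; split; first exact: fwd_cod.
  by rewrite /= fwdK.
Qed.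

Lemma tr_trans P Q S x : trdom P Q x -> tr Q S (tr P Q x) = tr P S x.
Proof. by move=> [_ Qx]; rewrite /tr /= pchartK. Qed.

Lemma tr_differentiable P Q x : trdom P Q x -> differentiable (tr P Q) x.
Proof.
move=> Ux; apply: differentiable_rowP => k.
by apply: (smooth_diff (@open_trdom P Q)) => //; exact: smooth_tr.
Qed.

Lemma jac_tr_trans P Q S x : trdom P Q x -> trdom P S x ->
  jac (tr P S) x = jac (tr P Q) x *m jac (tr Q S) (tr P Q x).
Proof.
move=> xQ xS; rewrite -jac_comp; first last.
- move=> k; apply: (smooth_diff (@open_trdom Q S)); first exact: smooth_tr.
  split; first exact: pchart_dom xQ.2. by case: xQ => _ h; rewrite /= pchartK//; case: xS.
- exact: tr_differentiable.
apply: (jac_eq_on (@open_trdom P Q) xQ) => y yQ.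
by rewrite /= tr_trans.
Qed.

Lemma jac_tr_self P x : pdom P x -> jac (tr P P) x = 1%:M.
Proof.
move=> Px; rewrite -(jac_id x); apply: (jac_eq_on (open_pdom P) Px) => y Py.
exact: pparK.
Qed.

Lemma jac_trV P Q x : trdom P Q x ->
  jac (tr P Q) x *m jac (tr Q P) (tr P Q x) = 1%:M.
Proof.
move=> xQ; have Px := xQ.1; rewrite -jac_tr_trans ?jac_tr_self//.
by split => //; exact: ppar_ran.
Qed.

Lemma jac_tr_unit P Q x : trdom P Q x -> jac (tr P Q) x \in unitmx.
Proof. by move=> /jac_trV/mulmx1_unit[]. Qed.

Lemma pchart_continuous P p : pran P p -> {for p, continuous (pchart P)}.
Proof.
move=> Pp; have [ac dc] := chart_atP p; set c := chart_at p in ac dc.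
have h : {for p, continuous (fun q => (pchart P \o bwd c) (fwd c q))}.
  apply: (@continuous_comp _ _ _ (fwd c) (pchart P \o bwd c)); first exact: fwd_continuous.
  apply/differentiable_continuous/differentiable_rowP => k.
  have oW : open (cod c `&` bwd c @^-1` pran P) by apply: open_preimage_on; [exact: open_cod|exact: bwd_continuous|exact: open_pran].
  apply: (smooth_diff oW); first exact: pchart_smooth. by split; [exact: fwd_cod|rewrite /= fwdK].
apply: (continuous_near _ h); apply: (@filterS _ (nbhs p) _ (dom c)).
  by move=> q dq; rewrite /= fwdK.
by apply: open_nbhs_nbhs; split => //; exact: open_dom.
Qed.

Lemma ppar_continuous P x : pdom P x -> {for x, continuous (ppar P)}.
Proof. by have [h _] := ppar_smooth P; exact: h. Qed.

End Params.

Section ParamMetric.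
Context R n (M : riemannianManifold R n).
Implicit Types (P Q S : param M) (c : chart R n M).

(** The chart from which the metric is pulled back varies with the point; [pmetE] shows that every
    chart of the atlas around the point gives the same matrix, and smoothness follows from that
    locally. *)
Definition pmet P (x : 'rV[R]_n) : 'M[R]_n :=
  let c := chart_at (ppar P x) in pullmx (metric c) (fwd c \o ppar P) x.

Lemma pullmx_trans P Q c x (ac : atlas c) : trdom P Q x -> dom c (ppar P x) ->
  pullmx (metric c) (fwd c \o ppar P) x =
  pullmx (pullmx (metric c) (fwd c \o ppar Q)) (tr P Q) x.
Proof.
move=> xQ dx; have xc : trdom P (cpar ac) x by split; [exact: xQ.1|rewrite /= cpar_ran].
rewrite /pullmx; have := jac_tr_trans xQ xc; rewrite /tr /= => ->.
rewrite trmx_mul !mulmxA; congr (_ *m _ *m _ *m _ *m _).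
by rewrite /= pchartK//; exact: xQ.2.
Qed.

Lemma pmetE P c x : atlas c -> pdom P x -> dom c (ppar P x) ->
  pmet P x = pullmx (metric c) (fwd c \o ppar P) x.
Proof.
move=> ac Px dx; rewrite /pmet /=; have [ac0 dc0] := chart_atP (ppar P x).
set c0 := chart_at _ in ac0 dc0 *.
have x0 : trdom P (cpar ac0) x by split; rewrite //= cpar_ran.
have xc : trdom P (cpar ac) x by split; rewrite //= cpar_ran.
have oc : overlap c0 c (fwd c0 (ppar P x)) by split; [exact: fwd_cod|rewrite /= fwdK].
rewrite {1}/pullmx (metric_transition ac0 ac oc).
have dt : differentiable (transition c0 c) (fwd c0 (ppar P x)).
  have : trdom (cpar ac0) (cpar ac) (fwd c0 (ppar P x)) by split; [exact: fwd_cod|rewrite /= cpar_ran /= fwdK].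
  exact: tr_differentiable.
rewrite jacobian_jac//.
have := jac_tr_trans x0 xc; rewrite /tr /= -/(transition c0 c) => e.
rewrite /pullmx e trmx_mul !mulmxA; congr (_ *m _ *m _ *m _ *m _).
by rewrite /transition /= fwdK.
Qed.

Lemma pmet_tr P Q x : trdom P Q x -> pmet P x = pullmx (pmet Q) (tr P Q) x.
Proof.
move=> xQ; have [ac dc] := chart_atP (ppar P x); set c := chart_at _ in ac dc.
rewrite (pmetE ac xQ.1 dc) (pullmx_trans ac xQ dc) /pullmx.
by rewrite (@pmetE Q c)//; [exact: pchart_dom xQ.2|rewrite /= pchartK//; exact: xQ.2].
Qed.

Lemma inner_pmet_tr P Q x u v : trdom P Q x ->
  inner (pmet P x) u v = inner (pmet Q (tr P Q x)) (u *m jac (tr P Q) x) (v *m jac (tr P Q) x).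
Proof. by move=> xQ; rewrite (pmet_tr xQ) inner_pull. Qed.

Lemma pmet_smooth P : smooth_mx (pdom P) (pmet P).
Proof.
move=> i j; apply: smooth_local => x Px.
have [ac dc] := chart_atP (ppar P x); set c := chart_at _ in ac dc.
pose V := pdom P `&` ppar P @^-1` dom c.
have oV : open V by have := @open_trdom _ _ _ P (cpar ac); rewrite /trdom cpar_ran.
exists V => //; have h : smooth_mx V (pullmx (metric c) (fwd c \o ppar P)).
  apply: (@smooth_pull _ _ V (cod c)) => //; first exact: open_cod.
  - exact: smooth_ppar_chart.
  - by move=> y [_ dy]; exact: fwd_cod.
  - by move=> a b; exact: metric_smooth.
by apply: smooth_ext oV _ (h i j) => y [Py dy]; rewrite (pmetE ac).
Qed.

Lemma pmet_sym P x : pdom P x -> (pmet P x)^T = pmet P x.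
Proof.
move=> Px; have [ac dc] := chart_atP (ppar P x); set c := chart_at _ in ac dc.
rewrite (pmetE ac)// /pullmx !trmx_mul trmxK mulmxA Defs.metric_sym//.
exact: fwd_cod.
Qed.

Lemma pmet_pos P x v : pdom P x -> v != 0 -> 0 < inner (pmet P x) v v.
Proof.
move=> Px v0; have [ac dc] := chart_atP (ppar P x); set c := chart_at _ in ac dc.
rewrite (pmetE ac)// inner_pull; apply: metric_pos => //; first exact: fwd_cod.
have ju : jac (fwd c \o ppar P) x \in unitmx by apply: (@jac_tr_unit _ _ _ P (cpar ac)); split; rewrite //= cpar_ran.
by apply: contra_neq v0 => /(congr1 (mulmx^~ (invmx (jac (fwd c \o ppar P) x)))); rewrite mulmxK// mul0mx.
Qed.

Lemma pmet_unit P x : pdom P x -> pmet P x \in unitmx.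
Proof. by move=> Px; apply: posdef_unitmx => v; exact: pmet_pos. Qed.

Lemma pmet_chart c (ac : atlas c) x : cod c x -> pmet (cpar ac) x = metric c x.
Proof.
move=> cx; rewrite (@pmetE (cpar ac) c)//=; last exact: bwd_dom.
have e : pullmx (metric c) (fwd c \o bwd c) x = jac (tr (cpar ac) (cpar ac)) x *m metric c x *m (jac (tr (cpar ac) (cpar ac)) x)^T.
  by rewrite /pullmx /= bwdK.
by rewrite e jac_tr_self// trmx1 mulmx1 mul1mx.
Qed.

End ParamMetric.

(** A derivative is already determined on one side. Curves are often known to agree only on one side
    of a time: before the current time of a continuity induction, or on [[0, 1]] for an exponential
    ray. The sign of [s] selects the side. *)
Lemma derive_side0 R (f : R -> R) (t a s d : R) : s != 0 -> 0 < d ->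
  is_derive t 1 f a -> (forall h, 0 < h < d -> f (t + s * h) = f t) -> a = 0.
Proof.
move=> s0 d0 [df <-] H; apply/eqP/negPn/negP => a0.
move: df => /cvg_ex[l fl].
have e : 'D_1 f t = l by exact: cvg_lim fl.
move: a0; rewrite e => a0; have a1 : 0 < `|l| by rewrite normr_gt0.
move/cvgrPdist_lt: fl => /(_ _ a1) /nbhs_ballP[r /= r0 Hr].
have sp : 0 < `|s| by rewrite normr_gt0.
pose h := Num.min (d / 2) (r / (2 * `|s|)).
have h0 : 0 < h by rewrite lt_min !divr_gt0 ?mulr_gt0.
have hd : h < d by rewrite gt_min; apply/orP; left; lra.
have := Hr (s * h); rewrite /ball /= sub0r normrN normrM (gtr0_norm h0).
have sh : `|s| * h < r.
  apply: (@le_lt_trans _ _ (r / 2)); last lra. rewrite -ler_pdivlMl// /h ge_min; apply/orP; right.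
  by rewrite (_ : `|s|^-1 * (r / 2) = r / (2 * `|s|)) ?lexx//; field; rewrite gt_eqF.
move=> /(_ sh); rewrite mulf_neq0 ?(gt_eqF h0)// => /(_ isT).
rewrite /GRing.scale /= mulr1 (addrC (s * h)) H ?h0//.
by rewrite subrr mulr0 subr0 ltxx.
Qed.

Section OneSided.
Context R n.

Lemma derive1_side (x1 x2 : R -> 'rV[R]_n) (t s d : R) : s != 0 -> 0 < d ->
  derivable x1 t 1 -> derivable x2 t 1 -> x1 t = x2 t ->
  (forall h, 0 < h < d -> x1 (t + s * h) = x2 (t + s * h)) -> derive1 x1 t = derive1 x2 t.
Proof.
move=> s0 d0 d1 d2 e0 e; apply/rowP => k; apply/eqP; rewrite -subr_eq0; apply/eqP.
have h1 := derive1_coord k d1; have h2 := derive1_coord k d2.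
apply: (@derive_side0 R (fun s => x1 s 0 k - x2 s 0 k) t _ s d s0 d0).
  by move=> h hd; rewrite e// e0 !subrr.
Qed.

Lemma derive1Z_row (x : R -> 'rV[R]_n) (k t : R) : derivable x t 1 ->
  derivable (fun s => k *: x s) t 1 /\ derive1 (fun s => k *: x s) t = k *: derive1 x t.
Proof.
move=> dx; split; first exact: derivableZ.
by rewrite !derive1E; exact: deriveZ.
Qed.

Lemma derive1_affine (x : R -> 'rV[R]_n) (a b t : R) : derivable x (a + b * t) 1 ->
  derivable (fun s => x (a + b * s)) t 1 /\
  derive1 (fun s => x (a + b * s)) t = b *: derive1 x (a + b * t).
Proof.
move=> dx.
have d k : is_derive t 1 (fun s => x (a + b * s) 0 k) (b * derive1 x (a + b * t) 0 k).
  have h1 := derive1_coord k dx. have h2 : is_derive t (1 : R) (fun s : R => a + b * s) b.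
    apply: is_derive_eq; rewrite /GRing.scale /= !(mulr1, add0r, mulr0, addr0, mul1r) //.
  have := @is_derive1_comp R (fun s => x s 0 k) (fun s : R => a + b * s) t _ _ h1 h2. by rewrite mulrC.
have dd : derivable (fun s => x (a + b * s)) t 1 by apply: derivable_rowP => k; have [] := d k.
split => //; apply/rowP => k; have [_] := derive1_coord k dd; have [_ ->] := d k.
by move=> <-; rewrite mxE.
Qed.

Lemma derive1_near (x1 x2 : R -> 'rV[R]_n) (t : R) : (\forall s \near t, x1 s = x2 s) ->
  derivable x1 t 1 -> derivable x2 t 1 /\ derive1 x1 t = derive1 x2 t.
Proof.
move=> e d1; split; first exact: near_eq_derivable e d1.
by rewrite !derive1E; exact: near_eq_derive.
Qed.

Lemma derive1_near2 (x1 x2 : R -> 'rV[R]_n) (t : R) : (\forall s \near t, x1 s = x2 s) ->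
  \forall s \near t, derive1 x1 s = derive1 x2 s.
Proof.
move=> /near_join; apply: filterS => s e.
by rewrite !derive1E; exact: near_eq_derive.
Qed.

Lemma geo_eq_near g (x1 x2 : R -> 'rV[R]_n) (t : R) : (\forall s \near t, x1 s = x2 s) ->
  geo_eq g x1 t -> geo_eq g x2 t.
Proof.
move=> e [d1 d2 e1]; have [dx2 ex] := derive1_near e d1.
have [dv2 ev] := derive1_near (derive1_near2 e) d2.
by split; [exact: dx2|exact: dv2|rewrite -ev -ex -(nbhs_singleton e)].
Qed.

Lemma chrZ g y (a : R) (v : 'rV[R]_n) : chr g y (a *: v) = a ^+ 2 *: chr g y v.
Proof.
apply/rowP => k; rewrite [RHS]mxE !chrE mulr_sumr; apply: eq_bigr => i _.
rewrite mulr_sumr; apply: eq_bigr => j _; rewrite !mxE.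
by move: (christoffel _ _ _ _ _) => c; ring.
Qed.

Lemma derive1_ray (x : 'rV[R]_n) (t : R) : derivable (fun s : R => s *: x) t 1 /\
  derive1 (fun s : R => s *: x) t = x.
Proof.
have d k : is_derive t 1 (fun s : R => (s *: x) 0 k) (x 0 k).
  rewrite (_ : (fun s => _) = (fun s : R => s * x 0 k)).
    by apply: is_derive_eq; rewrite /GRing.scale /= !(mulr1, mul1r, mulr0, addr0, add0r).
  by apply/funext => s; rewrite mxE.
have dd : derivable (fun s : R => s *: x) t 1 by apply: derivable_rowP => k; have [] := d k.
split; first exact: dd.
by apply/rowP => k; have [_ <-] := derive1_coord k dd; have [_ ->] := d k.
Qed.

End OneSided.

Section Geodesics.
Context R n (M : riemannianManifold R n).
Implicit Types (P Q : param M) (gamma : R -> M).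

Lemma near_itvoo (a b t : R) : t \in `]a, b[ -> \forall s \near t, s \in `]a, b[.
Proof. by move=> tab; exact: near_in_itvoo. Qed.

(** The definition of a geodesic speaks of charts of the atlas only. [geo_eq_push] along the
    transition carries the equation to an arbitrary parametrization. *)
Lemma geodesic_param (a b : R) gamma t P : geodesic a b gamma -> t \in `]a, b[ ->
  pran P (gamma t) -> geo_eq (pmet P) (pchart P \o gamma) t.
Proof.
move=> geo tab Pt; have [ct _] := geo t tab.
have [ac dc] := chart_atP (gamma t); set c := chart_at _ in ac dc.
pose C := cpar ac; pose x := fwd c \o gamma; pose U := trdom C P.
have nc : \forall s \near t, dom c (gamma s) by apply: ct; apply: open_nbhs_nbhs; split => //; exact: open_dom.
have nP : \forall s \near t, pran P (gamma s) by apply: ct; apply: open_nbhs_nbhs; split => //; exact: open_pran.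
have oU : open U := @open_trdom _ _ _ C P.
have xU s : dom c (gamma s) -> pran P (gamma s) -> U (x s) by move=> ds Ps; split; [exact: fwd_cod|rewrite /= fwdK].
have gs : \forall s \near t, geo_eq (pullmx (pmet P) (tr C P)) x s.
  apply: filterS3 nc nP (near_itvoo tab) => s ds Ps sab. have [_ /(_ c ac ds) /= [d1 d2 e]] := geo s sab.
  split; [exact: d1|exact: d2|]. rewrite -(@chr_eq _ _ U (metric c) _ _ _ oU (xU _ ds Ps)).
    by apply/rowP => k; rewrite mxE chrE [RHS]mxE e.
  by move=> z zU; rewrite -(pmet_tr zU) pmet_chart//; exact: zU.1.
have := @geo_eq_push _ _ U (pdom P) (pmet P) (tr C P) x t oU (open_pdom P)
   (@smooth_tr _ _ _ C P) (fun y yU => pchart_dom yU.2) (@pmet_smooth _ _ _ P)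
   (fun y => @pmet_sym _ _ _ P y) (fun y => @pmet_unit _ _ _ P y)
   (fun y => @jac_tr_unit _ _ _ C P y) (xU _ dc Pt) gs.
apply: geo_eq_near; apply: filterS nc => s ds.
by rewrite /tr /= fwdK.
Qed.

Lemma geo_eqE g (x : R -> 'rV[R]_n) t : geo_eq g x t <->
  [/\ derivable x t 1, derivable (derive1 x) t 1 &
   forall k : 'I_n, derive1 (derive1 x) t 0 k +
     \sum_(i < n) \sum_(j < n) christoffel g k i j (x t) * derive1 x t 0 i * derive1 x t 0 j = 0].
Proof.
split=> -[d1 d2 e]; split => //.
  by move=> k; rewrite -chrE; have /rowP/(_ k) := e; rewrite !mxE.
by apply/rowP => k; rewrite mxE chrE e mxE.
Qed.

Lemma geodesic_sub (a b a' b' : R) gamma : a <= a' -> b' <= b -> geodesic a b gamma -> geodesic a' b' gamma.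
Proof.
move=> aa bb geo t; rewrite in_itv /= => /andP[at_ tb]; apply: geo.
by rewrite in_itv /= (le_lt_trans aa at_) (lt_le_trans tb bb).
Qed.

Lemma geodesic_local (g1 g2 : R -> M) (a b t0 : R) P : geodesic a b g1 -> geodesic a b g2 ->
  t0 \in `]a, b[ -> g1 t0 = g2 t0 -> pran P (g1 t0) ->
  derive1 (pchart P \o g1) t0 = derive1 (pchart P \o g2) t0 ->
  exists2 d, 0 < d & forall t, t0 <= t < t0 + d -> g1 t = g2 t.
Proof.
move=> G1 G2 tab e12 P0 v12.
have nP g : geodesic a b g -> pran P (g t0) -> \forall s \near t0, pran P (g s).
  move=> /(_ _ tab)[cg _] Pg. by apply: cg; apply: open_nbhs_nbhs; split => //; exact: open_pran.
have n1 := nP _ G1 P0; have P0' := P0; rewrite e12 in P0'; have n2 := nP _ G2 P0'.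
have [e e0 He] := near_right_ex (filterI (near_itvoo tab) (filterI n1 n2)).
have He' s : t0 <= s < t0 + e -> [/\ s \in `]a, b[, pran P (g1 s) & pran P (g2 s)].
  rewrite le_eqVlt => /andP[/orP[/eqP <- //|ts] se]. by have [] := He s; rewrite ?ts// => h1 [].
have [d d0 Hd] := @geodesic_local_unique R n (pdom P) (pmet P) (pchart P \o g1) (pchart P \o g2) t0 e
  (open_pdom P) (fun i => smooth_Gam i (open_pdom P) (@pmet_smooth _ _ _ P) (fun y => @pmet_sym _ _ _ P y)
   (fun y => @pmet_unit _ _ _ P y)) e0
   (fun s hs => let: And3 h1 h2 h3 := He' s hs in geodesic_param G1 h1 h2)
   (fun s hs => let: And3 h1 h2 h3 := He' s hs in geodesic_param G2 h1 h3)
   (pchart_dom P0) (congr1 (pchart P) e12) v12.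
exists (Num.min d e); first by rewrite lt_min d0.
move=> s /andP[ts sd]; have [_ h1 h2] : [/\ s \in `]a, b[, pran P (g1 s) & pran P (g2 s)].
  by apply: He'; rewrite ts (lt_le_trans sd)// lerD2l ge_min lexx orbT.
have := Hd s; rewrite ts (lt_le_trans sd) ?lerD2l ?ge_min ?lexx// => /(_ isT) /(congr1 (ppar P)).
by rewrite /= !pchartK.
Qed.

(** Continuity induction: if the geodesics agree before [t], they agree at [t] because the manifold
    is Hausdorff, their velocities agree there as left derivatives, and [geodesic_local] continues
    beyond [t]. *)
Lemma geodesic_unique (g1 g2 : R -> M) (e : R) P : 0 < e ->
  geodesic (- e) (1 + e) g1 -> geodesic (- e) (1 + e) g2 -> g1 0 = g2 0 -> pran P (g1 0) ->
  derive1 (pchart P \o g1) 0 = derive1 (pchart P \o g2) 0 ->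
  forall t, 0 <= t <= 1 -> g1 t = g2 t.
Proof.
move=> e0 G1 G2 e12 P0 v12.
have i0 : (0 : R) \in `]- e, 1 + e[ by rewrite in_itv /= oppr_lt0 e0 addr_gt0.
have [d d0 Hd] := geodesic_local G1 G2 i0 e12 P0 v12.
suff H t : 0 < t < 1 + e -> g1 t = g2 t.
  move=> t /andP[]; rewrite le_eqVlt => /orP[/eqP <- //|t0] t1; apply: H. by rewrite t0 (le_lt_trans t1)// ltrDl.
apply: (@real_bootstrap R (1 + e) d (fun t => g1 t = g2 t)) => //.
  by move=> s /andP[s0 sd]; apply: Hd; rewrite (ltW s0) add0r.
move=> {}t /andP[t0 t1] eqt.
have tab : t \in `]- e, 1 + e[ by rewrite in_itv /= t1 andbT (lt_trans _ t0)// oppr_lt0.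
have [c1 _] := G1 t tab; have [c2 _] := G2 t tab.
have eqm h : 0 < h < t -> g1 (t + - 1 * h) = g2 (t + - 1 * h) by move=> /andP[h0 ht]; rewrite mulN1r; apply: eqt; rewrite subr_gt0 ht gtrBl.
have et : g1 t = g2 t.
  apply: contrapT => ne; have := @points_hausdorff _ _ M.
  rewrite open_hausdorff => /(_ (g1 t) (g2 t)) [|[A B] /= [Ag Bg] [oA oB AB]].
    by apply/eqP.
  have nA : \forall s \near t, A (g1 s) by apply: c1; apply: open_nbhs_nbhs; split => //; exact: set_mem.
  have nB : \forall s \near t, B (g2 s) by apply: c2; apply: open_nbhs_nbhs; split => //; exact: set_mem.
  have : nbhs t (fun s => A (g1 s) /\ B (g2 s)) by exact: filterI. move=> /nbhs_ballP[r /= r0 Hr].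
  pose h := Num.min (r / 2) (t / 2). have h0 : 0 < h by rewrite lt_min !divr_gt0.
  have hr : h < r by rewrite gt_min; apply/orP; left; lra. have ht : h < t by rewrite gt_min; apply/orP; right; lra.
  have [|hA hB] := Hr (t + -1 * h); first by rewrite /ball /= mulN1r opprB addrC subrK gtr0_norm.
  have : (A `&` B) (g1 (t + -1 * h)) by split => //; rewrite eqm// h0. by move/eqP: AB => ->.
have [ac dc] := chart_atP (g1 t); set c := chart_at _ in ac dc.
have Pt : pran (cpar ac) (g1 t) by rewrite cpar_ran.
have Pt' := Pt; rewrite et in Pt'.
have [d1 _ _] := geodesic_param G1 tab Pt; have [d2 _ _] := geodesic_param G2 tab Pt'.
split; first exact: et.
have [|r r0 Hr] := geodesic_local G1 G2 tab et Pt.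
  apply: (@derive1_side _ _ _ _ t (-1) t) => //.
    by rewrite /= et.
  by move=> h ht; rewrite /= eqm.
by exists r => // s /andP[ts sr]; apply: Hr; rewrite (ltW ts).
Qed.

Lemma geodesic_affine gamma (a b a' b' s0 k : R) : geodesic a b gamma ->
  (forall s, s \in `]a', b'[ -> s0 + k * s \in `]a, b[) ->
  geodesic a' b' (fun s => gamma (s0 + k * s)).
Proof.
move=> geo sub s hs; have [ct geoc] := geo _ (sub _ hs); split.
  apply: (@continuous_comp _ _ _ (fun s : R => s0 + k * s) gamma) => //. apply: (@continuousD _ R); first exact: cst_continuous.
  by apply: (@continuousM R R); [exact: cst_continuous|exact: cvg_id].
move=> c ac dc x.
have nd : \forall u \near s, dom c (gamma (s0 + k * u)).
  have h : {for s, continuous (fun u => gamma (s0 + k * u))}.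
    apply: (@continuous_comp _ _ _ (fun s : R => s0 + k * s) gamma) => //. apply: (@continuousD _ R); first exact: cst_continuous.
    by apply: (@continuousM R R); [exact: cst_continuous|exact: cvg_id].
  by apply: h; apply: open_nbhs_nbhs; split => //; exact: open_dom.
have [d1 d2 e] := geoc c ac dc.
have [D1 E1] := @derive1_affine _ _ (fwd c \o gamma) s0 k s d1.
have n1 : \forall u \near s, k *: derive1 (fwd c \o gamma) (s0 + k * u) = derive1 x u.
  apply: filterS2 nd (near_itvoo hs) => u du hu. have [_ /(_ c ac du)[d1' _ _]] := geo _ (sub _ hu).
  have [_ e1] := @derive1_affine _ _ (fwd c \o gamma) s0 k u d1'; exact: esym e1.
have [D2 E2] := @derive1_affine _ _ (derive1 (fwd c \o gamma)) s0 k s d2.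
have D3 : derivable (fun u => k *: derive1 (fwd c \o gamma) (s0 + k * u)) s 1.
  exact: derivableZ.
have E3 : derive1 (fun u => k *: derive1 (fwd c \o gamma) (s0 + k * u)) s = k ^+ 2 *: derive1 (derive1 (fwd c \o gamma)) (s0 + k * s).
  have e3 := congr1 (fun v => k *: v) E2; rewrite scalerA -expr2 in e3.
  have [_ e2] := @derive1Z_row R n (fun u => derive1 (fwd c \o gamma) (s0 + k * u)) k s D2. by rewrite e2; exact: e3.
have [D4 E4] := derive1_near n1 D3.
apply/geo_eqE; split; [exact: D1|exact: D4|].
have /geo_eqE[_ _ e'] := And3 d1 d2 e.
rewrite -[LHS](congr1 (fun u => u + _) E4) E3.
have -> : derive1 x s = k *: derive1 (fwd c \o gamma) (s0 + k * s) by exact: E1.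
by rewrite chrZ -scalerDr e' scaler0.
Qed.

(** [is_exp] fixes only the end point for each vector. The geodesic with velocity [v], run at speed
    [t], has initial velocity [t *: v], so by uniqueness it ends at [e (t *: v)]. *)
Lemma exp_ray (e : 'rV[R]_n -> M) p (rho : R) gamma eg v :
  (forall v, tangent_ball p rho v -> is_exp p v (e v)) -> tangent_ball p rho v ->
  0 < eg -> geodesic (- eg) (1 + eg) gamma -> gamma 0 = p ->
  derive1 (fwd (chart_at p) \o gamma) 0 = v ->
  forall t, 0 <= t <= 1 -> gamma t = e (t *: v).
Proof.
move=> He Bv eg0 G0 gp gv t /andP[t0 t1].
have Bt : tangent_ball p rho (t *: v).
  rewrite /tangent_ball /= innerZl innerZr; apply: le_lt_trans Bv; rewrite mulrA.
  rewrite ler_piMl//; last by rewrite -[leRHS]mulr1 ler_pM. have [->|v0] := eqVneq v 0; first by rewrite /inner mul0mx mul0mx mxE.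
  have [ac dc] := chart_atP p; apply/ltW/metric_pos => //; exact: fwd_cod.
have [g' [e' [e'0 G' g'p g'v <-]]] := He _ Bt.
have [ac dc] := chart_atP p; set c := chart_at _ in ac dc gv g'v.
pose m := Num.min eg e'; have m0 : 0 < m by rewrite lt_min eg0.
have G2 : geodesic (- m) (1 + m) (fun s => gamma (0 + t * s)).
  apply: geodesic_affine G0 _ => s; rewrite !in_itv /= add0r => /andP[s1 s2]. have me : m <= eg by rewrite ge_min lexx.
  have [s0|s0] := leP 0 s.
    have ts0 : 0 <= t * s by rewrite mulr_ge0. have ts : t * s <= s by rewrite ler_piMl. by itv_lra.
  have ts0 : t * s <= 0 by rewrite mulr_ge0_le0// ltW. have ts : s <= t * s by rewrite ler_niMl// ltW. by itv_lra.
have G1 : geodesic (- m) (1 + m) g' by apply: geodesic_sub G'; rewrite ?lerN2 ?lerD2l ge_min lexx orbT.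
have P0 : pran (cpar ac) (g' 0) by rewrite cpar_ran g'p.
have -> : gamma t = (fun s => gamma (0 + t * s)) 1 by rewrite add0r mulr1.
have g0 : g' 0 = (fun s => gamma (0 + t * s)) 0 by rewrite mulr0 addr0 g'p gp.
have h1 : 0 <= (1 : R) <= 1 by rewrite ler01 lexx.
apply/esym/(geodesic_unique m0 G1 G2 g0 P0 _ h1); rewrite [LHS]g'v.
have i0' : (0 : R) \in `]- eg, 1 + eg[ by rewrite in_itv /= oppr_lt0 eg0 addr_gt0.
have [_ /(_ c ac)] := G0 0 i0'; rewrite gp => /(_ dc) [d1 _ _].
have d1' : derivable (fwd c \o gamma) (0 + t * 0) 1 by rewrite mulr0 addr0.
have [_] := @derive1_affine _ _ (fwd c \o gamma) 0 t 0 d1'.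
by rewrite /= mulr0 addr0 gv => ->.
Qed.

End Geodesics.

Section CurvatureLocality.
Context R n (U : set 'rV[R]_n) (g1 g2 : 'rV[R]_n -> 'M[R]_n).
Hypothesis oU : open U.

Lemma curvature_christoffel x u v w : U x ->
  (forall y k i j, U y -> christoffel g1 k i j y = christoffel g2 k i j y) ->
  curvature g1 x u v w = curvature g2 x u v w.
Proof.
move=> Ux ch; apply/rowP => l; rewrite [LHS]mxE [RHS]mxE.
apply: eq_bigr => i _; apply: eq_bigr => j _; apply: eq_bigr => k _.
have e (A B C A' B' C' : R) : A = A' -> B = B' -> C = C' -> A - B + C = A' - B' + C' by move=> -> -> ->.
apply: (congr1 (fun z => z * u 0 i * v 0 j * w 0 k)); apply: e.
- by apply: partial_near; apply: (open_eq_near oU Ux) => y Uy; exact: ch.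
- by apply: partial_near; apply: (open_eq_near oU Ux) => y Uy; exact: ch.
- by apply: eq_bigr => m _; rewrite !ch.
Qed.

Lemma curvature_eq x u v w : U x -> (forall y, U y -> g1 y = g2 y) ->
  curvature g1 x u v w = curvature g2 x u v w.
Proof.
move=> Ux e; apply: curvature_christoffel => // y k i j Uy.
rewrite /christoffel; congr (_ * _); apply: eq_bigr => l _; congr (_ * _).
  by rewrite (e _ Uy).
by congr (_ + _ - _); apply: partial_near; apply: (open_eq_near oU Uy) => z Uz; rewrite e.
Qed.

End CurvatureLocality.

Section Scaling.
Context R n (U : set 'rV[R]_n) (g : 'rV[R]_n -> 'M[R]_n) (a : R).
Hypotheses (oU : open U) (sg : smooth_mx U g) (a0 : a != 0).
Hypothesis gu : forall x, U x -> g x \in unitmx.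

Lemma partial_scale (f : 'rV[R]_n -> R) i x : differentiable f x ->
  partial i (fun y => a * f y) x = a * partial i f x.
Proof.
move=> df; have -> : (fun y => a * f y) = a \*: f by apply/funext.
by rewrite /partial deriveZ//; exact: diff_derivable.
Qed.

(** The factor [a] of the metric cancels against that of its inverse. Hence lengths may be measured
    in units of [r] without changing the geodesic equation or the curvature tensor. *)
Lemma christoffel_scale k i j x : U x ->
  christoffel (fun y => a *: g y) k i j x = christoffel g k i j x.
Proof.
move=> Ux; rewrite /christoffel; congr (_ * _); apply: eq_bigr => l _.
have p b c d : partial b (fun y => (a *: g y) c d) x = a * partial b (fun y => g y c d) x.
  rewrite -partial_scale; last exact: (smooth_mx_diff oU _ _ sg Ux). by congr (partial _ _ _); apply/funext => y; rewrite mxE.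
rewrite !p invmxZ ?unitmxZ ?unitfE ?gu// [in LHS]mxE.
rewrite -!mulrDr -mulrBr; move: (invmx _ _ _) (_ + _ - _) => u v.
by field.
Qed.

Lemma curvature_scale x u v w : U x ->
  curvature (fun y => a *: g y) x u v w = curvature g x u v w.
Proof.
move=> Ux; apply: (@curvature_christoffel _ _ U _ _ oU x u v w Ux) => *.
exact: christoffel_scale.
Qed.

Lemma chr_scale x v : U x -> chr (fun y => a *: g y) x v = chr g x v.
Proof.
move=> Ux; apply/rowP => k; rewrite !chrE.
by apply: eq_bigr => i _; apply: eq_bigr => j _; rewrite christoffel_scale.
Qed.

End Scaling.

(** One step of Gram-Schmidt per dimension: [Q] clears the first row and column, the induction
    hypothesis is applied to the Schur complement [S], and [k] normalizes the first vector. *)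
Lemma orthonormal_frame R n (A : 'M[R]_n) : A^T = A ->
  (forall v, v != 0 -> 0 < inner A v v) ->
  exists2 P, P \in unitmx & P *m A *m P^T = 1%:M.
Proof.
elim: n A => [|n IH] A As Ap.
  by exists 1%:M; [exact: unitmx1|apply/matrixP => -[]].
rewrite -[n.+1]/(1 + n)%N in A As Ap *.
pose a := ulsubmx A; pose b := dlsubmx A; pose D := drsubmx A.
have eA : A = block_mx a b^T b D.
  rewrite -[LHS]submxK; congr block_mx. by rewrite -[in LHS]As /b trmx_dlsub.
have a0 : 0 < a 0 0.
  have d0 : (delta_mx 0 0 : 'rV[R]_(1 + n)) != 0 by apply/eqP => /rowP/(_ 0)/eqP; rewrite !mxE !eqxx oner_eq0.
  have := Ap _ d0; rewrite inner_delta /a !mxE. by rewrite (_ : lshift n 0 = 0)//; apply: val_inj.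
have aE : a = (a 0 0)%:M by rewrite -mx11_scalar.
pose Q : 'M[R]_(1 + n) := block_mx 1%:M 0 (- (a 0 0)^-1 *: b) 1%:M.
pose S := D - (a 0 0)^-1 *: (b *m b^T).
have QA : Q *m A *m Q^T = block_mx a 0 0 S.
  rewrite eA /Q tr_block_mx !mulmx_block !trmx1 trmx0 linearZ /=.
  rewrite !mul1mx !mul0mx !mulmx1 !mulmx0 !addr0 -!scalemxAl -!scalemxAr.
  have ab : (a 0 0)^-1 *: (a *m b^T) = b^T by rewrite aE mul_scalar_mx scalerA mxE eqxx mulr1n mulVf ?gt_eqF// scale1r.
  have ba : (a 0 0)^-1 *: (b *m a) = b by rewrite aE mul_mx_scalar scalerA mxE eqxx mulr1n mulVf ?gt_eqF// scale1r.
  rewrite !scaleNr ab ba !addNr mul0mx scaler0 oppr0 add0r. by congr block_mx; rewrite addrC.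
have uQ : Q \in unitmx by rewrite unitmxE /Q det_lblock !det1 mulr1 unitr1.
have Ss : S^T = S.
  have /(congr1 trmx) := QA; rewrite !trmx_mul trmxK As mulmxA QA. by rewrite tr_block_mx => /eq_block_mx[_ _ _].
have Sp v : v != 0 -> 0 < inner S v v.
  move=> v0; pose w : 'rV[R]_(1 + n) := row_mx 0 v. have wQ : w *m Q != 0.
    apply: contra_neq v0 => e. have : w = 0 by rewrite -[w](mulmxK uQ) e mul0mx. by rewrite -[0](@row_mx0 _ 1 1 n) => /eq_row_mx[].
  have := Ap _ wQ; rewrite /inner trmx_mul !mulmxA -(mulmxA (w *m Q) A) .
  rewrite -(mulmxA w Q) (mulmxA Q A) QA /w mul_row_block !mul0mx !mulmx0 !add0r. by rewrite tr_row_mx mul_row_col mul0mx add0r.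
have [P uP eP] := IH S Ss Sp.
pose k := (Num.sqrt (a 0 0))^-1.
pose T : 'M[R]_(1 + n) := block_mx k%:M 0 0 P.
exists (T *m Q).
  rewrite unitmx_mul uQ andbT unitmxE /T det_ublock unitrM -!unitmxE uP andbT.
  by rewrite unitmxE det_scalar expr1 unitfE invr_neq0// gt_eqF// sqrtr_gt0.
rewrite trmx_mul !mulmxA -(mulmxA T Q) -(mulmxA T (Q *m A)) QA /T.
rewrite tr_block_mx !mulmx_block !trmx0 !mul0mx !mulmx0 !addr0 !add0r !mul0mx eP.
rewrite tr_scalar_mx aE -!scalar_mxM (_ : k * a 0 0 * k = 1) -?scalar_mx_block//.
rewrite -[a 0 0 in LHS](sqr_sqrtr (ltW a0)) /k expr2.
have : Num.sqrt (a 0 0) != 0 by rewrite gt_eqF// sqrtr_gt0.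
by move: (Num.sqrt _) => s s0; field.
Qed.

Section LinearReparam.
Context R n (M : smoothManifold R n) (P : param M).
Variables (A : 'M[R]_n) (U : set 'rV[R]_n).
Hypotheses (uA : A \in unitmx) (oU : open U) (UP : forall x, U x -> pdom P (x *m A)).

Let lmap x := ppar P (x *m A).
Let linv p := pchart P p *m invmx A.

Lemma smooth_linear m (B : 'M[R]_(n, m)) (W : set 'rV[R]_n) : open W ->
  smooth_on W (fun x => x *m B).
Proof.
move=> oW k; apply: (@smooth_ext _ _ _ (fun x => \sum_j x 0 j * B j k)) => //.
  by move=> x _; rewrite mxE.
apply: smooth_sum => // j; apply: smooth_mul => //; first exact: smooth_coord.
exact: smooth_cst.
Qed.

Lemma continuous_linear m (B : 'M[R]_(n, m)) x : {for x, continuous (fun x : 'rV[R]_n => x *m B)}.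
Proof.
apply/differentiable_continuous/differentiable_rowP => k.
exact: (smooth_diff openT (smooth_linear B openT k)).
Qed.

Lemma lran : lmap @` U = pran P `&` pchart P @^-1` (fun y => U (y *m invmx A)).
Proof.
apply/seteqP; split => [_ [x Ux <-]|p [Pp Up]].
  split; first by exists (x *m A) => //; exact: UP. by rewrite /= pparK ?mulmxK//; exact: UP.
exists (pchart P p *m invmx A) => //.
by rewrite /lmap mulmxKV// pchartK.
Qed.

Lemma open_lran : open (lmap @` U).
Proof.
rewrite lran; apply: open_preimage_on; first exact: open_pran.
  by move=> p; exact: pchart_continuous.
have := @open_preimage_on _ _ setT U (fun y : 'rV[R]_n => y *m invmx A) openT
  (fun y _ => @continuous_linear _ (invmx A) y) oU.
by rewrite setTI.
Qed.

Lemma lmap_smooth : smooth_into U lmap.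
Proof.
have cl : continuous_on U lmap.
  move=> x Ux; have h := ppar_continuous (UP Ux).
  exact: (@continuous_comp _ _ _ (fun x : 'rV[R]_n => x *m A) (ppar P) x (@continuous_linear _ A x) h).
split=> // c ac k.
have oW : open (U `&` lmap @^-1` dom c) by apply: open_preimage_on => //; exact: open_dom.
apply: (@smooth_comp _ _ _ oW _ (pdom P `&` ppar P @^-1` dom c) (fun y => (fwd c \o ppar P) y 0 k) (fun x => x *m A)).
- apply: open_preimage_on; [exact: open_pdom| |exact: open_dom].
  by move=> x; exact: ppar_continuous.
- exact: smooth_ppar_chart.
- exact: smooth_linear.
- by move=> x [Ux dx]; split => //; exact: UP.
Qed.

Lemma linv_smooth : smooth_from (lmap @` U) linv.
Proof.
move=> c ac k.
have oW : open (cod c `&` bwd c @^-1` (lmap @` U)) by apply: open_preimage_on; [exact: open_cod|exact: bwd_continuous|exact: open_lran].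
apply: (@smooth_comp _ _ _ oW _ setT (fun y => (y *m invmx A) 0 k) (pchart P \o bwd c)) => //.
- exact: openT.
- exact: (smooth_linear _ openT).
move=> j; have h := pchart_smooth P c ac j.
apply: (@smooth_sub _ _ _ (cod c `&` bwd c @^-1` (lmap @` U)) _ _ h) => y [cy hy].
by split => //; move: hy; rewrite /preimage /= => -[z Uz <-]; exact/ppar_ran/UP.
Qed.

Lemma lmapK x : U x -> linv (lmap x) = x.
Proof. by move=> Ux; rewrite /linv pparK ?mulmxK//; exact: UP. Qed.

Definition lpar : param M := Param oU open_lran lmap_smooth linv_smooth lmapK.

End LinearReparam.

(** * Normal charts from the exponential map *)

Section NormalCharts.
Context R n (M : riemannianManifold R n).

(** All that is retained of the geometry around a point: a metric on a Euclidean ball, Euclidean at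
    the centre, with rays as geodesics and a bound on the curvature of planes containing the radial
    direction. *)
Record normal_metric (rho kappa : R) (G : 'rV[R]_n -> 'M[R]_n) := NormalMetric {
  nm_smooth : smooth_mx (eball rho) G;
  nm_sym : forall x, eball rho x -> (G x)^T = G x;
  nm_pos : forall x, eball rho x -> forall v, v != 0 -> 0 < inner (G x) v v;
  nm_0 : G 0 = 1%:M;
  nm_geo : forall x, eball rho x -> chr G x x = 0;
  nm_curv : forall x, eball rho x -> forall u,
    `|inner (G x) (curvature G x u x x) u| <= kappa * dot x x * inner (G x) u u }.

Lemma inner_scale (a : R) (A : 'M[R]_n) u v : inner (a *: A) u v = a * inner A u v.
Proof. by rewrite !innerE -scalemxAr dotZl. Qed.

Lemma inner0l (A : 'M[R]_n) v : inner A 0 v = 0.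
Proof. by rewrite innerE mul0mx dot0l. Qed.

Lemma inner_mul (A B : 'M[R]_n) u v : inner A (u *m B) (v *m B) = inner (B *m A *m B^T) u v.
Proof. by rewrite /inner trmx_mul !mulmxA. Qed.

Lemma inner1 (u v : 'rV[R]_n) : inner 1%:M u v = dot u v.
Proof. by rewrite innerE mulmx1. Qed.

Lemma curvature_dep (g : 'rV[R]_n -> 'M[R]_n) x (a : R) v w : curvature g x (a *: v) v w = 0.
Proof.
have anti i j : Fc g i j x = - Fc g j i x by rewrite /Fc; apply/matrixP => p q; rewrite !mxE; ring.
have e : Fuv g (a *: v) v x = - Fuv g (a *: v) v x.
  rewrite {1}/Fuv exchange_big /= -sumrN; apply: eq_bigr => i _; rewrite -sumrN.
  apply: eq_bigr => j _; rewrite (anti j i) scalerN; congr (- _); congr (_ *: _). by rewrite !mxE; ring.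
rewrite curvatureE (_ : Fuv _ _ _ _ = 0) ?mulmx0//.
apply/matrixP => p q; have /matrixP/(_ p q) := e; rewrite !mxE => h.
by move: h; move: (Fuv _ _ _ _ p q) => z; lra.
Qed.

(** [sec_bounded] speaks of quotients for independent pairs. Multiplying by the positive Gram
    determinant and dropping its square term gives a bound for such pairs; for dependent pairs the
    curvature term vanishes by antisymmetry. *)
Lemma curvature_bound K (P : param M) x u v : 0 <= K -> sec_bounded M K -> pdom P x ->
  `|inner (pmet P x) (curvature (pmet P) x u v v) u| <= K * (inner (pmet P x) u u * inner (pmet P x) v v).
Proof.
move=> K0 sK Px; have [ac dc] := chart_atP (ppar P x); set c := chart_at _ in ac dc.
pose C := cpar ac; pose U := trdom P C.
have Ux : U x by split; rewrite //= cpar_ran.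
have oU : open U := @open_trdom _ _ _ P C.
have U_cod y : U y -> cod c (tr P C y) by move=> [_ /=]; rewrite cpar_ran; exact: fwd_cod.
have c0 : cod c (tr P C x) by exact: U_cod.
have mpos y : y != 0 -> 0 < inner (metric c (tr P C x)) y y by exact: metric_pos.
have mge y : 0 <= inner (metric c (tr P C x)) y y.
  have [->|y0] := eqVneq y 0; first by rewrite inner0l. exact/ltW/mpos.
have ms : (metric c (tr P C x))^T = metric c (tr P C x) by exact: Defs.metric_sym.
have epm y : U y -> pmet P y = pullmx (metric c) (tr P C) y by move=> Uy; rewrite (pmetE ac)//; [exact: Uy.1|case: Uy => _ /=; rewrite cpar_ran].
have -> : curvature (pmet P) x u v v = curvature (pullmx (metric c) (tr P C)) x u v v.
  exact: (@curvature_eq _ _ U _ _ oU x u v v Ux epm).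
rewrite epm// !inner_pull (@curvature_pull _ _ U (cod c))//; first last.
- by move=> y; exact: jac_tr_unit.
- by move=> y cy; apply: posdef_unitmx => w; exact: metric_pos.
- by move=> y cy; exact: Defs.metric_sym.
- by move=> i j; exact: metric_smooth.
- exact: smooth_tr.
- exact: open_cod.
move: (u *m _) (v *m _) => {}u {}v; set g := metric c; set y := tr P C x in c0 mpos mge ms *.
have [v0|v0] := eqVneq v 0.
  by rewrite v0 curvatureE mul0mx !inner0l !mulr0 normr0.
have [uv|uv] := boolP (row_free (col_mx u v)); last first.
  suff [a ->] : exists a, u = a *: v.
    by rewrite curvature_dep inner0l normr0 mulr_ge0// mulr_ge0.
  have : (u <= v)%MS.
    apply: contraNT uv => nuv; rewrite -row_leq_rank. rewrite -addsmxE; have := mxrank_sum_cap u v.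
    have rv : \rank v = 1%N by rewrite rank_rV v0.
    have ru : \rank u = 1%N by rewrite rank_rV; case: eqP nuv => // ->; rewrite sub0mx. have -> : \rank (u :&: v)%MS = 0%N.
      apply/eqP; rewrite mxrank_eq0; apply: contraNT nuv => nz. have h : (u :&: v :=: u)%MS.
        apply/eqmxP; rewrite capmxSl /= -mxrank_leqif_sup ?capmxSl// ru.
        have le1 : (\rank (u :&: v)%MS <= 1)%N by rewrite -[X in (_ <= X)%N]ru mxrankS ?capmxSl.
        by rewrite eqn_leq le1 lt0n mxrank_eq0.
      by rewrite -h capmxSr.
    by rewrite ru rv addn0 => ->.
  by move=> /sub_rVP[a ->]; exists a.
have := sK c ac y c0 u v uv; rewrite /sectional_curvature -/g.
set D := _ - _ ^+ 2.
have D0 : 0 < D.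
  pose w := inner (g y) v v *: u - inner (g y) u v *: v. have w0 : w != 0.
    apply/eqP => /eqP; rewrite subr_eq0 => /eqP e. move: uv; apply/negP; rewrite -row_leq_rank -ltnNge -addsmxE.
    have uv : (u <= v)%MS.
      apply/sub_rVP; exists ((inner (g y) v v)^-1 * inner (g y) u v). by rewrite -scalerA -e scalerA mulVf ?scale1r// gt_eqF// mpos.
    by rewrite (addsmx_idPr uv) rank_rV v0.
  have := mpos _ w0; rewrite /w. rewrite -scaleNr innerDl !innerDr !innerZl !innerZr (inner_sym v u ms).
  have vp := mpos _ v0; rewrite -/g in vp *. move: vp; rewrite /D; move: (inner _ v v) (inner _ u v) (inner _ u u) => p q s p0.
  have -> : p * (p * s) + p * (- q * q) + (- q * (p * q) + - q * (- q * p)) = p * (s * p - q ^+ 2) by ring. by rewrite pmulr_rgt0.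
rewrite normrM normfV (gtr0_norm D0) ler_pdivrMr// => h; apply: le_trans h _.
by rewrite ler_wpM2l// /D gerBl sqr_ge0.
Qed.

Lemma open_tangent_ball (p : M) rho : open (tangent_ball p rho).
Proof.
have c x : {for x, continuous (fun v => inner (metric (chart_at p) (fwd (chart_at p) p)) v v)}.
  have -> : (fun v => inner (metric (chart_at p) (fwd (chart_at p) p)) v v) =
    (fun v => dot (v *m metric (chart_at p) (fwd (chart_at p) p)) v).
    by apply/funext => v; rewrite innerE.
  by apply: continuous_dot; [exact: continuous_linear|exact: cvg_id].
have oI : open [set y : R | y < rho ^+ 2] by exact: open_lt.
have := @open_preimage_on _ _ setT _ _ openT (fun x _ => c x) oI.
by rewrite setTI.
Qed.

Lemma exp_param (p : M) rho : exp_diffeo p rho ->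
  exists E : param M, pdom E = tangent_ball p rho /\
    forall v, tangent_ball p rho v -> is_exp p v (ppar E v).
Proof.
move=> [e [f [He fK se oe sf]]].
by exists (Param (@open_tangent_ball p rho) oe se sf fK).
Qed.

(** The exponential map is composed with an orthonormal frame and with multiplication by [r], and
    the metric is divided by [r^2]. The ball of radius [2 * r] becomes a ball of radius 2, and the
    curvature bound becomes [K * r ^+ 2]. *)
Lemma normal_chart (p : M) (r rho K : R) : 0 < r -> 2 * r < rho -> 0 <= K ->
  exp_diffeo p rho -> sec_bounded M K ->
  exists P : param M, [/\ pdom P = eball 2, ppar P 0 = p &
    normal_metric 2 (K * r ^+ 2) (fun x => (r ^+ 2)^-1 *: pmet P x)].
Proof.
move=> r0 rrho K0 /exp_param[E [dE expE]] sK.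
have [ac dc] := chart_atP p; set c := chart_at p in ac dc.
have r2 : 0 < r ^+ 2 by rewrite exprn_gt0.
have r2n : r ^+ 2 != 0 by rewrite gt_eqF.
have cp := fwd_cod dc; pose g := metric c (fwd c p).
have [F uF eF] := @orthonormal_frame R n g (Defs.metric_sym ac cp) (fun v => metric_pos ac cp (v := v)).
have urF : r *: F \in unitmx by rewrite unitmxZ ?unitfE ?gt_eqF.
have tb x : eball 2 x -> tangent_ball p rho (x *m (r *: F)).
  rewrite /eball /tangent_ball /= -/c -/g => x2.
  rewrite inner_mul linearZ /= -!scalemxAl -scalemxAr scalerA eF -expr2 inner_scale inner1 -sqr_enorm -exprMn.
  rewrite ltr_pXn2r ?nnegrE ?mulr_ge0 ?enorm_ge0//; [|exact: ltW|].
    by apply: lt_trans rrho; rewrite mulrC ltr_pM2r.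
  by apply: le_trans (ltW rrho); rewrite mulr_ge0// ltW.
have UP x : eball 2 x -> pdom E (x *m (r *: F)) by rewrite dE; exact: tb.
have [P [dP PE]] : exists P : param M, pdom P = eball 2 /\ forall x, ppar P x = ppar E (x *m (r *: F)) by exists (lpar urF (@open_eball0 R n 2) UP).
have Pd x : eball 2 x -> pdom P x by rewrite dP.
have B0' : eball 2 (0 : 'rV[R]_n) by rewrite /eball /= enorm0.
have ray x : eball 2 x -> exists gamma e, [/\ 0 < e, geodesic (- e) (1 + e) gamma, gamma 0 = p,
    derive1 (fwd c \o gamma) 0 = x *m (r *: F) & forall t, 0 <= t <= 1 -> gamma t = ppar P (t *: x)].
  move=> x2; have [gamma [e [e0 G0 gp gv _]]] := expE _ (tb _ x2). exists gamma, e; split => // t t01.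
  by rewrite (exp_ray expE (tb _ x2) e0 G0 gp gv)// PE scalemxAl.
have P0 : ppar P 0 = p.
  have [gamma [e [_ _ gp _ h]]] := ray 0 B0'. by rewrite -gp h ?scaler0// lexx ler01.
have p0c : trdom P (cpar ac) 0 by split; [exact: Pd|rewrite /= cpar_ran P0].
(* The geodesic with initial velocity [delta_mx 0 i *m (r *: F)] is the image of a ray on [[0, 1]],
   so the two curves have the same right derivative at 0. *)
have jac0 : jac (tr P (cpar ac)) 0 = r *: F.
  apply/row_matrixP => i; rewrite !rowE. have d2 : eball 2 (delta_mx 0 i : 'rV[R]_n).
    rewrite /eball /= -(@ltr_pXn2r _ 2) ?nnegrE ?enorm_ge0// sqr_enorm dot_delta mxE !eqxx. by rewrite -natrX ltr_nat.
  have [gamma [e [e0 G0 gp gv h]]] := ray _ d2. have i0 : (0 : R) \in `]- e, 1 + e[ by rewrite in_itv /= oppr_lt0 e0 addr_gt0.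
  have [_ /(_ c ac)] := G0 0 i0; rewrite gp => /(_ dc) [dg _ _]. have [dr er] := derive1_ray (delta_mx 0 i : 'rV[R]_n) 0.
  have p0c' : trdom P (cpar ac) (0 *: (delta_mx 0 i : 'rV[R]_n)) by rewrite scale0r.
  have [dq eq] := derive1_comp_smooth (@open_trdom _ _ _ P (cpar ac)) (@smooth_tr _ _ _ P (cpar ac)) dr p0c'.
  move: eq; rewrite er scale0r => <-; rewrite -gv. apply: (@derive1_side _ _ _ _ 0 1 1); rewrite ?oner_neq0//.
    by rewrite /tr /= gp scale0r P0.
  by move=> t /andP[t0 t1]; rewrite add0r mul1r /tr /= h// !ltW.
have sP : smooth_mx (eball 2) (pmet P) by rewrite -dP; exact: pmet_smooth.
have uP x : eball 2 x -> pmet P x \in unitmx by move=> /Pd; exact: pmet_unit.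
have oB : open (@eball R n 2) := @open_eball0 R n 2.
have in0 : (r ^+ 2)^-1 != 0 by rewrite invr_neq0.
have sG : smooth_mx (eball 2) (fun x => (r ^+ 2)^-1 *: pmet P x) by apply: smooth_mxZ => //; exact: smooth_cst.
have Gs x : eball 2 x -> ((r ^+ 2)^-1 *: pmet P x)^T = (r ^+ 2)^-1 *: pmet P x by move=> /Pd x2; rewrite linearZ /= pmet_sym.
have Gp x : eball 2 x -> forall v, v != 0 -> 0 < inner ((r ^+ 2)^-1 *: pmet P x) v v.
  by move=> /Pd x2 v v0; rewrite inner_scale mulr_gt0 ?invr_gt0//; exact: pmet_pos.
have G0 : (r ^+ 2)^-1 *: pmet P 0 = 1%:M.
  rewrite (pmet_tr p0c) /pullmx jac0 pmet_chart; last by rewrite /tr /= P0. rewrite [tr _ _ 0]/= P0 -/g.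
  rewrite linearZ /= -!scalemxAl -scalemxAr !scalerA eF. by rewrite -mulrA -expr2 mulVf// scale1r.
have Ggeo x : eball 2 x -> chr (fun x => (r ^+ 2)^-1 *: pmet P x) x x = 0.
  (* The geodesic is known to be a ray on [[0, 1]] only. To have [x] at an interior time, the ray is
     prolonged to [k *: x] with [k > 1], still inside the ball, and inspected at time [k^-1]. *)
  move=> x2; rewrite (chr_scale oB)//. have [k k1 kx] : exists2 k : R, 1 < k & eball 2 (k *: x).
    have [->|x0] := eqVneq x 0; first by exists 2; rewrite ?scaler0// ltrDl.
    have ex := enorm_gt0 x0; exists ((1 + 2 / enorm x) / 2).
      rewrite ltr_pdivlMr// mul1r {1}(_ : 2 = 1 + 1)// ltrD2l ltr_pdivlMr// mul1r. exact: x2.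
    rewrite /eball /= enormZ ger0_norm; last by rewrite divr_ge0// addr_ge0// divr_ge0// ltW.
    move: x2; rewrite /eball /=; move: (enorm x) ex => q q0 q2.
    by rewrite (_ : (1 + 2 / q) / 2 * q = (q + 2) / 2); [lra|field; rewrite gt_eqF].
  have k0 : 0 < k by exact: lt_trans k1. have [gamma [e [e0 Gg _ _ h]]] := ray _ kx.
  have tk : 0 < k^-1 < 1 by rewrite invr_gt0 k0 invf_lt1. have /andP[tk0 tk1] := tk.
  have ti : k^-1 \in `]- e, 1 + e[ by rewrite in_itv /=; itv_lra. have n1 : \forall t \near k^-1, gamma t = ppar P (t *: (k *: x)).
    have : k^-1 \in `]0, 1[ by rewrite in_itv. move=> /near_in_itvoo; apply: filterS => t; rewrite in_itv /= => /andP[t0 t1].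
    by rewrite h// !ltW.
  have Bt t : 0 <= t <= 1 -> eball 2 (t *: (k *: x)).
    move=> /andP[t0 t1]; move: kx; rewrite /eball /= [enorm (t *: _)]enormZ ger0_norm//.
    by apply: le_lt_trans; rewrite ler_piMl// enorm_ge0.
  have gP : pran P (gamma k^-1) by rewrite h ?(ltW tk0) ?(ltW tk1)//; apply/ppar_ran/Pd/Bt; rewrite (ltW tk0) (ltW tk1).
  have := geodesic_param Gg ti gP. have n2 : \forall t \near k^-1, (pchart P \o gamma) t = t *: (k *: x).
    have : k^-1 \in `]0, 1[ by rewrite in_itv. move=> /near_in_itvoo; apply: filterS2 n1 => t e1; rewrite in_itv /= => /andP[t0 t1].
    by rewrite /comp e1 pparK//; apply/Pd/Bt; rewrite (ltW t0) (ltW t1).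
  move=> /(geo_eq_near n2)[_ _].
  have -> : derive1 (fun t : R => t *: (k *: x)) = fun=> k *: x by apply/funext => t; have [_ ->] := derive1_ray (k *: x) t.
  rewrite derive1_cst add0r chrZ scalerA mulVf ?gt_eqF// scale1r => /eqP. by rewrite scaler_eq0 expf_eq0 /= gt_eqF//= => /eqP.
exists P; split => //; split => // x x2 u.
rewrite (@curvature_scale _ _ _ _ _ oB sP in0 uP x u x x x2) !inner_scale normrM gtr0_norm ?invr_gt0//.
have rad := inner_radial sG Gs Gp G0 Ggeo x2.
rewrite inner_scale in rad.
apply: le_trans (ler_wpM2l _ (curvature_bound u x K0 sK (Pd _ x2))) _; first by rewrite invr_ge0 ltW.
rewrite -rad le_eqVlt; apply/orP; left; apply/eqP.
by move: (inner _ u u) (inner _ x x) => p1 p2; field; rewrite gt_eqF.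
Qed.

End NormalCharts.

Local Opaque derivable derive derive1 partial.

(** * Length and distance *)

Section RealCurves.
Variable R : realType.

(** The list [s] holds the break points of piecewise C^1 curves; the interval is cut at them one
    after the other, and continuity joins the pieces. *)
Lemma mono_except (s : seq R) (f : R -> R) (a b : R) : a <= b ->
  (forall x, a <= x <= b -> {for x, continuous f}) ->
  (forall x, a < x < b -> x \notin s -> exists2 l, is_derive x 1 f l & 0 <= l) ->
  f a <= f b.
Proof.
elim: s a b => [|c s IH] a b ab cf df.
  have [->//|anb] := eqVneq a b. have dfl x : x \in `]a, b[ -> derivable f x 1 /\ 0 <= derive1 f x.
    rewrite in_itv /= => /df[]// l [h1 h2] h3; split; first exact: h1. by rewrite derive1E h2.
  apply: (@ger0_derive1_le_cc R f a b).
  - by move=> x /dfl[].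
  - by move=> x /dfl[].
  - by apply: continuous_in_subspaceT => x; rewrite inE /= in_itv; exact: cf.
  - by rewrite in_itv /= lexx ab.
  - by rewrite in_itv /= lexx ab.
  - exact: ab.
have [/andP[ac cb]|nc] := boolP (a < c < b); last first.
  apply: (IH a b ab cf) => x xab xs; apply: df => //. by rewrite inE negb_or xs andbT; apply: contraNN nc => /eqP <-.
apply: (@le_trans _ _ (f c)).
  apply: IH; first exact: ltW.
    by move=> x /andP[ax xc]; apply: cf; rewrite ax (le_trans xc (ltW cb)).
  move=> x /andP[ax xc] xs; apply: df; first by rewrite ax (lt_trans xc). by rewrite inE negb_or xs andbT lt_eqF.
apply: IH; first exact: ltW.
  by move=> x /andP[cx xb]; apply: cf; rewrite xb (le_trans (ltW ac) cx).
move=> x /andP[cx xb] xs; apply: df; first by rewrite xb (lt_trans ac).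
by rewrite inE negb_or xs andbT gt_eqF.
Qed.

(** Precomposition with [clamp] extends a function on [[0, 1]] to the whole line, so that two-sided
    continuity can be used at the end points. *)
Definition clamp (x : R) : R := Num.max 0 (Num.min x 1).

Lemma clamp01 x : 0 <= clamp x <= 1.
Proof. by rewrite /clamp le_max lexx /= ge_max ler01 ge_min lexx orbT. Qed.

Lemma clamp_id x : 0 <= x <= 1 -> clamp x = x.
Proof. by move=> /andP[x0 x1]; rewrite /clamp (min_idPl x1) (max_idPr x0). Qed.

Lemma continuous_clamp x : {for x, continuous clamp}.
Proof.
apply: (@continuous_max R R (fun=> 0) (fun x => Num.min x 1)); first exact: cst_continuous.
by apply: (@continuous_min R R (fun x => x) (fun=> 1)); [exact: cvg_id|exact: cst_continuous].
Qed.

Lemma near_clamp (T : topologicalType) (f : R -> T) :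
  (forall t, 0 <= t <= 1 -> forall V, nbhs (f t) V -> \forall s \near t, 0 <= s <= 1 -> V (f s)) ->
  continuous (f \o clamp).
Proof.
move=> H x V /(H _ (clamp01 x)) h.
have : nbhs x (clamp @^-1` [set s | 0 <= s <= 1 -> V (f s)]) by exact: continuous_clamp h.
by apply: filterS => y /=; apply; exact: clamp01.
Qed.

Lemma continuous_affine (a b t : R) : {for t, continuous (fun s : R => a + b * s)}.
Proof.
apply: (@continuousD _ R); first exact: cst_continuous.
by apply: (@continuousM R R); [exact: cst_continuous|exact: cvg_id].
Qed.

Lemma near_affine (Q : R -> Prop) (a b t : R) :
  (\forall s \near a + b * t, Q s) -> \forall s \near t, Q (a + b * s).
Proof. exact: continuous_affine. Qed.

Lemma half_lt1 : (2^-1 : R) < 1. Proof. lra. Qed.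
Lemma neg1D2 : -1 + 2 = 1 :> R. Proof. lra. Qed.

Lemma add_diff (l1 l0 a1 a0 b1 : R) : l1 - l0 = a1 - a0 -> l0 - 0 = b1 - 0 -> a0 = 0 -> l1 = b1 + a1.
Proof. lra. Qed.

Lemma half1 : 0 + 2 * 0 = 0 :> R. Proof. by rewrite mulr0 addr0. Qed.
Lemma half2 : 0 + 2 * 2^-1 = 1 :> R. Proof. by rewrite add0r mulfV. Qed.
Lemma half3 : -1 + 2 * 2^-1 = 0 :> R. Proof. by rewrite mulfV// addNr. Qed.
Lemma half4 : -1 + 2 * 1 = 1 :> R. Proof. by rewrite mulr1 neg1D2. Qed.
Lemma sg2 : Num.sg 2 = 1 :> R. Proof. by rewrite gtr0_sg. Qed.

Lemma half_itv (x : R) : 0 < x < 2^-1 -> 0 < 0 + 2 * x < 1.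
Proof. by move=> /andP[x0 x1]; itv_lra. Qed.

Lemma half_itv2 (x : R) : 2^-1 < x < 1 -> 0 < -1 + 2 * x < 1.
Proof. by move=> /andP[x0 x1]; itv_lra. Qed.

Lemma rev_itv (x : R) : 0 < x < 1 -> 0 < 1 + -1 * x < 1.
Proof. by move=> /andP[x0 x1]; itv_lra. Qed.

End RealCurves.

Section Curves.
Context R n (M : smoothManifold R n).
Implicit Types (P Q : param M) (gamma : R -> M).

Definition C1_at gamma t := {for t, continuous gamma} /\
  forall c, atlas c -> dom c (gamma t) ->
    derivable (fwd c \o gamma) t 1 /\ {for t, continuous (derive1 (fwd c \o gamma))}.

Lemma continuous_rowP (T : topologicalType) m (f : T -> 'rV[R]_m) x :
  (forall k, {for x, continuous (fun y => f y 0 k)}) -> {for x, continuous f}.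
Proof.
move=> cf; apply/cvgrPdist_le => e e0.
have : \forall y \near x, forall k, `|f x 0 k - f y 0 k| <= e.
  apply: (@filter_forall _ _ (fun k y => `|f x 0 k - f y 0 k| <= e) (nbhs x)) => k. by have /cvgrPdist_le/(_ e e0) := cf k.
apply: filterS => y h; apply: norm_row_le; first exact: ltW.
by move=> k; rewrite row_subE.
Qed.

Lemma continuous_curve_mul m (v : R -> 'rV[R]_n) (A : R -> 'M[R]_(n, m)) t :
  {for t, continuous v} -> (forall i k, {for t, continuous (fun s => A s i k)}) ->
  {for t, continuous (fun s => v s *m A s)}.
Proof.
move=> cv cA; apply: continuous_rowP => k.
have -> : (fun s => (v s *m A s) 0 k) = (fun s => \sum_j v s 0 j * A s j k) by apply/funext => s; rewrite mxE.
apply: continuous_sum => j _.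
by apply: (@continuousM R R); [exact: continuous_coord|exact: cA].
Qed.

Lemma smooth_jac_gen m (U : set 'rV[R]_n) (h : 'rV[R]_n -> 'rV[R]_m) : smooth_on U h -> smooth_mx U (jac h).
Proof.
move=> sh i k; rewrite (_ : (fun x => _) = partial i (fun y => h y 0 k)).
  exact/smooth_partial/sh.
by apply/funext => x; rewrite jacE.
Qed.

Lemma C1_push (U : set 'rV[R]_n) m (h : 'rV[R]_n -> 'rV[R]_m) (z : R -> 'rV[R]_n) (y : R -> 'rV[R]_m) t :
  open U -> smooth_on U h -> (\forall s \near t, derivable z s 1) ->
  {for t, continuous (derive1 z)} -> U (z t) -> (\forall s \near t, h (z s) = y s) ->
  [/\ derivable y t 1, {for t, continuous (derive1 y)} & derive1 y t = derive1 z t *m jac h (z t)].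
Proof.
move=> oU sh nd cz Uz ny; have dz := nbhs_singleton nd.
have nU : \forall s \near t, U (z s) by apply: (derivable_continuous dz); exact: open_nbhs_nbhs.
have H s : derivable z s 1 -> U (z s) -> (\forall u \near s, h (z u) = y u) ->
    derivable y s 1 /\ derive1 z s *m jac h (z s) = derive1 y s.
  move=> ds Us ys; have [d e] := derive1_comp_smooth oU sh ds Us.
  by have [d' e'] := derive1_near ys d; split; [exact: d'|rewrite -e' e].
have [dy ey] := H t dz Uz ny; split; [exact: dy| |by rewrite ey].
have e2 : \forall s \near t, derive1 z s *m jac h (z s) = derive1 y s by apply: filterS3 nd nU (near_join ny) => s d Us nys; have [] := H s d Us nys.
apply: (continuous_near e2); apply: (continuous_curve_mul cz) => i k.
have cj := smooth_continuous (smooth_jac_gen sh i k) Uz.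
exact: (@continuous_comp _ _ _ z (fun x => jac h x i k) t (derivable_continuous dz) cj).
Qed.

Lemma near_dom gamma t (A : set M) : open A -> {for t, continuous gamma} -> A (gamma t) ->
  \forall s \near t, A (gamma s).
Proof. by move=> oA ct At; apply: ct; exact: open_nbhs_nbhs. Qed.

Lemma C1_param gamma t P : (\forall s \near t, C1_at gamma s) -> pran P (gamma t) ->
  derivable (pchart P \o gamma) t 1 /\ {for t, continuous (derive1 (pchart P \o gamma))}.
Proof.
move=> nC Pt; have [ct Ct] := nbhs_singleton nC.
have [ac dc] := chart_atP (gamma t); set c := chart_at _ in ac dc.
pose C := cpar ac; pose x := fwd c \o gamma.
have nc := near_dom (@open_dom _ _ _ c) ct dc.
have [dx cdx] := Ct c ac dc.
have nx : \forall s \near t, derivable x s 1.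
  apply: filterS2 nC nc => s [_ Cs] ds; exact: (Cs c ac ds).1.
have Ux : trdom C P (x t) by split; [exact: fwd_cod|rewrite /= fwdK].
have [|d1 d2 _] := @C1_push _ _ (tr C P) x (pchart P \o gamma) t (@open_trdom _ _ _ C P) (@smooth_tr _ _ _ C P) nx cdx Ux.
  by apply: filterS nc => s ds; rewrite /tr /x /= fwdK.
by split.
Qed.

Lemma C1_of_param gamma (z : R -> 'rV[R]_n) t P : (\forall s \near t, derivable z s 1) ->
  {for t, continuous (derive1 z)} -> pdom P (z t) -> (\forall s \near t, ppar P (z s) = gamma s) ->
  C1_at gamma t.
Proof.
move=> nd cz Pz ng; have dz := nbhs_singleton nd; split.
  apply: (continuous_near ng). apply: (@continuous_comp _ _ _ z (ppar P)); first exact: derivable_continuous.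
  exact: ppar_continuous.
move=> c ac dc; pose C := cpar ac.
have Uz : trdom P C (z t) by split => //; rewrite /= cpar_ran (nbhs_singleton ng).
have [|d1 d2 _] := @C1_push _ _ (tr P C) z (fwd c \o gamma) t (@open_trdom _ _ _ P C) (@smooth_tr _ _ _ P C) nd cz Uz.
  by apply: filterS ng => s es; rewrite /tr /= es.
by split.
Qed.

Lemma C1_at_near gamma gamma' t : (\forall s \near t, gamma s = gamma' s) -> C1_at gamma t -> C1_at gamma' t.
Proof.
move=> e [ct Ct]; split; first exact: continuous_near ct.
move=> c ac; rewrite -(nbhs_singleton e) => dc; have [d1 d2] := Ct c ac dc.
have e' : \forall s \near t, (fwd c \o gamma) s = (fwd c \o gamma') s by apply: filterS e => s /= ->.
split; first by have [] := derive1_near e' d1.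
exact: (continuous_near (derive1_near2 e')).
Qed.

Lemma C1_at_affine gamma (a b t : R) : (\forall s \near a + b * t, C1_at gamma s) ->
  C1_at (fun s => gamma (a + b * s)) t.
Proof.
move=> nC; have [ct Ct] := nbhs_singleton nC.
have ca s := @continuous_affine R a b s.
split; first by apply: (@continuous_comp _ _ _ (fun s : R => a + b * s) gamma).
move=> c ac dc; have [d1 d2] := Ct c ac dc.
have [d e] := @derive1_affine _ _ (fwd c \o gamma) a b t d1; split; first exact: d.
have n1 : \forall s \near t, derivable (fwd c \o gamma) (a + b * s) 1.
  have : \forall s \near a + b * t, derivable (fwd c \o gamma) s 1.
    apply: filterS2 nC (near_dom (@open_dom _ _ _ c) ct dc) => s [_ Cs] ds; exact: (Cs c ac ds).1.
  exact: near_affine.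
have n2 : \forall s \near t, b *: derive1 (fwd c \o gamma) (a + b * s) = derive1 (fwd c \o (fun s => gamma (a + b * s))) s.
  by apply: filterS n1 => s ds; have [_ <-] := @derive1_affine _ _ (fwd c \o gamma) a b s ds.
apply: (continuous_near n2).
have cd : {for t, continuous (fun s => derive1 (fwd c \o gamma) (a + b * s))}.
  exact: (@continuous_comp _ _ _ (fun s : R => a + b * s) (derive1 (fwd c \o gamma)) t (ca t) d2).
apply: continuous_rowP => k.
have -> : (fun s => (b *: derive1 (fwd c \o gamma) (a + b * s)) 0 k) = (fun s => b * derive1 (fwd c \o gamma) (a + b * s) 0 k).
  by apply/funext => s; rewrite mxE.
by apply: (@continuousM R R); [exact: cst_continuous|exact: continuous_coord].
Qed.

Lemma C1_curve_near (a b : R) gamma t : C1_curve a b gamma -> t \in `]a, b[ -> \forall s \near t, C1_at gamma s.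
Proof. by move=> C /near_itvoo; apply: filterS => s; exact: C. Qed.

End Curves.

Section Speed.
Context R n (M : riemannianManifold R n).
Implicit Types (P Q : param M) (gamma : R -> M).

Lemma speedE gamma t P : {for t, continuous gamma} -> pran P (gamma t) ->
  derivable (pchart P \o gamma) t 1 ->
  speed gamma t = Num.sqrt (inner (pmet P (pchart P (gamma t)))
    (derive1 (pchart P \o gamma) t) (derive1 (pchart P \o gamma) t)).
Proof.
move=> ct Pt dz; rewrite /speed; have [ac dc] := chart_atP (gamma t); set c := chart_at _ in ac dc *.
pose C := cpar ac; apply: (congr1 Num.sqrt).
have Uz : trdom P C (pchart P (gamma t)) by split; [exact: pchart_dom|rewrite /= cpar_ran pchartK].
have [d e] := derive1_comp_smooth (@open_trdom _ _ _ P C) (@smooth_tr _ _ _ P C) dz Uz.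
have n1 : \forall s \near t, (tr P C \o (pchart P \o gamma)) s = (fwd c \o gamma) s.
  by apply: filterS (near_dom (@open_pran _ _ _ P) ct Pt) => s Ps; rewrite /tr /= pchartK.
have [_ <-] := derive1_near n1 d; rewrite (inner_pmet_tr _ _ Uz).
have -> : tr P C (pchart P (gamma t)) = fwd c (gamma t) by rewrite /tr /= pchartK.
rewrite pmet_chart; last exact: fwd_cod.
by move: e; move: (derive1 (tr P C \o _) t) => w ->.
Qed.

Lemma speed_near gamma gamma' t : (\forall s \near t, gamma s = gamma' s) -> speed gamma t = speed gamma' t.
Proof.
move=> e; rewrite /speed (nbhs_singleton e); set c := chart_at _.
have -> // : derive1 (fwd c \o gamma) t = derive1 (fwd c \o gamma') t.
rewrite !derive1E; apply: near_eq_derive.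
by apply: filterS e => s /= ->.
Qed.

Lemma speed_ge0 gamma t : 0 <= speed gamma t. Proof. exact: sqrtr_ge0. Qed.

Lemma speed_continuous gamma t : (\forall s \near t, C1_at gamma s) -> {for t, continuous (speed gamma)}.
Proof.
move=> nC; have [ct Ct] := nbhs_singleton nC.
have [ac dc] := chart_atP (gamma t); set c := chart_at _ in ac dc.
pose P := cpar ac; have Pt : pran P (gamma t) by rewrite cpar_ran.
have nP := near_dom (@open_pran _ _ _ P) ct Pt.
pose z := pchart P \o gamma.
have n1 : \forall s \near t, Num.sqrt (dot (derive1 z s *m pmet P (z s)) (derive1 z s)) = speed gamma s.
  apply: filterS3 nP nC (near_join nC) => s Ps [cs _] nCs; have [dz _] := C1_param nCs Ps. by rewrite (speedE cs Ps dz) innerE.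
have [dz cz] := C1_param nC Pt.
apply: (continuous_near n1).
apply: (@continuous_comp _ _ _ (fun s => dot (derive1 z s *m pmet P (z s)) (derive1 z s)) Num.sqrt); last exact: sqrt_continuous.
have cm i k : {for t, continuous (fun s => pmet P (z s) i k)}.
  have cj := smooth_continuous (@pmet_smooth _ _ _ P i k) (pchart_dom Pt).
  exact: (@continuous_comp _ _ _ z (fun x => pmet P x i k) t (derivable_continuous dz) cj).
exact: (continuous_dot (continuous_curve_mul cz cm) cz).
Qed.

Lemma speed_affine gamma (a b t : R) : (\forall s \near a + b * t, C1_at gamma s) ->
  speed (fun s => gamma (a + b * s)) t = `|b| * speed gamma (a + b * t).
Proof.
move=> nC; have [ct Ct] := nbhs_singleton nC; rewrite /speed.
have [ac dc] := chart_atP (gamma (a + b * t)); set c := chart_at _ in ac dc *.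
have [d1 _] := Ct c ac dc.
have [_ e] := @derive1_affine _ _ (fwd c \o gamma) a b t d1.
have -> : derive1 (fwd c \o (fun s => gamma (a + b * s))) t = b *: derive1 (fwd c \o gamma) (a + b * t) by exact: e.
by rewrite innerZl innerZr mulrA -expr2 sqrtrM ?sqr_ge0// sqrtr_sqr.
Qed.

End Speed.

Section Arcs.
Context R n (M : riemannianManifold R n).
Implicit Types (P Q : param M) (gamma : R -> M).
Local Notation mu := (@lebesgue_measure R).

Lemma piece_of (k : nat) (t : nat -> R) s : t 0%N <= s <= t k -> (0 < k)%N ->
  exists2 i, (i < k)%N & t i <= s <= t i.+1.
Proof.
elim: k => // k IH /andP[s0 sk] _.
have [h|h] := leP s (t k); last by exists k; rewrite // (ltW h).
have [k0|k0] := posnP k; first by exists 0%N; rewrite // s0 -k0.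
by have [|//|i ik si] := IH; [rewrite s0|exists i => //; exact: ltnW].
Qed.

Definition pieces gamma (k : nat) (t : nat -> R) := [/\ t 0%N = 0, t k = 1 &
  forall i, (i < k)%N -> t i < t i.+1 /\ exists (eta : R -> M) (e : R),
    [/\ 0 < e, C1_curve (t i - e) (t i.+1 + e) eta & {in `[t i, t i.+1], gamma =1 eta}]].

Lemma pieces_mono gamma k t i : pieces gamma k t -> (i <= k)%N -> t 0%N <= t i <= t k.
Proof.
move=> [_ _ H] ik.
have inc j l : (j <= l)%N -> (l <= k)%N -> t j <= t l.
  elim: l => [|l IH]; first by rewrite leqn0 => /eqP ->. rewrite leq_eqVlt => /orP[/eqP -> //|jl] lk.
  by apply: le_trans (IH _ (ltnW lk)) _ => //; have [/ltW] := H l lk.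
by rewrite !inc.
Qed.

Lemma piecewise_continuous gamma : piecewise_C1 gamma -> continuous (gamma \o @clamp R).
Proof.
move=> [k [t [t0 t1 H]]]; have pc : pieces gamma k t by [].
apply: near_clamp => x x01 V xV.
have k0 : (0 < k)%N by case: k t1 {H pc} => // t1; move: (oner_neq0 R); rewrite -t1 t0 eqxx.
have : \forall s \near x, forall i : 'I_k, t i <= s <= t i.+1 -> V (gamma s).
  apply: (@filter_forall _ _ (fun (i : 'I_k) s => t i <= s <= t i.+1 -> V (gamma s)) (nbhs x)) => i.
  have [ti [eta [e [e0 Ce He]]]] := H i (ltn_ord i). have [xi|/negP xi] := boolP (t i <= x <= t i.+1).
    have xe : x \in `]t i - e, t i.+1 + e[ by rewrite in_itv /=; case/andP: xi => h1 h2; itv_lra. have [ce _] := Ce x xe.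
    have exV : nbhs (eta x) V by rewrite -He. have h : nbhs x (eta @^-1` V) := ce _ exV. by apply: filterS h => s Vs si; rewrite He.
  have [h|h] := ltP x (t i).
    have : \forall s \near x, s < t i by exact: lt_nbhsl. by apply: filterS => s si /andP[/(lt_le_trans si)]; rewrite ltxx.
  have h' : t i.+1 < x by rewrite ltNge; apply/negP => h'; apply: xi; rewrite h h'.
  have : \forall s \near x, t i.+1 < s by exact: lt_nbhsr. by apply: filterS => s si /andP[_ /(lt_le_trans si)]; rewrite ltxx.
apply: filterS => s Hs s01.
have [|i ik si] := @piece_of k t s _ k0; first by rewrite t0 t1.
exact: (Hs (Ordinal ik)).
Qed.

Lemma piece_C1 gamma k t x : pieces gamma k t -> 0 < x < 1 -> (forall i, (i <= k)%N -> x != t i) ->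
  \forall s \near x, C1_at gamma s.
Proof.
move=> pc /andP[x0 x1] xt; have [t0 t1 H] := pc.
have k0 : (0 < k)%N by case: k t1 {H pc xt} => // t1; move: (oner_neq0 R); rewrite -t1 t0 eqxx.
have [|i ik /andP[ti ti']] := @piece_of k t x _ k0; first by rewrite t0 t1 !ltW.
have [tt [eta [e [e0 Ce He]]]] := H i ik.
have xi : x \in `]t i, t i.+1[ by rewrite in_itv /= lt_neqAle eq_sym xt ?(ltnW ik)// ti lt_neqAle xt// ti'.
apply: filterS (near_itvoo xi) => s si.
have ee : \forall u \near s, eta u = gamma u by apply: filterS (near_itvoo si) => u ui; rewrite He//; exact: subset_itv_oo_cc ui.
apply: (C1_at_near ee); apply: Ce; move: si; rewrite !in_itv /= => /andP[h1 h2].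
by itv_lra.
Qed.

Lemma bounded_itv (g : R -> R) (a b : R) : a <= b ->
  (forall x, a <= x <= b -> {for x, continuous g}) -> exists B, forall x, a <= x <= b -> g x <= B.
Proof.
move=> ab cg; have [|c _ hc] := @EVT_max R g a b ab.
  by apply: continuous_in_subspaceT => x; rewrite inE /= in_itv; exact: cg.
by exists (g c) => x xab; apply: hc; rewrite in_itv.
Qed.

(** Inside each piece the speed is that of a C^1 curve, continuous up to the ends. At the break
    points its value is arbitrary, hence the single points are split off for measurability and enter
    the bound separately. *)
Lemma speed_integrable gamma : piecewise_C1 gamma -> mu.-integrable `[0, 1] (EFin \o speed gamma).
Proof.
move=> [k [t [t0 t1 H]]]; have pc : pieces gamma k t by [].
have inv i : (i <= k)%N -> measurable_fun `[0, t i] (speed gamma) /\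
    exists B, forall x, 0 <= x <= t i -> speed gamma x <= B.
  elim: i => [_|i IH ik].
    rewrite t0 set_itv1; split; first exact: measurable_fun_set1.
    by exists (speed gamma 0) => x /andP[h1 h2]; rewrite (_ : x = 0)//; apply/eqP; rewrite eq_le h1 h2.
  have [mi [B HB]] := IH (ltnW ik). have [tt [eta [e [e0 Ce He]]]] := H i ik.
  have ti0 : 0 <= t i by have /andP[] := pieces_mono pc (ltnW ik); rewrite t0.
  have se x : t i < x < t i.+1 -> speed gamma x = speed eta x.
    move=> xi; apply: speed_near; have xi' : x \in `]t i, t i.+1[ by rewrite in_itv.
    by apply: filterS (near_itvoo xi') => u ui; rewrite He//; exact: subset_itv_oo_cc ui.
  have ce x : t i <= x <= t i.+1 -> {for x, continuous (speed eta)}.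
    move=> xi; apply: speed_continuous; apply: (C1_curve_near Ce). by rewrite in_itv /=; case/andP: xi => h1 h2; itv_lra.
  split.
    have -> : `[0, t i.+1]%classic = (`[0, t i] `|` `]t i, t i.+1[ `|` [set t i.+1])%classic :> set R.
      apply/seteqP; split => x /=; rewrite !in_itv /=.
        move=> /andP[x0 xi]; have [h|h] := leP x (t i); first by left; left; rewrite x0.
        by move: xi; rewrite le_eqVlt => /orP[/eqP ->|xi]; [right|left; right].
      move=> [[/andP[h1 h2]|/andP[h1 h2]]|->]; itv_lra.
    apply/measurable_funU => //; first exact: measurableU. split; last exact: measurable_fun_set1.
    apply/measurable_funU => //; split => //. apply: (@eq_measurable_fun _ _ _ _ _ (speed eta)).
      by move=> x; rewrite inE /= in_itv /= => /se ->.
    apply: measurable_realfun.open_continuous_measurable_fun; first exact: interval_open.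
    move=> x; rewrite inE /= in_itv /= => /andP[h1 h2]. by apply: ce; rewrite !ltW.
  have [B' HB'] := bounded_itv (ltW tt) ce. exists (Num.max (Num.max B B') (speed gamma (t i.+1))) => x /andP[x0 xi].
  have [h|h] := leP x (t i); first by rewrite !le_max HB// x0.
  move: xi; rewrite le_eqVlt => /orP[/eqP ->|xi]; first by rewrite le_max lexx orbT. by rewrite !le_max se ?h// HB' ?orbT// !ltW.
have [mk [B HB]] := inv k (leqnn k); rewrite t1 in mk HB.
apply: measurable_bounded_integrable => //=.
  by rewrite /= lebesgue_measure_itv /= lte_fin ltr01 -EFinB ltry.
exists B; split; first exact: num_real.
move=> C BC x /=; rewrite in_itv /= => x01.
by rewrite ger0_norm ?speed_ge0//; apply: le_trans (HB _ x01) (ltW BC).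
Qed.

(** Arc length as a primitive of the speed. Every later statement about length compares derivatives
    off the list [s] by [mono_except] and does not touch the integral again. *)
Lemma arc_ex gamma : piecewise_C1 gamma -> exists (L : R -> R) (s : seq R),
  [/\ continuous L, L 0 = 0, L 1 = curve_length gamma &
   forall x, 0 < x < 1 -> x \notin s -> (\forall u \near x, C1_at gamma u) /\ is_derive x 1 L (speed gamma x)].
Proof.
move=> pw; have ig := speed_integrable pw; have [k [t [t0 t1 H]]] := pw.
have pc : pieces gamma k t by [].
pose I x := parameterized_integral mu 0 x (speed gamma).
exists (I \o @clamp R), [seq t i | i <- iota 0 k.+1]; split.
- apply: near_clamp => x x01 V xV.
  have /(_ x) := parameterized_integral_continuous ler01 ig. move=> /(_ V xV) h.
  have : nbhs_subspace (A := [set` `[(0 : R), 1]]) x (I @^-1` V) by exact: h. rewrite -nbhs_subspace_in; last by rewrite /= in_itv.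
  by rewrite /within /=; apply: filterS => s h' s01; apply: h'; rewrite /= in_itv.
- by rewrite /= clamp_id ?lexx ?ler01// /I /parameterized_integral set_itv1 Rintegral_set1.
- by rewrite /= clamp_id ?lexx ?ler01.
move=> x x01 xs.
have nC : \forall u \near x, C1_at gamma u.
  apply: (piece_C1 pc x01) => i ik; apply: contraNneq xs => ->. by apply: map_f; rewrite mem_iota.
split=> //; case/andP: (x01) => x0 x1.
have [d e] := continuous_FTC1_closed x1 ig x0 (speed_continuous nC).
have nI : \forall u \near x, I u = (I \o @clamp R) u.
  have xi : x \in `]0, 1[ by rewrite in_itv /= x0. apply: filterS (near_itvoo xi) => u; rewrite in_itv /= => /andP[u0 u1].
  by rewrite clamp_id// !ltW.
have dI : is_derive x 1 I (speed gamma x) by split; [exact: d|rewrite -derive1E].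
exact: (near_eq_is_derive nI dI).
Qed.

End Arcs.

Section RDist.
Context R n (M : riemannianManifold R n).
Implicit Types (P Q : param M) (gamma : R -> M).

Lemma near01 (x : R) : 0 < x < 1 -> \forall s \near x, 0 < s < 1.
Proof.
move=> x01; have : x \in `]0, 1[ by rewrite in_itv.
by move=> /near_itvoo; apply: filterS => s; rewrite in_itv.
Qed.

(** The mechanism for bounding lengths from below: a function that grows along the curve at most at
    its speed. It is applied to the truncated distance [radial]. *)
Lemma length_lipschitz gamma (h : M -> R) : piecewise_C1 gamma -> continuous h ->
  (forall t : R, 0 < t < 1 -> (\forall s \near t, C1_at gamma s) ->
     exists2 l, is_derive t 1 (h \o gamma) l & `|l| <= speed gamma t) ->
  h (gamma 1) - h (gamma 0) <= curve_length gamma.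
Proof.
move=> pw ch H; have [L [s [cL L0 L1 HL]]] := arc_ex pw.
have cg := piecewise_continuous pw.
pose f x := L x - h (gamma (clamp x)).
have : f 0 <= f 1.
  apply: (@mono_except R s f 0 1 ler01) => x x01.
    apply: (@continuousB R R R L (fun x => h (gamma (clamp x)))); first exact: cL.
    by apply: (@continuous_comp _ _ _ (gamma \o @clamp R) h); [exact: cg|exact: ch].
  move=> xs; have [nC dL] := HL x x01 xs; have [l dl hl] := H x x01 nC.
  exists (speed gamma x - l); last by rewrite subr_ge0; apply: le_trans hl; exact: ler_norm.
  have dl' : is_derive x 1 (fun x => h (gamma (clamp x))) l.
    apply: near_eq_is_derive dl; apply: filterS (near01 x01) => u /andP[u0 u1]. by rewrite /= clamp_id// !ltW.
  exact: is_deriveB.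
rewrite /f L0 L1 !clamp_id ?lexx ?ler01// sub0r => h1; rewrite -subr_ge0; move: h1; rewrite -subr_ge0.
by rewrite opprK opprB addrA addrAC.
Qed.

Lemma length_compare m (M' : riemannianManifold R m) gamma (gamma' : R -> M') (k : R) :
  piecewise_C1 gamma -> piecewise_C1 gamma' ->
  (forall t : R, 0 < t < 1 -> (\forall s \near t, C1_at gamma s) -> (\forall s \near t, C1_at gamma' s) ->
     speed gamma' t <= k * speed gamma t) ->
  curve_length gamma' <= k * curve_length gamma.
Proof.
move=> pw pw' H; have [L [s [cL L0 L1 HL]]] := arc_ex pw; have [L' [s' [cL' L0' L1' HL']]] := arc_ex pw'.
pose f x := k * L x - L' x.
have : f 0 <= f 1.
  apply: (@mono_except R (s ++ s') f 0 1 ler01) => x x01.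
    apply: (@continuousB R R R (fun x => k * L x) L'); last exact: cL'.
    by apply: (@continuousM R R); [exact: cst_continuous|exact: cL].
  rewrite mem_cat negb_or => /andP[xs xs']. have [nC dL] := HL x x01 xs; have [nC' dL'] := HL' x x01 xs'.
  exists (k * speed gamma x - speed gamma' x); last by rewrite subr_ge0 H.
  have dk : is_derive x 1 (fun x => k * L x) (k * speed gamma x).
    have -> : (fun x => k * L x) = k \*: L by apply/funext. exact: is_deriveZ.
  exact: is_deriveB.
by rewrite /f L0 L1 L0' L1' mulr0 subr0 subr_ge0.
Qed.

(* Comparison of a primitive of the speed with that of a reparametrized piece. *)
Lemma arc_affine gamma gamma1 (L L1 : R -> R) (s s1 : seq R) (u0 u1 a b : R) :
  u0 <= u1 -> 0 <= u0 -> u1 <= 1 -> b != 0 ->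
  continuous L -> continuous L1 ->
  (forall x, 0 < x < 1 -> x \notin s -> (\forall u \near x, C1_at gamma u) /\ is_derive x 1 L (speed gamma x)) ->
  (forall x, 0 < x < 1 -> x \notin s1 -> (\forall u \near x, C1_at gamma1 u) /\ is_derive x 1 L1 (speed gamma1 x)) ->
  (forall x, u0 < x < u1 -> 0 < a + b * x < 1) ->
  (forall x, u0 < x < u1 -> gamma x = gamma1 (a + b * x)) ->
  L u1 - L u0 = Num.sg b * (L1 (a + b * u1) - L1 (a + b * u0)).
Proof.
move=> u01 u00 u11 b0 cL cL1 H H1 ab e.
pose D x := L x - Num.sg b * L1 (a + b * x).
have cD x : {for x, continuous D}.
  apply: (@continuousB R R R L); first exact: cL. apply: (@continuousM R R); first exact: cst_continuous.
  apply: (@continuous_comp R R R (fun x : R => a + b * x) L1); [exact: continuous_affine|exact: cL1].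
have dD x : u0 < x < u1 -> x \notin s ++ [seq (y - a) / b | y <- s1] -> is_derive x 1 D 0.
  move=> xu; rewrite mem_cat negb_or => /andP[xs xs1].
  have x01 : 0 < x < 1 by case/andP: xu => h1 h2; rewrite (le_lt_trans u00 h1) (lt_le_trans h2 u11). have [nC dL] := H x x01 xs.
  have [|nC1 dL1] := H1 (a + b * x) (ab x xu).
    apply: contra xs1 => h; apply/mapP; exists (a + b * x) => //. by rewrite [a + _]addrC addrK mulrC mulKf.
  have se : speed gamma x = `|b| * speed gamma1 (a + b * x).
    rewrite -(speed_affine nC1); apply: speed_near. have xi : x \in `]u0, u1[ by rewrite in_itv.
    by apply: filterS (near_itvoo xi) => y; rewrite in_itv /=; exact: e.
  have da : is_derive x (1 : R) (fun x : R => a + b * x) b by apply: is_derive_eq; rewrite /GRing.scale /= !(mulr1, add0r, mulr0, addr0, mul1r).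
  have dc : is_derive x 1 (fun x => L1 (a + b * x)) (speed gamma1 (a + b * x) * b).
    exact: (@is_derive1_comp R L1 (fun x : R => a + b * x) x _ _ dL1 da).
  have dk : is_derive x 1 (fun x => Num.sg b * L1 (a + b * x)) (Num.sg b * (speed gamma1 (a + b * x) * b)).
    have -> : (fun x => Num.sg b * L1 (a + b * x)) = Num.sg b \*: (fun x => L1 (a + b * x)) by apply/funext. exact: is_deriveZ.
  have := is_deriveB dL dk; rewrite se normrEsg. by rewrite (_ : Num.sg b * b * _ - _ = 0)//; ring.
have h1 : D u0 <= D u1.
  apply: (@mono_except R _ D u0 u1 u01) => x xu; first exact: cD. by move=> /(dD x xu); exists 0.
have h2 : - D u0 <= - D u1.
  apply: (@mono_except R _ (fun x => - D x) u0 u1 u01) => x xu; first exact: (@continuousN R R R D x (cD x)).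
  by move=> /(dD x xu) d; exists 0 => //; rewrite -oppr0; exact: is_deriveN.
have : D u0 = D u1 by apply/eqP; rewrite eq_le h1 -lerN2 h2.
by rewrite /D; move: (L _) (L _) (L1 _) (L1 _) => p q p' q' h; rewrite mulrBr; lra.
Qed.

Lemma C1_curve_affine gamma (a b a' b' u v : R) : C1_curve a b gamma ->
  (forall s, s \in `]a', b'[ -> u + v * s \in `]a, b[) ->
  C1_curve a' b' (fun s => gamma (u + v * s)).
Proof.
by move=> C sub t tab; apply: C1_at_affine; apply: (C1_curve_near C); exact: sub.
Qed.

Lemma piecewise_rev gamma : piecewise_C1 gamma -> piecewise_C1 (fun s => gamma (1 + -1 * s)).
Proof.
move=> [k [t [t0 t1 H]]]; exists k, (fun i => 1 - t (k - i)%N).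
split; rewrite ?subn0 ?subnn ?t0 ?t1 ?subrr ?subr0// => i ik.
have ki : (k - i)%N = (k - i.+1).+1 by rewrite subnS prednK// subn_gt0.
have [|tt [eta [e [e0 C He]]]] := H (k - i.+1)%N; first by rewrite ltn_subrL /= (leq_ltn_trans _ ik).
rewrite ki; split; first by rewrite ltrD2l ltrN2.
exists (fun s => eta (1 + -1 * s)), e; split => //.
  by apply: (C1_curve_affine C) => s; rewrite !in_itv /= => /andP[h1 h2]; itv_lra.
by move=> s; rewrite in_itv /= => /andP[h1 h2]; rewrite He// in_itv /=; itv_lra.
Qed.

Definition concat gamma1 gamma2 (s : R) : M := if s <= 2^-1 then gamma1 (0 + 2 * s) else gamma2 (-1 + 2 * s).

Lemma piecewise_concat gamma1 gamma2 : piecewise_C1 gamma1 -> piecewise_C1 gamma2 ->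
  gamma1 1 = gamma2 0 -> piecewise_C1 (concat gamma1 gamma2).
Proof.
move=> [k1 [t1 [t10 t11 H1]]] [k2 [t2 [t20 t21 H2]]] e12.
exists (k1 + k2)%N, (fun i => if (i <= k1)%N then t1 i / 2 else (1 + t2 (i - k1)%N) / 2).
split; first by rewrite leq0n t10 mul0r.
  case: ifP => [h|_]; last by rewrite addKn t21; lra. have k20 : k2 = 0%N by apply/eqP; rewrite -leqn0 -(leq_add2l k1) addn0.
  by move: (oner_neq0 R); rewrite -t21 k20 t20 eqxx.
have pc1 : pieces gamma1 k1 t1 by []; have pc2 : pieces gamma2 k2 t2 by [].
move=> i ik; have [ik1|ik1] := ltnP i k1.
  rewrite (ltnW ik1); have [tt [eta [e [e0 C He]]]] := H1 i ik1. have /andP[_ ti1] := pieces_mono pc1 ik1; rewrite t11 in ti1.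
  split; first by rewrite ltr_pM2r. exists (fun s => eta (0 + 2 * s)), (e / 2); split; first by rewrite divr_gt0.
    by apply: (C1_curve_affine C) => s; rewrite !in_itv /= => /andP[h1 h2]; itv_lra.
  move=> s; rewrite in_itv /= => /andP[h1 h2]; rewrite /concat. have -> : s <= 2^-1 by lra. by rewrite He// in_itv /=; itv_lra.
have jk : (i - k1 < k2)%N by rewrite ltn_subLR.
have [tt [eta [e [e0 C He]]]] := H2 _ jk.
have -> : (if (i <= k1)%N then t1 i / 2 else (1 + t2 (i - k1)%N) / 2) = (1 + t2 (i - k1)%N) / 2.
  by case: ifP => // h; have -> : i = k1 by [apply/eqP; rewrite eqn_leq h]; rewrite t11 subnn t20 addr0.
rewrite subSn//.
have /andP[ti0 _] := pieces_mono pc2 (ltnW jk); rewrite t20 in ti0.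
split; first by rewrite ltr_pM2r// ltrD2l.
exists (fun s => eta (-1 + 2 * s)), (e / 2); split; first by rewrite divr_gt0.
  by apply: (C1_curve_affine C) => s; rewrite !in_itv /= => /andP[h1 h2]; itv_lra.
move=> s; rewrite in_itv /= => /andP[h1 h2]; rewrite /concat -He; last first.
  by rewrite in_itv /=; itv_lra.
case: ifP => // h; have -> : s = 2^-1 by apply/eqP; rewrite eq_le h /=; lra.
by rewrite add0r mulfV// addNr.
Qed.

Definition joins (p q : M) gamma := [/\ piecewise_C1 gamma, gamma 0 = p & gamma 1 = q].

Lemma joins_rev p q gamma : joins p q gamma -> exists2 gamma', joins q p gamma' & curve_length gamma' = curve_length gamma.
Proof.
move=> [pw g0 g1]; exists (fun s => gamma (1 + -1 * s)).
  by split; [exact: piecewise_rev|rewrite mulr0 addr0|rewrite mulr1 subrr].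
have [L [s [cL L0 L1 HL]]] := arc_ex pw.
have [L' [s' [cL' L0' L1' HL']]] := arc_ex (piecewise_rev pw).
have n1 : (-1 : R) != 0 by rewrite oppr_eq0 oner_eq0.
have := @arc_affine (fun s => gamma (1 + -1 * s)) gamma L' L s' s 0 1 1 (-1) ler01 (lexx 0) (lexx 1) n1 cL' cL HL' HL (@rev_itv R) (fun _ _ => erefl).
by rewrite mulr0 addr0 mulr1 subrr L0 L1 L0' L1' sgrN sgr1 !subr0 sub0r mulN1r opprK.
Qed.

Lemma joins_concat p q r gamma1 gamma2 : joins p q gamma1 -> joins q r gamma2 ->
  exists2 gamma, joins p r gamma & curve_length gamma = curve_length gamma1 + curve_length gamma2.
Proof.
move=> [pw1 g10 g11] [pw2 g20 g21].
have e12 : gamma1 1 = gamma2 0 by rewrite g11.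
have pw := piecewise_concat pw1 pw2 e12.
exists (concat gamma1 gamma2).
  split=> //; rewrite /concat ?invr_ge0 ?ler0n ?mulr0 ?addr0//. by rewrite leNgt half_lt1 mulr1 neg1D2.
have [L1 [s1 [c1 L10 L11 H1]]] := arc_ex pw1; have [L2 [s2 [c2 L20 L21 H2]]] := arc_ex pw2.
have [L [s [cL L_0 L_1 H]]] := arc_ex pw.
have t0 : (2 : R) != 0 by [].
have h0 : (0 : R) <= 2^-1 by rewrite invr_ge0.
have h1 : (2^-1 : R) <= 1 by exact: ltW (@half_lt1 R).
have E1 x : 0 < x < 2^-1 -> concat gamma1 gamma2 x = gamma1 (0 + 2 * x) by move=> /andP[_ x1]; rewrite /concat ltW.
have E2 x : 2^-1 < x < 1 -> concat gamma1 gamma2 x = gamma2 (-1 + 2 * x) by move=> /andP[x0 _]; rewrite /concat leNgt x0.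
have := @arc_affine (concat gamma1 gamma2) gamma1 L L1 s s1 0 2^-1 0 2 h0 (lexx 0) h1 t0 cL c1 H H1 (@half_itv R) E1.
have := @arc_affine (concat gamma1 gamma2) gamma2 L L2 s s2 2^-1 1 (-1) 2 h1 h0 (lexx 1) t0 cL c2 H H2 (@half_itv2 R) E2.
rewrite half1 half2 half3 half4 sg2 L_0 L10 !mul1r.
by rewrite -L_1 -L11 -L21 => h1' h2'; exact: add_diff h1' h2' L20.
Qed.

Lemma curve_length_ge0 gamma : 0 <= curve_length gamma.
Proof. by apply: Rintegral_ge0 => x _; exact: speed_ge0. Qed.

Lemma rdist_le p q gamma : joins p q gamma -> rdist p q <= curve_length gamma.
Proof.
move=> [pw g0 g1]; apply: ge_inf; last by exists gamma.
by exists 0 => _ [g [_ _ _ <-]]; exact: curve_length_ge0.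
Qed.

Lemma le_rdist p q a gamma : joins p q gamma -> (forall gamma', joins p q gamma' -> a <= curve_length gamma') ->
  a <= rdist p q.
Proof.
move=> [pw g0 g1] H; apply: lb_le_inf; first by exists (curve_length gamma), gamma.
by move=> _ [g [h0 h1 h2 <-]]; apply: H.
Qed.

Lemma rdist_ge0 (p q : M) : 0 <= rdist p q.
Proof.
rewrite /rdist; set S := [set l | _]; have [->|/set0P[l Sl]] := eqVneq S set0; first by rewrite inf0.
by apply: lb_le_inf; [exists l|move=> _ [g [_ _ _ <-]]; exact: curve_length_ge0].
Qed.

End RDist.

Local Transparent derivable derive derive1 partial.

Section Midpoint.
Variable R : realType.
Implicit Types m e x : R.
Lemma mid_lt2 m : m < 2 -> (m + 2) / 2 < 2. Proof. lra. Qed.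
Lemma mid_ge1 m : 0 <= m -> 1 <= (m + 2) / 2. Proof. lra. Qed.
Lemma mid_ge m : m <= 2 -> m <= (m + 2) / 2. Proof. lra. Qed.
Lemma mid_gt m : m < 2 -> m < (m + 2) / 2. Proof. lra. Qed.
Lemma half_sub x e : 1 <= x -> e <= 2^-1 -> e <= x - e. Proof. lra. Qed.
Lemma sub_half_ge m x e : m <= x -> 0 < e -> m - e <= x - e / 2. Proof. lra. Qed.
End Midpoint.

Section Cutoff.
Variable R : realType.

Definition sqpos (x : R) := Num.max 0 x ^+ 2.

Lemma sqpos_le x : 0 <= sqpos x <= x ^+ 2.
Proof.
rewrite /sqpos sqr_ge0 /=; have [x0|x0] := leP 0 x; first by rewrite lexx.
by rewrite expr0n sqr_ge0.
Qed.

Lemma is_derive_sqpos (x : R) : is_derive x 1 sqpos (2 * Num.max 0 x).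
Proof.
have d2 : is_derive x 1 (fun y : R => y ^+ 2) (2 * x) by apply: is_derive_eq; rewrite /GRing.scale /= mulr1 mulr_natl.
have [x0|x0|x0] := ltgtP x 0.
- have e : \forall y \near x, cst 0 y = sqpos y.
    by apply: filterS (lt_nbhsl x0) => y y0; rewrite /sqpos /= (max_idPl (ltW y0)) expr0n.
  rewrite mulr0; exact: (near_eq_is_derive e (is_derive_cst (0 : R) x (1 : R))).
- have e : \forall y \near x, y ^+ 2 = sqpos y.
    by apply: filterS (lt_nbhsr x0) => y y0; rewrite /sqpos /= (max_idPr (ltW y0)).
  exact: (near_eq_is_derive e d2).
rewrite x0 mulr0.
have h : (fun h : R => h^-1 *: (sqpos (h *: 1 + 0) - sqpos 0)) @ 0^' --> (0 : R).
  apply/cvgrPdist_le => e e0. have : \forall h \near (0 : R)^', h != 0 by exact: nbhs_dnbhs_neq.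
  apply: filterS2 (dnbhs0_le e0) => h he hn. rewrite sub0r normrN /GRing.scale /= mulr1 addr0.
  have /andP[s00 s01] := sqpos_le 0; have /andP[s0 s1] := sqpos_le h.
  have -> : sqpos 0 = 0 by apply/eqP; rewrite eq_le s00 andbT (le_trans s01)// expr0n.
  rewrite subr0 normrM normfV (ger0_norm s0) ler_pdivrMl ?normr_gt0//.
  apply: le_trans s1 _; rewrite -real_normK ?num_real// expr2 ler_wpM2l//.
apply: DeriveDef; first by apply/cvg_ex; exists 0.
exact: cvg_lim h.
Qed.

(* A C^1 function equal to the identity up to rho - eta and constant from rho on. *)
Definition cutoff (rho eta t : R) :=
  rho - eta / 2 - (sqpos (rho - t) - sqpos (rho - eta - t)) / (2 * eta).

Variables rho eta : R.
Hypothesis eta0 : 0 < eta.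

Lemma cutoff_lo t : t <= rho - eta -> cutoff rho eta t = t.
Proof.
move=> tr; rewrite /cutoff /sqpos (max_idPr (_ : 0 <= rho - t)); last by move: eta0 tr; clear; lra.
rewrite (max_idPr (_ : 0 <= rho - eta - t)); last by move: tr; clear; lra.
by field; rewrite gt_eqF.
Qed.

Lemma cutoff_hi t : rho <= t -> cutoff rho eta t = rho - eta / 2.
Proof.
move=> rt; rewrite /cutoff /sqpos (max_idPl (_ : rho - t <= 0)); last by move: rt; clear; lra.
rewrite (max_idPl (_ : rho - eta - t <= 0)); last by move: eta0 rt; clear; lra.
by rewrite subrr mul0r subr0.
Qed.

Lemma is_derive_cutoff (t : R) : exists2 l, is_derive t 1 (cutoff rho eta) l & 0 <= l <= 1.
Proof.
exists ((Num.max 0 (rho - t) - Num.max 0 (rho - eta - t)) / eta).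
  have da (c : R) : is_derive t (1 : R) (fun t : R => c - t) (-1).
    by have := is_deriveB (is_derive_cst c t (1 : R)) (is_derive_id t (1 : R)); rewrite sub0r.
  have d1 (c : R) : is_derive t 1 (fun t => sqpos (c - t)) (2 * Num.max 0 (c - t) * -1).
    exact: (@is_derive1_comp R sqpos (fun t : R => c - t) t _ _ (is_derive_sqpos _) (da c)).
  have -> : cutoff rho eta = (fun t => - (2 * eta)^-1 * (sqpos (rho - t) - sqpos (rho - eta - t)) + (rho - eta / 2)).
    by apply/funext => u; rewrite /cutoff mulNr addrC [_^-1 * _]mulrC.
  apply: is_derive_eq; rewrite /GRing.scale /=. rewrite addr0; move: (Num.max _ _) (Num.max _ _) => p q. by field; rewrite gt_eqF.
have [h1|h1] := leP 0 (rho - t); have [h2|h2] := leP 0 (rho - eta - t).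
- by rewrite divr_ge0 ?ler_pdivrMr ?mul1r ?(ltW eta0)//=; move: h1 h2 eta0; clear; lra.
- rewrite subr0 divr_ge0 ?ler_pdivrMr ?mul1r ?(ltW eta0)//=; move: h1 h2 eta0; clear; lra.
- by exfalso; move: h1 h2 eta0; clear; lra.
- by rewrite subrr mul0r lexx ler01.
Qed.

Lemma cutoff_mono t u : t <= u -> cutoff rho eta t <= cutoff rho eta u.
Proof.
move=> tu; apply: (@mono_except R [::] (cutoff rho eta) t u tu) => x _.
  have [l [d _] _] := is_derive_cutoff x. exact: derivable_continuous.
by move=> _; have [l d /andP[l0 _]] := is_derive_cutoff x; exists l.
Qed.

Lemma cutoff_ge t : 0 <= t -> Num.min t rho - eta <= cutoff rho eta t.
Proof.
move=> t0; have [h|h] := leP t (rho - eta).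
  rewrite (cutoff_lo h); have : Num.min t rho <= t by rewrite ge_min lexx. by move: eta0; clear; move: (Num.min _ _) => m; lra.
apply: (@le_trans _ _ (cutoff rho eta (rho - eta))); last exact/cutoff_mono/ltW.
by rewrite cutoff_lo// lerD2r ge_min lexx orbT.
Qed.

End Cutoff.

Local Opaque derivable derive derive1 partial.

Section SmoothMaps.
Context R n (m : nat) (M : smoothManifold R n) (N : smoothManifold R m) (F : M -> N).
Hypothesis sF : smooth_map F.

Lemma smooth_map_continuous : continuous F.
Proof.
move=> p; have [ac dc] := chart_atP p; set c := chart_at p in ac dc.
have [cF _] := sF ac.
have h : {for p, continuous (fun q => (F \o bwd c) (fwd c q))}.
  apply: (@continuous_comp _ _ _ (fwd c) (F \o bwd c) p (fwd_continuous dc)). by apply: cF; exact: fwd_cod.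
apply: (continuous_near _ h); apply: (@filterS _ (nbhs p) _ (dom c)).
  by move=> q dq; rewrite /= fwdK.
by apply: open_nbhs_nbhs; split => //; exact: open_dom.
Qed.

Definition mdom (P : param M) (Q : param N) : set 'rV[R]_n := pdom P `&` (F \o ppar P) @^-1` pran Q.

Lemma C1_at_map (gamma : R -> M) t : (\forall s \near t, C1_at gamma s) -> C1_at (F \o gamma) t.
Proof.
move=> nC; have [ct Ct] := nbhs_singleton nC.
have [ac dc] := chart_atP (gamma t); set c := chart_at _ in ac dc.
split.
  exact: (@continuous_comp _ _ _ gamma F t ct (@smooth_map_continuous _)).
move=> c' ac' dc'; have nc := near_dom (@open_dom _ _ _ c) ct dc.
have [dx cdx] := Ct c ac dc; pose x := fwd c \o gamma.
have nx : \forall s \near t, derivable x s 1 by apply: filterS2 nC nc => s [_ Cs] ds; exact: (Cs c ac ds).1.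
have [cF /(_ c' ac') sFc] := sF ac.
have oV2 : open (cod c `&` (F \o bwd c) @^-1` dom c') by apply: open_preimage_on; [exact: open_cod|exact: cF|exact: open_dom].
have Ux : (cod c `&` (F \o bwd c) @^-1` dom c') (x t) by split; [exact: fwd_cod|rewrite /x /= fwdK].
have [|d1 d2 _] := @C1_push _ _ _ _ (fwd c' \o (F \o bwd c)) x (fwd c' \o (F \o gamma)) t oV2 sFc nx cdx Ux.
  by apply: filterS nc => s ds; rewrite /x /= fwdK.
by split.
Qed.

Lemma piecewise_map (gamma : R -> M) : piecewise_C1 gamma -> piecewise_C1 (F \o gamma).
Proof.
move=> [k [t [t0 t1 H]]]; exists k, t; split => // i ik.
have [ti [eta [e [e0 C He]]]] := H i ik; split => //.
exists (F \o eta), e; split => //.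
  by move=> s sab; apply: C1_at_map; exact: (C1_curve_near C).
by move=> s sab; rewrite /= He.
Qed.

End SmoothMaps.

Section CauchySchwarz.
Context R n (A : 'M[R]_n).
Hypotheses (As : A^T = A) (Ap : forall v, v != 0 -> 0 < inner A v v).

Lemma inner_ge0 v : 0 <= inner A v v.
Proof. by have [->|/Ap/ltW//] := eqVneq v 0; rewrite inner0l. Qed.

Lemma inner_CS u v : inner A u v ^+ 2 <= inner A u u * inner A v v.
Proof.
have [->|v0] := eqVneq v 0.
  by rewrite (inner_sym u 0 As) !inner0l expr2 !mulr0.
have := inner_ge0 (inner A v v *: u - inner A u v *: v).
rewrite -scaleNr innerDl !innerDr !innerZl !innerZr (inner_sym v u As).
have := Ap v0; move: (inner _ v v) (inner _ u v) (inner _ u u) => p q s p0.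
have -> : p * (p * s) + p * (- q * q) + (- q * (p * q) + - q * (- q * p)) = p * (s * p - q ^+ 2) by ring.
by rewrite pmulr_rge0// subr_ge0.
Qed.

End CauchySchwarz.

Section Metric.
Context R n (M : riemannianManifold R n).
Implicit Types p q : M.

Lemma rdist_sym p q : rdist p q = rdist q p.
Proof.
rewrite /rdist; congr inf; apply/seteqP; split => l [g [h0 h1 h2 <-]].
  by have [g' [? ? ?] <-] := joins_rev (And3 h0 h1 h2); exists g'.
by have [g' [? ? ?] <-] := joins_rev (And3 h0 h1 h2); exists g'.
Qed.

Lemma rdist_triangle p q z : (exists g, joins p q g) -> (exists g, joins q z g) ->
  rdist p z <= rdist p q + rdist q z.
Proof.
have near_inf a b : (exists g, @joins R n M a b g) -> forall e, 0 < e -> exists2 g, joins a b g & curve_length g < rdist a b + e.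
  move=> [g [g0 g1 g2]] e e0; have [|_ [g' [h0 h1 h2 <-]] lt] := @inf_adherent R [set l | exists gamma : R -> M,
    [/\ piecewise_C1 gamma, gamma 0 = a, gamma 1 = b & curve_length gamma = l]] e e0. split; first by exists (curve_length g), g.
    by exists 0 => _ [g' [_ _ _ <-]]; exact: curve_length_ge0.
  by exists g'.
move=> /near_inf H1 /near_inf H2; apply/ler_addgt0Pr => e e0.
have e2 : 0 < e / 2 by rewrite divr_gt0.
have [g1 j1 l1] := H1 _ e2; have [g2 j2 l2] := H2 _ e2.
have [g j l] := joins_concat j1 j2.
apply: le_trans (rdist_le j) _; rewrite l; move: l1 l2.
move: (curve_length g1) (curve_length g2) (rdist p q) (rdist q z) => x y z' w; clear; lra.
Qed.

Lemma length_le_const (gamma : R -> M) (k : R) : piecewise_C1 gamma ->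
  (forall t : R, 0 < t < 1 -> (\forall s \near t, C1_at gamma s) -> speed gamma t <= k) ->
  curve_length gamma <= k.
Proof.
move=> pw H; have [L [s [cL L0 L1 HL]]] := arc_ex pw.
pose f x := k * x - L x.
have : f 0 <= f 1.
  apply: (@mono_except R s f 0 1 ler01) => x x01.
    apply: (@continuousB R R R (fun x => k * x) L); last exact: cL.
    by apply: (@continuousM R R); [exact: cst_continuous|exact: cvg_id].
  move=> xs; have [nC dL] := HL x x01 xs. exists (k - speed gamma x); last by rewrite subr_ge0 H.
  have dk : is_derive x 1 (fun x : R => k * x) k by apply: is_derive_eq; rewrite /GRing.scale /= !(mulr1, add0r, mulr0, addr0).
  exact: is_deriveB.
by rewrite /f L0 L1 mulr0 mulr1 subr0 subr_ge0.
Qed.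

End Metric.

(** One normal parametrization of the ball of radius [2 * r] around every point, in units of [r]. No
    regularity in the point is required, and the frames at different points are unrelated. *)
Record normal_atlas R n (M : riemannianManifold R n) (r kappa : R)
    (nc : M -> param M) := NormalAtlas {
  na_dom : forall p, pdom (nc p) = eball 2;
  na_0 : forall p, ppar (nc p) 0 = p;
  na_metric : forall p, normal_metric 2 kappa (fun x => (r ^+ 2)^-1 *: pmet (nc p) x) }.

(** * Distance in normal charts *)

Section NormalAtlas.
Context R n (M : riemannianManifold R n) (r kappa : R) (nc : M -> param M).
Hypotheses (r0 : 0 < r) (NA : normal_atlas r kappa nc).
Local Notation G p := (fun x => (r ^+ 2)^-1 *: pmet (nc p) x).

Lemma nc_dom p x : enorm x < 2 -> pdom (nc p) x.
Proof. by rewrite (na_dom NA). Qed.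

Lemma nc_radial p x : enorm x < 2 -> inner (G p x) x x = dot x x.
Proof. by case: (na_metric NA p) => sG Gs Gp G0 Gg _; exact: (inner_radial sG Gs Gp G0 Gg). Qed.

Lemma nc_radial2 p x c : enorm (c *: x) < 2 -> inner (G p (c *: x)) x x = dot x x.
Proof.
move=> cx; have [->|c0] := eqVneq c 0.
  by rewrite scale0r; have -> := nm_0 (na_metric NA p); rewrite inner1.
have := nc_radial p cx; rewrite !innerZl !innerZr dotZl dotZr.
by move=> /(mulfI c0)/(mulfI c0).
Qed.

Lemma pmet_G p x u v : inner (pmet (nc p) x) u v = r ^+ 2 * inner (G p x) u v.
Proof. by rewrite inner_scale mulrA mulfV ?mul1r// expf_neq0// gt_eqF. Qed.

Lemma sqrt_speed (k u : R) : 0 <= u -> Num.sqrt (r ^+ 2 * (k ^+ 2 * u)) = r * `|k| * Num.sqrt u.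
Proof.
move=> u0; rewrite mulrA -exprMn sqrtrM ?sqr_ge0// sqrtr_sqr normrM (gtr0_norm r0).
by [].
Qed.

(** By the Gauss lemma the ray has constant speed, so its length is at most its Euclidean length
    times [r]. *)
Lemma ray_joins p x a b : enorm (a *: x) < 2 -> enorm (b *: x) < 2 ->
  exists2 g, joins (ppar (nc p) (a *: x)) (ppar (nc p) (b *: x)) g &
    curve_length g <= r * `|b - a| * enorm x.
Proof.
move=> ax bx; pose k := b - a; pose z (s : R) := (a + k * s) *: x.
pose m := Num.max (enorm (a *: x)) (enorm (b *: x)).
have m2 : m < 2 by rewrite /m gt_max ax bx.
have m01 s : 0 <= s <= 1 -> enorm (z s) <= m.
  move=> /andP[s0 s1]; have -> : z s = (1 - s) *: (a *: x) + s *: (b *: x).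
    by rewrite /z /k !scalerA -scalerDl; congr (_ *: _); ring.
  apply: le_trans (enormD _ _) _; rewrite !(enormZ (1 - s), enormZ s) ger0_norm ?subr_ge0// (ger0_norm s0).
  have h1 : enorm (a *: x) <= m by rewrite /m le_max lexx. have h2 : enorm (b *: x) <= m by rewrite /m le_max lexx orbT.
  have h3 : (1 - s) * enorm (a *: x) <= (1 - s) * m by rewrite ler_wpM2l ?subr_ge0.
  have h4 : s * enorm (b *: x) <= s * m by rewrite ler_wpM2l. apply: le_trans (lerD h3 h4) _; by rewrite -mulrDl subrK mul1r.
pose C := `|k| * enorm x + 1.
have C0 : 0 < C by rewrite ltr_wpDl// mulr_ge0// enorm_ge0.
(* A piece of a curve must be C^1 on an open interval larger than [[0, 1]]; [e] is how far the
   segment can be prolonged inside the ball of radius 2. *)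
pose e := (2 - m) / C.
have e0 : 0 < e by rewrite divr_gt0// subr_gt0.
have z2 s : - e < s < 1 + e -> enorm (z s) < 2.
  move=> /andP[s0 s1]. have [t t01 ts] : exists2 t, 0 <= t <= 1 & `|s - t| < e.
    have [h|h] := ltP s 0.
      by exists 0; rewrite ?lexx ?ler01// subr0 ltr0_norm// ltrNl.
    have [h'|h'] := leP s 1; first by exists s; rewrite ?h// subrr normr0.
    by exists 1; rewrite ?ler01 ?lexx// gtr0_norm ?subr_gt0// ltrBlDl.
  have -> : z s = z t + (k * (s - t)) *: x by rewrite /z -scalerDl; congr (_ *: _); ring.
  apply: le_lt_trans (enormD _ _) _; rewrite (enormZ (k * _)) normrM. have h1 := m01 _ t01.
  have h2 : `|k| * `|s - t| * enorm x <= `|k| * enorm x * e.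
    rewrite mulrAC ler_wpM2l ?mulr_ge0 ?enorm_ge0//; exact: ltW.
  have h3 : `|k| * enorm x * e < 2 - m.
    have -> : 2 - m = C * e by rewrite /e mulrC divfK// gt_eqF. by rewrite ltr_pM2r// ltrDl.
  by move: (le_lt_trans h2 h3) h1; clear; move: (enorm _) (_ * enorm x) => u v; lra.
pose g s := ppar (nc p) (z s).
have dz (s : R) : derivable z s 1 /\ derive1 z s = k *: x.
  have [d1 e1] := derive1_ray x (a + k * s). have [d2 e2] := derive1_affine d1; split; first exact: d2.
  by apply: etrans e2 _; rewrite e1.
have Cg s : - e < s < 1 + e -> C1_at g s.
  move=> hs; apply: (@C1_of_param _ _ _ g z s (nc p)).
  - by apply: filterE => u; exact: (dz u).1.
  - have -> : derive1 z = cst (k *: x) by apply/funext => u; exact: (dz u).2.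
    exact: cst_continuous.
  - exact/nc_dom/z2.
  - by apply: filterE.
exists g.
  split.
  - exists 1%N, (fun i => i%:R); split => // i; rewrite ltnS leqn0 => /eqP ->.
    split; first exact: ltr01. by exists g, e; split => //; rewrite sub0r.
  - by rewrite /g /z mulr0 addr0.
  - by rewrite /g /z mulr1 /k addrC subrK.
apply: length_le_const.
  exists 1%N, (fun i => i%:R); split => // i; rewrite ltnS leqn0 => /eqP ->. split; first exact: ltr01.
  by exists g, e; split => //; rewrite sub0r.
move=> t /andP[t0 t1] nC; have [ct _] := nbhs_singleton nC.
have te : - e < t < 1 + e by apply/andP; split; move: t0 t1 e0; clear; lra.
have zt := z2 t te.
have Pt : pran (nc p) (g t) by apply/ppar_ran/nc_dom.
have [d _] := C1_param nC Pt.
rewrite (speedE ct Pt d).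
have nz : \forall s \near t, (pchart (nc p) \o g) s = z s.
  have ti : t \in `]- e, 1 + e[ by rewrite in_itv.
  by apply: filterS (near_itvoo ti) => s; rewrite in_itv /= => /z2/nc_dom sd; rewrite /g pparK.
have [_ e1] := derive1_near nz d; rewrite e1 (dz t).2.
rewrite /g pparK; last exact: nc_dom.
rewrite pmet_G innerZl innerZr nc_radial2// (mulrA k) -expr2 sqrt_speed ?dot_ge0//.
Qed.

Lemma ray_le p x : enorm x < 2 -> rdist p (ppar (nc p) x) <= r * enorm x.
Proof.
move=> x2; have h0 : enorm (0 *: x) < 2 by rewrite scale0r enorm0.
have h1 : enorm (1 *: x) < 2 by rewrite scale1r.
have [g j l] := ray_joins p h0 h1.
rewrite scale0r scale1r (na_0 NA) in j; apply: le_trans (rdist_le j) _.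
by move: l; rewrite subr0 normr1 mulr1.
Qed.

Hypothesis cM : connected [set: M].

Lemma nc_open p s : s <= 2 -> open (ppar (nc p) @` [set x | enorm x < s]).
Proof.
move=> s2; have -> : ppar (nc p) @` [set x | enorm x < s] =
    pran (nc p) `&` pchart (nc p) @^-1` (@eball R n s).
  apply/seteqP; split => [_ [x xs <-]|q [Pq qs]].
    by have xd := nc_dom p (lt_le_trans xs s2); split; [exact: ppar_ran|rewrite /= pparK].
  by exists (pchart (nc p) q) => //; exact: pchartK.
apply: open_preimage_on; [exact: open_pran| |exact: open_eball0].
by move=> q; exact: pchart_continuous.
Qed.

Lemma nc_nbhs p s : 0 < s <= 2 -> nbhs p (ppar (nc p) @` [set x | enorm x < s]).
Proof.
move=> /andP[s0 s2]; apply: open_nbhs_nbhs; split; first exact: nc_open.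
by exists 0; rewrite /= ?enorm0// (na_0 NA).
Qed.

(** The points joined to [p] form a nonempty set that is open and closed, by short rays around each
    point. This also keeps the default value of [inf set0] out of [rdist]. *)
Lemma all_joined (p q : M) : exists g, joins p q g.
Proof.
pose A := [set q | exists g, joins p q g].
have loc (a b : M) x : enorm x < 2 -> b = ppar (nc a) x -> exists g, joins a b g.
  move=> x2 ->; have h0 : enorm (0 *: x) < 2 by rewrite scale0r enorm0. have h1 : enorm (1 *: x) < 2 by rewrite scale1r.
  by have [g j _] := ray_joins a h0 h1; exists g; rewrite scale0r scale1r (na_0 NA) in j.
have tr' (a b c : M) : (exists g, joins a b g) -> (exists g, joins b c g) -> exists g, joins a c g.
  by move=> [g1 j1] [g2 j2]; have [g j _] := joins_concat j1 j2; exists g.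
have rv (a b : M) : (exists g, joins a b g) -> exists g, joins b a g by move=> [g1 j1]; have [g j _] := joins_rev j1; exists g.
have two : 0 < (2 : R) <= 2 by rewrite ltr0n lexx.
suff : A = setT by move=> AT; have : A q by rewrite AT.
apply: cM.
- by exists p; apply: (loc p p 0); rewrite ?enorm0 ?(na_0 NA).
- exists A; last by rewrite setTI.
  rewrite openE => a Aa; apply: filterS (nc_nbhs a two) => _ [x x2 <-]. by apply: tr' Aa _; exact: (loc a _ x).
- exists A; last by rewrite setTI.
  rewrite -openC openE => a Aa; apply: filterS (nc_nbhs a two) => _ [x x2 <-] Ab.
  by apply: Aa; apply: tr' Ab _; apply: rv; exact: (loc a _ x).
Qed.

(** The image of a compact ball in a Hausdorff space. Closedness makes [radial] locally constant at
    the points off the normal ball, where no coordinates are available. *)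
Lemma nc_ball_closed p rho : rho < 2 -> closed (ppar (nc p) @` [set x | enorm x <= rho]).
Proof.
move=> rho2; apply: compact_closed; first exact: points_hausdorff.
apply: continuous_compact.
  apply: continuous_in_subspaceT => x; rewrite inE /= => xr. by apply/ppar_continuous/nc_dom; exact: le_lt_trans rho2.
apply: bounded_closed_compact.
  exists rho; split; first exact: num_real. by move=> y ry x /= xr; apply: le_trans (norm_le_enorm x) (le_trans xr (ltW ry)).
rewrite -openC (_ : ~` _ = (@enorm R n) @^-1` [set y | rho < y]); last first.
  by apply/seteqP; split => x /=; rewrite ltNge => /negP.
apply: open_comp; last exact: open_gt.
by move=> x _; apply: (@continuous_enorm R n _ (fun x => x)); exact: cvg_id.
Qed.

(* A regularized truncation of the distance to p, which is 1-Lipschitz by the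
   Gauss lemma; off the normal ball it is the constant rho. *)
Definition radial p (rho eta : R) (q : M) : R :=
  if pselect (pran (nc p) q) then r * cutoff rho eta (Num.sqrt (dot (pchart (nc p) q) (pchart (nc p) q) + eta ^+ 2))
  else r * cutoff rho eta rho.

Variables (p : M) (rho eta : R).
Hypotheses (eta0 : 0 < eta) (rho2 : rho < 2).

Lemma radial_in q : pran (nc p) q -> radial p rho eta q =
  r * cutoff rho eta (Num.sqrt (dot (pchart (nc p) q) (pchart (nc p) q) + eta ^+ 2)).
Proof. by rewrite /radial; case: pselect. Qed.

Lemma radial_out q : ~ (ppar (nc p) @` [set x | enorm x <= rho]) q -> radial p rho eta q = r * cutoff rho eta rho.
Proof.
rewrite /radial; case: pselect => // Pq nq; rewrite !cutoff_hi//.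
have h : rho < enorm (pchart (nc p) q) by rewrite ltNge; apply/negP => h; apply: nq; exists (pchart (nc p) q) => //; exact: pchartK.
apply: le_trans (ltW h) _; rewrite /enorm ler_sqrt ?lerDl ?sqr_ge0//.
by rewrite addr_ge0 ?dot_ge0 ?sqr_ge0.
Qed.

(** The term [eta ^+ 2] under the root removes the singularity of the distance at the centre; the
    cutoff has slope between 0 and 1, so only the slope of the root remains in the bound. *)
Lemma profile_derive (u : R) : 0 <= u -> exists2 l,
  is_derive u 1 (fun u => r * cutoff rho eta (Num.sqrt (u + eta ^+ 2))) l &
  0 <= l <= r / (2 * Num.sqrt (u + eta ^+ 2)).
Proof.
move=> u0; have v0 : 0 < u + eta ^+ 2 by rewrite ltr_wpDl ?exprn_gt0.
have [l dl /andP[l0 l1]] := @is_derive_cutoff R rho eta eta0 (Num.sqrt (u + eta ^+ 2)).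
have ds := is_derive1_sqrt v0.
have da : is_derive u (1 : R) (fun u : R => u + eta ^+ 2) 1 by apply: is_derive_eq; rewrite addr0.
exists (r * (l * ((2 * Num.sqrt (u + eta ^+ 2))^-1 * 1))).
  have -> : (fun u => r * cutoff rho eta (Num.sqrt (u + eta ^+ 2))) =
    r \*: (fun u => cutoff rho eta (Num.sqrt (u + eta ^+ 2))) by apply/funext.
  exact: is_deriveZ.
rewrite mulr1 !mulr_ge0 ?(ltW r0)//= ler_wpM2l ?(ltW r0)//.
by rewrite -[leRHS]mul1r ler_wpM2r.
Qed.

Lemma radial_continuous : continuous (radial p rho eta).
Proof.
move=> q; have [Pq|Pq] := pselect (pran (nc p) q).
  have n1 : \forall y \near q, r * cutoff rho eta (Num.sqrt (dot (pchart (nc p) y) (pchart (nc p) y) + eta ^+ 2)) = radial p rho eta y.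
    have : nbhs q (pran (nc p)) by apply: open_nbhs_nbhs; split => //; exact: open_pran.
    by apply: filterS => y Py; rewrite radial_in.
  apply: (continuous_near n1).
  apply: (@continuous_comp _ _ _ (fun y => dot (pchart (nc p) y) (pchart (nc p) y))
     (fun u => r * cutoff rho eta (Num.sqrt (u + eta ^+ 2)))).
    by apply: continuous_dot; exact: pchart_continuous.
  have [l [d _] _] := profile_derive (dot_ge0 (pchart (nc p) q)). exact: derivable_continuous.
have nq : ~ (ppar (nc p) @` [set x | enorm x <= rho]) q by move=> [x xr xq]; apply: Pq; rewrite -xq; apply/ppar_ran/nc_dom; exact: le_lt_trans rho2.
have n1 : \forall y \near q, cst (r * cutoff rho eta rho) y = radial p rho eta y.
  have : nbhs q (~` (ppar (nc p) @` [set x | enorm x <= rho])) by apply: open_nbhs_nbhs; split => //; apply: closed_openC; exact: nc_ball_closed.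
  by apply: filterS => y ny; rewrite radial_out.
by apply: (continuous_near n1); exact: cst_continuous.
Qed.

(** In the normal chart the Gauss lemma turns [dot z z'] into the inner product of [z] and [z'] for
    the metric. Cauchy-Schwarz for the metric and [inner_radial] bound it by [enorm z] times the
    speed, and the factor [enorm z] is absorbed by the root. *)
Lemma radial_lipschitz gamma (t : R) : (\forall s \near t, C1_at gamma s) ->
  exists2 l, is_derive t 1 (radial p rho eta \o gamma) l & `|l| <= speed gamma t.
Proof.
move=> nC; have [ct _] := nbhs_singleton nC.
have [Pt|Pt] := pselect (pran (nc p) (gamma t)); last first.
  have nq : ~ (ppar (nc p) @` [set x | enorm x <= rho]) (gamma t).
    by move=> [x xr xq]; apply: Pt; rewrite -xq; apply/ppar_ran/nc_dom; exact: le_lt_trans rho2.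
  exists 0; last by rewrite normr0 speed_ge0.
  have n1 : \forall s \near t, cst (r * cutoff rho eta rho) s = (radial p rho eta \o gamma) s.
    have := near_dom (closed_openC (nc_ball_closed rho2)) ct nq. by apply: filterS => y ny; rewrite /= radial_out.
  exact: (near_eq_is_derive n1 (is_derive_cst (r * cutoff rho eta rho) t (1 : R))).
have [dz _] := C1_param nC Pt; set z := pchart (nc p) \o gamma in dz.
have dd := is_derive_dot dz dz.
have [l dl /andP[l0 l1]] := profile_derive (dot_ge0 (z t)).
have d2 := @is_derive1_comp R (fun u => r * cutoff rho eta (Num.sqrt (u + eta ^+ 2))) (fun s => dot (z s) (z s)) t _ _ dl dd.
have n1 : \forall s \near t, ((fun u => r * cutoff rho eta (Num.sqrt (u + eta ^+ 2))) \o (fun s => dot (z s) (z s))) s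
    = (radial p rho eta \o gamma) s.
  by apply: filterS (near_dom (@open_pran _ _ _ (nc p)) ct Pt) => s Ps; rewrite /= radial_in.
exists (l * (dot (derive1 z t) (z t) + dot (z t) (derive1 z t))); first exact: (near_eq_is_derive n1 d2).
rewrite (speedE ct Pt dz) -/z -[pchart (nc p) (gamma t)]/(z t).
move: (derive1 z t) => v; rewrite (dotC v).
have zB : enorm (z t) < 2 by have := pchart_dom Pt; rewrite (na_dom NA).
have zv : dot (z t) v = inner (G p (z t)) (z t) v.
  by case: (na_metric NA p) => sG Gs Gp G0 Gg _; rewrite innerE (gauss sG Gs Gp G0 Gg zB).
have cs := inner_CS (nm_sym (na_metric NA p) zB) (nm_pos (na_metric NA p) zB) (z t) v.
rewrite -zv (nc_radial p zB) in cs; rewrite pmet_G.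
have g0 : 0 <= inner (G p (z t)) v v by exact: (inner_ge0 (nm_pos (na_metric NA p) zB)).
move: cs l1 g0; move: (dot (z t) v) (inner _ v v) (dot_ge0 (z t)) => a b.
move: (dot (z t) (z t)) => d d0 cs l1 b0.
have s0 : 0 < Num.sqrt (d + eta ^+ 2) by rewrite sqrtr_gt0 ltr_wpDl ?exprn_gt0.
rewrite sqrtrM ?sqr_ge0// sqrtr_sqr (gtr0_norm r0) normrM (ger0_norm l0).
have -> : `|a + a| = 2 * `|a| by rewrite (_ : a + a = 2 * a); [rewrite normrM ger0_norm|rewrite mulr_natl mulr2n].
have ha : `|a| <= Num.sqrt (d + eta ^+ 2) * Num.sqrt b.
  rewrite -(@ler_pXn2r _ 2) ?nnegrE ?mulr_ge0 ?sqrtr_ge0// real_normK ?num_real// exprMn !sqr_sqrtr//; last first.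
    by rewrite addr_ge0 ?sqr_ge0.
  by apply: le_trans cs _; rewrite ler_wpM2r// lerDl sqr_ge0.
apply: (@le_trans _ _ (r / (2 * Num.sqrt (d + eta ^+ 2)) * (2 * (Num.sqrt (d + eta ^+ 2) * Num.sqrt b)))).
  by rewrite ler_pM// ?mulr_ge0// ler_wpM2l.
move: s0; move: (Num.sqrt _) => w w0; rewrite le_eqVlt; apply/orP; left; apply/eqP.
by field; rewrite gt_eqF.
Qed.

Lemma radial_le q : radial p rho eta q - radial p rho eta p <= rdist p q.
Proof.
have [g j] := all_joined p q; apply: (le_rdist j) => g' [pw gp gq].
rewrite -[in X in X - _ <= _]gq -[X in _ - radial p rho eta X]gp.
by apply: (length_lipschitz pw radial_continuous) => t _; exact: radial_lipschitz.
Qed.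

End NormalAtlas.

Section NormalDistance.
Context R n (M : riemannianManifold R n) (r kappa : R) (nc : M -> param M).
Hypotheses (r0 : 0 < r) (NA : normal_atlas r kappa nc) (cM : connected [set: M]).

Lemma pchart_self p : pchart (nc p) p = 0.
Proof. by rewrite -[X in pchart _ X](na_0 NA p) pparK// (na_dom NA) /eball /= enorm0. Qed.

Lemma pran_self p : pran (nc p) p.
Proof. by rewrite -[X in pran _ X](na_0 NA p); apply/ppar_ran; rewrite (na_dom NA) /eball /= enorm0. Qed.

(** Along any curve to [q] the function [radial] rises from nearly 0 to nearly [r * m], whether [q]
    lies outside the normal ball or in it at radius at least [m]. *)
Lemma rdist_ge p q m : 0 <= m -> m < 2 -> (pran (nc p) q -> m <= enorm (pchart (nc p) q)) ->
  r * m <= rdist p q.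
Proof.
move=> m0 m2 H; apply/ler_addgt0Pr => e e0.
(* The truncation lies between [m] and 2, and [eta] is so small that the two losses [r * eta] sum to
   at most [e]. *)
pose rho := (m + 2) / 2; have rho2 : rho < 2 by exact: mid_lt2.
have rho1 : 1 <= rho by exact: mid_ge1.
have mrho : m <= rho by exact/mid_ge/ltW.
pose eta := Num.min 2^-1 (e / (2 * r)).
have eta0 : 0 < eta by rewrite /eta lt_min invr_gt0 ltr0n divr_gt0// mulr_gt0.
have eta1 : eta <= 2^-1 by rewrite /eta ge_min lexx.
have etae : r * (2 * eta) <= e.
  have : eta <= e / (2 * r) by rewrite /eta ge_min lexx orbT.
  by rewrite ler_pdivlMr ?mulr_gt0// => h; apply: le_trans h; rewrite le_eqVlt; apply/orP; left; apply/eqP; ring.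
have := radial_le r0 NA cM p eta0 rho2 q.
rewrite (radial_in r _ _ (pran_self p)) pchart_self dot0l add0r sqrtr_sqr (gtr0_norm eta0).
rewrite (@cutoff_lo R rho eta eta0 eta); last exact: half_sub.
have hq : r * (m - eta) <= radial r nc p rho eta q.
  have [Pq|Pq] := pselect (pran (nc p) q).
    rewrite radial_in// ler_pM2l//; set t := Num.sqrt _. have mt : m <= t.
      apply: le_trans (H Pq) _; rewrite /t /enorm ler_sqrt ?lerDl ?sqr_ge0//. by rewrite addr_ge0 ?dot_ge0 ?sqr_ge0.
    apply: le_trans (cutoff_ge rho eta0 (sqrtr_ge0 _)); rewrite lerD2r le_min mt. exact: mrho.
  have -> : radial r nc p rho eta q = r * cutoff rho eta rho by rewrite /radial; case: pselect.
  by rewrite ler_pM2l// cutoff_hi//; exact: sub_half_ge.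
move=> h; have : r * (m - eta) - r * eta <= rdist p q by apply: le_trans h; rewrite lerD2r.
rewrite (_ : r * (m - eta) - r * eta = r * m - r * (2 * eta)); last by ring.
by rewrite lerBlDr => /le_trans; apply; rewrite lerD2l.
Qed.

Definition ud (p q : M) := rdist p q / r.
Lemma ud_ge0 p q : 0 <= ud p q. Proof. by rewrite divr_ge0 ?rdist_ge0 ?ltW. Qed.
Lemma ud_sym p q : ud p q = ud q p. Proof. by rewrite /ud rdist_sym. Qed.

Lemma ud_tri p q z : ud p z <= ud p q + ud q z.
Proof.
rewrite /ud -mulrDl ler_pM2r ?invr_gt0//.
by apply: rdist_triangle; exact: (all_joined r0 NA cM).
Qed.

(** The ray gives one inequality and [rdist_ge] the other: normal coordinates compute the distance
    to their centre. *)
Lemma ud_nc p x : enorm x < 2 -> ud p (ppar (nc p) x) = enorm x.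
Proof.
move=> x2; apply: (mulIf (lt0r_neq0 r0)); rewrite /ud divfK ?gt_eqF//; apply/eqP.
rewrite eq_le [enorm x * r]mulrC (ray_le r0 NA p x2) rdist_ge// ?enorm_ge0// => _.
by rewrite pparK ?lexx//; exact: (nc_dom NA).
Qed.

Lemma ud_lt2 p q : ud p q < 2 -> pran (nc p) q.
Proof.
move=> h; apply: contrapT => Pq.
pose m := (ud p q + 2) / 2; have m2 : m < 2 by exact: mid_lt2.
have : r * m <= rdist p q by apply: rdist_ge => //; rewrite divr_ge0// addr_ge0// ud_ge0.
by rewrite mulrC -ler_pdivlMr// -/(ud p q) leNgt mid_gt.
Qed.

Lemma pran_enorm p q : pran (nc p) q -> enorm (pchart (nc p) q) < 2.
Proof. by move=> /pchart_dom; rewrite (na_dom NA). Qed.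

Lemma ud_pchart p q : pran (nc p) q -> ud p q = enorm (pchart (nc p) q).
Proof. move=> Pq; rewrite -[X in ud _ X](pchartK Pq) ud_nc//; exact: pran_enorm. Qed.

Lemma ud_lt2P p q : ud p q < 2 -> exists x, [/\ enorm x < 2, ppar (nc p) x = q, pchart (nc p) q = x & enorm x = ud p q].
Proof.
move=> /ud_lt2 Pq; exists (pchart (nc p) q).
by rewrite (pran_enorm Pq) (pchartK Pq) (ud_pchart Pq).
Qed.

Lemma ud_self p : ud p p = 0.
Proof. by rewrite -[X in ud _ X](na_0 NA p) ud_nc enorm0. Qed.

Lemma ud_eq0 p q : ud p q = 0 -> p = q.
Proof.
move=> e; have [|x [_ xq _]] := @ud_lt2P p q; first by rewrite e.
by rewrite e -xq => /enorm_eq0 ->; rewrite (na_0 NA).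
Qed.

Lemma ud_nc_ray p x a b : enorm (a *: x) < 2 -> enorm (b *: x) < 2 ->
  ud (ppar (nc p) (a *: x)) (ppar (nc p) (b *: x)) <= `|b - a| * enorm x.
Proof.
move=> ax bx; have [g j l] := ray_joins r0 NA p ax bx.
rewrite /ud ler_pdivrMr//; apply: le_trans (rdist_le j) _.
by rewrite [leRHS]mulrC mulrA.
Qed.

End NormalDistance.

Local Transparent derivable derive derive1 partial.

(** A first order consequence of an inequality with quadratic error. It yields the first variation
    formula from the triangle inequality, and the criticality of minimizers. *)
Lemma derive_le_right R (f : R -> R) (l A B d : R) : is_derive (0 : R) 1 f l -> 0 < d ->
  (forall t, 0 < t < d -> f t - f 0 <= t * (A + B * t)) -> l <= A.
Proof.
move=> [df <-] d0 H; rewrite leNgt; apply/negP => lA.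
move: df => /cvg_ex[k fk].
have e : 'D_1 f 0 = k by exact: cvg_lim fk.
move: lA; rewrite e => Ak.
have e0 : 0 < (k - A) / 2 by rewrite divr_gt0// subr_gt0.
move/cvgrPdist_lt: fk => /(_ _ e0) /nbhs_ballP[r /= r0 Hr].
pose t := Num.min (Num.min (d / 2) (r / 2)) ((k - A) / (2 * (`|B| + 1))).
have t0 : 0 < t by rewrite !lt_min !divr_gt0// ?subr_gt0// mulr_gt0.
have td : t < d by apply: (@le_lt_trans _ _ (d / 2)); [rewrite !ge_min lexx|move: d0; clear; lra].
have tr : t < r by apply: (@le_lt_trans _ _ (r / 2)); [rewrite !ge_min lexx !orbT|move: r0; clear; lra].
have tB : B * t <= (k - A) / 2.
  have h : t <= (k - A) / (2 * (`|B| + 1)) by rewrite ge_min lexx orbT. move: h; rewrite ler_pdivlMr ?mulr_gt0// => h.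
  apply: (@le_trans _ _ ((`|B| + 1) * t)).
    by rewrite ler_wpM2r ?(ltW t0)//; apply: le_trans (ler_norm B) _; rewrite lerDl.
  by rewrite ler_pdivlMr// mulrC mulrA mulrC.
have := Hr t; rewrite /ball /= sub0r normrN gtr0_norm// => /(_ tr).
rewrite gt_eqF// => /(_ isT); rewrite /GRing.scale /= mulr1 addr0 => h.
have := H t; rewrite t0 td => /(_ isT) h2.
have h3 : t^-1 * (f t - f 0) <= A + B * t by rewrite ler_pdivrMl.
by move: h h3 tB; rewrite ltr_norml => /andP[_]; clear; move: (_^-1 * _) (B * t) => u v; lra.
Qed.

Local Opaque derivable derive derive1 partial.

Lemma taylor2_le R (f f' : R -> R) (T hi : R) : 0 <= T ->
  (forall t : R, 0 <= t <= T -> is_derive t 1 f (f' t)) ->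
  (forall t : R, 0 <= t <= T -> exists2 dd, is_derive t 1 f' dd & dd <= hi) ->
  f' T <= f' 0 + hi * T /\ f T <= f 0 + f' 0 * T + hi * T ^+ 2 / 2.
Proof.
move=> T0 d1 d2.
have c2 t : 0 <= t <= T -> {for t, continuous f'} by move=> /d2[dd [h _] _]; exact: derivable_continuous.
have dl (c t : R) : is_derive t (1 : R) (fun t : R => c * t) c by apply: is_derive_eq; rewrite /GRing.scale /= !(mulr1, add0r, mulr0, addr0).
have cl (c t : R) : {for t, continuous (fun t : R => c * t)} by have [h _] := dl c t; exact: derivable_continuous.
have A t : 0 <= t <= T -> f' t <= f' 0 + hi * t.
  move=> /andP[t0 tT]. pose g s := hi * s - f' s. have : g 0 <= g t.
    apply: (@mono_except R [::] g 0 t t0) => s /andP[s0 st].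
      by apply: (@continuousB R R R (fun s => hi * s) f'); [exact: cl|apply: c2; rewrite s0 (le_trans st)].
    move=> _; have [|dd h1 h2] := d2 s; first by rewrite (ltW s0) (le_trans (ltW st)).
    by exists (hi - dd); [exact: is_deriveB (dl hi s) h1|rewrite subr_ge0].
  by rewrite /g mulr0 sub0r; clear; move: (f' 0) (f' t) (hi * t) => a b c; lra.
split; first by apply: A; rewrite T0 lexx.
pose g (s : R) := f' 0 * s + hi / 2 * s ^+ 2 - f s.
have dg s : 0 <= s <= T -> is_derive s 1 g (f' 0 + hi * s - f' s).
  move=> hs; have h1 := d1 s hs. have h2 : is_derive s (1 : R) (fun s : R => hi / 2 * s ^+ 2) (hi * s).
    by apply: is_derive_eq; rewrite /GRing.scale /= ?(mulr0, addr0, mulr1, expr1); field.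
  have h3 := is_deriveD (dl (f' 0) s) h2. exact: is_deriveB h3 h1.
have : g 0 <= g T.
  apply: (@mono_except R [::] g 0 T T0) => s hs.
    by have [h _] := dg s hs; exact: derivable_continuous.
  move=> _; case/andP: hs => s0 sT; exists (f' 0 + hi * s - f' s).
    by apply: dg; rewrite !ltW.
  by rewrite subr_ge0; apply: A; rewrite !ltW.
rewrite /g mulr0 expr0n mulr0 addr0 sub0r mulrAC.
by clear; move: (f 0) (f T) (f' 0 * T) (hi * T ^+ 2 / 2) => a b c d; lra.
Qed.

Lemma taylor2_ge R (f f' : R -> R) (T lo : R) : 0 <= T ->
  (forall t : R, 0 <= t <= T -> is_derive t 1 f (f' t)) ->
  (forall t : R, 0 <= t <= T -> exists2 dd, is_derive t 1 f' dd & lo <= dd) ->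
  f' 0 + lo * T <= f' T /\ f 0 + f' 0 * T + lo * T ^+ 2 / 2 <= f T.
Proof.
move=> T0 d1 d2; have [] := @taylor2_le R (fun t => - f t) (fun t => - f' t) T (- lo) T0.
- by move=> t /d1 h; exact: is_deriveN.
- by move=> t /d2[dd h1 h2]; exists (- dd); [exact: is_deriveN|rewrite lerN2].
rewrite !mulNr; clear; move: (f 0) (f T) (f' 0 * T) (lo * T ^+ 2 / 2) (f' T) (f' 0) (lo * T) => a b c d e g h.
by move=> h1 h2; split; lra.
Qed.

(** * Hessian of the squared distance *)

Section QuadraticForms.
Context R n.

Lemma inner_sumE (A : 'M[R]_n) (u v : 'rV[R]_n) : inner A u v = \sum_i \sum_j u 0 i * A i j * v 0 j.
Proof.
rewrite innerE /dot exchange_big /=; apply: eq_bigr => j _; rewrite mxE mulr_suml.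
by apply: eq_bigr => i _.
Qed.

Lemma dot_mulmxr (A : 'M[R]_n) (u v : 'rV[R]_n) : dot u (v *m A) = dot (u *m A^T) v.
Proof.
rewrite dotC -!innerE !inner_sumE exchange_big /=; apply: eq_bigr => i _; apply: eq_bigr => j _.
by rewrite mxE; ring.
Qed.

Lemma parallelogram (u v : 'rV[R]_n) : dot (u + v) (u + v) + dot (u - v) (u - v) = 2 * (dot u u + dot v v).
Proof.
rewrite !dotDl !dotDr !dotNl !dotNr (dotC v u).
by move: (dot u u) (dot u v) (dot v v) => x y z; ring.
Qed.

Lemma inner_polar (A : 'M[R]_n) (k : R) (u v : 'rV[R]_n) : A^T = A -> 0 <= k ->
  (forall w, `|inner A w w| <= k * dot w w) -> `|inner A u v| <= k * (enorm u * enorm v).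
Proof.
move=> As k0 H.
have [->|u0] := eqVneq u 0; first by rewrite inner0l enorm0 mul0r mulr0 normr0.
have [->|v0] := eqVneq v 0.
  by rewrite (inner_sym u 0 As) inner0l enorm0 !mulr0 normr0.
have eu := enorm_gt0 u0; have ev := enorm_gt0 v0.
have polar a b : inner A a b = (inner A (a + b) (a + b) - inner A (a - b) (a - b)) / 4.
  have -> : a - b = a + (-1) *: b by rewrite scaleN1r. rewrite !innerDl !innerDr !innerZl !innerZr (inner_sym b a As).
  by move: (inner A a a) (inner A a b) (inner A b b) => x y z; field.
pose a := (enorm u)^-1 *: u; pose b := (enorm v)^-1 *: v.
have unit1 w : w != 0 -> dot ((enorm w)^-1 *: w) ((enorm w)^-1 *: w) = 1.
  by move=> /enorm_gt0 w0; rewrite dotZl dotZr -sqr_enorm; field; rewrite gt_eqF.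
have ab : `|inner A a b| <= k.
  have h1 := H (a + b); have h2 := H (a - b).
  have par : dot (a + b) (a + b) + dot (a - b) (a - b) = 4 by rewrite parallelogram (unit1 _ _ u u0) (unit1 _ _ v v0); ring.
  rewrite polar normrM (ger0_norm (_ : 0 <= 4^-1)) ?invr_ge0// ler_pdivrMr//.
  apply: le_trans (ler_normB _ _) _; apply: le_trans (lerD h1 h2) _. by rewrite -mulrDr par.
have -> : inner A u v = enorm u * enorm v * inner A a b by rewrite innerZl innerZr; field; rewrite !gt_eqF.
by rewrite normrM (ger0_norm (mulr_ge0 (ltW eu) (ltW ev))) mulrC ler_wpM2r// mulr_ge0// ltW.
Qed.

Lemma quad_le (A : 'M[R]_n) (w : 'rV[R]_n) : `|inner A w w| <= n%:R ^+ 2 * `|A| * dot w w.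
Proof.
rewrite inner_sumE; apply: le_trans (ler_norm_sum _ _ _) _.
apply: (@le_trans _ _ (\sum_(i < n) n%:R * (`|A| * dot w w))); last first.
  by rewrite sumr_const card_ord -[_ *+ n]mulr_natl !mulrA -expr2.
apply: ler_sum => i _; apply: le_trans (ler_norm_sum _ _ _) _.
apply: (@le_trans _ _ (\sum_(j < n) `|A| * dot w w)); last by rewrite sumr_const card_ord -[_ *+ n]mulr_natl.
apply: ler_sum => j _; rewrite !normrM.
have h1 := coord_le_enorm w i; have h2 := coord_le_enorm w j; have h3 := mx_entry_le A i j.
rewrite -sqr_enorm expr2; apply: (@le_trans _ _ (enorm w * `|A| * enorm w)).
  by rewrite ler_pM// ?mulr_ge0// ler_pM.
by rewrite -mulrA mulrCA.
Qed.

End QuadraticForms.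

Section RadialChristoffel.
Context R n (G : 'rV[R]_n -> 'M[R]_n) (rho kappa : R).
Hypothesis nG : normal_metric rho kappa G.

Lemma gauss_dmx x i : eball rho x -> x *m dmx i G x = delta_mx 0 i - row i (G x).
Proof.
case: nG => sG Gs Gp G0 Gg _ xB.
have oB : open (@eball R n rho) := @open_eball0 R n rho.
have := @dmx_eq _ _ (eball rho) oB _ _ (fun y => y *m G y) (fun y => y) i x xB.
move=> /(_ (fun y yB => gauss sG Gs Gp G0 Gg yB)).
rewrite (dmxM oB i (@smooth_mx_id _ _ _ oB) sG xB) dmx_id -rowE => <-.
by rewrite addrC addKr.
Qed.

(* The lowered Christoffel symbols contracted twice with w and once with the
   position vector, by differentiating x G(x) = x. *)
Lemma dot_chr x w : eball rho x ->
  dot x (chr G x w) = dot w w - inner (G x) w w - 2^-1 * inner (Dr G x) w w.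
Proof.
move=> xB; case: (nG) => sG Gs Gp G0 Gg _; have xG := gauss sG Gs Gp G0 Gg xB.
have E i j : \sum_l dmx i G x j l * x 0 l = (i == j)%:R - G x i j.
  have /rowP/(_ j) := gauss_dmx i xB; rewrite !mxE eq_sym => <-. apply: eq_bigr => l _; rewrite mulrC; congr (_ * _).
  rewrite !dmxE; apply: partial_near; apply: (open_eq_near (@open_eball0 R n rho) xB) => y yB. by rewrite -[in LHS](Gs y yB) mxE.
have e2 i j : \sum_l lowmx G i x j l * x 0 l = (i == j)%:R - G x i j - 2^-1 * Dr G x i j.
  have -> : \sum_l lowmx G i x j l * x 0 l = 2^-1 * (\sum_l dmx i G x j l * x 0 l + \sum_l dmx j G x i l * x 0 l - \sum_l x 0 l * dmx l G x i j).
    rewrite -big_split -sumrB mulr_sumr; apply: eq_bigr => l _. rewrite lowmxE !dmxE /=.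
    by move: (partial _ _ _) (partial _ _ _) (partial _ _ _) => a b c; ring.
  have -> : \sum_l x 0 l * dmx l G x i j = Dr G x i j by rewrite /Dr summxE; apply: eq_bigr => l _; rewrite mxE.
  rewrite !E (eq_sym j i) (_ : G x j i = G x i j); last by rewrite -[in LHS](Gs x xB) mxE.
  by move: ((i == j)%:R - G x i j) (Dr G x i j) => a b; field.
have -> : dot x (chr G x w) = \sum_i \sum_j w 0 i * w 0 j * \sum_l lowmx G i x j l * x 0 l.
  rewrite -{1}xG dotC (_ : dot _ _ = dot (chr G x w *m G x) x); last first.
    by rewrite dotC -innerE (inner_sym _ _ (Gs x xB)) innerE.
  rewrite /chr -mulmxA mulmx_suml /dot.
  have -> : \sum_i (w *m \sum_i0 (w 0 i0 *: Gam G i0 x) *m G x) 0 i * x 0 i =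
     \sum_l \sum_i \sum_j w 0 i * w 0 j * (lowmx G i x j l * x 0 l).
    apply: eq_bigr => l _; rewrite mxE mulr_suml exchange_big /=; apply: eq_bigr => j _.
    rewrite summxE mulr_sumr mulr_suml; apply: eq_bigr => i _.
    rewrite -scalemxAl (Gam_mul i (Gs x xB) (posdef_unitmx (Gp x xB))) mxE. by move: (lowmx _ _ _ _ _) => a; ring.
  rewrite exchange_big /=; apply: eq_bigr => i _; rewrite exchange_big /=. by apply: eq_bigr => j _; rewrite mulr_sumr.
have -> : dot w w = \sum_i \sum_j w 0 i * w 0 j * (i == j)%:R.
  rewrite /dot; apply: eq_bigr => i _; rewrite (bigD1 i)//= eqxx mulr1 big1 ?addr0// => j ji. by rewrite eq_sym (negbTE ji) mulr0.
rewrite !inner_sumE mulr_sumr -!sumrB; apply: eq_bigr => i _; rewrite mulr_sumr -!sumrB.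
apply: eq_bigr => j _; rewrite e2.
by move: (G x i j) (Dr G x i j) (_%:R) => a b c; ring.
Qed.

End RadialChristoffel.

(** Here [d] and [g] are the squared lengths of one vector in the Euclidean norm and in the metric.
    Smallness gives [d <= 2 * g] and [1 + G1 <= 2], so the constant is 32 times 2 times 2. *)
Lemma arith_hess R (n' K E G1 d g : R) : 1 <= n' -> 0 <= K -> 512 * n' ^+ 4 * K <= 1 ->
  0 <= E <= 32 * n' * K -> 0 <= G1 <= 64 * n' ^+ 2 * K -> `|d - g| <= n' ^+ 2 * G1 * d -> 0 <= d -> 0 <= g ->
  n' ^+ 2 * (n' * (E * (1 + G1))) * d <= 128 * n' ^+ 4 * K * g.
Proof.
move=> n1 K0 sm /andP[E0 E1] /andP[g0 g1] dg d0 gg.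
have n0 : 0 <= n' by apply: le_trans n1.
have a1 : n' ^+ 2 * G1 <= 2^-1.
  have h : n' ^+ 2 * G1 <= n' ^+ 2 * (64 * n' ^+ 2 * K) by rewrite ler_wpM2l// exprn_ge0.
  apply: le_trans h _; rewrite (_ : n' ^+ 2 * (64 * n' ^+ 2 * K) = 64 * n' ^+ 4 * K); last by ring.
  by move: sm; move: (n' ^+ 4) => m; lra.
have n2 : 1 <= n' ^+ 2 by rewrite expr_ge1.
have a2 : G1 <= 1 by apply: le_trans (_ : n' ^+ 2 * G1 <= 1); [rewrite ler_peMl|apply: le_trans a1 _; lra].
have a3 : n' ^+ 2 * G1 * d <= 2^-1 * d by rewrite ler_wpM2r.
have a4 : d <= 2 * g by move: dg; rewrite ler_norml => /andP[_]; move: a3 gg; clear; lra.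
have b1 : E * (1 + G1) <= 32 * n' * K * 2 by rewrite ler_pM// ?addr_ge0//; lra.
have b2 : n' * (E * (1 + G1)) <= n' * (32 * n' * K * 2) by rewrite ler_wpM2l.
have b3 : n' ^+ 2 * (n' * (E * (1 + G1))) <= n' ^+ 2 * (n' * (32 * n' * K * 2)) by rewrite ler_wpM2l// exprn_ge0.
have b4 : 0 <= n' ^+ 2 * (n' * (E * (1 + G1))) by rewrite !mulr_ge0// ?exprn_ge0// addr_ge0.
apply: le_trans (ler_pM b4 d0 b3 a4) _; rewrite le_eqVlt; apply/orP; left; apply/eqP; ring.
Qed.

Section SquareDifferences.
Variable R : realType.
Implicit Types u a t w x y : R.

Lemma sqr_diff_up u a t w : u ^+ 2 <= (a + t * w) ^+ 2 -> u ^+ 2 - a ^+ 2 <= t * (a * w + w ^+ 2 / 2 * t) * 2.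
Proof.
have -> : t * (a * w + w ^+ 2 / 2 * t) * 2 = (a + t * w) ^+ 2 - a ^+ 2 by field.
by rewrite lerD2r.
Qed.

Lemma sqr_diff_lo u a t : u ^+ 2 <= ((1 - t) * a) ^+ 2 -> u ^+ 2 - a ^+ 2 <= t * (- a ^+ 2 + a ^+ 2 / 2 * t) * 2.
Proof.
have -> : t * (- a ^+ 2 + a ^+ 2 / 2 * t) * 2 = ((1 - t) * a) ^+ 2 - a ^+ 2 by field.
by rewrite lerD2r.
Qed.

Lemma small3 u x : 1 <= u -> 0 <= x -> 512 * u ^+ 4 * x <= 1 -> 128 * u ^+ 3 * x * 2 ^+ 2 <= 1.
Proof.
move=> u1 x0; apply: le_trans.
rewrite (_ : 128 * u ^+ 3 * x * 2 ^+ 2 = 512 * (u ^+ 3 * x)); last by ring.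
have h : u ^+ 3 <= u ^+ 4 by exact: ler_weXn2l.
by have := ler_wpM2r x0 h; move: (u ^+ 3 * x) => y; rewrite -mulrA; move: (u ^+ 4 * x) => z; lra.
Qed.

Lemma taylor_fold (f' f a b v e t : R) :
  f' <= - a + (v + e * v) * t -> f <= b + - a * t + (v + e * v) * t ^+ 2 / 2 ->
  - a + (v - e * v) * t <= f' -> b + - a * t + (v - e * v) * t ^+ 2 / 2 <= f ->
  `|f' + a - v * t| <= e * v * t /\ `|f - b + a * t - v * t ^+ 2 / 2| <= e * v * t ^+ 2 / 2.
Proof.
move: (t ^+ 2) => t2; rewrite !mulNr !mulrDl !mulNr !ler_norml.
move: (a * t) (v * t) (v * t2) (e * v * t) (e * v * t2) => at' vt vt2 et et2 h1 h2 h3 h4.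
by split; itv_lra.
Qed.

Lemma cos_fold (h a b c e : R) : `|h - a / 2 + c - b / 2| <= e * b / 2 ->
  `|h - (a - c - (c - b)) / 2| <= e * b / 2.
Proof. by rewrite (_ : h - (a - c - (c - b)) / 2 = h - a / 2 + c - b / 2)//; field. Qed.

Lemma small1 u x : 1 <= u -> 0 <= x -> 512 * u ^+ 4 * x <= 1 -> 128 * u ^+ 4 * x <= 1.
Proof. by move=> u1 x0; apply: le_trans; rewrite -!mulrA ler_pM// ?mulr_ge0 ?exprn_ge0// ?(le_trans _ u1)// ler_nat. Qed.

Lemma quad_le2 (q d e : R) : e <= 1 -> 0 <= d -> `|q - d| <= e * d -> `|q| <= 2 * d.
Proof.
move=> e1 d0; have ed : e * d <= d by rewrite ler_piMl.
rewrite ler_distl ler_norml => /andP[h1 h2].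
by apply/andP; split; move: h1 h2; move: (e * d) ed => x; lra.
Qed.

Lemma neg_sum u x y : u <= - x -> y <= x -> y + u + (u + x) <= 0. Proof. lra. Qed.

End SquareDifferences.

Section RayFunctions.
Context R n (M : riemannianManifold R n) (r kappa : R) (nc : M -> param M).
Hypotheses (r0 : 0 < r) (NA : normal_atlas r kappa nc) (cM : connected [set: M]).
Hypotheses (kappa0 : 0 <= kappa) (small : 512 * n%:R ^+ 4 * kappa <= 1) (n_gt0 : (0 < n)%N).
Local Notation ud := (ud r).

Lemma nc_chr x y v : enorm y < 2 -> chr (fun z => (r ^+ 2)^-1 *: pmet (nc x) z) y v = chr (pmet (nc x)) y v.
Proof.
move=> y2; have a0 : (r ^+ 2)^-1 != 0 by rewrite invr_neq0// expf_neq0// gt_eqF.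
have oU := @open_eball0 R n 2.
have sg : forall i j, smooth_fun (@eball R n 2) (fun z => pmet (nc x) z i j) by rewrite -(na_dom NA x); exact: pmet_smooth.
have gu : forall z, (@eball R n 2) z -> pmet (nc x) z \in unitmx by move=> z z2; apply: pmet_unit; rewrite (na_dom NA).
exact: (chr_scale oU sg a0 gu).
Qed.

Lemma nc_chr_ray x v s : enorm (s *: v) < 2 -> chr (pmet (nc x)) (s *: v) v = 0.
Proof.
move=> sv; rewrite -nc_chr//; case: (na_metric NA x) => sG Gs Gp G0 Gg _.
have [->|s0] := eqVneq s 0.
  rewrite scale0r /chr big1 ?mulmx0// => i _. by rewrite (Gam0 _ sG Gs Gp Gg) ?scaler0// ltr0n.
have := Gg _ sv; rewrite chrZ => /eqP; rewrite scaler_eq0 expf_eq0 (negbTE s0) andbF => /eqP.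
by [].
Qed.

Definition hd (p q : M) := ud p q ^+ 2 / 2.

Lemma hd_in p q : pran (nc p) q -> hd p q = dot (pchart (nc p) q) (pchart (nc p) q) / 2.
Proof. by move=> Pq; rewrite /hd (ud_pchart r0 NA cM Pq) sqr_enorm. Qed.

Lemma hd_smooth p (Q : param M) : smooth_fun (trdom Q (nc p)) (fun y => hd p (ppar Q y)).
Proof.
have oU := @open_trdom _ _ _ Q (nc p).
apply: (@smooth_ext _ _ _ (fun y => (\sum_k tr Q (nc p) y 0 k * tr Q (nc p) y 0 k) * 2^-1)) => //.
  by move=> y [_ yp]; rewrite hd_in.
apply: smooth_mul => //; last exact: smooth_cst.
by apply: smooth_sum => // k; apply: smooth_mul => //; exact: smooth_tr.
Qed.

Definition rayf (p x : M) (v : 'rV[R]_n) (t : R) := hd p (ppar (nc x) (t *: v)).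

Lemma ray_trdom p x y : enorm y < 2 -> ud p (ppar (nc x) y) < 2 -> trdom (nc x) (nc p) y.
Proof.
by move=> y2 h; split; [rewrite (na_dom NA)|exact: (ud_lt2 r0 NA cM h)].
Qed.

Definition raytr (p x : M) (v : 'rV[R]_n) (t : R) := tr (nc x) (nc p) (t *: v).

Lemma raytr_derive p x v (t : R) : trdom (nc x) (nc p) (t *: v) ->
  derivable (raytr p x v) t 1 /\ derive1 (raytr p x v) t = v *m jac (tr (nc x) (nc p)) (t *: v).
Proof.
move=> tU; have [d e] := derive1_ray v t.
have [d1 e1] := derive1_comp_smooth (@open_trdom _ _ _ (nc x) (nc p)) (@smooth_tr _ _ _ (nc x) (nc p)) d tU.
split; first exact: d1.
by apply: etrans e1 _; rewrite e.
Qed.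

Lemma near_ray (U : set 'rV[R]_n) v (t : R) : open U -> U (t *: v) -> \forall s \near t, U (s *: v).
Proof.
move=> oU Ut; have [d _] := derive1_ray v t.
by apply: (derivable_continuous d); exact: open_nbhs_nbhs.
Qed.

(** A ray from [x] seen in the normal coordinates at [p] is no longer straight, but it is still a
    geodesic; this computes the second derivative of the squared distance to [p] along it. *)
Lemma raytr_geo p x v (t : R) : trdom (nc x) (nc p) (t *: v) -> geo_eq (pmet (nc p)) (raytr p x v) t.
Proof.
move=> tU; have oU := @open_trdom _ _ _ (nc x) (nc p).
have d1 : derive1 (fun s : R => s *: v) = cst v by apply/funext => s; have [_ ->] := derive1_ray v s.
apply: (@geo_eq_push _ _ (trdom (nc x) (nc p)) (pdom (nc p)) (pmet (nc p)) (tr (nc x) (nc p)) (fun s : R => s *: v) t oU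
  (open_pdom (nc p)) (@smooth_tr _ _ _ (nc x) (nc p)) (fun y yU => pchart_dom yU.2) (@pmet_smooth _ _ _ (nc p))
  (fun y => @pmet_sym _ _ _ (nc p) y) (fun y => @pmet_unit _ _ _ (nc p) y)
  (fun y => @jac_tr_unit _ _ _ (nc x) (nc p) y) tU).
apply: filterS (near_ray oU tU) => s sU; split.
- exact: (derive1_ray v s).1.
- rewrite d1; exact: derivable_cst.
rewrite d1 derive1_cst add0r -(@chr_eq _ _ _ (pmet (nc x)) _ _ _ oU sU).
  by apply: nc_chr_ray; have := sU.1; rewrite (na_dom NA).
by move=> y yU; rewrite (pmet_tr yU).
Qed.

Lemma rayf_d1 p x v (t : R) : trdom (nc x) (nc p) (t *: v) ->
  is_derive t 1 (rayf p x v) (dot (raytr p x v t) (derive1 (raytr p x v) t)).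
Proof.
move=> tU; have oU := @open_trdom _ _ _ (nc x) (nc p); have [d _] := raytr_derive tU.
have n1 : \forall s \near t, 2^-1 * dot (raytr p x v s) (raytr p x v s) = rayf p x v s.
  by apply: filterS (near_ray oU tU) => s [_ sU]; rewrite /rayf hd_in// mulrC.
have h := is_derive_dot d d.
have h2 : is_derive t 1 (fun s => 2^-1 * dot (raytr p x v s) (raytr p x v s))
   (2^-1 * (dot (derive1 (raytr p x v) t) (raytr p x v t) + dot (raytr p x v t) (derive1 (raytr p x v) t))).
  have -> : (fun s => 2^-1 * dot (raytr p x v s) (raytr p x v s)) = 2^-1 \*: (fun s => dot (raytr p x v s) (raytr p x v s)) by apply/funext.
  exact: is_deriveZ.
apply: (is_derive_eq (near_eq_is_derive n1 h2)).
by rewrite (dotC (derive1 _ _)); move: (dot _ _) => a; field.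
Qed.

Lemma speed_raytr p x v (t : R) : trdom (nc x) (nc p) (t *: v) ->
  inner ((r ^+ 2)^-1 *: pmet (nc p) (raytr p x v t)) (derive1 (raytr p x v) t) (derive1 (raytr p x v) t) = dot v v.
Proof.
move=> tU; have [_ ->] := raytr_derive tU; rewrite inner_scale -(inner_pmet_tr _ _ tU) -inner_scale.
by apply: (nc_radial2 NA); have := tU.1; rewrite (na_dom NA).
Qed.

(** The second derivative is [|z'|^2 - z . chr(z', z')] for the ray [z] in the coordinates at [p].
    By [dot_chr] it differs from the squared speed [dot v v] by the quadratic form of [Emx G] only,
    and [Emx_le], [metric_le] apply with [|z|^2 <= 4]. *)
Lemma rayf_d2 p x v (t : R) : trdom (nc x) (nc p) (t *: v) ->
  exists2 dd, is_derive t 1 (derive1 (rayf p x v)) dd & `|dd - dot v v| <= 128 * n%:R ^+ 4 * kappa * dot v v.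
Proof.
move=> tU; have oU := @open_trdom _ _ _ (nc x) (nc p); have [d _] := raytr_derive tU.
have [dz dz2 ez] := raytr_geo tU; set z := raytr p x v in dz dz2 ez d *.
have n1 : \forall s \near t, dot (z s) (derive1 z s) = derive1 (rayf p x v) s.
  by apply: filterS (near_ray oU tU) => s sU; have [_ h] := rayf_d1 sU; apply: esym; rewrite derive1E; exact: h.
exists (dot (derive1 z t) (derive1 z t) + dot (z t) (derive1 (derive1 z) t)).
  exact: (near_eq_is_derive n1 (is_derive_dot dz dz2)).
have sp := speed_raytr tU; rewrite -/z in sp.
have zB : eball 2 (z t) by have := pchart_dom tU.2; rewrite (na_dom NA).
have -> : derive1 (derive1 z) t = - chr (pmet (nc p)) (z t) (derive1 z t) by move/eqP: ez; rewrite addr_eq0 => /eqP.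
rewrite dotNr -nc_chr// (dot_chr (na_metric NA p) _ zB) sp.
move: (derive1 z t) sp => w sp.
case: (na_metric NA p) => sG Gs Gp G0 Gg Gc; set G := (fun z => _) in sG Gs Gp G0 Gg Gc sp *.
have n1' : (1 : R) <= n%:R by rewrite ler1n.
have sm := small3 n1' kappa0 small.
have h2 : (0 : R) < 2 by [].
have E1 := Emx_le h2 sG Gs Gp G0 Gg kappa0 Gc sm zB.
have G1 := metric_le h2 sG Gs Gp G0 Gg kappa0 Gc sm zB.
have zz : dot (z t) (z t) <= 4.
  rewrite -sqr_enorm (_ : 4 = 2 ^+ 2 :> R); last by rewrite -natrX. by rewrite ler_pXn2r ?nnegrE ?enorm_ge0// ltW.
have EG := Emx_mulG sG Gs Gp G0 Gg zB.
have -> : dot w w - (dot w w - dot v v - 2^-1 * inner (Dr G (z t)) w w) - dot v v = inner (Emx G (z t) *m G (z t)) w w.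
  by rewrite EG inner_scale; move: (dot w w) (dot v v) (inner _ w w) => a b c; clear; ring.
apply: le_trans (quad_le _ _) _.
have q := quad_le (G (z t) - 1%:M) w.
have iB : inner (G (z t) - 1%:M) w w = dot v v - dot w w by rewrite innerE mulmxBr mulmx1 dotBl -innerE sp.
rewrite iB distrC in q.
have E2 : 0 <= `|Emx G (z t)| <= 32 * n%:R * kappa.
  rewrite normr_ge0 /=; apply: le_trans E1 _. have := ler_wpM2l (_ : 0 <= 8 * n%:R * kappa) zz; rewrite !mulr_ge0// => /(_ isT) h.
  by apply: le_trans h _; rewrite le_eqVlt; apply/orP; left; apply/eqP; ring.
have G2 : 0 <= `|G (z t) - 1%:M| <= 64 * n%:R ^+ 2 * kappa.
  rewrite normr_ge0 /=; apply: le_trans G1 _.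
  have := ler_wpM2l (_ : 0 <= 16 * n%:R ^+ 2 * kappa) zz; rewrite !mulr_ge0// ?exprn_ge0// => /(_ isT) h.
  by apply: le_trans h _; rewrite le_eqVlt; apply/orP; left; apply/eqP; ring.
apply: le_trans (arith_hess n1' kappa0 small E2 G2 q (dot_ge0 w) (dot_ge0 v)).
rewrite ler_wpM2r ?dot_ge0// ler_wpM2l ?exprn_ge0//.
apply: le_trans (mx_norm_mul _ _) _; rewrite -mulrA ler_wpM2l// ler_wpM2l//.
have e : G (z t) = 1%:M + (G (z t) - 1%:M) by rewrite addrC subrK.
rewrite [X in `|X| <= _]e; apply: le_trans (ler_normD _ _) _; rewrite lerD2r.
by apply: mx_norm_le => // i j; rewrite mxE; case: eqP => _; rewrite ?normr1 ?normr0.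
Qed.

(** The inverse exponential of [p] at [x]; by [rayf_grad] it is minus the gradient at [x] of half
    the squared distance to [p]. *)
Definition ngrad (p x : M) := pchart (nc x) p.

Lemma enorm_ngrad (p x : M) : ud x p < 2 -> enorm (ngrad p x) = ud x p.
Proof. by move=> /(ud_lt2 r0 NA cM) h; rewrite (ud_pchart r0 NA cM h). Qed.

Lemma trdom0 (p x : M) (v : 'rV[R]_n) : ud x p < 2 -> trdom (nc x) (nc p) ((0 : R) *: v).
Proof.
move=> h; apply: ray_trdom; rewrite scale0r ?enorm0//.
by rewrite (na_0 NA) (ud_sym r p x).
Qed.

Lemma rayf0 (p x : M) (v : 'rV[R]_n) : ud x p < 2 -> rayf p x v 0 = enorm (ngrad p x) ^+ 2 / 2.
Proof. by move=> h; rewrite /rayf scale0r (na_0 NA) enorm_ngrad// /hd (ud_sym r p x). Qed.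

(** The first variation formula from the triangle inequality alone. Let [b] be the gradient and
    [a = ngrad p x]. Moving in any direction [w] raises the distance at most by the length, so
    [b . w <= |a| |w|]; moving towards [p] lowers it, so [b . a <= - |a|^2]. Then
    [|b + a|^2 <= 0]. *)
Lemma rayf_grad (p x : M) (v : 'rV[R]_n) : ud x p < 2 ->
  is_derive (0 : R) 1 (rayf p x v) (- dot (ngrad p x) v).
Proof.
move=> h; set a := ngrad p x; have ea : enorm a = ud x p := enorm_ngrad h.
pose b := raytr p x 0 0 *m (jac (tr (nc x) (nc p)) 0)^T.
have db w : is_derive (0 : R) 1 (rayf p x w) (dot b w).
  have tU := trdom0 w h; apply: is_derive_eq (rayf_d1 tU) _. have [_ ->] := raytr_derive tU; rewrite scale0r.
  have -> : raytr p x w 0 = raytr p x 0 0 by rewrite /raytr !scale0r. by rewrite dot_mulmxr.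
have small_ray (w : 'rV[R]_n) : exists2 d : R, 0 < d & forall t : R, 0 < t < d -> enorm (t *: w) < 2.
  exists (enorm w + 1)^-1; first by rewrite invr_gt0 ltr_wpDl ?enorm_ge0. have w1 : 0 < enorm w + 1 by rewrite ltr_wpDl ?enorm_ge0.
  move=> t /andP[t0]; rewrite -div1r ltr_pdivlMr// => ht.
  rewrite enormZ gtr0_norm//; apply: le_lt_trans (_ : t * (enorm w + 1) < 2).
    by rewrite ler_pM2l// lerDl.
  by apply: lt_trans ht _; rewrite ltr1n.
have up w : dot b w <= enorm a * enorm w.
  have [d d0 Hd] := small_ray w. apply: (@derive_le_right R (rayf p x w) _ _ (enorm w ^+ 2 / 2) d (db w) d0) => t td.
  have tw := Hd t td; case/andP: td => t0 _. have e : rayf p x w 0 = enorm a ^+ 2 / 2 by exact: rayf0.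
  have tri : ud p (ppar (nc x) (t *: w)) <= enorm a + t * enorm w.
    apply: le_trans (ud_tri r0 NA cM _ x _) _. by rewrite (ud_sym r p x) -ea lerD2l (ud_nc r0 NA cM)// enormZ gtr0_norm.
  rewrite e /rayf /hd -mulrBl ler_pdivrMr//.
  have := lerXn2r 2 (ud_ge0 r0 _ _) (addr_ge0 (enorm_ge0 a) (mulr_ge0 (ltW t0) (enorm_ge0 w))) tri. by apply: sqr_diff_up.
have lo : dot b a <= - enorm a ^+ 2.
  have [d d0 Hd] := small_ray a. have d1 : 0 < Num.min d 1 by rewrite lt_min d0 ltr01.
  apply: (@derive_le_right R (rayf p x a) _ _ (enorm a ^+ 2 / 2) _ (db a) d1) => t.
  rewrite lt_min => /andP[t0 /andP[td t1]]; have ta := Hd t; rewrite t0 td in ta.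
  have e : rayf p x a 0 = enorm a ^+ 2 / 2 by exact: rayf0. have a2 : enorm (1 *: a) < 2 by rewrite scale1r ea.
  have pe : ppar (nc x) (1 *: a) = p by rewrite scale1r; apply: pchartK; exact: (ud_lt2 r0 NA cM).
  have tri : ud p (ppar (nc x) (t *: a)) <= (1 - t) * enorm a.
    have := ud_nc_ray r0 NA x a2 (ta isT); rewrite pe => /le_trans; apply. by rewrite distrC ger0_norm// subr_ge0 ltW.
  rewrite e /rayf /hd -mulrBl ler_pdivrMr//. have t10 : 0 <= 1 - t by rewrite subr_ge0 ltW.
  have := lerXn2r 2 (ud_ge0 r0 _ _) (mulr_ge0 t10 (enorm_ge0 a)) tri. by apply: sqr_diff_lo.
have b1 : enorm b <= enorm a.
  have [->|b0] := eqVneq b 0; first by rewrite enorm0 enorm_ge0. by have := up b; rewrite -sqr_enorm expr2 ler_pM2r// enorm_gt0.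
have ba : b = - a.
  apply/eqP; rewrite -addr_eq0; apply/eqP/dot_eq0/eqP; rewrite eq_le dot_ge0 andbT. rewrite dotDl !dotDr (dotC a b) -!sqr_enorm.
  have := lerXn2r 2 (enorm_ge0 _) (enorm_ge0 _) b1. by move: lo; apply: neg_sum.
by rewrite -dotNl -ba; exact: db.
Qed.

Lemma ray_in (p x : M) (v : 'rV[R]_n) (t : R) : ud x p + enorm v < 2 -> 0 <= t <= 1 ->
  trdom (nc x) (nc p) (t *: v).
Proof.
move=> h /andP[t0 t1]; have tv : enorm (t *: v) <= enorm v.
  by rewrite enormZ ger0_norm// ler_piMl ?enorm_ge0.
have tv2 : enorm (t *: v) < 2 by apply: le_lt_trans tv (le_lt_trans _ h); rewrite lerDr (ud_ge0 r0).
apply: ray_trdom => //; apply: le_lt_trans (ud_tri r0 NA cM p x _) _.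
by apply: le_lt_trans h; rewrite (ud_nc r0 NA cM)// (ud_sym r p x) lerD2l.
Qed.

Local Notation eps1 := (128 * n%:R ^+ 4 * kappa).

Lemma eps1_ge0 : 0 <= eps1. Proof. by rewrite !mulr_ge0// exprn_ge0. Qed.

Lemma rayf_derive1 (p x : M) (v : 'rV[R]_n) (t : R) : ud x p + enorm v < 2 -> 0 <= t <= 1 ->
  is_derive t 1 (rayf p x v) (derive1 (rayf p x v) t).
Proof.
move=> h t01; have [d _] := rayf_d1 (ray_in h t01).
by apply: DeriveDef => //; rewrite derive1E.
Qed.

Lemma rayf_derive1_0 (p x : M) (v : 'rV[R]_n) : ud x p < 2 -> derive1 (rayf p x v) 0 = - dot (ngrad p x) v.
Proof. by move=> /(rayf_grad v)[_ h]; apply: etrans (derive1E _ _) h. Qed.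

Lemma rayf_derive2 (p x : M) (v : 'rV[R]_n) (t : R) : ud x p + enorm v < 2 -> 0 <= t <= 1 ->
  exists2 dd, is_derive t 1 (derive1 (rayf p x v)) dd & `|dd - dot v v| <= eps1 * dot v v.
Proof. by move=> h t01; exact: (rayf_d2 (ray_in h t01)). Qed.

Lemma ud_lt2_add (p x : M) (v : 'rV[R]_n) : ud x p + enorm v < 2 -> ud x p < 2.
Proof. by apply: le_lt_trans; rewrite lerDl enorm_ge0. Qed.

Lemma rayf_taylor (p x : M) (v : 'rV[R]_n) (t : R) : ud x p + enorm v < 2 -> 0 <= t <= 1 ->
  `|derive1 (rayf p x v) t + dot (ngrad p x) v - dot v v * t| <= eps1 * dot v v * t /\
  `|rayf p x v t - enorm (ngrad p x) ^+ 2 / 2 + dot (ngrad p x) v * t - dot v v * t ^+ 2 / 2|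
    <= eps1 * dot v v * t ^+ 2 / 2.
Proof.
move=> h /andP[t0 t1]; have x2 := ud_lt2_add h.
have d1 (s : R) : 0 <= s <= t -> is_derive s 1 (rayf p x v) (derive1 (rayf p x v) s).
  by move=> /andP[s0 st]; apply: rayf_derive1; rewrite // s0 (le_trans st).
have d2 (s : R) : 0 <= s <= t ->
   exists2 dd, is_derive s 1 (derive1 (rayf p x v)) dd & `|dd - dot v v| <= eps1 * dot v v.
  by move=> /andP[s0 st]; apply: rayf_derive2; rewrite // s0 (le_trans st).
have [|u1 u2] := @taylor2_le R _ _ t (dot v v + eps1 * dot v v) t0 d1.
  by move=> s /d2[dd hd1 hd2]; exists dd => //; rewrite -lerBlDl; apply: le_trans hd2; exact: ler_norm.
have [|l1 l2] := @taylor2_ge R _ _ t (dot v v - eps1 * dot v v) t0 d1.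
  by move=> s /d2[dd hd1 hd2]; exists dd => //; move: hd2; rewrite ler_distl => /andP[].
rewrite rayf_derive1_0// in u1 u2 l1 l2; rewrite rayf0// in u2 l2.
by move: u1 u2 l1 l2; apply: taylor_fold.
Qed.

(** The Taylor formula for the squared distance to [p] along the unit time ray from [x] to [q]. In
    flat space it is an identity; the error is governed by the curvature and by the side from [x] to
    [q]. *)
Lemma cosine_law (p q x : M) : ud x p + ud x q < 2 ->
  `|hd p q - dot (ngrad p x - ngrad q x) (ngrad p x - ngrad q x) / 2| <= eps1 * ud x q ^+ 2 / 2.
Proof.
move=> h; have q2 : ud x q < 2 by apply: le_lt_trans h; rewrite lerDr (ud_ge0 r0).
have eq := enorm_ngrad q2; have h' : ud x p + enorm (ngrad q x) < 2 by rewrite eq.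
have h01 : 0 <= (1 : R) <= 1 by rewrite ler01 lexx.
have [_] := rayf_taylor h' h01.
have -> : rayf p x (ngrad q x) 1 = hd p q by rewrite /rayf scale1r; congr hd; apply: pchartK; exact: (ud_lt2 r0 NA cM).
rewrite expr1n !mulr1 sqr_enorm -eq -sqr_enorm.
rewrite dotBl !dotBr (dotC (ngrad q x) (ngrad p x)) -!sqr_enorm; apply: cos_fold.
Qed.

Section Chart.
Variables (p x : M).
Hypothesis xp : ud x p < 2.

Definition nhd (z : 'rV[R]_n) := hd p (ppar (nc x) z).

Lemma nhd_smooth : smooth_fun (trdom (nc x) (nc p)) nhd.
Proof. exact: hd_smooth. Qed.

Lemma trdom_0 : trdom (nc x) (nc p) 0.
Proof. by have := trdom0 0 xp; rewrite scaler0. Qed.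

Lemma rayf_comp (v : 'rV[R]_n) (t : R) : trdom (nc x) (nc p) (t *: v) ->
  is_derive t 1 (rayf p x v) (\sum_k v 0 k * partial k nhd (t *: v)).
Proof.
move=> tU; have [d e] := derive1_ray v t.
have oU := @open_trdom _ _ _ (nc x) (nc p).
have := is_derive_comp_curve (smooth_diff oU nhd_smooth tU) d.
by rewrite e.
Qed.

Lemma nhd_partial k : partial k nhd 0 = - ngrad p x 0 k.
Proof.
have tU := trdom0 (delta_mx 0 k) xp.
have [_ e1] := rayf_grad (delta_mx 0 k) xp; have [_ e2] := rayf_comp tU.
have := etrans (esym e2) e1; rewrite scale0r dot_delta => <-.
rewrite (bigD1 k)//= big1 ?addr0; first by rewrite mxE !eqxx mul1r.
by move=> j jk; rewrite mxE (negbTE jk) andbF mul0r.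
Qed.

(** In normal coordinates the symbols vanish at the centre, so the coordinate second derivatives
    there form the covariant Hessian. *)
Definition nhess : 'M[R]_n := \matrix_(k, l) partial l (partial k nhd) 0.

Lemma nhess_sym : nhess^T = nhess.
Proof.
apply/matrixP => k l; rewrite !mxE.
exact: (partial_comm _ _ (@open_trdom _ _ _ (nc x) (nc p)) trdom_0 nhd_smooth).
Qed.

Lemma nhess_quad (v : 'rV[R]_n) : `|inner nhess v v - dot v v| <= eps1 * dot v v.
Proof.
have tU := trdom0 v xp; have oU := @open_trdom _ _ _ (nc x) (nc p).
have [dd d1 h] := rayf_d2 tU; suff -> : inner nhess v v = dd by [].
have n1 : \forall s \near (0 : R), \sum_k v 0 k * partial k nhd (s *: v) = derive1 (rayf p x v) s.
  apply: filterS (near_ray oU tU) => s sU; have [_ e] := rayf_comp sU. by apply: esym; apply: etrans (derive1E _ _) e.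
have d2 : is_derive (0 : R) 1 (fun s : R => \sum_k v 0 k * partial k nhd (s *: v))
   (\sum_k v 0 k * \sum_l v 0 l * partial l (partial k nhd) ((0 : R) *: v)).
  have [d e] := derive1_ray v 0.
  have -> : (fun s : R => \sum_k v 0 k * partial k nhd (s *: v)) =
     \sum_k (v 0 k \*: (fun s : R => partial k nhd (s *: v))).
    by apply/funext => s; rewrite fct_sumE.
  apply: is_derive_sum => k; apply: is_deriveZ.
  have := is_derive_comp_curve (smooth_diff oU (smooth_partial k nhd_smooth) tU) d. by rewrite e.
have [_ e1] := near_eq_is_derive n1 d2; have [_ e2] := d1.
rewrite -(etrans (esym e1) e2) inner_sumE; apply: eq_bigr => k _; rewrite mulr_sumr.
by apply: eq_bigr => l _; rewrite mxE scale0r; ring.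
Qed.

Lemma nhess_le (u v : 'rV[R]_n) : `|inner nhess u v| <= 2 * (enorm u * enorm v).
Proof.
apply: inner_polar => //; first exact: nhess_sym.
move=> w; have := nhess_quad w; have n1 : (1 : R) <= n%:R by rewrite ler1n.
have e1 := small1 n1 kappa0 small.
apply: quad_le2 => //; exact: dot_ge0.
Qed.

End Chart.
End RayFunctions.

Local Opaque derivable derive derive1 partial.

(** The error [x] is small relative to [d + s], while the increment [s] is itself at most
    [C * d + x]. Since [e * c <= 2^-1], the [x] hidden in [s] can be absorbed, and the second bound
    in the minimum makes the result at most [e' * d]. *)
Lemma implicit_arith R (c C d s x e e' : R) : 0 < c -> 0 <= C -> 0 <= d -> 0 < e' ->
  e = Num.min (2 * c)^-1 (e' / (c * (2 * C + 2))) ->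
  x <= e * c * (d + s) -> s <= C * d + x -> x <= e' * d.
Proof.
move=> c0 C0 d0 e0 ee hx hs.
have e1 : e * c <= 2^-1.
  have : e <= (2 * c)^-1 by rewrite ee ge_min lexx.
  by move=> h1; apply: le_trans (ler_wpM2r (ltW c0) h1) _; rewrite invfM mulfVK// gt_eqF.
have ep : 0 < e by rewrite ee lt_min invr_gt0 divr_gt0 ?mulr_gt0// ltr_wpDl// mulr_ge0.
have [sd|sd] := leP 0 (d + s); last first.
  apply: le_trans hx _; apply: le_trans (_ : 0 <= _); last by rewrite mulr_ge0// ltW.
  by rewrite mulr_ge0_le0 ?mulr_ge0 ?(ltW ep) ?(ltW c0) ?(ltW sd).
have x2 : x <= 2^-1 * (d + s) by apply: le_trans hx _; rewrite ler_wpM2r.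
have s2 : d + s <= (2 * C + 2) * d by move: x2 hs d0; clear; rewrite mulrDl -mulrA; move: (C * d) => y h1 h2 h3; lra.
apply: le_trans hx _.
have ec : 0 <= e * c by rewrite mulr_ge0 ?ltW.
apply: le_trans (ler_wpM2l ec s2) _; rewrite mulrA ler_wpM2r//.
have : e <= e' / (c * (2 * C + 2)) by rewrite ee ge_min lexx orbT.
by rewrite ler_pdivlMr ?mulr_gt0// ?ltr_wpDl ?mulr_ge0// mulrA.
Qed.

Lemma derive_coord R n (u v : 'rV[R]_n) i : 'D_v (fun y : 'rV[R]_n => y 0 i) u = v 0 i.
Proof.
have := @derive_mx R _ _ _ (@id 'rV[R]_n) u v (@derivable_id _ _ _ _).
by rewrite derive_id => /(congr1 (fun M : 'rV[R]_n => M 0 i)) e; rewrite [RHS]mxE in e.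
Qed.

Lemma open_neq0 R : open [set x : R | x != 0].
Proof.
rewrite (_ : [set x : R | x != 0] = ~` [set 0]); last by apply/seteqP; split=> x /eqP.
apply: closed_openC; apply: accessible_closed_set1; apply: hausdorff_accessible.
exact: norm_hausdorff.
Qed.

(** * Implicit functions and cut-offs *)

Section Implicit.
Context R n (m : nat).

Lemma smooth_expand l (W : set 'rV[R]_l) f x : open W -> smooth_fun W f -> W x ->
  forall e, 0 < e -> \forall h \near (0 : 'rV[R]_l),
    `|f (h + x) - f x - \sum_i h 0 i * partial i f x| <= e * `|h|.
Proof.
move=> oW sf Wx e e0; have [df ef] := C1_is_diff oW Wx (sf 1%N).
have /eqaddoP/(_ e e0) := diff_locally df.
by apply: filterS => h /=; rewrite !fctE opprD addrA ef.
Qed.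

Variables (U : set 'rV[R]_n) (W : set 'rV[R]_(n + m)).
Variables (q : 'rV[R]_(n + m) -> 'rV[R]_m) (h : 'rV[R]_n -> 'rV[R]_m).
Hypotheses (oU : open U) (oW : open W) (sq : smooth_on W q) (ch : continuous_on U h).
Hypotheses (hW : forall u, U u -> W (row_mx u (h u))) (qh : forall u, U u -> q (row_mx u (h u)) = 0).

Definition jacl w : 'M[R]_(n, m) := \matrix_(i, k) partial (lshift m i) (fun w => q w 0 k) w.
Definition jacr w : 'M[R]_m := \matrix_(l, k) partial (rshift n l) (fun w => q w 0 k) w.
Hypothesis hu : forall u, U u -> jacr (row_mx u (h u)) \in unitmx.

(** Here the implicit function is given and continuous, and only its regularity is at stake.
    Linearizing [q] along the graph gives a relation between the two increments, which is solved
    with the inverse of the partial Jacobian. *)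
Lemma implicit_diff u k : U u ->
  is_diff u (fun y => h y 0 k) (fun d => \sum_i d 0 i * (- (jacl (row_mx u (h u)) *m invmx (jacr (row_mx u (h u)))) i k)).
Proof.
move=> Uu; set A := jacl _; set B := jacr _; have Bu : B \in unitmx by exact: hu.
apply: is_diff_row => e' e0.
pose c := m%:R * `|invmx B| + 1; pose C := n%:R * `|A *m invmx B|.
have c0 : 0 < c by rewrite ltr_wpDl// mulr_ge0.
have C0 : 0 <= C by rewrite mulr_ge0.
pose e := Num.min (2 * c)^-1 (e' / (c * (2 * C + 2))).
have ep : 0 < e by rewrite lt_min invr_gt0 divr_gt0 ?mulr_gt0// ltr_wpDl// mulr_ge0.
pose w0 := row_mx u (h u); pose w d := row_mx d (h (d + u) - h u).
have wE d : w d + w0 = row_mx (d + u) (h (d + u)) by rewrite /w /w0 add_row_mx subrK.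
have cw : {for 0, continuous w}.
  have c1 : {for (0 : 'rV[R]_n), continuous (fun d : 'rV[R]_n => d + u)} by apply: (@continuousD R); [exact: cvg_id|exact: cst_continuous].
  have c2 : {for (0 : 'rV[R]_n), continuous (fun d : 'rV[R]_n => h (d + u))}.
    by apply: (@continuous_comp _ _ _ (fun d : 'rV[R]_n => d + u) h); [exact: c1|rewrite add0r; exact: ch].
  apply: continuous_rowP => j; case: (split_ordP j) => i ->.
    rewrite (_ : (fun y => _) = (fun d : 'rV[R]_n => d 0 i)); last by apply/funext => d; rewrite row_mxEl. exact: coord_continuous.
  rewrite (_ : (fun y => _) = (fun d : 'rV[R]_n => h (d + u) 0 i - h u 0 i)); last first.
    by apply/funext => d; rewrite row_mxEr !mxE.
  apply: (@continuousB R R); last exact: cst_continuous. exact: continuous_coord.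
have w00 : w 0 = 0 by rewrite /w add0r subrr row_mx0.
have near1 : \forall d \near (0 : 'rV[R]_n), forall k, `|q (w d + w0) 0 k - q w0 0 k - \sum_i w d 0 i * partial i (fun x => q x 0 k) w0| <= e * `|w d|.
  have H (l : 'I_m) : \forall d \near (0 : 'rV[R]_n), `|q (w d + w0) 0 l - q w0 0 l - \sum_i w d 0 i * partial i (fun x => q x 0 l) w0| <= e * `|w d|.
    have := smooth_expand oW (sq l) (hW Uu) ep; rewrite -w00 => hh; exact: cw hh.
  exact: (@filter_forall _ _ (fun l d => `|q (w d + w0) 0 l - q w0 0 l - \sum_i w d 0 i * partial i (fun x => q x 0 l) w0| <= e * `|w d|) (nbhs (0 : 'rV[R]_n))).
have near2 : \forall d \near (0 : 'rV[R]_n), U (d + u).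
  have c1 : {for (0 : 'rV[R]_n), continuous (fun d : 'rV[R]_n => d + u)} by apply: (@continuousD R); [exact: cvg_id|exact: cst_continuous].
  by apply: c1; rewrite add0r; exact: open_nbhs_nbhs.
apply: filterS2 near1 near2 => d H Ud.
set s := h (d + u) - h u.
have ws : `|w d| <= `|d| + `|s|.
  apply: norm_row_le => [|j]; first by rewrite addr_ge0. case: (split_ordP j) => i ->; rewrite ?row_mxEl ?row_mxEr.
    by apply: le_trans (coord_le_norm _ _) _; rewrite lerDl.
  by apply: le_trans (coord_le_norm _ _) _; rewrite lerDr.
have E1 : `|s *m B + d *m A| <= e * (`|d| + `|s|).
  apply: norm_row_le => [|l]; first by rewrite mulr_ge0 ?addr_ge0// ltW.
  have := H l; rewrite wE !qh// !mxE subrr sub0r normrN big_split_ord /= => h1.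
  have -> : (\sum_j s 0 j * B j l + \sum_j d 0 j * A j l) =
     \sum_(i < n) w d 0 (lshift m i) * partial (lshift m i) (fun x => q x 0 l) w0 +
     \sum_(i < m) w d 0 (rshift n i) * partial (rshift n i) (fun x => q x 0 l) w0.
    rewrite addrC; congr (_ + _); apply: eq_bigr => i _; first by rewrite row_mxEl mxE.
    by rewrite [in RHS]row_mxEr; congr (_ * _); rewrite [LHS]mxE.
  by apply: le_trans h1 _; rewrite ler_wpM2l// ltW.
have E2 : `|s + d *m (A *m invmx B)| <= e * c * (`|d| + `|s|).
  have -> : s + d *m (A *m invmx B) = (s *m B + d *m A) *m invmx B by rewrite mulmxDl mulmxK// mulmxA.
  apply: le_trans (mx_norm_mul _ _) _. apply: (@le_trans _ _ (m%:R * (e * (`|d| + `|s|) * `|invmx B|))).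
    by rewrite -mulrA; apply: ler_wpM2l => //; apply: ler_wpM2r.
  have g0 : 0 <= e * (`|d| + `|s|) by rewrite mulr_ge0 ?addr_ge0// ltW. have cB : m%:R * `|invmx B| <= c by rewrite lerDl.
  have := ler_wpM2l g0 cB; rewrite (_ : m%:R * (e * (`|d| + `|s|) * `|invmx B|) = e * (`|d| + `|s|) * (m%:R * `|invmx B|)); last by ring.
  by rewrite (_ : e * c * (`|d| + `|s|) = e * (`|d| + `|s|) * c)//; ring.
have E3 : `|s| <= C * `|d| + `|s + d *m (A *m invmx B)|.
  have {1}-> : s = - (d *m (A *m invmx B)) + (s + d *m (A *m invmx B)) by rewrite addrC addrK.
  apply: le_trans (ler_normD _ _) _; rewrite lerD2r normrN.
  by apply: le_trans (mx_norm_mul _ _) _; rewrite /C le_eqVlt; apply/orP; left; apply/eqP; ring.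
have := implicit_arith c0 C0 (normr_ge0 d) e0 (erefl e) E2 E3; apply: le_trans.
apply: le_trans (coord_le_norm _ k); rewrite !mxE le_eqVlt; apply/orP; left; apply/eqP; congr (`|_|).
by congr (_ + _); rewrite -sumrN; apply: eq_bigr => i _; rewrite mulrN opprK !mxE.
Qed.

(** The class of functions [g (u, h u)] with [g] smooth near the graph is closed under partial
    derivatives, because the derivative of [h] is a smooth matrix function evaluated on the graph.
    Hence [smooth_coind] applies. *)
Lemma implicit_smooth : smooth_on U h.
Proof.
pose P f := exists g V, [/\ open V, smooth_fun V g, forall u, U u -> V (row_mx u (h u)) &
  f = (fun u => g (row_mx u (h u)))].
move=> k; apply: (@smooth_coind _ _ U P oU); last first.
  exists (fun w => w 0 (rshift n k)), setT; split => //; first exact: openT.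
    exact: (smooth_coord (@openT _)).
  by apply/funext => u; rewrite row_mxEr.
move=> _ [g [V [oV sg hV ->]]].
have dh u l : U u -> differentiable (fun y => h y 0 l) u by move=> Uu; have [] := implicit_diff l Uu.
have dH u : U u -> differentiable (fun y => row_mx y (h y)) u.
  move=> Uu; apply: differentiable_rowP => j; case: (split_ordP j) => i ->.
    rewrite (_ : (fun y => _) = (fun d : 'rV[R]_n => d 0 i)); last by apply/funext => d; rewrite row_mxEl.
    exact: differentiable_coord.
  rewrite (_ : (fun y => _) = (fun d : 'rV[R]_n => h d 0 i)); last by apply/funext => d; rewrite row_mxEr. exact: dh.
split.
  move=> u Uu; apply: differentiable_comp; first exact: dH. by apply: (smooth_diff oV sg); exact: hV.
move=> i; pose D w := \det (jacr w).
have sB : smooth_mx W jacr.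
  move=> a b; rewrite (_ : (fun x => _) = partial (rshift n a) (fun w => q w 0 b)).
    exact/smooth_partial/sq.
  by apply/funext => w; rewrite mxE.
have sA : smooth_mx W jacl.
  move=> a b; rewrite (_ : (fun x => _) = partial (lshift m a) (fun w => q w 0 b)).
    exact/smooth_partial/sq.
  by apply/funext => w; rewrite mxE.
pose V' := V `&` (W `&` D @^-1` [set x | x != 0]).
have oWD : open (W `&` D @^-1` [set x | x != 0]).
  apply: (@open_preimage_on _ R W [set x : R | x != 0] D oW _ (@open_neq0 R)).
  by move=> w Ww; exact: (smooth_continuous (smooth_det oW sB) Ww).
have oV' : open V' by exact: openI.
pose g' w := partial (lshift m i) g w + \sum_l (- (jacl w *m invmx (jacr w)) i l) * partial (rshift n l) g w.
exists (fun u => g' (row_mx u (h u))).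
  exists g', V'; split => //.
    have s1 : smooth_fun V' (partial (lshift m i) g) by apply: (@smooth_sub _ _ V); [move=> w []|exact: smooth_partial].
    apply: (smooth_add oV' s1); apply: (smooth_sum oV') => l; apply: (smooth_mul oV'); last first.
      by apply: (@smooth_sub _ _ V); [move=> w []|exact: smooth_partial].
    apply: smooth_opp => //; apply: smooth_mulmx => //.
      by move=> a b; apply: (@smooth_sub _ _ W) (sA a b) => w [_ []].
    apply: smooth_invmx => //.
      by move=> a b; apply: (@smooth_sub _ _ W) (sB a b) => w [_ []].
    by move=> w [_ [_ d0]]; rewrite unitmxE unitfE.
  move=> u Uu; split; first exact: hV. by split; [exact: hW|have := hu Uu; rewrite unitmxE unitfE].
move=> u Uu; rewrite /g'.
have -> : partial i (fun u => g (row_mx u (h u))) u = \sum_k 'D_(delta_mx 0 i) (fun y => row_mx y (h y) 0 k) u * partial k g (row_mx u (h u)).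
  by apply: derive_comp_row; [apply: (smooth_diff oV sg); exact: hV|exact: dH].
rewrite big_split_ord /=; congr (_ + _).
  have dl j : 'D_(delta_mx 0 i) (fun y => row_mx y (h y) 0 (lshift m j)) u = (delta_mx 0 i : 'rV[R]_n) 0 j.
    rewrite (_ : (fun y => _) = (fun d : 'rV[R]_n => d 0 j)); last by apply/funext => d; rewrite row_mxEl. exact: derive_coord.
  rewrite (bigD1 i)//= big1 ?addr0; first by rewrite dl mxE !eqxx mul1r. by move=> j ji; rewrite dl mxE (negbTE ji) andbF mul0r.
apply: eq_bigr => l _; congr (_ * _).
rewrite (_ : (fun y => _) = (fun d : 'rV[R]_n => h d 0 l)); last by apply/funext => d; rewrite row_mxEr.
have [d1 e1] := implicit_diff l Uu; rewrite deriveE// e1 (bigD1 i)//= big1 ?addr0.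
  by rewrite !mxE !eqxx mul1r.
by move=> j ji; rewrite !mxE (negbTE ji) andbF mul0r.
Qed.

End Implicit.

Section SmoothMapLocal.
Context R n (m : nat) (M : smoothManifold R n) (N : smoothManifold R m) (F : M -> N).

Lemma smooth_map_local : continuous F ->
  (forall p, exists (P : param M) (Q : param N) V, [/\ open V, V `<=` mdom F P Q, pran P p, V (pchart P p) &
     smooth_on V (pchart Q \o F \o ppar P)]) -> smooth_map F.
Proof.
move=> cF H c ac; have cFc : continuous_on (cod c) (F \o bwd c).
  move=> x xc; apply: (@continuous_comp _ _ _ (bwd c) F x); first exact: bwd_continuous. exact: cF.
split => // c' ac' j; apply: smooth_local => x [xc xc'].
have [P [Q [V [oV VF Pp Vp sV]]]] := H (bwd c x).
pose A := trdom (cpar ac) P; have oA : open A := @open_trdom _ _ _ (cpar ac) P.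
pose B := cod c `&` (F \o bwd c) @^-1` dom c'.
have oB : open B by apply: open_preimage_on; [exact: open_cod|exact: cFc|exact: open_dom].
pose C := trdom Q (cpar ac'); have oC : open C := @open_trdom _ _ _ Q (cpar ac').
pose V0 := (A `&` tr (cpar ac) P @^-1` V) `&` B.
have oV0 : open V0.
  apply: openI => //; apply: (@open_preimage_on _ _ A V (tr (cpar ac) P) oA _ oV).
  by move=> y yA; apply/differentiable_continuous/tr_differentiable.
have K y : A y -> ppar P (tr (cpar ac) P y) = bwd c y by move=> [_ yP]; rewrite /tr /= pchartK.
exists V0.
  by split => //; split => //; split => //.
apply: (@smooth_ext _ _ _ (fun y => tr Q (cpar ac') ((pchart Q \o F \o ppar P) (tr (cpar ac) P y)) 0 j)) => //.
  move=> y [[yA yV] [_ yd]]; rewrite /= K//; have [_ /= h] := VF _ yV; rewrite K// in h. by rewrite /tr /= pchartK.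
apply: (@smooth_comp _ _ _ oV0 _ C (fun z => tr Q (cpar ac') z 0 j) (fun y => (pchart Q \o F \o ppar P) (tr (cpar ac) P y))) => //.
- exact: smooth_tr.
- move=> k; apply: (@smooth_comp _ _ _ oV0 _ V (fun z => (pchart Q \o F \o ppar P) z 0 k) (tr (cpar ac) P)) => //.
    move=> l; have h := @smooth_tr _ _ _ (cpar ac) P l. by apply: (@smooth_sub _ _ _ V0 _ _ h) => y [[]].
  by move=> y [[_]].
- move=> y [[yA yV] [_ yd]]; have [_ /= h] := VF _ yV.
  split; first exact: pchart_dom. by rewrite /= pchartK// cpar_ran K.
Qed.

End SmoothMapLocal.

Section Flat.
Variable R : realType.

(** The powers of [x^-1] make the family closed under differentiation up to linear combinations, so
    [smooth_coind] gives the smoothness of [flat 0], the profile of the weights. *)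
Definition flat (k : nat) (x : R) : R := if 0 < x then x^-1 ^+ k * expR (- x^-1) else 0.

Lemma flat_pos k x : 0 < x -> flat k x = x^-1 ^+ k * expR (- x^-1).
Proof. by rewrite /flat => ->. Qed.

Lemma flat_neg k x : x <= 0 -> flat k x = 0.
Proof. by rewrite /flat leNgt => /negbTE ->. Qed.

Lemma flat_ge0 k x : 0 <= flat k x.
Proof.
rewrite /flat; case: ifP => // x0; rewrite mulr_ge0 ?expR_ge0// exprn_ge0// invr_ge0.
exact: ltW.
Qed.

(** One term of the series of [expR x^-1], the one of degree [k.+2], beats the power and leaves
    [x ^+ 2]. This gives derivative 0 at the origin. *)
Lemma flat_le k x : flat k x <= (k.+2)`!%:R * x ^+ 2.
Proof.
have [x0|x0] := leP x 0; first by rewrite flat_neg// mulr_ge0// sqr_ge0.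
have xn : 0 < x^-1 by rewrite invr_gt0.
rewrite flat_pos// expRN ler_pdivrMr ?expR_gt0//.
have h : x^-1 ^+ k.+2 / (k.+2)`!%:R <= expR x^-1 by apply: le_trans (expR_ge1Dxn k.+1 (ltW xn)); rewrite lerDr.
rewrite -[_ * x ^+ 2 * _]mulrA mulrC -ler_pdivrMr// mulrC.
have -> : x^-1 ^+ k = x ^+ 2 * x^-1 ^+ k.+2.
  have -> : x^-1 ^+ k.+2 = x^-1 ^+ 2 * x^-1 ^+ k by rewrite -exprD. by rewrite mulrA -exprMn mulfV ?gt_eqF// expr1n mul1r.
by rewrite mulrCA ler_wpM2l ?sqr_ge0// mulrC.
Qed.

Lemma flat0_le1 x : flat 0 x <= 1.
Proof.
have [x0|x0] := leP x 0; first by rewrite flat_neg.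
by rewrite flat_pos// expr0 mul1r expR_le1 oppr_le0 invr_ge0 ltW.
Qed.

Lemma flat2_le2 x : flat 2 x <= 2.
Proof.
have [x0|x0] := leP x 0; first by rewrite flat_neg.
have xn : 0 < x^-1 by rewrite invr_gt0.
rewrite flat_pos// expRN ler_pdivrMr ?expR_gt0//.
have h : x^-1 ^+ 2 / 2%:R <= expR x^-1 by apply: le_trans (expR_ge1Dxn 1 (ltW xn)); rewrite lerDr.
by rewrite mulrC -ler_pdivrMr.
Qed.

Lemma flat0_mono x y : x <= y -> flat 0 x <= flat 0 y.
Proof.
move=> xy; have [x0|x0] := leP x 0; first by rewrite flat_neg// flat_ge0.
have y0 := lt_le_trans x0 xy; rewrite !flat_pos// !expr0 !mul1r ler_expR lerN2.
by rewrite lef_pV2.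
Qed.

Lemma is_derive_flat k (x : R) : is_derive x 1 (flat k) (flat k.+2 x - k%:R * flat k.+1 x).
Proof.
have [x0|x0|x0] := ltgtP x 0.
- have e : \forall y \near x, cst 0 y = flat k y.
    by apply: filterS (lt_nbhsl x0) => y y0; rewrite flat_neg// ltW.
  rewrite !flat_neg ?(ltW x0)// mulr0 subr0. exact: (near_eq_is_derive e (is_derive_cst (0 : R) x (1 : R))).
- have e : \forall y \near x, y^-1 ^+ k * expR (- y^-1) = flat k y.
    by apply: filterS (lt_nbhsr x0) => y y0; rewrite flat_pos.
  apply: (near_eq_is_derive e); rewrite !flat_pos//. have xn : x != 0 by rewrite gt_eqF.
  have dv : is_derive x (1 : R) (fun y : R => y^-1) (- x ^- 2).
    have := is_deriveV xn (is_derive_id x (1 : R)). by rewrite /GRing.scale /= mulr1.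
  have de := @is_derive1_comp R expR (fun y : R => - y^-1) x _ _ (is_derive_expR _) (is_deriveN dv). have dk := is_deriveX k dv.
  have -> : (fun y : R => y^-1 ^+ k * expR (- y^-1)) = ((fun y : R => y^-1) ^+ k) * (expR \o (fun y : R => - y^-1)).
    by apply/funext => y; rewrite !fctE.
  apply: is_derive_eq (is_deriveM dk de) _. rewrite /GRing.scale /= opprK exprfctE; move: (expR _) => E.
  rewrite -exprVn; move: x^-1 => z; case: k {dk e} => [|k /=].
    by rewrite !expr0; ring.
  by rewrite !exprS -mulr_natl; ring.
rewrite x0 !flat_neg// mulr0 subr0.
have h : (fun h : R => h^-1 *: (flat k (h *: 1 + 0) - flat k 0)) @ 0^' --> (0 : R).
  apply/cvgrPdist_le => e e0. have : \forall h \near (0 : R)^', h != 0 by exact: nbhs_dnbhs_neq.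
  have e1 : 0 < e / (k.+2)`!%:R by rewrite divr_gt0. apply: filterS2 (dnbhs0_le e1) => h he hn.
  rewrite sub0r normrN /GRing.scale /= mulr1 addr0 (@flat_neg k 0)// subr0.
  rewrite normrM normfV (ger0_norm (flat_ge0 _ _)) ler_pdivrMl ?normr_gt0//.
  apply: le_trans (flat_le _ _) _; rewrite -real_normK ?num_real// expr2 mulrCA ler_wpM2l//. by rewrite mulrC -ler_pdivlMr.
apply: DeriveDef; first by apply/cvg_ex; exists 0.
exact: cvg_lim h.
Qed.

Local Transparent partial.

Inductive flat_comb : ('rV[R]_1 -> R) -> Prop :=
| flat_base k : flat_comb (fun z => flat k (z 0 0))
| flat_add f g : flat_comb f -> flat_comb g -> flat_comb (f + g)
| flat_scale a f : flat_comb f -> flat_comb (a \*: f).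

Lemma flat_comb_step f : flat_comb f -> (forall x, setT x -> differentiable f x) /\
  forall i, exists2 g, flat_comb g & forall x, setT x -> g x = partial i f x.
Proof.
elim=> {f}.
- move=> k; have df (z : 'rV[R]_1) : differentiable (fun z : 'rV[R]_1 => flat k (z 0 0)) z.
    apply: (@differentiable_comp _ _ _ _ (fun z : 'rV[R]_1 => z 0 0) (flat k)).
      exact: differentiable_coord.
    by have [d _] := is_derive_flat k (z 0 0); exact/derivable1_diffP.
  split => // i; exists ((fun z : 'rV[R]_1 => flat k.+2 (z 0 0)) + ((- k%:R) \*: (fun z : 'rV[R]_1 => flat k.+1 (z 0 0)))).
    by apply: flat_add; [exact: flat_base|exact/flat_scale/flat_base].
  move=> z _; have [d e] := is_derive_flat k (z 0 0).
  have -> : partial i (fun z : 'rV[R]_1 => flat k (z 0 0)) z = flat k.+2 (z 0 0) - k%:R * flat k.+1 (z 0 0).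
    rewrite /partial deriveE; last exact: df. rewrite (@diff_comp _ _ _ _ (fun z : 'rV[R]_1 => z 0 0) (flat k)); last 2 first.
    - exact: differentiable_coord.
    - exact/derivable1_diffP.
    rewrite /= -[X in 'd (flat k) _ X]deriveE; last exact: differentiable_coord.
    rewrite derive_coord mxE (ord1 i) /= -deriveE; last exact/derivable1_diffP. exact: e.
  by rewrite -[LHS]/(flat k.+2 (z 0 0) + (- k%:R) * flat k.+1 (z 0 0)) mulNr.
- move=> f g ff [df pf] gg [dg pg]; split.
    by move=> x Ux; apply: differentiableD; [exact: df|exact: dg].
  move=> i; have [f' sf' f'E] := pf i; have [g' sg' g'E] := pg i. exists (f' + g'); first exact: flat_add.
  move=> x Ux; rewrite /partial deriveD ?fctE ?f'E ?g'E//.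
    exact/diff_derivable/df.
  exact/diff_derivable/dg.
- move=> a f ff [df pf]; split.
    by move=> x Ux; apply: differentiableZ; exact: df.
  move=> i; have [f' sf' f'E] := pf i. exists (a \*: f'); first exact: flat_scale.
  move=> x Ux; rewrite /partial deriveZ; last exact/diff_derivable/df. by rewrite -[LHS]/(a *: f' x) f'E.
Qed.

Local Opaque partial.

Lemma smooth_flat n (U : set 'rV[R]_n) g k : open U -> smooth_fun U g -> smooth_fun U (fun y => flat k (g y)).
Proof.
move=> oU sg; have s1 : smooth_fun setT (fun z : 'rV[R]_1 => flat k (z 0 0)).
  exact: (smooth_coind (@openT _) flat_comb_step (flat_base k)).
apply: (@smooth_ext _ _ _ (fun y => (fun z : 'rV[R]_1 => flat k (z 0 0)) (const_mx (g y)))) => //.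
  by move=> y _; rewrite /= mxE.
apply: (@smooth_comp _ _ _ oU _ setT (fun z : 'rV[R]_1 => flat k (z 0 0)) (fun y => const_mx (g y))) => //.
  exact: openT.
by move=> j; apply: smooth_ext sg => // y _; rewrite mxE.
Qed.

End Flat.

(** Here [z], [s], [p] are the norms of [U - ut], [U], [u] in [gram_estimate]. Inserting the second
    inequality into the first produces [e * z], which is absorbed since [2 * e <= c]. *)
Lemma gram_arith R (W c z s p q e : R) : 0 <= W -> 0 < c -> 0 <= p -> 0 <= e -> 2 * e <= c ->
  c * z <= e * (p + s) + W * (W / c * e * p) -> s <= z + W / c * p ->
  z <= 2 / c * (1 + W / c + W ^+ 2 / c) * e * p.
Proof.
move=> W0 c0 p0 e0 ec h1 h2.
have h3 : c * z <= e * (p + (z + W / c * p)) + W * (W / c * e * p) by apply: le_trans h1 _; rewrite lerD2r ler_wpM2l// lerD2l.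
have [z0|z0] := leP z 0.
  apply: le_trans z0 _; rewrite !mulr_ge0 ?addr_ge0 ?mulr_ge0 ?invr_ge0 ?W0 ?(ltW c0)//.
have h4 : e * z <= c / 2 * z by rewrite ler_wpM2r ?(ltW z0)//; move: ec; clear; lra.
have -> : 2 / c * (1 + W / c + W ^+ 2 / c) * e * p = (2 * (e * (p + W / c * p) + W * (W / c * e * p))) / c by ring.
rewrite ler_pdivlMr// mulrC; move: h3 h4.
have -> : e * (p + (z + W / c * p)) = e * p + e * z + e * (W / c * p) by ring.
have -> : e * (p + W / c * p) = e * p + e * (W / c * p) by ring.
have -> : c / 2 * z = (c * z) / 2 by ring.
by move: (c * z) (e * z) (e * p) (e * (W / c * p)) (W * _) => t1 t2 t3 t4 t5; lra.
Qed.

(** * Gram matrices of gradients *)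

Section Gram.
Context R n (I : finType) (w : I -> R) (a b : I -> 'rV[R]_n).
Variables (W c eta : R).
Hypotheses (w0 : forall j, 0 <= w j) (sw : \sum_j w j <= W) (c0 : 0 < c) (eta0 : 0 <= eta).
Hypotheses (a1 : forall j, w j != 0 -> enorm (a j) <= 1) (b1 : forall j, w j != 0 -> enorm (b j) <= 1).
Hypothesis gram : forall j k, w j != 0 -> w k != 0 -> `|dot (a j) (a k) - dot (b j) (b k)| <= eta.
Hypothesis la : forall v, c * dot v v <= \sum_j w j * dot (a j) v ^+ 2.
Hypothesis lb : forall v, c * dot v v <= \sum_j w j * dot (b j) v ^+ 2.

Lemma W_ge0 : 0 <= W. Proof. by apply: le_trans sw; apply: sumr_ge0. Qed.

Lemma wsum_le (x : I -> R) (m : R) : 0 <= m -> (forall j, w j != 0 -> `|x j| <= m) ->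
  `|\sum_j w j * x j| <= W * m.
Proof.
move=> m0 H; apply: le_trans (ler_norm_sum _ _ _) _.
apply: (@le_trans _ _ ((\sum_j w j) * m)); last by rewrite ler_wpM2r.
rewrite mulr_suml; apply: ler_sum => j _; have [->|wj] := eqVneq (w j) 0.
  by rewrite !mul0r normr0.
by rewrite normrM (ger0_norm (w0 j)) ler_wpM2l// H.
Qed.

(** The frame operator of the weighted vectors [b]; by [lb] it is bounded below by [c], and its
    inverse produces coefficients expressing any vector through the [b j]. *)
Definition gmx : 'M[R]_n := \sum_j w j *: ((b j)^T *m b j).

Lemma mul_gmx v : v *m gmx = \sum_j (w j * dot (b j) v) *: b j.
Proof.
rewrite mulmx_sumr; apply: eq_bigr => j _; rewrite -scalemxAr mulmxA -scalerA; congr (_ *: _).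
rewrite [v *m _]mx11_scalar mul_scalar_mx; congr (_ *: _).
by rewrite mxE; apply: eq_bigr => k _; rewrite mxE mulrC.
Qed.

Lemma gmx_quad v : inner gmx v v = \sum_j w j * dot (b j) v ^+ 2.
Proof.
rewrite innerE mul_gmx dot_suml; apply: eq_bigr => j _.
by rewrite dotZl; ring.
Qed.

Lemma gmx_unit : gmx \in unitmx.
Proof.
apply: posdef_unitmx => v v0; rewrite gmx_quad.
by apply: lt_le_trans (lb v); rewrite mulr_gt0// dot_gt0.
Qed.

(* The coefficients that express u through the b's transplant u to the a's. *)
Lemma transplant u : exists ut, [/\
  forall j, w j != 0 -> `|dot (a j) ut - dot (b j) u| <= W / c * eta * enorm u,
  enorm ut <= W / c * enorm u &
  `|enorm ut - enorm u| <= (W / c) ^+ 2 * eta * enorm u].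
Proof.
pose beta := u *m invmx gmx.
have ub : beta *m gmx = u by rewrite /beta mulmxKV// gmx_unit.
have bu : c * enorm beta <= enorm u.
  have [->|b0] := eqVneq beta 0; first by rewrite enorm0 mulr0 enorm_ge0.
  have h := lb beta; rewrite -gmx_quad innerE ub -sqr_enorm in h. have := le_trans h (dot_le _ _).
  by rewrite expr2 mulrA ler_pM2r// enorm_gt0.
(* The expansion [u = \sum w j * ck j *: b j] has coefficients at most [enorm u / c]. Any inner
   product with [ut] then differs from the one with [u] by a combination of differences of Gram
   entries. *)
pose ck j := dot (b j) beta.
have ckb j : w j != 0 -> `|ck j| <= enorm u / c.
  move=> wj; apply: le_trans (abs_dot_le _ _) _; rewrite ler_pdivlMr// mulrC. apply: le_trans bu; rewrite ler_pM2l//.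
  by rewrite ler_piMl ?enorm_ge0// b1.
have uE : u = \sum_j (w j * ck j) *: b j by rewrite -mul_gmx ub.
pose ut := \sum_j (w j * ck j) *: a j.
have m0 : 0 <= enorm u / c by rewrite divr_ge0 ?enorm_ge0// ltW.
have WE : W / c * enorm u = W * (enorm u / c) by ring.
have utb : enorm ut <= W / c * enorm u.
  have [->|ut0] := eqVneq ut 0.
    by rewrite enorm0 WE mulr_ge0// W_ge0.
  rewrite -(ler_pM2r (enorm_gt0 ut0)) -expr2 sqr_enorm {1}/ut dot_suml WE. rewrite -mulrA; apply: le_trans (ler_norm _) _.
  rewrite (eq_bigr (fun j => w j * (ck j * dot (a j) ut))); last by move=> j _; rewrite dotZl mulrA.
  apply: wsum_le; first by rewrite mulr_ge0 ?enorm_ge0. move=> j wj; rewrite normrM; apply: ler_pM => //; first exact: ckb.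
  apply: le_trans (abs_dot_le _ _) _; by rewrite ler_piMl ?enorm_ge0// a1.
have close j : w j != 0 -> `|dot (a j) ut - dot (b j) u| <= W / c * eta * enorm u.
  move=> wj; rewrite {1}uE /ut !dot_sumr -sumrB.
  rewrite (eq_bigr (fun k => w k * (ck k * (dot (a j) (a k) - dot (b j) (b k))))); last first.
    by move=> k _; rewrite !dotZr; ring.
  rewrite (_ : W / c * eta * enorm u = W * (enorm u / c * eta)); last by ring. apply: wsum_le; first by rewrite mulr_ge0.
  by move=> k wk; rewrite normrM; apply: ler_pM => //; [exact: ckb|exact: gram].
exists ut; split => //.
have [u0|u0] := eqVneq u 0.
  have ut0 : enorm ut = 0 by apply/eqP; rewrite eq_le enorm_ge0 andbT; apply: le_trans utb _; rewrite u0 enorm0 mulr0.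
  by rewrite ut0 u0 enorm0 subrr normr0 mulr0.
have sq : `|enorm ut ^+ 2 - enorm u ^+ 2| <= (W / c) ^+ 2 * eta * enorm u ^+ 2.
  rewrite !sqr_enorm {1}/ut dot_suml {1}uE dot_suml -sumrB.
  rewrite (eq_bigr (fun k => w k * (ck k * (dot (a k) ut - dot (b k) u)))); last first.
    by move=> k _; rewrite !dotZl; ring.
  rewrite -sqr_enorm (_ : (W / c) ^+ 2 * eta * enorm u ^+ 2 = W * (enorm u / c * (W / c * eta * enorm u))); last by ring.
  apply: wsum_le; last by move=> k wk; rewrite normrM; apply: ler_pM => //; [exact: ckb|exact: close].
  by rewrite !mulr_ge0 ?W_ge0 ?invr_ge0 ?enorm_ge0 ?(ltW c0).
have eu := enorm_gt0 u0.
rewrite -(ler_pM2r eu) -[X in _ <= X]mulrA -expr2; apply: le_trans sq.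
rewrite subr_sqr normrM; apply: ler_wpM2l => //.
by rewrite ger0_norm ?addr_ge0 ?enorm_ge0// lerDr enorm_ge0.
Qed.

Definition gram_cst := 2 / c * (1 + W / c + W ^+ 2 / c) + (W / c) ^+ 2 + W / c.

(** [U] is compared with the transplant [ut] of [u]. Testing the hypothesis against [z = U - ut] and
    using the lower bound [la] shows that [z] has size [eta * enorm u]; the rest is the accuracy of
    [ut]. *)
Lemma gram_estimate u U : 2 * eta <= c ->
  (forall z, `|\sum_j w j * ((dot (a j) U - dot (b j) u) * dot (a j) z)| <= eta * (enorm u + enorm U) * enorm z) ->
  `|enorm U - enorm u| <= gram_cst * eta * enorm u /\
  forall j, w j != 0 -> `|dot (a j) U - dot (b j) u| <= gram_cst * eta * enorm u.
Proof.
move=> ec H; have [ut [h1 h2 h3]] := transplant u.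
have Wc : 0 <= W / c by rewrite divr_ge0 ?W_ge0// ltW.
have eu := enorm_ge0 u.
pose z := U - ut.
have zb : enorm z <= 2 / c * (1 + W / c + W ^+ 2 / c) * eta * enorm u.
  apply: (@gram_arith _ _ _ _ (enorm U)) => //; first exact: W_ge0.
    have [->|z0] := eqVneq z 0.
      have k1 : 0 <= eta * (enorm u + enorm U) by apply: mulr_ge0 => //; rewrite addr_ge0 ?enorm_ge0.
      have k0 : 0 <= W / c * eta * enorm u by apply: mulr_ge0 => //; exact: mulr_ge0. have k2 := mulr_ge0 W_ge0 k0.
      by rewrite enorm0 mulr0 addr_ge0.
    rewrite -(ler_pM2r (enorm_gt0 z0)) -[X in X <= _]mulrA -expr2 sqr_enorm; apply: le_trans (la z) _.
    rewrite (eq_bigr (fun j => w j * ((dot (a j) U - dot (b j) u) * dot (a j) z) +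
        w j * ((dot (b j) u - dot (a j) ut) * dot (a j) z))); last first.
      by move=> j _; rewrite {1}/z expr2 {1}dotBr; ring.
    rewrite big_split /= mulrDl; apply: lerD.
      by apply: le_trans (H z); exact: ler_norm.
    have h4 := @wsum_le (fun j => (dot (b j) u - dot (a j) ut) * dot (a j) z) (W / c * eta * enorm u * enorm z).
    apply: le_trans (ler_norm _) _; rewrite -[X in _ <= X]mulrA; apply: h4.
      by apply: mulr_ge0; rewrite ?enorm_ge0//; apply: mulr_ge0 => //; exact: mulr_ge0.
    move=> j wj; rewrite normrM; apply: ler_pM => //; first by rewrite distrC h1.
    by apply: le_trans (abs_dot_le _ _) _; rewrite ler_piMl ?enorm_ge0// a1.
  have -> : U = z + ut by rewrite subrK. by apply: le_trans (enormD _ _) _; rewrite lerD2l.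
have K1 : 0 <= W / c * eta * enorm u by apply: mulr_ge0 => //; exact: mulr_ge0.
have K2 : 0 <= (W / c) ^+ 2 * eta * enorm u by apply: mulr_ge0 => //; apply: mulr_ge0 => //; exact: exprn_ge0.
have -> : gram_cst * eta * enorm u = 2 / c * (1 + W / c + W ^+ 2 / c) * eta * enorm u +
    (W / c) ^+ 2 * eta * enorm u + W / c * eta * enorm u by rewrite /gram_cst; ring.
split.
  have e1 : `|enorm U - enorm ut| <= enorm z.
    rewrite ler_norml; have -> : U = z + ut by rewrite subrK. rewrite lerBlDr enormD andbT lerNl opprB lerBlDr.
    have {1}-> : ut = (z + ut) - z by rewrite addrC addKr. by apply: le_trans (enormD _ _) _; rewrite enormN addrC.
  have := le_trans (ler_normD (enorm U - enorm ut) (enorm ut - enorm u)) (lerD (le_trans e1 zb) h3).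
  rewrite addrA subrK => h; apply: le_trans h _; rewrite lerDl. exact: K1.
move=> j wj; have e1 : `|dot (a j) U - dot (a j) ut| <= enorm z.
  by rewrite -dotBr; apply: le_trans (abs_dot_le _ _) _; rewrite ler_piMl ?enorm_ge0// a1.
have := le_trans (ler_normD (dot (a j) U - dot (a j) ut) (dot (a j) ut - dot (b j) u)) (lerD (le_trans e1 zb) (h1 j wj)).
rewrite addrA subrK => h; apply: le_trans h _; rewrite lerD2r lerDl.
exact: K2.
Qed.

End Gram.

(** Pigeonhole: in a grid of mesh [h = (30 * n)^-1] two vectors of the same cell differ by less than
    [30^-1] in Euclidean norm. The interval from -1 to 1 meets [60 * n + 1] cells, the last one for
    its right end point. *)
Lemma separated_card R n (I : finType) (A : {set I}) (a : I -> 'rV[R]_n) : (0 < n)%N ->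
  (forall j, j \in A -> enorm (a j) <= 1) ->
  (forall j k, j \in A -> k \in A -> j != k -> 30^-1 <= enorm (a j - a k)) ->
  (#|A| <= (60 * n).+1 ^ n)%N.
Proof.
move=> n0 a1 sep; pose h : R := (30 * n%:R)^-1.
have n0' : (0 : R) < n%:R by rewrite ltr0n.
have h0 : 0 < h by rewrite invr_gt0 mulr_gt0.
pose cell j (i : 'I_n) := Num.truncn ((a j 0 i + 1) / h).
have cellP j i : j \in A -> (cell j i)%:R <= (a j 0 i + 1) / h < (cell j i).+1%:R.
  move=> /a1 aj; apply: truncn_itv; rewrite divr_ge0// ?(ltW h0)//.
  have := le_trans (coord_le_enorm (a j) i) aj; rewrite ler_norml => /andP[+ _]. by rewrite -subr_ge0 opprK.
have cell_le j i : j \in A -> (cell j i < (60 * n).+1)%N.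
  move=> jA; rewrite ltnS -(ler_nat R); have /andP[h1 _] := cellP j i jA. apply: le_trans h1 _; rewrite ler_pdivrMr//.
  rewrite (_ : (60 * n)%:R * h = 2); last by rewrite /h natrM; field; rewrite gt_eqF.
  have := le_trans (coord_le_enorm (a j) i) (a1 j jA); rewrite ler_norml => /andP[_].
  by rewrite (_ : 2 = 1 + 1 :> R) ?lerD2r// -natrD.
pose f j : {ffun 'I_n -> 'I_(60 * n).+1} := [ffun i => inord (cell j i)].
have fi : {in A &, injective f}.
  move=> j k jA kA fjk; apply/eqP; apply: contraT => jk. have e i : cell j i = cell k i.
    have /ffunP/(_ i) := fjk; rewrite !ffunE => /(congr1 val). by rewrite /= !inordK// cell_le.
  have : enorm (a j - a k) < 30^-1.
    apply: le_lt_trans (enorm_le_norm _) _. have -> : 30^-1 = n%:R * h by rewrite /h; field; rewrite gt_eqF.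
    rewrite ltr_pM2l//; apply: le_lt_trans (_ : `|a j - a k| <= \big[Num.max/0]_(i < n) `|a j 0 i - a k 0 i|) _.
      rewrite [leLHS]/Num.Def.normr/= mx_normrE; apply: bigmax_le => [|[i1 i] _] /=.
        by apply: bigmax_ge_id.
      by rewrite (ord1 i1) !mxE; exact: (le_bigmax _ (fun i => `|a j 0 i - a k 0 i|)).
    apply: bigmax_lt => // i _; have /andP[h1 h2] := cellP j i jA; have /andP[h3 h4] := cellP k i kA.
    rewrite -e in h3 h4; move: h1 h2 h3 h4; rewrite -!natr1. rewrite !ler_pdivlMr// !ltr_pdivrMr// mulrDl mul1r.
    by move: ((cell j i)%:R * h) => m h1 h2 h3 h4; rewrite ltr_norml; itv_lra.
  by rewrite ltNge sep.
rewrite -(card_in_imset fi); apply: leq_trans (max_card _) _.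
by rewrite card_ffun !card_ord.
Qed.

(** * Gradients and net points on one manifold *)

Section OneManifold.
Context R n (M : riemannianManifold R n) (r kappa : R) (nc : M -> param M).
Hypotheses (r0 : 0 < r) (NA : normal_atlas r kappa nc) (cM : connected [set: M]).
Hypotheses (kappa0 : 0 <= kappa) (tiny : 128 * n%:R ^+ 4 * kappa <= 2000^-1) (n_gt0 : (0 < n)%N).
Local Notation ud := (@ud R n M r).
Local Notation hd := (@hd R n M r).
Local Notation ngrad := (ngrad nc).

Lemma small_of_tiny : 512 * n%:R ^+ 4 * kappa <= 1.
Proof. by move: tiny; rewrite -!mulrA; move: (n%:R ^+ 4 * kappa) => x; lra. Qed.

Lemma hd_curve (p : M) (gamma : R -> M) (t : R) : ud (gamma t) p < 2 -> {for t, continuous gamma} ->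
  derivable (pchart (nc (gamma t)) \o gamma) t 1 ->
  is_derive t 1 (fun s => hd p (gamma s)) (- dot (ngrad p (gamma t)) (derive1 (pchart (nc (gamma t)) \o gamma) t)).
Proof.
move=> xp ct dz; set x := gamma t in xp dz *; set z := _ \o _ in dz *.
have n1 : \forall s \near t, nhd r nc p x (z s) = hd p (gamma s).
  have := near_dom (open_pran (nc x)) ct (pran_self NA x). by apply: filterS => s sx; rewrite /nhd /z /= pchartK.
have z0 : z t = 0 by exact: (pchart_self NA).
have oU := @open_trdom _ _ _ (nc x) (nc p).
have dq : differentiable (nhd r nc p x) (z t).
  rewrite z0; apply: (smooth_diff oU); first exact: (nhd_smooth r0 NA cM). exact: (trdom_0 r0 NA cM xp).
have d := is_derive_comp_curve dq dz.
apply: is_derive_eq (near_eq_is_derive n1 d) _; rewrite z0 dotC -dotNr /dot.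
by apply: eq_bigr => k _; rewrite (nhd_partial r0 NA cM xp) mxE.
Qed.

(** Away from the centre of the chart the gradient is read in the normal chart at the point itself,
    where [nhd_partial] applies; the Jacobian of the transition carries it back. *)
Lemma nhd_partial_at (p x : M) (z : 'rV[R]_n) i : enorm z < 2 -> ud (ppar (nc x) z) p < 2 ->
  partial i (nhd r nc p x) z = - dot (row i (jac (tr (nc x) (nc (ppar (nc x) z))) z)) (ngrad p (ppar (nc x) z)).
Proof.
move=> z2 xp; set x' := ppar (nc x) z in xp *; pose h := tr (nc x) (nc x').
have zU : trdom (nc x) (nc x') z by split; [exact: (nc_dom NA)|exact: (pran_self NA)].
have oU := @open_trdom _ _ _ (nc x) (nc x'); have oV := @open_trdom _ _ _ (nc x') (nc p).
have hz : h z = 0 by exact: (pchart_self NA).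
have n1 : \forall y \near z, nhd r nc p x y = (nhd r nc p x' \o h) y by apply: (open_eq_near oU zU) => y [yd yx]; rewrite /nhd /h /tr /= pchartK.
rewrite (partial_near _ n1); have dh := tr_differentiable zU.
have dq : differentiable (nhd r nc p x') (h z).
  rewrite hz; apply: (smooth_diff oV); first exact: (nhd_smooth r0 NA cM). exact: (trdom_0 r0 NA cM xp).
apply: etrans (derive_comp_row _ dq dh) _; rewrite -dotNr hz /dot; apply: eq_bigr => k _.
by rewrite (nhd_partial r0 NA cM xp) [in RHS]mxE jacE [in RHS]mxE.
Qed.

Lemma ray_velocity (x : M) (v : 'rV[R]_n) (t : R) : enorm (t *: v) < 2 ->
  exists2 v', enorm v' = enorm v & forall p, ud (ppar (nc x) (t *: v)) p < 2 ->
    derive1 (rayf r nc p x v) t = - dot (ngrad p (ppar (nc x) (t *: v))) v'.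
Proof.
move=> tv; set x' := ppar _ _.
have zU : trdom (nc x) (nc x') (t *: v) by split; [exact: (nc_dom NA)|exact: (pran_self NA)].
have [dz ez] := raytr_derive zU; have sp := speed_raytr NA zU.
exists (derive1 (raytr nc x' x v) t).
  have e0 : raytr nc x' x v t = 0 by exact: (pchart_self NA).
  rewrite e0 in sp; have n0 := nm_0 (na_metric NA x'); rewrite n0 inner1 in sp. by rewrite /enorm sp.
move=> p xp; have ct : {for t, continuous (fun s : R => ppar (nc x) (s *: v))}.
  apply: (@continuous_comp _ _ _ (fun s : R => s *: v) (ppar (nc x)) t).
    by apply: derivable_continuous; have [] := derive1_ray v t.
  by apply: ppar_continuous; exact: (nc_dom NA).
have [_ e] := @hd_curve p (fun s : R => ppar (nc x) (s *: v)) t xp ct dz.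
exact: etrans (derive1E _ _) e.
Qed.

Section Points.
Variables (I : finType) (p : I -> M) (S : {set I}).

(** A point [10^-1] away in the direction opposite to [v] has a net point within [18^-1]. By the law
    of cosines the two vectors from [x] differ by at most [3/50], which leaves the component
    [1/10 - 3/50 = 1/25] against [v]. *)
Lemma direction (x : M) (v : 'rV[R]_n) :
  (forall y, exists2 j, j \in S & ud y (p j) <= 18^-1) ->
  exists j, [/\ j \in S, ud x (p j) <= 10^-1 + 18^-1 & enorm v / 25 <= - dot (ngrad (p j) x) v].
Proof.
move=> H; have [->|v0] := eqVneq v 0.
  have [j jS h] := H x; exists j; split => //; last by rewrite enorm0 mul0r dot0r oppr0. by apply: le_trans h _; rewrite lerDr.
have ev := enorm_gt0 v0; pose b := - (10 * enorm v)^-1 *: v.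
have eb : enorm b = 10^-1 by rewrite enormZ normrN gtr0_norm ?invr_gt0 ?mulr_gt0//; field; rewrite gt_eqF.
have b2 : enorm b < 2 by rewrite eb; lra.
have [j jS h] := H (ppar (nc x) b); exists j.
have ub := ud_nc r0 NA cM x b2; rewrite eb in ub.
have uj : ud x (p j) <= 10^-1 + 18^-1 by apply: le_trans (ud_tri r0 NA cM x (ppar (nc x) b) _) _; rewrite ub lerD2l.
split => //.
have xj : ud x (ppar (nc x) b) + ud x (p j) < 2 by rewrite ub; lra.
have := cosine_law r0 NA cM kappa0 small_of_tiny n_gt0 xj.
have -> : ngrad (ppar (nc x) b) x = b by apply: pparK; exact: (nc_dom NA).
have h2 : hd (ppar (nc x) b) (p j) <= 18^-1 ^+ 2 / 2 by rewrite /hd ler_pM2r// lerXn2r ?nnegrE// ud_ge0.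
have h3 : 128 * n%:R ^+ 4 * kappa * ud x (p j) ^+ 2 / 2 <= 2000^-1 * 1 / 2.
  rewrite ler_pM2r//; apply: ler_pM => //; first exact: eps1_ge0.
    by rewrite exprn_ge0// ud_ge0.
  by rewrite expr_le1 ?ud_ge0//; lra.
rewrite -sqr_enorm => h4.
have h5 : enorm (b - ngrad (p j) x) <= 50^-1 * 3.
  rewrite -(@ler_pXn2r _ 2) ?nnegrE ?enorm_ge0//. move: h4; rewrite ler_distl => /andP[+ _]; move: h2 h3.
  by move: (hd _ _) (128 * n%:R ^+ 4 * kappa * ud x (p j) ^+ 2 / 2) (enorm _ ^+ 2) => A B C; lra.
have h6 : dot (ngrad (p j) x - b) v <= 50^-1 * 3 * enorm v by apply: le_trans (dot_le _ _) _; rewrite enormBC ler_wpM2r ?enorm_ge0.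
have h7 : dot b v = - (10^-1 * enorm v) by rewrite dotZl -sqr_enorm; field; rewrite gt_eqF.
by move: h6; rewrite dotBl h7; move: (dot _ v) (enorm v) => A B; lra.
Qed.

(** Points at mutual distance [20^-1] have inverse exponentials at distance at least [30^-1], by the
    law of cosines with [tiny]; [separated_card] then counts them. *)
Lemma count_near (y : M) : (forall j k, j \in S -> k \in S -> j != k -> 20^-1 <= ud (p j) (p k)) ->
  (#|[set j in S | (ud (p j) y < 4^-1)%R]| <= (60 * n).+1 ^ n)%N.
Proof.
move=> sep; apply: (@separated_card R n I _ (fun j => ngrad (p j) y)) => //.
  move=> j; rewrite inE => /andP[_ h]; rewrite (enorm_ngrad r0 NA cM) ud_sym; lra.
move=> j k; rewrite !inE => /andP[jS hj] /andP[kS hk] jk.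
have yjk : ud y (p j) + ud y (p k) < 2 by rewrite !(ud_sym r y); lra.
have := cosine_law r0 NA cM kappa0 small_of_tiny n_gt0 yjk.
have h2 : 20^-1 ^+ 2 / 2 <= hd (p j) (p k) by rewrite /hd ler_pM2r// lerXn2r ?nnegrE ?ud_ge0// sep.
have h3 : 128 * n%:R ^+ 4 * kappa * ud y (p k) ^+ 2 / 2 <= 2000^-1 * 1 / 2.
  rewrite ler_pM2r//; apply: ler_pM => //; first exact: eps1_ge0.
    by rewrite exprn_ge0// ud_ge0.
  by rewrite expr_le1 ?ud_ge0// ud_sym; lra.
rewrite -sqr_enorm => h4; rewrite -(@ler_pXn2r _ 2) ?nnegrE ?enorm_ge0//.
move: h4; rewrite ler_distl => /andP[_]; move: h2 h3.
by move: (hd _ _) (128 * n%:R ^+ 4 * kappa * ud y (p k) ^+ 2 / 2) (enorm _ ^+ 2) => A B C; lra.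
Qed.

End Points.
End OneManifold.

Lemma is_derive_bigsum R (I : Type) (s : seq I) (f : I -> R -> R) (df : I -> R) (t : R) :
  (forall i, is_derive t 1 (f i) (df i)) ->
  is_derive t 1 (fun u => \sum_(i <- s) f i u) (\sum_(i <- s) df i).
Proof.
move=> H; elim: s => [|i s IH].
  rewrite big_nil (_ : (fun u => _) = cst 0); first exact: is_derive_cst. by apply/funext => u; rewrite big_nil.
rewrite big_cons (_ : (fun u => _) = f i + (fun u => \sum_(j <- s) f j u)).
  exact: is_deriveD.
by apply/funext => u; rewrite big_cons.
Qed.

Lemma is_derive_weighted R (w : R) (f : R -> R) (df t : R) :
  (w != 0 -> is_derive t 1 f df) -> is_derive t 1 (fun u => w * f u) (w * df).
Proof.
have [->|w0] := eqVneq w 0.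
  move=> _; rewrite mul0r (_ : (fun u => _) = cst 0); first exact: is_derive_cst. by apply/funext => u; rewrite mul0r.
move=> /(_ isT) h; rewrite (_ : (fun u => _) = w \*: f); last by [].
exact: is_deriveZ.
Qed.

Lemma sum_row_mx0 R n m (v : 'rV[R]_m) (f : 'I_(n + m) -> R) :
  \sum_k row_mx (0 : 'rV[R]_n) v 0 k * f k = \sum_l v 0 l * f (rshift n l).
Proof.
rewrite big_split_ord /= big1 ?add0r; first by apply: eq_bigr => l _; rewrite row_mxEr.
by move=> k _; rewrite row_mxEl mxE mul0r.
Qed.

Lemma unitmx_ker R n (A : 'M[R]_n) : (forall v : 'rV[R]_n, v *m A = 0 -> v = 0) -> A \in unitmx.
Proof.
move=> H; rewrite -row_free_unit -kermx_eq0; apply/eqP/row_matrixP => i.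
by rewrite row0; apply: H; rewrite -row_mul mulmx_ker row0.
Qed.

(** The smoothness half of the inverse function theorem, from [implicit_smooth] for the equation
    [H y - z = 0] in the unknown [y]. *)
Lemma smooth_left_inverse R n (V U : set 'rV[R]_n) (H G : 'rV[R]_n -> 'rV[R]_n) :
  open V -> open U -> smooth_on V H -> continuous_on U G -> (forall z, U z -> V (G z)) ->
  (forall z, U z -> H (G z) = z) -> (forall z, U z -> jac H (G z) \in unitmx) -> smooth_on U G.
Proof.
move=> oV oU sH cG GV HG uJ.
pose rs (w : 'rV[R]_(n + n)) : 'rV[R]_n := rsubmx w.
have crs : continuous rs.
  move=> w; apply: continuous_rowP => i.
  rewrite (_ : (fun w => _) = (fun w : 'rV[R]_(n + n) => w 0 (rshift n i))); last by apply/funext => z; rewrite mxE.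
  exact: coord_continuous.
pose W := rs @^-1` V.
have oW : open W by apply: open_comp => // w _; exact: crs.
have srs : smooth_on W rs by move=> i; apply: (smooth_ext oW _ (smooth_coord oW (rshift n i))) => w _; rewrite mxE.
pose q (w : 'rV[R]_(n + n)) : 'rV[R]_n := H (rs w) - lsubmx w.
have sHr k : smooth_fun W (fun w => H (rs w) 0 k) by apply: (smooth_comp oW oV (sH k) srs).
apply: (@implicit_smooth R n n U W q G oU oW _ cG).
- move=> k; apply: (@smooth_ext _ _ _ (fun w => H (rs w) 0 k - w 0 (lshift n k))) => //.
    by move=> w _; rewrite !mxE.
  by apply: smooth_sub_fun => //; exact: smooth_coord.
- by move=> z Uz; rewrite /W /rs /= row_mxKr; exact: GV.
- by move=> z Uz; rewrite /q /rs row_mxKr row_mxKl HG// subrr.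
move=> z Uz; suff -> : jacr q (row_mx z (G z)) = jac H (G z) by exact: uJ.
have Ww : W (row_mx z (G z)) by rewrite /W /rs /= row_mxKr; exact: GV.
apply/matrixP => l k; rewrite mxE jacE.
have qE : (fun w => q w 0 k) = (fun w => H (rs w) 0 k) - (fun w : 'rV[R]_(n + n) => w 0 (lshift n k)) by apply/funext => w; rewrite /q !mxE.
have dH := smooth_diff oW (sHr k) Ww.
have dl : differentiable (fun w : 'rV[R]_(n + n) => w 0 (lshift n k)) (row_mx z (G z)) by exact: differentiable_coord.
apply: etrans (congr1 (fun f => 'D_(delta_mx 0 (rshift n l)) f (row_mx z (G z))) qE) _.
rewrite deriveB; [|exact/diff_derivable|exact/diff_derivable].
have -> : 'D_(delta_mx 0 (rshift n l)) (fun w : 'rV[R]_(n + n) => w 0 (lshift n k)) (row_mx z (G z)) = 0.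
  by rewrite derive_coord mxE eq_lrshift ?andbF.
rewrite subr0.
have dHk : differentiable (fun y => H y 0 k) (rs (row_mx z (G z))) by exact: (smooth_diff oV (sH k) Ww).
have drs : differentiable rs (row_mx z (G z)) by exact: (smooth_on_differentiable oW srs Ww).
apply: etrans (derive_comp_row _ dHk drs) _.
have dk i : 'D_(delta_mx 0 (rshift n l)) (fun w => rs w 0 i) (row_mx z (G z)) = (i == l)%:R.
  rewrite (_ : (fun w => _) = (fun w : 'rV[R]_(n + n) => w 0 (rshift n i))); last by apply/funext => w; rewrite mxE.
  by rewrite derive_coord mxE eq_rshift eqxx.
rewrite (bigD1 l)//= dk eqxx mul1r big1 ?addr0; first by rewrite /rs row_mxKr.
by move=> i il; rewrite dk (negbTE il) mul0r.
Qed.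

Lemma gram_fold R (X Y e4 e5 e A1 A2 A3 B1 B2 B3 : R) :
  `|A1 - (2 * A2 + 2 * A3 - 2 * X) / 2| <= e4 / 2 -> `|B1 - (2 * B2 + 2 * B3 - 2 * Y) / 2| <= e4 / 2 ->
  `|B1 - A1| <= 2 * e -> `|A2 - B2| <= e5 -> `|A3 - B3| <= e5 -> `|X - Y| <= 2 * e5 + 2 * e + e4.
Proof.
rewrite !ler_distl => /andP[? ?] /andP[? ?] /andP[? ?] /andP[? ?] /andP[? ?].
by itv_lra.
Qed.

Lemma dotBB R n (a b : 'rV[R]_n) : dot (a - b) (a - b) = dot a a + dot b b - 2 * dot a b.
Proof. by rewrite dotBl !dotBr (dotC b a); ring. Qed.

Section MetricContinuity.
Context R n (M : riemannianManifold R n) (r kappa : R) (nc : M -> param M).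
Hypotheses (r0 : 0 < r) (NA : normal_atlas r kappa nc) (cM : connected [set: M]).
Local Notation ud := (@ud R n M r).
Local Notation hd := (@hd R n M r).

Lemma ud_near (q : M) (e : R) : 0 < e -> \forall q' \near q, ud q q' < e.
Proof.
move=> e0; pose d := Num.min e 2.
have d2 : 0 < d <= 2 by rewrite lt_min e0 ltr0n ge_min lexx orbT.
apply: filterS (nc_nbhs NA q d2) => _ [x /= xd <-].
rewrite (ud_nc r0 NA cM); last by case/andP: d2 => _; exact: lt_le_trans.
by apply: lt_le_trans xd _; rewrite ge_min lexx.
Qed.

Lemma ud_lip (p q q' : M) : `|ud p q - ud p q'| <= ud q q'.
Proof.
have h1 := ud_tri r0 NA cM p q' q; have h2 := ud_tri r0 NA cM p q q'.
by rewrite (ud_sym r q' q) in h1; rewrite ler_distl lerBlDr h2 h1.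
Qed.

Lemma ud_continuous (p : M) : continuous (ud p).
Proof.
move=> q; apply/cvgrPdist_lt => e e0.
by apply: filterS (ud_near q e0) => q'; apply: le_lt_trans; exact: ud_lip.
Qed.

Lemma hd_continuous (p : M) : continuous (hd p).
Proof.
move=> q; apply: (@continuousM R M (fun q => ud p q ^+ 2) (fun=> 2^-1)); last exact: cst_continuous.
by apply: (@continuousM R M (ud p) (ud p)); exact: ud_continuous.
Qed.

Lemma hd_lip (p q : M) (p' u : R) : 0 <= p' -> ud p q <= 1 -> p' <= 1 -> `|ud p q - p'| <= u -> `|hd p q - p' ^+ 2 / 2| <= u.
Proof.
move=> p0 h1 h2 h; rewrite /hd -mulrBl subr_sqr normrM (ger0_norm (_ : 0 <= 2^-1))// normrM.
have u0 := ud_ge0 r0 p q.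
rewrite (ger0_norm (addr_ge0 u0 p0)) -mulrA; apply: le_trans h.
rewrite ler_piMr// ler_pdivrMr// mul1r; apply: le_trans (lerD h1 h2) _; lra.
Qed.

Lemma ud_nbhs (q : M) (V : set M) : nbhs q V -> exists2 e : R, 0 < e & forall q', ud q q' < e -> V q'.
Proof.
rewrite -[X in nbhs X](na_0 NA) => qV.
have /(_ _ qV) : {for 0, continuous (ppar (nc q))} by apply: ppar_continuous; apply: (nc_dom NA); rewrite enorm0.
rewrite /= => /nbhs_normP[d /= d0 H]; exists (Num.min d 2); first by rewrite lt_min d0 ltr0n.
move=> q'; rewrite lt_min => /andP[h1 h2].
have [x [x2 xq _ ex]] := ud_lt2P r0 NA cM h2; rewrite -xq; apply: H.
by rewrite /ball_ /= sub0r normrN; apply: le_lt_trans (norm_le_enorm x) _; rewrite ex.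
Qed.

Lemma ray_curve (x : M) (v : 'rV[R]_n) (t : R) : enorm (t *: v) < 2 ->
  let gamma := fun s : R => ppar (nc x) (s *: v) in let z := pchart (nc (gamma t)) \o gamma in
  [/\ {for t, continuous gamma}, derivable z t 1 & enorm (derive1 z t) = enorm v].
Proof.
move=> tv gamma z.
have zU : trdom (nc x) (nc (gamma t)) (t *: v) by split; [exact: (nc_dom NA)|exact: (pran_self NA)].
split.
- apply: (@continuous_comp _ _ _ (fun s : R => s *: v) (ppar (nc x)) t).
    by apply: derivable_continuous; have [] := derive1_ray v t.
  by apply: ppar_continuous; exact: (nc_dom NA).
- by have [dz _] := raytr_derive zU.
have sp := speed_raytr NA zU.
have e0 : raytr nc (gamma t) x v t = 0 by exact: (pchart_self NA).
rewrite e0 in sp; have n0 := nm_0 (na_metric NA (gamma t)); rewrite n0 inner1 in sp.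
by rewrite /enorm sp.
Qed.

(** At its centre a normal chart has metric [r^2] times the identity, so speeds become Euclidean
    norms. Each time [t] uses the chart centred at [gamma t]. *)
Lemma speed_center (gamma : R -> M) (t : R) : {for t, continuous gamma} ->
  derivable (pchart (nc (gamma t)) \o gamma) t 1 ->
  speed gamma t = r * enorm (derive1 (pchart (nc (gamma t)) \o gamma) t).
Proof.
move=> ct dz; rewrite (speedE ct (pran_self NA _) dz) (pchart_self NA) (pmet_G nc r0).
have n0 := nm_0 (na_metric NA (gamma t)); rewrite n0 inner1 sqrtrM ?sqr_ge0// sqrtr_sqr.
by rewrite (gtr0_norm r0).
Qed.

End MetricContinuity.

Section Constants.
Context R n.
(** The bound of [count_near] on the number of active net points; since the weights are at most 1,
    it also bounds their sum. *)
Definition Wcst : R := ((60 * n).+1 ^ n)%:R.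
(** The least weight of a net point within distance [5^-1]: there half the squared distance is at
    most [50^-1], while the support ends at distance [4^-1], that is, at [32^-1]. *)
Definition wmin : R := flat 0 (32^-1 - 50^-1).
(** The lower bound of the weighted quadratic form of the gradients: a single point of weight [wmin]
    with component [1/25]. *)
Definition ccst : R := wmin / 625.
(** The scale on which the energy is convex: the Hessian terms are at most [W * (2 * s) * 2], which
    must not exceed half of [c]. *)
Definition scst : R := ccst / (8 * Wcst).
(** A gradient of size at most [W * 3 * eps] against convexity [c / 4] displaces the minimizer by at
    most [12 * W / c * eps]. *)
Definition C1cst : R := 12 * Wcst / ccst.
Lemma Wcst_ge1 : 1 <= Wcst. Proof. by rewrite ler1n expn_gt0. Qed.

Lemma wmin_gt0 : 0 < wmin.
Proof.
have h : (0 : R) < 32^-1 - 50^-1 by rewrite subr_gt0 ltf_pV2// ?posrE// ltr_nat.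
by rewrite /wmin flat_pos// mulr_gt0 ?expR_gt0// exprn_gt0// invr_gt0.
Qed.

Lemma wmin_le1 : wmin <= 1. Proof. exact: flat0_le1. Qed.

Lemma ccstE : wmin = 625 * ccst.
Proof. by rewrite /ccst; move: wmin => w; field. Qed.

Lemma ccst_gt0 : 0 < ccst. Proof. by have := wmin_gt0; rewrite ccstE; move: ccst => x; lra. Qed.

Lemma ccst_le : ccst <= 625^-1.
Proof. by have := wmin_le1; rewrite ccstE; move: ccst => x; lra. Qed.

Lemma scst8 : 2 * scst = ccst / (4 * Wcst).
Proof.
have := Wcst_ge1; rewrite /scst; move: ccst Wcst => x y y1; field.
by rewrite gt_eqF// (lt_le_trans ltr01).
Qed.

Lemma scst_gt0 : 0 < scst.
Proof.
have := Wcst_ge1; have := ccst_gt0; rewrite /scst; move: ccst Wcst => x y x0 y1.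
by rewrite divr_gt0// mulr_gt0// (lt_le_trans ltr01).
Qed.

Lemma scst_le : scst <= 5000^-1.
Proof.
have := Wcst_ge1; have := ccst_le; rewrite /scst; move: ccst Wcst => x y x0 y1.
rewrite ler_pdivrMr; last by rewrite mulr_gt0// (lt_le_trans ltr01).
by apply: le_trans x0 _; lra.
Qed.

Lemma C1cstE : ccst * C1cst = 12 * Wcst.
Proof. by have := ccst_gt0; rewrite /C1cst; move: ccst => x x0; field; rewrite gt_eqF. Qed.

Lemma C1cst_ge : 12 <= C1cst.
Proof.
have := ccst_gt0; have := ccst_le; have := Wcst_ge1; rewrite /C1cst; move: ccst Wcst => x y y1 x1 x0.
rewrite ler_pdivlMr// ler_pM2l//; apply: le_trans y1.
by apply: le_trans x1 _; lra.
Qed.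

Lemma WcstE : Wcst = ((60 * n).+1 ^ n)%:R. Proof. by []. Qed.

End Constants.

Opaque Wcst wmin ccst scst C1cst.

(* Every order hypothesis slows [lra] down, even an irrelevant one. *)
Ltac linear := repeat match goal with H : is_true ?P |- _ =>
  lazymatch P with
  | context [@ud] => clear H | context [@hd] => clear H
  | context [@dot] => clear H | context [@enorm] => clear H
  end end; lra.

(** * Stability under small perturbations *)

Section Stability.
Context R n (M N : riemannianManifold R n) (r eps : R).
Variables (nc1 : M -> param M) (nc2 : N -> param N).
Hypotheses (r0 : 0 < r) (NA1 : normal_atlas r eps nc1) (NA2 : normal_atlas r eps nc2).
Hypotheses (cM : connected [set: M]) (cN : connected [set: N]).
Hypotheses (eps0 : 0 < eps) (n_gt0 : (0 < n)%N).
Hypotheses (tiny : 128 * n%:R ^+ 4 * eps <= 2000^-1) (tiny1 : C1cst R n * eps <= scst R n / 4).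
Variables (I : finType) (x1 : I -> M) (x2 : I -> N) (S : {set I}).
Local Notation ud1 := (@ud R n M r).
Local Notation ud2 := (@ud R n N r).
Local Notation hd1 := (@hd R n M r).
Local Notation hd2 := (@hd R n N r).
Local Notation W := (Wcst R n).
Local Notation c := (ccst R).
Local Notation s := (scst R n).
Local Notation gap j y x := (hd2 (x2 j) x - hd1 (x1 j) y).
Local Notation tri1 := (ud_tri r0 NA1 cM).
Local Notation tri2 := (ud_tri r0 NA2 cN).
Local Notation eps1 := (128 * n%:R ^+ 4 * eps).
Local Notation C1 := (C1cst R n).
(** Distances are measured only below [r], that is below 1 in these units; the threshold [9 / 10]
    leaves room for the measurement error. Smallness on one of the two manifolds is enough. *)
Hypothesis match12 : forall i j, ud1 (x1 i) (x1 j) < 9 / 10 \/ ud2 (x2 i) (x2 j) < 9 / 10 ->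
  `|ud1 (x1 i) (x1 j) - ud2 (x2 i) (x2 j)| <= 2 * eps.
Hypothesis net1 : forall y, exists i, ud1 y (x1 i) <= eps.
Hypothesis net2 : forall x, exists i, ud2 x (x2 i) <= eps.
(** The net itself may be arbitrarily dense. The separated subset [S] bounds the number of active
    weights, and its covering property [covS] still supplies net points in every direction. *)
Hypothesis sepS : forall j k, j \in S -> k \in S -> j != k -> 20^-1 <= ud1 (x1 j) (x1 k).
Hypothesis covS : forall i, exists2 j, j \in S & ud1 (x1 i) (x1 j) <= 20^-1.

Lemma eps_le : 48 * eps <= s.
Proof.
have := tiny1; have h : 12 * eps <= C1 * eps by rewrite ler_wpM2r ?(ltW eps0)// C1cst_ge.
by move: h; move: (C1 * eps) => x; lra.
Qed.

Lemma s_le : s <= 5000^-1. Proof. exact: scst_le. Qed.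
Lemma s_gt0 : 0 < s. Proof. exact: scst_gt0. Qed.
(** The weight depends on the point of M only, so differentiating the energy on N touches the
    differences of squared distances alone. The support has radius [4^-1], within the range of
    [match12]. *)
Definition wt (j : I) (y : M) : R := if j \in S then flat 0 (32^-1 - hd1 (x1 j) y) else 0.
Lemma wt_ge0 j y : 0 <= wt j y. Proof. by rewrite /wt; case: ifP => // _; exact: flat_ge0. Qed.

Lemma hd_lt32 (p y : M) : hd1 p y < 32^-1 -> ud1 p y < 4^-1.
Proof.
rewrite /hd ltr_pdivrMr// (_ : 32^-1 * 2 = 4^-1 ^+ 2); last by field.
by rewrite ltr_pXn2r// nnegrE ?ud_ge0.
Qed.

Lemma wt_neq0 j y : wt j y != 0 -> j \in S /\ ud1 (x1 j) y < 4^-1.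
Proof.
rewrite /wt; case: ifP; last by rewrite eqxx.
move=> jS h; split => //; apply: hd_lt32; rewrite ltNge; apply/negP => h'.
by move: h; rewrite flat_neg ?eqxx// subr_le0.
Qed.

Lemma wt_le j y : wt j y <= ((j \in S) && (ud1 (x1 j) y < 4^-1)%R)%:R.
Proof.
have [->|/[dup] h /wt_neq0[-> ->]] := eqVneq (wt j y) 0; first by case: (_ && _).
by rewrite /wt; case: ifP => // _; exact: flat0_le1.
Qed.

Lemma sum_wt y : \sum_j wt j y <= W.
Proof.
apply: (@le_trans _ _ (\sum_j ((j \in S) && (ud1 (x1 j) y < 4^-1)%R)%:R)).
  by apply: ler_sum => j _; exact: wt_le.
rewrite -natr_sum WcstE ler_nat; apply: leq_trans (count_near r0 NA1 cM (ltW eps0) tiny n_gt0 y sepS).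
rewrite -sum1_card [leqRHS]big_mkcond /=; apply: leq_sum => j _.
by rewrite inE; case: (_ && _).
Qed.

Lemma wt_ge j y : j \in S -> ud1 (x1 j) y <= 5^-1 -> wmin R <= wt j y.
Proof.
move=> jS h; rewrite /wt jS; apply: flat0_mono; rewrite lerD2l lerN2.
rewrite /hd ler_pdivrMr// (_ : 50^-1 * 2 = 5^-1 ^+ 2); last by field.
by rewrite lerXn2r ?nnegrE ?ud_ge0.
Qed.

(** The covering by [S] is transported from M to N through [match12]: [20^-1] plus three errors
    [eps] stays below [18^-1]. *)
Lemma covN (x : N) : exists2 j, j \in S & ud2 x (x2 j) <= 18^-1.
Proof.
have [i xi] := net2 x; have [j jS ij] := covS i; exists j => //.
have h : ud1 (x1 i) (x1 j) < 9 / 10 by move: ij; move: (ud1 _ _) => u; lra.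
have := match12 (or_introl h); have t := tri2 x (x2 i) (x2 j); move: t xi ij.
have := eps_le; have := s_le; move: (ud2 x (x2 j)) (ud2 _ _) (ud2 _ _) (ud1 _ _) => a b d e.
by rewrite ler_distl => h1 h2 h3 h4 h5 /andP[h6 h7]; lra.
Qed.

Lemma covM (y : M) : exists2 j, j \in S & ud1 y (x1 j) <= 18^-1.
Proof.
have [i xi] := net1 y; have [j jS ij] := covS i; exists j => //.
have t := tri1 y (x1 i) (x1 j); move: t xi ij.
have := eps_le; have := s_le; move: (ud1 y (x1 j)) (ud1 _ _) (ud1 _ _) => a b d.
by move=> h1 h2 h3 h4 h5; lra.
Qed.

Lemma dist_cmp y x k j (a b : R) : ud1 y (x1 k) <= a -> ud2 x (x2 k) <= b -> a + b <= 4^-1 ->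
  ud1 (x1 j) y <= 2^-1 \/ ud2 (x2 j) x <= 2^-1 -> `|ud1 (x1 j) y - ud2 (x2 j) x| <= a + b + 2 * eps.
Proof.
move=> ya xb ab.
have t1 := tri1 (x1 j) y (x1 k); have t2 := tri1 (x1 j) (x1 k) y.
have t3 := tri2 (x2 j) x (x2 k); have t4 := tri2 (x2 j) (x2 k) x.
rewrite (ud_sym r (x1 k) y) in t2; rewrite (ud_sym r (x2 k) x) in t4.
have p1 := ud_ge0 r0 y (x1 k); have p2 := ud_ge0 r0 x (x2 k).
have m := @match12 j k; move: t1 t2 t3 t4 ya xb p1 p2 m.
move: (ud1 (x1 j) y) (ud2 (x2 j) x) (ud1 y _) (ud2 x _) (ud1 _ _) (ud2 _ _) => A B C D E F.
move=> t1 t2 t3 t4 ya xb p1 p2 m h.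
have /m : E < 9 / 10 \/ F < 9 / 10 by case: h => h; [left|right]; linear.
by rewrite !ler_distl => /andP[h1 h2]; apply/andP; split; linear.
Qed.

Lemma hd_cmp y x k j (a b : R) : ud1 y (x1 k) <= a -> ud2 x (x2 k) <= b -> a + b <= 4^-1 ->
  ud1 (x1 j) y <= 2^-1 \/ ud2 (x2 j) x <= 2^-1 -> `|gap j y x| <= a + b + 2 * eps.
Proof.
move=> ya xb ab h; have d := dist_cmp ya xb ab h; have e1 := eps_le; have e2 := s_le.
have [b1 b2] : ud1 (x1 j) y <= 1 /\ ud2 (x2 j) x <= 1.
  by move: d h; rewrite ler_distl; move: (ud1 _ _) (ud2 _ _) => u v /andP[h1 h2] h; case: h => h; split; linear.
by rewrite distrC; exact: (hd_lip r0 (ud_ge0 r0 _ _) b1 b2 d).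
Qed.

Lemma direction2 y x k (a b : R) v : ud1 y (x1 k) <= a -> ud2 x (x2 k) <= b -> a + b <= 100^-1 ->
  exists j, [/\ wmin R <= wt j y, ud2 (x2 j) x <= 2^-1 & enorm v / 25 <= - dot (ngrad nc2 (x2 j) x) v].
Proof.
move=> ya xb ab; have [j [jS xj h]] := direction r0 NA2 cN (ltW eps0) tiny n_gt0 x v covN.
exists j; rewrite ud_sym; split => //; last by move: xj; move: (ud2 _ _) => u; lra.
apply: wt_ge => //; have ab' : a + b <= 4^-1 by lra.
have xj' : ud2 (x2 j) x <= 2^-1 by rewrite ud_sym; move: xj; move: (ud2 _ _) => u; lra.
have := dist_cmp ya xb ab' (or_intror xj'); have e1 := eps_le; have e2 := s_le.
by rewrite (ud_sym r (x2 j) x) ler_distl; move: xj; move: (ud1 _ _) (ud2 _ _) => A B h1 /andP[h2 h3]; linear.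
Qed.

Lemma direction1 y v : exists j, [/\ wmin R <= wt j y, ud1 (x1 j) y <= 4^-1 & enorm v / 25 <= - dot (ngrad nc1 (x1 j) y) v].
Proof.
have [j [jS yj h]] := direction r0 NA1 cM (ltW eps0) tiny n_gt0 y v covM.
exists j; rewrite ud_sym; split => //; last by move: yj; move: (ud1 _ _) => u; lra.
by apply: wt_ge => //; rewrite ud_sym; move: yj; move: (ud1 _ _) => u; lra.
Qed.

Lemma quad_lower (a : I -> R) j y (l : R) : 0 <= l -> wmin R <= wt j y -> l / 25 <= a j ->
  c * l ^+ 2 <= \sum_j wt j y * a j ^+ 2.
Proof.
move=> l0 wj aj; rewrite (bigD1 j)//= -[leLHS]addr0; apply: lerD; last first.
  by apply: sumr_ge0 => k _; rewrite mulr_ge0 ?wt_ge0// sqr_ge0.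
have -> : c * l ^+ 2 = wmin R * (l / 25) ^+ 2 by rewrite ccstE; move: c => c'; field.
apply: ler_pM => //; first exact/ltW/wmin_gt0; first exact: sqr_ge0.
by rewrite lerXn2r ?nnegrE ?divr_ge0// (le_trans _ aj)// divr_ge0.
Qed.

Definition energy (y : M) (x : N) : R := \sum_j wt j y * ((gap j y x) ^+ 2 / 2).

(** Minus the gradient of [energy y] at [x], because [ngrad] is minus a gradient; see
    [energy_ray0]. *)
Definition grad (y : M) (x : N) : 'rV[R]_n := \sum_j (wt j y * (gap j y x)) *: ngrad nc2 (x2 j) x.

Lemma dot_grad y x v : dot (grad y x) v = \sum_j wt j y * ((gap j y x) * dot (ngrad nc2 (x2 j) x) v).
Proof. by rewrite /grad dot_suml; apply: eq_bigr => j _; rewrite dotZl mulrA. Qed.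

Lemma sum_wt_le (y : M) (f : I -> R) m : 0 <= m -> (forall j, wt j y != 0 -> `|f j| <= m) ->
  `|\sum_j wt j y * f j| <= W * m.
Proof. by apply: wsum_le; [move=> j; exact: wt_ge0|exact: sum_wt]. Qed.

Lemma half_sqr (f : R -> R) (df b t : R) : is_derive t 1 f df ->
  is_derive t 1 (fun u => (f u - b) ^+ 2 / 2) ((f t - b) * df).
Proof.
move=> h; have h1 : is_derive t (1 : R) (fun u => f u - b) df.
  by have := is_deriveB h (is_derive_cst b t (1 : R)); rewrite subr0.
have -> : (fun u => (f u - b) ^+ 2 / 2) = 2^-1 \*: ((fun u => f u - b) * (fun u => f u - b)).
  by apply/funext => u; rewrite -[RHS]/(2^-1 * ((f u - b) * (f u - b))) mulrC expr2.
apply: is_derive_eq (is_deriveZ _ (is_deriveM h1 h1)) _.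
by rewrite /GRing.scale /=; field.
Qed.

Definition denergy y x v (t : R) : R :=
  \sum_j wt j y * ((rayf r nc2 (x2 j) x v t - hd1 (x1 j) y) * derive1 (rayf r nc2 (x2 j) x v) t).

Section Energy.
Variables (y : M) (x : N) (k : I) (a b : R).
Hypotheses (ya : ud1 y (x1 k) <= a) (xb : ud2 x (x2 k) <= b) (ab : a + b <= 100^-1).

Lemma ab_ge0 : 0 <= a /\ 0 <= b.
Proof. by split; [apply: le_trans ya|apply: le_trans xb]; exact: ud_ge0. Qed.

Lemma ab4 : a + b <= 4^-1. Proof. by move: ab; lra. Qed.

Lemma act_hd j : wt j y != 0 -> ud2 x (x2 j) <= 2^-1 /\ `|gap j y x| <= a + b + 2 * eps.
Proof.
move=> /wt_neq0[_ h]; have h' : ud1 (x1 j) y <= 2^-1 by move: h; move: (ud1 _ _) => u; lra.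
split; last exact: (hd_cmp ya xb ab4 (or_introl h')).
have := dist_cmp ya xb ab4 (or_introl h'); have := eps_le; have := s_le; rewrite (ud_sym r x) ler_distl.
by move: h ab; move: (ud1 _ _) (ud2 _ _) => u1 u2 h1 h0 h2 h3 /andP[h4 h5]; linear.
Qed.

Lemma quad2 v : c * dot v v <= \sum_j wt j y * dot (ngrad nc2 (x2 j) x) v ^+ 2.
Proof.
have [j [wj _ h]] := direction2 v ya xb ab; rewrite -sqr_enorm.
have := @quad_lower (fun j => - dot (ngrad nc2 (x2 j) x) v) j y (enorm v) (enorm_ge0 v) wj h.
by rewrite (eq_bigr (fun j => wt j y * dot (ngrad nc2 (x2 j) x) v ^+ 2))// => i _; rewrite sqrrN.
Qed.

Lemma energy_ray v (t : R) : enorm v <= 1 -> 0 <= t <= 1 ->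
  is_derive t 1 (fun u => energy y (ppar (nc2 x) (u *: v))) (denergy y x v t).
Proof.
move=> v1 t01; apply: is_derive_bigsum => j; apply: is_derive_weighted => /act_hd[xj _].
have h : ud2 x (x2 j) + enorm v < 2 by move: xj v1; move: (ud2 _ _) (enorm v) => A B; linear.
exact: (half_sqr _ (rayf_derive1 r0 NA2 cN h t01)).
Qed.

Lemma energy_ray0 v : is_derive (0 : R) 1 (fun u => energy y (ppar (nc2 x) (u *: v))) (- dot (grad y x) v).
Proof.
rewrite dot_grad -sumrN; apply: is_derive_bigsum => j.
have h0 : is_derive (0 : R) 1 (fun u => wt j y * ((hd2 (x2 j) (ppar (nc2 x) (u *: v)) - hd1 (x1 j) y) ^+ 2 / 2))
    (wt j y * ((gap j y x) * - dot (ngrad nc2 (x2 j) x) v)).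
  apply: is_derive_weighted => /act_hd[xj _]. have h : ud2 x (x2 j) < 2 by move: xj; move: (ud2 _ _) => A; lra.
  have e := half_sqr (hd1 (x1 j) y) (rayf_grad r0 NA2 cN v h). by rewrite /rayf scale0r (na_0 NA2) in e.
by apply: is_derive_eq h0 _; ring.
Qed.

Lemma denergy0 v : denergy y x v 0 = - dot (grad y x) v.
Proof.
rewrite /denergy dot_grad -sumrN; apply: eq_bigr => j _.
have [->|/act_hd[xj _]] := eqVneq (wt j y) 0; first by rewrite !mul0r oppr0.
have h : ud2 x (x2 j) < 2 by move: xj; move: (ud2 _ _) => A; lra.
by rewrite (rayf_derive1_0 r0 NA2 cN)// /rayf scale0r (na_0 NA2) !mulrN.
Qed.

Lemma dd_le (d q : R) : 0 <= q -> `|d - q| <= eps1 * q -> `|d| <= 2 * q.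
Proof.
move=> q0; apply: quad_le2 => //; apply: le_trans tiny _; linear.
Qed.

(** The second derivative along the ray is a weighted sum of squares of first derivatives plus
    differences times second derivatives. The sum of squares is at least [c * dot v v] by
    [direction2]. The hypothesis keeps the differences below [2 * s] along the whole ray, so by the
    choice of [s] the other part costs at most half of that. *)
Lemma energy_convex v : a + b + enorm v + 2 * eps <= 2 * s ->
  - dot (grad y x) v + c / 2 * dot v v <= denergy y x v 1 /\
  energy y x - dot (grad y x) v + c / 4 * dot v v <= energy y (ppar (nc2 x) v).
Proof.
move=> hs; have [a0 b0] := ab_ge0; have sl := s_le; have ev := enorm_ge0 v.
have v1 : enorm v <= 1 by move: hs eps0; linear.
have := @taylor2_ge R (fun u => energy y (ppar (nc2 x) (u *: v))) (denergy y x v) 1 (c / 2 * dot v v) ler01.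
case=> [t t01|t t01|]; first exact: energy_ray.
  exists (\sum_j wt j y * (derive1 (rayf r nc2 (x2 j) x v) t * derive1 (rayf r nc2 (x2 j) x v) t +
     (rayf r nc2 (x2 j) x v t - hd1 (x1 j) y) * derive1 (derive1 (rayf r nc2 (x2 j) x v)) t)).
    apply: is_derive_bigsum => j; apply: is_derive_weighted => /act_hd[xj _].
    have h : ud2 x (x2 j) + enorm v < 2 by move: xj v1; move: (ud2 _ _) (enorm v) => A B; linear.
    have d1 := rayf_derive1 r0 NA2 cN h t01. have [d2 d2' _] := rayf_derive2 r0 NA2 cN (ltW eps0) (small_of_tiny tiny) n_gt0 h t01.
    have h1 : is_derive t (1 : R) (fun u => rayf r nc2 (x2 j) x v u - hd1 (x1 j) y) (derive1 (rayf r nc2 (x2 j) x v) t).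
      by have := is_deriveB d1 (is_derive_cst (hd1 (x1 j) y) t (1 : R)); rewrite subr0.
    have e2 : derive1 (derive1 (rayf r nc2 (x2 j) x v)) t = d2 by have [_ e] := d2'; apply: etrans (derive1E _ _) e.
    apply: is_derive_eq (is_deriveM h1 d2') _; rewrite e2. by rewrite /GRing.scale /= addrC; congr (_ + _); rewrite mulrC.
  (* The index is chosen at the start of the ray. Since the second derivatives are close to
     [dot v v], the first derivative for this index does not decrease along the ray, and the bound
     persists. *)
  have [j [wj xj h]] := direction2 v ya xb ab.
  have Q : c * enorm v ^+ 2 <= \sum_j wt j y * (derive1 (rayf r nc2 (x2 j) x v) t) ^+ 2.
    apply: (@quad_lower (fun j => derive1 (rayf r nc2 (x2 j) x v) t) j y (enorm v) ev wj).
    have xj' : ud2 x (x2 j) + enorm v < 2 by rewrite (ud_sym r x); move: xj v1; move: (ud2 _ _) (enorm v) => A B; linear.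
    have [T _] := rayf_taylor r0 NA2 cN (ltW eps0) (small_of_tiny tiny) n_gt0 xj' t01.
    apply: le_trans h _; move: T; rewrite ler_distl => /andP[T _]. rewrite -subr_ge0 opprK; apply: le_trans T; rewrite subr_ge0.
    case/andP: t01 => t0 _; rewrite ler_wpM2r// ler_piMl ?dot_ge0//. by apply: le_trans tiny _; linear.
  have E : `|\sum_j wt j y * ((rayf r nc2 (x2 j) x v t - hd1 (x1 j) y) * derive1 (derive1 (rayf r nc2 (x2 j) x v)) t)|
     <= W * (2 * s * (2 * dot v v)).
    have m0 : 0 <= 2 * s * (2 * dot v v) by apply: mulr_ge0; apply: mulr_ge0 => //; [exact: ltW s_gt0|exact: dot_ge0].
    apply: (@sum_wt_le y (fun j => (rayf r nc2 (x2 j) x v t - hd1 (x1 j) y) * derive1 (derive1 (rayf r nc2 (x2 j) x v)) t) _ m0).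
    move=> i wi; have [xi _] := act_hd wi; rewrite normrM.
    have xi' : ud2 x (x2 i) + enorm v < 2 by move: xi v1; move: (ud2 _ _) (enorm v) => A B; linear.
    have [d2 d2' hd2'] := rayf_derive2 r0 NA2 cN (ltW eps0) (small_of_tiny tiny) n_gt0 xi' t01. apply: ler_pM => //; last first.
      have -> : derive1 (derive1 (rayf r nc2 (x2 i) x v)) t = d2 by have [_ e] := d2'; apply: etrans (derive1E _ _) e.
      by apply: dd_le hd2'; exact: dot_ge0.
    apply: le_trans (hs); have [_ wi'] := wt_neq0 wi.
    have tv : enorm (t *: v) <= enorm v by case/andP: t01 => t0 t1; rewrite enormZ ger0_norm// ler_piMl ?enorm_ge0.
    have xt : ud2 (ppar (nc2 x) (t *: v)) (x2 k) <= b + enorm v.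
      apply: le_trans (tri2 _ x _) _. rewrite (ud_sym r _ x) (ud_nc r0 NA2 cN); last by apply: le_lt_trans tv _; move: v1; linear.
      by rewrite addrC; apply: lerD.
    rewrite (_ : a + b + enorm v + 2 * eps = a + (b + enorm v) + 2 * eps); last by ring.
    apply: (hd_cmp ya xt); first by move: hs eps0 sl; linear. by left; move: wi'; move: (ud1 _ _) => u; linear.
  rewrite -[leLHS]addr0 (_ : \sum_j _ = \sum_j wt j y * (derive1 (rayf r nc2 (x2 j) x v) t) ^+ 2 +
     \sum_j wt j y * ((rayf r nc2 (x2 j) x v t - hd1 (x1 j) y) * derive1 (derive1 (rayf r nc2 (x2 j) x v)) t)); last first.
    by rewrite -big_split; apply: eq_bigr => i _; rewrite mulrDr -expr2.
  have e3 : W * (2 * s * (2 * dot v v)) = c / 2 * dot v v.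
    by rewrite (scst8 R n); have := Wcst_ge1 R n; move: W c => w c' w1; field; rewrite gt_eqF// (lt_le_trans ltr01).
  rewrite e3 ler_norml in E; rewrite sqr_enorm in Q; case/andP: E => E _; move: Q E.
  by rewrite (_ : c / 2 * dot v v = (c * dot v v) / 2); [move: (c * _) (\sum_j _) (\sum_j _) => q1 q2 q3; linear|ring].
rewrite denergy0 mulr1 scale1r scale0r (na_0 NA2) expr1n !mulr1.
by rewrite (_ : c / 2 * dot v v / 2 = c / 4 * dot v v)//; field.
Qed.

Lemma grad_le : enorm (grad y x) <= W * (a + b + 2 * eps).
Proof.
have [a0 b0] := ab_ge0; have d0 : 0 <= a + b + 2 * eps by move: eps0; lra.
have [->|g0] := eqVneq (grad y x) 0; first by rewrite enorm0 mulr_ge0// (le_trans ler01 (Wcst_ge1 R n)).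
have eg := enorm_gt0 g0; rewrite -(ler_pM2r eg) -expr2 sqr_enorm dot_grad -mulrA.
apply: le_trans (ler_norm _) _.
apply: (@sum_wt_le y (fun j => (gap j y x) * dot (ngrad nc2 (x2 j) x) (grad y x))).
  by rewrite mulr_ge0// enorm_ge0.
move=> j /act_hd[xj h]; rewrite normrM; apply: ler_pM => //.
apply: le_trans (abs_dot_le _ _) _; rewrite ler_piMl ?enorm_ge0//.
have xj2 : ud2 x (x2 j) < 2 by move: xj; move: (ud2 _ _) => A; lra.
by rewrite (enorm_ngrad r0 NA2 cN xj2); move: xj; move: (ud2 _ _) => A; lra.
Qed.

Lemma denergy1 v (b' : R) : enorm v <= 1 -> ud2 (ppar (nc2 x) v) (x2 k) <= b' -> a + b' <= 100^-1 ->
  exists v', denergy y x v 1 = - dot (grad y (ppar (nc2 x) v)) v'.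
Proof.
move=> v1 xb' ab'; have v2 : enorm ((1 : R) *: v) < 2 by rewrite scale1r; move: v1; lra.
have [v' _ H] := ray_velocity r0 NA2 cN x v2; exists v'; rewrite scale1r in H.
rewrite dot_grad -sumrN; apply: eq_bigr => j _; rewrite /rayf scale1r.
have [->|/[dup] wj /wt_neq0[_ h]] := eqVneq (wt j y) 0; first by rewrite !mul0r oppr0.
rewrite -/(rayf r nc2 (x2 j) x v) H; first by rewrite !mulrN.
have ab4' : a + b' <= 4^-1 by move: ab'; lra.
have h' : ud1 (x1 j) y <= 2^-1 by move: h; move: (ud1 _ _) => u; lra.
have := dist_cmp ya xb' ab4' (or_introl h'); have := eps_le; have := s_le; rewrite (ud_sym r _ (x2 j)) ler_distl.
by move: h ab'; move: (ud1 _ _) (ud2 _ _) => u1 u2 h1 h0 h2 h3 /andP[h4 h5]; linear.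
Qed.

End Energy.

(** Strong convexity: near a critical point [x'] the gradient controls the distance to it. This
    gives uniqueness of the critical point and, applied to nearby parameters, continuity of the
    critical map. *)
Lemma grad_gap y x x' k (a b b' : R) : ud1 y (x1 k) <= a -> ud2 x (x2 k) <= b -> ud2 x' (x2 k) <= b' ->
  a + 2 * b + b' + 2 * eps <= 2 * s -> grad y x' = 0 -> c / 2 * ud2 x x' <= enorm (grad y x).
Proof.
move=> ya xb xb' hs g'; have sl := s_le; have e1 := eps_le.
have a0 := le_trans (ud_ge0 r0 y (x1 k)) ya; have b0 := le_trans (ud_ge0 r0 x (x2 k)) xb.
have b0' := le_trans (ud_ge0 r0 x' (x2 k)) xb'.
have xx : ud2 x x' <= b + b' by apply: le_trans (tri2 _ (x2 k) _) _; rewrite (ud_sym r (x2 k)); apply: lerD.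
have xx2 : ud2 x x' < 2 by move: xx hs sl eps0; lra.
have [v [v2 vx _ ev]] := ud_lt2P r0 NA2 cN xx2.
have ab : a + b <= 100^-1 by move: hs sl eps0; lra.
have ab' : a + b' <= 100^-1 by move: hs sl eps0; linear.
have v1 : enorm v <= 1 by rewrite ev; move: xx hs sl eps0; linear.
have xb2 : ud2 (ppar (nc2 x) v) (x2 k) <= b' by rewrite vx.
have hv : a + b + enorm v + 2 * eps <= 2 * s by rewrite ev; move: xx hs; linear.
have [h1 _] := energy_convex ya xb ab hv; have [v' e] := denergy1 ya v1 xb2 ab'.
rewrite vx g' dot0l oppr0 in e; rewrite -ev; rewrite e addrC subr_le0 in h1.
have [->|v0] := eqVneq v 0; first by rewrite enorm0 mulr0 enorm_ge0.
rewrite -(ler_pM2r (enorm_gt0 v0)) -[X in X <= _]mulrA -expr2 sqr_enorm; apply: le_trans h1 _.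
exact: dot_le.
Qed.

(** The energy is minimized over the closed ball of radius [s] around the matching net point.
    Convexity from the centre bounds the minimizer by [C1 * eps], at most [s / 4], so it is interior
    and the gradient vanishes there. *)
Lemma crit_exists y k : ud1 y (x1 k) <= eps -> exists x, grad y x = 0 /\ ud2 x (x2 k) <= C1 * eps.
Proof.
move=> yk; have sl := s_le; have e1 := eps_le; have s0 := s_gt0; set x0 := x2 k.
have x00 : ud2 x0 (x2 k) <= 0 by rewrite (ud_self r0 NA2 cN).
have ab0 : eps + 0 <= 100^-1 by rewrite addr0; move: e1 sl; lra.
pose B : set 'rV[R]_n := [set v | enorm v <= s].
have cB : compact B.
  apply: bounded_closed_compact.
    exists s; split; first exact: num_real. by move=> u su v /= vs; apply: le_trans (norm_le_enorm v) (le_trans vs (ltW su)).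
  rewrite -openC (_ : ~` _ = (@enorm R n) @^-1` [set u | s < u]); last first.
    by apply/seteqP; split => v /=; rewrite ltNge => /negP.
  apply: open_comp; last exact: open_gt. by move=> v _; apply: (@continuous_enorm R n _ (fun v => v)); exact: cvg_id.
pose f v := energy y (ppar (nc2 x0) v).
have cf : {within B, continuous f}.
  apply: continuous_in_subspaceT => v; rewrite inE /= => vs. apply: (@continuous_comp _ _ _ (ppar (nc2 x0)) (energy y) v).
    by apply: ppar_continuous; apply: (nc_dom NA2); apply: le_lt_trans vs _; move: sl; lra.
  apply: (@continuous_sum R N) => j _.
  apply: (@continuousM R N (fun=> wt j y) (fun x => (gap j y x) ^+ 2 / 2)); first exact: cst_continuous.
  apply: (@continuousM R N (fun x => (gap j y x) ^+ 2) (fun=> 2^-1)); last exact: cst_continuous.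
  have ch : {for ppar (nc2 x0) v, continuous (fun x => gap j y x)}.
    by apply: (@continuousB R R N (hd2 (x2 j)) (fun=> hd1 (x1 j) y)); [exact: (hd_continuous r0 NA2 cN)|exact: cst_continuous].
  exact: (@continuousM R N (fun x => gap j y x) (fun x => gap j y x)).
have B0 : B 0 by rewrite /B /= enorm0 ltW.
have [v vB vmin] := @EVT_min_rV R n f B (ex_intro _ 0 B0) cB cf.
rewrite inE /B /= in vB.
have vm u : enorm u <= s -> energy y (ppar (nc2 x0) v) <= energy y (ppar (nc2 x0) u) by move=> us; apply: vmin; rewrite inE.
have hv : eps + 0 + enorm v + 2 * eps <= 2 * s by move: vB e1; linear.
have [_ h2] := energy_convex yk x00 ab0 hv.
have h3 := vm 0; rewrite enorm0 (na_0 NA2) (ltW s0) in h3.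
have gl := grad_le yk x00 ab0.
have evC : enorm v <= C1 * eps.
  have [->|v0] := eqVneq v 0; first by rewrite enorm0 mulr_ge0 ?(ltW eps0)// (le_trans _ (C1cst_ge R n)). have ev := enorm_gt0 v0.
  have h4 : c / 4 * enorm v <= enorm (grad y x0).
    rewrite -(ler_pM2r ev) -[X in X <= _]mulrA -expr2 sqr_enorm; apply: le_trans (dot_le _ _).
    by move: (le_trans h2 (h3 isT)); move: (energy _ _) (dot _ _) (_ * dot v v) => A B' C; linear.
  have c0 := ccst_gt0 R; rewrite -(ler_pM2l c0) mulrA C1cstE.
  have := le_trans h4 gl; rewrite (_ : eps + 0 + 2 * eps = 3 * eps); last by ring.
  rewrite (_ : W * (3 * eps) = W * eps * 3); last by ring. rewrite (_ : 12 * W * eps = W * eps * 12); last by ring.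
  by move: (c0); rewrite (_ : c / 4 * enorm v = (c * enorm v) / 4); [move: (c * _) (W * _) => A B' _; linear|ring].
have C1s : C1 * eps <= s / 4 := tiny1.
have v2 : enorm v < 2 by move: vB sl; linear.
exists (ppar (nc2 x0) v); set x := ppar _ v.
have xk : ud2 x (x2 k) <= C1 * eps by rewrite (ud_sym r x) (ud_nc r0 NA2 cN x0 v2).
split => //; have abx : eps + C1 * eps <= 100^-1 by move: C1s e1 sl; linear.
suff H w : dot (grad y x) w <= 0.
  by apply/dot_eq0/eqP; rewrite eq_le H dot_ge0.
have d := is_deriveN (energy_ray0 yk xk abx w); rewrite opprK in d.
(* For [t < dl] the displaced point stays in the ball over which the minimum was taken. *)
pose dl := s / (2 * (enorm w + 1)).
have w1 : 0 < 2 * (enorm w + 1) by rewrite mulr_gt0// ltr_wpDl ?enorm_ge0.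
have dl0 : 0 < dl by rewrite divr_gt0.
apply: (@derive_le_right R _ _ 0 0 dl d dl0) => t /andP[t0 td].
rewrite mul0r addr0 mulr0.
rewrite -[leLHS]/(- energy y (ppar (nc2 x) (t *: w)) - - energy y (ppar (nc2 x) ((0 : R) *: w))).
rewrite scale0r (na_0 NA2) opprK addrC subr_le0.
have tw : t * enorm w <= s / 2.
  move: td; rewrite /dl ltr_pdivlMr// => td; have := enorm_ge0 w; move: td t0.
  by rewrite mulrCA mulrDr mulr1; move: (t * enorm w) => A; linear.
have tw2 : enorm (t *: w) < 2 by rewrite enormZ gtr0_norm//; move: tw sl; linear.
have un := ud_nc r0 NA2 cN x tw2; rewrite enormZ gtr0_norm// in un.
have ux : ud2 x0 (ppar (nc2 x) (t *: w)) <= s.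
  apply: le_trans (tri2 _ x _) _; rewrite un (ud_sym r x0). by move: xk tw C1s; move: (ud2 _ _) (t * _) => A B'; linear.
have ux2 : ud2 x0 (ppar (nc2 x) (t *: w)) < 2 by move: ux sl; move: (ud2 _ _) => A; linear.
have [u [_ ux' _ eu]] := ud_lt2P r0 NA2 cN ux2; rewrite -ux'.
by apply: vm; rewrite eu.
Qed.

Lemma crit_map : exists F : M -> N, forall y, grad y (F y) = 0 /\
  exists k, ud1 y (x1 k) <= eps /\ ud2 (F y) (x2 k) <= C1 * eps.
Proof.
have ex y : exists x, grad y x = 0 /\ exists k, ud1 y (x1 k) <= eps /\ ud2 x (x2 k) <= C1 * eps.
  have [k yk] := net1 y; have [x [gx xk]] := crit_exists yk. by exists x; split => //; exists k.
by have [F HF] := boolp.choice ex; exists F.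
Qed.

Lemma wt_continuous j : continuous (wt j).
Proof.
move=> y; rewrite /wt; case: (j \in S); last exact: cst_continuous.
apply: (@continuous_comp _ _ _ (fun y => 32^-1 - hd1 (x1 j) y) (flat 0) y).
  apply: (@continuousB R R M (fun=> 32^-1) (hd1 (x1 j))); first exact: cst_continuous. exact: (hd_continuous r0 NA1 cM).
by have [d _] := is_derive_flat 0 (32^-1 - hd1 (x1 j) y); exact: derivable_continuous.
Qed.

Lemma grad_continuous x : continuous (grad^~ x).
Proof.
move=> y; apply: continuous_rowP => i.
rewrite (_ : (fun y => grad y x 0 i) = (fun y => \sum_j wt j y * (gap j y x) * ngrad nc2 (x2 j) x 0 i)); last first.
  by apply/funext => z; rewrite /grad summxE; apply: eq_bigr => j _; rewrite mxE.
apply: (@continuous_sum R M) => j _.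
apply: (@continuousM R M (fun y => wt j y * (gap j y x)) (fun=> ngrad nc2 (x2 j) x 0 i)); last exact: cst_continuous.
apply: (@continuousM R M (wt j) (fun y => gap j y x)); first exact: wt_continuous.
apply: (@continuousB R R M (fun=> hd2 (x2 j) x) (hd1 (x1 j))); first exact: cst_continuous.
exact: (hd_continuous r0 NA1 cM).
Qed.

(** * The critical map: continuity, differential, bijectivity *)

Section CriticalMap.
Variable F : M -> N.
Hypothesis HF : forall y, grad y (F y) = 0 /\ exists k, ud1 y (x1 k) <= eps /\ ud2 (F y) (x2 k) <= C1 * eps.

Lemma F_near y k (a : R) : ud1 y (x1 k) <= a -> a <= 2^-1 -> ud2 (F y) (x2 k) <= C1 * eps + a + 3 * eps.
Proof.
move=> yk a2; have [_ [k' [yk' Fk']]] := HF y; have sl := s_le; have e1 := eps_le.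
have h1 := tri1 (x1 k') y (x1 k); have h2 := tri2 (F y) (x2 k') (x2 k).
have m := @match12 k' k; rewrite (ud_sym r (x1 k') y) in h1; move: yk yk' Fk' h1 h2 m.
move: (ud1 y (x1 k)) (ud1 y (x1 k')) (ud1 (x1 k') (x1 k)) (ud2 (F y) (x2 k)) (ud2 (F y) (x2 k')) (ud2 (x2 k') (x2 k)) => A B D E G H yk yk' Fk' h1 h2 m.
have /m : D < 9 / 10 \/ H < 9 / 10 by left; linear.
by rewrite ler_distl => /andP[h3 h4]; linear.
Qed.

(** [grad_gap] with the parameter [y] near [y0]: the gradient at the old critical point [F y0]
    bounds its distance to [F y], and it tends to 0 because the weights and distances depend
    continuously on [y]. *)
Lemma F_continuous : continuous F.
Proof.
move=> y0; have [k k0] := net1 y0; have sl := s_le; have e1 := eps_le; have C1s := tiny1.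
have eps2 : eps <= 2^-1 by move: e1 sl; lra.
have Fk := F_near k0 eps2.
have key y : ud1 y0 y < eps -> c / 2 * ud2 (F y0) (F y) <= enorm (grad y (F y0)).
  move=> yy; have yk : ud1 y (x1 k) <= 2 * eps.
    apply: le_trans (tri1 _ y0 _) _; rewrite (ud_sym r y). by move: yy k0; move: (ud1 _ _) (ud1 _ _) => A B; linear.
  have a2 : 2 * eps <= 2^-1 by move: e1 sl; lra. have Fy := F_near yk a2. apply: (grad_gap yk Fk Fy); last by case: (HF y).
  by move: e1 C1s s_gt0; move: (C1 * eps) => A; linear.
move=> V /(ud_nbhs r0 NA2 cN)[e e0 HV].
have ce : 0 < c / 2 * e by rewrite mulr_gt0// divr_gt0// ccst_gt0.
have g0 : \forall y \near y0, enorm (grad y (F y0)) < c / 2 * e.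
  have cg : {for y0, continuous (fun y => enorm (grad y (F y0)))} by apply: continuous_enorm; exact: grad_continuous.
  have g00 : enorm (grad y0 (F y0)) = 0 by rewrite (HF y0).1 enorm0. move/cvgrPdist_lt: cg => /(_ _ ce).
  by apply: filterS => y; rewrite g00 sub0r normrN ger0_norm// enorm_ge0.
apply: filterS2 g0 (ud_near r0 NA1 cM y0 eps0) => y h1 h2; apply: HV.
by have := le_lt_trans (key y h2) h1; rewrite ltr_pM2l// divr_gt0// ccst_gt0.
Qed.

Local Notation C4 := (C1 + 3).

Lemma C4_ge0 : 0 <= C4. Proof. by have := C1cst_ge R n; move: C1 => A; lra. Qed.

(** The first summand is the error of the linearized critical equation, the others that of the Gram
    matrices; one constant serves both hypotheses of [gram_estimate]. *)
Definition Ceta : R := 2 * W * C4 + 2 * C4 + 2 + 128 * n%:R ^+ 4.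

Definition C5 : R := gram_cst W c * Ceta.

Lemma Ceta_ge0 : 0 <= Ceta.
Proof.
have W1 := le_trans ler01 (Wcst_ge1 R n); have c4 := C4_ge0.
by rewrite /Ceta !addr_ge0 ?mulr_ge0 ?exprn_ge0.
Qed.

Lemma C5_ge0 : 0 <= C5.
Proof.
have W1 := le_trans ler01 (Wcst_ge1 R n); have c0 := ltW (ccst_gt0 R).
by rewrite /C5 /gram_cst mulr_ge0 ?Ceta_ge0 // !addr_ge0 // ?mulr_ge0 ?addr_ge0 ?mulr_ge0 ?exprn_ge0 ?mulr_ge0 ?invr_ge0.
Qed.

Lemma F_spec y : grad y (F y) = 0 /\ exists k, [/\ ud1 y (x1 k) <= eps, ud2 (F y) (x2 k) <= C1 * eps & eps + C1 * eps <= 100^-1].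
Proof.
have [g [k [yk Fk]]] := HF y; split => //; exists k; split => //.
by have := eps_le; have := s_le; have := tiny1; move: (C1 * eps) => A; lra.
Qed.

Lemma F_cmp y j : ud1 (x1 j) y <= 2^-1 \/ ud2 (x2 j) (F y) <= 2^-1 ->
  `|ud1 (x1 j) y - ud2 (x2 j) (F y)| <= C4 * eps /\ `|hd2 (x2 j) (F y) - hd1 (x1 j) y| <= C4 * eps.
Proof.
move=> h; have [_ [k [yk Fk ab]]] := F_spec y.
have ab' : eps + C1 * eps <= 4^-1 by apply: le_trans ab _; lra.
by rewrite (_ : C4 * eps = eps + C1 * eps + 2 * eps); [split; [exact: (dist_cmp yk Fk ab' h)|exact: (hd_cmp yk Fk ab' h)]|ring].
Qed.

Lemma C4eps : C4 * eps <= 1000^-1.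
Proof.
have -> : C4 * eps = C1 * eps + 3 * eps by ring.
by have := tiny1; have := s_le; have := eps_le; move: (C1 * eps) => A; lra.
Qed.

Section AtPoint.
Variable y : M.
Local Notation x := (F y).
Local Notation av j := (ngrad nc2 (x2 j) x).
Local Notation bv j := (ngrad nc1 (x1 j) y).

Lemma act_F j : wt j y != 0 -> [/\ ud1 (x1 j) y < 4^-1, ud2 (x2 j) x <= 2^-1 & `|gap j y x| <= C4 * eps].
Proof.
move=> /wt_neq0[_ h]; have h' : ud1 (x1 j) y <= 2^-1 by move: h; move: (ud1 _ _) => u; lra.
have [h1 h2] := F_cmp (or_introl h'); split => //.
have := C4eps; move: h1 h; rewrite ler_distl; move: (ud1 _ _) (ud2 _ _) (C4 * eps) => u u' e /andP[? ?] ? ?; lra.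
Qed.

Lemma act_av j : wt j y != 0 -> enorm (av j) <= 1.
Proof.
move=> /act_F[_ h _]; have h2 : ud2 x (x2 j) < 2 by rewrite (ud_sym r x); move: h; move: (ud2 _ _) => u; lra.
by rewrite (enorm_ngrad r0 NA2 cN h2) (ud_sym r x); move: h; move: (ud2 _ _) => u; lra.
Qed.

Lemma act_bv j : wt j y != 0 -> enorm (bv j) <= 1.
Proof.
move=> /act_F[h _ _]; have h2 : ud1 y (x1 j) < 2 by rewrite (ud_sym r y); move: h; move: (ud1 _ _) => u; lra.
by rewrite (enorm_ngrad r0 NA1 cM h2) (ud_sym r y); move: h; move: (ud1 _ _) => u; lra.
Qed.

Lemma lower_a v : c * dot v v <= \sum_j wt j y * dot (av j) v ^+ 2.
Proof. by have [_ [k [yk Fk ab]]] := F_spec y; exact: quad2 yk Fk ab v. Qed.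

Lemma lower_b v : c * dot v v <= \sum_j wt j y * dot (bv j) v ^+ 2.
Proof.
have [j [wj _ h]] := direction1 y v; rewrite -sqr_enorm.
have := @quad_lower (fun j => - dot (bv j) v) j y (enorm v) (enorm_ge0 v) wj h.
by rewrite (eq_bigr (fun j => wt j y * dot (bv j) v ^+ 2))// => i _; rewrite sqrrN.
Qed.

(** The law of cosines on both sides expresses each inner product by three squared distances. Those
    to [y] and [F y] agree up to [C4 * eps], those between net points up to [2 * eps], and each law
    costs [eps1 / 2]. *)
Lemma gram_close j k : wt j y != 0 -> wt k y != 0 ->
  `|dot (av j) (av k) - dot (bv j) (bv k)| <= (2 * C4 + 2 + 128 * n%:R ^+ 4) * eps.
Proof.
move=> wj wk; have [bj aj hj] := act_F wj; have [bk ak hk] := act_F wk.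
have aj2 : ud2 x (x2 j) < 2 by rewrite (ud_sym r x); move: aj; move: (ud2 _ _) => u; lra.
have ak2 : ud2 x (x2 k) < 2 by rewrite (ud_sym r x); move: ak; move: (ud2 _ _) => u; lra.
have bj2 : ud1 y (x1 j) < 2 by rewrite (ud_sym r y); move: bj; move: (ud1 _ _) => u; lra.
have bk2 : ud1 y (x1 k) < 2 by rewrite (ud_sym r y); move: bk; move: (ud1 _ _) => u; linear.
have sa : ud2 x (x2 j) + ud2 x (x2 k) < 2 by rewrite !(ud_sym r x); move: aj ak; move: (ud2 _ _) (ud2 _ _) => u u'; linear.
have sb : ud1 y (x1 j) + ud1 y (x1 k) < 2 by rewrite !(ud_sym r y); move: bj bk; move: (ud1 _ _) (ud1 _ _) => u u'; linear.
have sm := small_of_tiny tiny.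
have ca := cosine_law r0 NA2 cN (ltW eps0) sm n_gt0 sa.
have cb := cosine_law r0 NA1 cM (ltW eps0) sm n_gt0 sb.
have e1 : 0 <= eps1 by exact/eps1_ge0/ltW.
have ea : eps1 * ud2 x (x2 k) ^+ 2 / 2 <= eps1 / 2.
  rewrite ler_pM2r// ler_piMr// expr_le1// ?ud_ge0// (ud_sym r x); move: ak; move: (ud2 _ _) => u; linear.
have eb : eps1 * ud1 y (x1 k) ^+ 2 / 2 <= eps1 / 2.
  rewrite ler_pM2r// ler_piMr// expr_le1// ?ud_ge0// (ud_sym r y); move: bk; move: (ud1 _ _) => u; linear.
have jk1 : ud1 (x1 j) (x1 k) < 9 / 10.
  have := tri1 (x1 j) y (x1 k); rewrite (ud_sym r y); move: bj bk.
  by move: (ud1 (x1 j) y) (ud1 (x1 k) y) (ud1 _ _) => u u' u''; linear.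
have m := match12 (or_introl jk1); have el := eps_le; have sl := s_le.
have jk2 : ud2 (x2 j) (x2 k) <= 1 by move: m jk1; rewrite ler_distl; move: (ud1 _ _) (ud2 _ _) => u u' /andP[? ?] ?; linear.
have jk1' : ud1 (x1 j) (x1 k) <= 1 by move: jk1; move: (ud1 _ _) => u; linear.
have hjk := hd_lip r0 (ud_ge0 r0 _ _) jk1' jk2 m; rewrite -/(hd2 (x2 j) (x2 k)) in hjk.
have sq2 i : ud2 x (x2 i) < 2 -> dot (av i) (av i) = 2 * hd2 (x2 i) x.
  by move=> h; rewrite -sqr_enorm (enorm_ngrad r0 NA2 cN h) /hd (ud_sym r x); field.
have sq1 i : ud1 y (x1 i) < 2 -> dot (bv i) (bv i) = 2 * hd1 (x1 i) y.
  by move=> h; rewrite -sqr_enorm (enorm_ngrad r0 NA1 cM h) /hd (ud_sym r y); field.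
move: (le_trans ca ea) (le_trans cb eb) hjk hj hk.
rewrite (dotBB (av j) (av k)) (dotBB (bv j) (bv k)) (sq2 j)// (sq2 k)// (sq1 j)// (sq1 k)//.
have -> : (2 * C4 + 2 + 128 * n%:R ^+ 4) * eps = 2 * (C4 * eps) + 2 * eps + eps1 by ring.
move: (hd2 (x2 j) (x2 k)) (hd2 (x2 j) x) (hd2 (x2 k) x) (hd1 (x1 j) (x1 k)) (hd1 (x1 j) y) (hd1 (x1 k) y).
move: (dot (av j) _) (dot (bv j) _) eps1 (C4 * eps) => X Y e4 e5 A1 A2 A3 B1 B2 B3.
exact: gram_fold.
Qed.

(** The derivative of the weight profile, as [flat 2] is the derivative of [flat 0]. *)
Definition wt2 j : R := if j \in S then flat 2 (32^-1 - hd1 (x1 j) y) else 0.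
Lemma wt2_ge0 j : 0 <= wt2 j. Proof. by rewrite /wt2; case: ifP => // _; exact: flat_ge0. Qed.

Lemma wt2_neq0 j : wt2 j != 0 -> wt j y != 0.
Proof.
rewrite /wt2 /wt; case: ifP => // _; have [h|h] := leP (32^-1 - hd1 (x1 j) y) 0; first by rewrite flat_neg// eqxx.
by rewrite !flat_pos// expr0 mul1r (gt_eqF (expR_gt0 _)).
Qed.

Lemma sum_wt2 : \sum_j wt2 j <= 2 * W.
Proof.
apply: (@le_trans _ _ (\sum_j 2 * ((j \in S) && (ud1 (x1 j) y < 4^-1)%R)%:R)).
  apply: ler_sum => j _; have [->|/[dup] h /wt2_neq0/wt_neq0[-> ->]] := eqVneq (wt2 j) 0; first by rewrite mulr_ge0.
  by rewrite mulr1 /wt2; case: ifP => // _; exact: flat2_le2.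
rewrite -mulr_sumr ler_pM2l// -natr_sum WcstE ler_nat; apply: leq_trans (count_near r0 NA1 cM (ltW eps0) tiny n_gt0 y sepS).
rewrite -sum1_card [leqRHS]big_mkcond /=; apply: leq_sum => j _.
by rewrite inE; case: (_ && _).
Qed.

(** The hypothesis is the critical equation differentiated in direction [u] and tested against [z].
    Every term on its right carries a difference of half squared distances, at most [C4 * eps], so
    bounds by constants for the Hessians and [wt2] are enough. *)
Lemma wt_estimate (u U z : 'rV[R]_n) :
  \sum_j wt j y * ((dot (av j) U - dot (bv j) u) * dot (av j) z) =
  \sum_j wt2 j * (dot (bv j) u * (gap j y x) * dot (av j) z) -
  \sum_j wt j y * ((gap j y x) * inner (nhess r nc2 (x2 j) x) z U) ->
  `|\sum_j wt j y * ((dot (av j) U - dot (bv j) u) * dot (av j) z)| <= Ceta * eps * (enorm u + enorm U) * enorm z.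
Proof.
move=> ->; apply: le_trans (ler_normB _ _) _.
have z0 := enorm_ge0 z; have u0 := enorm_ge0 u; have U0 := enorm_ge0 U; have c4 := C4_ge0.
have W1 := Wcst_ge1 R n; have W0 : 0 <= W by apply: le_trans W1.
have h1 : `|\sum_j wt2 j * (dot (bv j) u * (gap j y x) * dot (av j) z)| <= 2 * W * (enorm u * (C4 * eps) * enorm z).
  apply: (@wsum_le R I wt2 (2 * W) wt2_ge0 sum_wt2); first by rewrite !mulr_ge0// ltW.
  move=> j /wt2_neq0 wj; have [_ _ hj] := act_F wj; rewrite !normrM. have ha := act_av wj; have hb := act_bv wj.
  have ha' : `|dot (av j) z| <= enorm z by apply: le_trans (abs_dot_le _ _) _; rewrite ler_piMl.
  have hb' : `|dot (bv j) u| <= enorm u by apply: le_trans (abs_dot_le _ _) _; rewrite ler_piMl.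
  by apply: ler_pM => //; apply: ler_pM.
have h2 : `|\sum_j wt j y * ((gap j y x) * inner (nhess r nc2 (x2 j) x) z U)| <= W * (C4 * eps * (2 * (enorm z * enorm U))).
  apply: (@sum_wt_le y (fun j => (gap j y x) * inner (nhess r nc2 (x2 j) x) z U)).
    by rewrite !mulr_ge0// ltW.
  move=> j /act_F[_ aj hj]; rewrite normrM; apply: ler_pM => //. apply: (nhess_le r0 NA2 cN (ltW eps0) (small_of_tiny tiny) n_gt0).
  by rewrite (ud_sym r x); move: aj; move: (ud2 _ _) => v; lra.
apply: le_trans (lerD h1 h2) _.
have -> : 2 * W * (enorm u * (C4 * eps) * enorm z) + W * (C4 * eps * (2 * (enorm z * enorm U))) =
   (2 * W * C4) * eps * (enorm u + enorm U) * enorm z by ring.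
rewrite ler_wpM2r// ler_wpM2r ?addr_ge0// ler_pM2r// /Ceta -!addrA lerDl.
by rewrite addr_ge0 ?mulr_ge0// addr_ge0// mulr_ge0// exprn_ge0.
Qed.

(** A fixed set of indices that contains all those active at points within [4^-1] of [y]. Their
    distance functions are smooth on the common coordinate balls, while inactive indices need not
    even lie in the normal charts. *)
Definition near_act j := (j \in S) && (ud1 (x1 j) y < 2^-1)%R.

Lemma near_actP j : near_act j -> [/\ j \in S, ud1 (x1 j) y < 2^-1 & ud2 (x2 j) x <= 1].
Proof.
move=> /andP[jS h]; split => //; have [h1 _] := F_cmp (or_introl (ltW h)).
have := C4eps; move: h1 h; rewrite ler_distl; move: (ud1 _ _) (ud2 _ _) (C4 * eps) => u u' e /andP[? ?] ? ?; lra.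
Qed.

Lemma wt_near_act j y' : ~~ near_act j -> ud1 y y' < 4^-1 -> wt j y' = 0.
Proof.
move=> nj yy; apply/eqP; apply: contraNT nj => /wt_neq0[jS h]; rewrite /near_act jS /=.
apply: le_lt_trans (tri1 _ y' _) _; rewrite (ud_sym r y').
by move: h yy; move: (ud1 _ _) (ud1 _ _) => u u'; lra.
Qed.

Local Notation e8 := (@eball R n 8^-1).
Local Notation h1 j := (nhd r nc1 (x1 j) y).
Local Notation h2 j := (nhd r nc2 (x2 j) x).

Definition qterm j i (u z : 'rV[R]_n) : R :=
  if near_act j then flat 0 (32^-1 - h1 j u) * (h2 j z - h1 j u) * partial i (h2 j) z else 0.

(** The critical equation in the normal coordinates at [y] and at [F y], as a function of both
    variables, ready for [implicit_smooth]. *)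
Definition qmap (w : 'rV[R]_(n + n)) : 'rV[R]_n := \row_i \sum_j qterm j i (lsubmx w) (rsubmx w).

Definition qdom : set 'rV[R]_(n + n) := [set w | e8 (lsubmx w) /\ e8 (rsubmx w)].

Lemma open_qdom : open qdom.
Proof.
have cl : continuous (fun w : 'rV[R]_(n + n) => lsubmx w : 'rV[R]_n).
  move=> w; apply: continuous_rowP => i.
  rewrite (_ : (fun w => _) = (fun w : 'rV[R]_(n + n) => w 0 (lshift n i))); last by apply/funext => z; rewrite mxE.
  exact: coord_continuous.
have cr : continuous (fun w : 'rV[R]_(n + n) => rsubmx w : 'rV[R]_n).
  move=> w; apply: continuous_rowP => i.
  rewrite (_ : (fun w => _) = (fun w : 'rV[R]_(n + n) => w 0 (rshift n i))); last by apply/funext => z; rewrite mxE.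
  exact: coord_continuous.
apply: openI.
  by apply: (@open_comp _ _ (fun w : 'rV[R]_(n + n) => lsubmx w : 'rV[R]_n)); [move=> w _; exact: cl|exact: open_eball0].
by apply: (@open_comp _ _ (fun w : 'rV[R]_(n + n) => rsubmx w : 'rV[R]_n)); [move=> w _; exact: cr|exact: open_eball0].
Qed.

Lemma trdom1 j u : near_act j -> e8 u -> trdom (nc1 y) (nc1 (x1 j)) u.
Proof.
move=> /near_actP[_ h _]; rewrite /eball /= => u8.
have u2 : enorm u < 2 by move: u8; move: (enorm u) => v; lra.
apply: (ray_trdom r0 NA1 cM) => //; apply: le_lt_trans (tri1 _ y _) _.
by rewrite (ud_nc r0 NA1 cM y u2); move: h u8; move: (ud1 _ _) (enorm u) => v w; lra.
Qed.

Lemma trdom2 j z : near_act j -> e8 z -> trdom (nc2 x) (nc2 (x2 j)) z.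
Proof.
move=> /near_actP[_ _ h]; rewrite /eball /= => z8.
have z2 : enorm z < 2 by move: z8; move: (enorm z) => v; lra.
apply: (ray_trdom r0 NA2 cN) => //; apply: le_lt_trans (tri2 _ x _) _.
by rewrite (ud_nc r0 NA2 cN x z2); move: h z8; move: (ud2 _ _) (enorm z) => v w; lra.
Qed.

Lemma smooth_lsub : smooth_on qdom (fun w => lsubmx w : 'rV[R]_n).
Proof.
move=> i; apply: (smooth_ext open_qdom _ (smooth_coord open_qdom (lshift n i))).
by move=> w _; rewrite mxE.
Qed.

Lemma smooth_rsub : smooth_on qdom (fun w => rsubmx w : 'rV[R]_n).
Proof.
move=> i; apply: (smooth_ext open_qdom _ (smooth_coord open_qdom (rshift n i))).
by move=> w _; rewrite mxE.
Qed.

Lemma smooth_qmap : smooth_on qdom qmap.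
Proof.
move=> i; have oQ := open_qdom.
apply: (@smooth_ext _ _ _ (fun w => \sum_j qterm j i (lsubmx w) (rsubmx w))) => //.
  by move=> w _; rewrite mxE.
apply: smooth_sum => // j; rewrite /qterm; have [ja|ja] := boolP (near_act j); last exact: smooth_cst.
have o1 := @open_trdom _ _ _ (nc1 y) (nc1 (x1 j)); have o2 := @open_trdom _ _ _ (nc2 x) (nc2 (x2 j)).
have g1 : smooth_fun (trdom (nc1 y) (nc1 (x1 j))) (h1 j) by exact: (nhd_smooth r0 NA1 cM).
have g2 : smooth_fun (trdom (nc2 x) (nc2 (x2 j))) (h2 j) by exact: (nhd_smooth r0 NA2 cN).
have s1 : smooth_fun qdom (fun w => h1 j (lsubmx w)).
  apply: (smooth_comp oQ o1 g1 smooth_lsub) => w [w1 _]; exact: trdom1.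
have s2 : smooth_fun qdom (fun w => h2 j (rsubmx w)).
  apply: (smooth_comp oQ o2 g2 smooth_rsub) => w [_ w2]; exact: trdom2.
have s3 : smooth_fun qdom (fun w => partial i (h2 j) (rsubmx w)).
  apply: (smooth_comp oQ o2 (smooth_partial i g2) smooth_rsub) => w [_ w2]; exact: trdom2.
apply: smooth_mul => //; apply: smooth_mul => //; last exact: smooth_sub_fun.
apply: smooth_flat => //; apply: smooth_sub_fun => //; exact: smooth_cst.
Qed.

Lemma qmap_zero u z : e8 u -> e8 z -> F (ppar (nc1 y) u) = ppar (nc2 x) z -> qmap (row_mx u z) = 0.
Proof.
rewrite /eball /= => u8 z8 E; have u2 : enorm u < 2 by move: u8; move: (enorm u) => v; lra.
have z2 : enorm z < 2 by move: z8; move: (enorm z) => v; lra.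
set y' := ppar (nc1 y) u in E; set x' := ppar (nc2 x) z in E.
have yy : ud1 y y' < 4^-1 by rewrite (ud_nc r0 NA1 cM y u2); move: u8; move: (enorm u) => v; lra.
apply/rowP => i; rewrite mxE [RHS]mxE row_mxKl row_mxKr.
pose rw := row i (jac (tr (nc2 x) (nc2 x')) z).
transitivity (- dot (grad y' x') rw); last first.
  by rewrite -E (HF y').1 dot0l oppr0.
rewrite dot_grad -sumrN; apply: eq_bigr => j _; rewrite /qterm; case: ifPn => ja; last first.
  by rewrite (wt_near_act ja yy) mul0r oppr0.
have [jS _ xj] := near_actP ja; rewrite /wt jS.
rewrite (nhd_partial_at r0 NA2 cN i z2); last first.
  apply: le_lt_trans (tri2 _ x _) _; rewrite (ud_sym r _ x) (ud_nc r0 NA2 cN x z2) (ud_sym r x).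
  by move: xj z8; move: (ud2 _ _) (enorm z) => v w; lra.
by rewrite -/x' -/rw (dotC rw) mulrN mulrA.
Qed.

(** The derivative at the centre of one summand of the critical equation: first the variation of the
    weight, then that of the difference of distances and of the gradient. *)
Definition dterm j i (u U : 'rV[R]_n) : R :=
  wt2 j * (dot (bv j) u * (gap j y x) * - av j 0 i) +
  wt j y * ((dot (bv j) u - dot (av j) U) * - av j 0 i + (gap j y x) * (U *m nhess r nc2 (x2 j) x) 0 i).

Lemma qterm_derive j i (al ze : R -> 'rV[R]_n) : al 0 = 0 -> ze 0 = 0 -> derivable al 0 1 -> derivable ze 0 1 ->
  is_derive (0 : R) 1 (fun t => qterm j i (al t) (ze t)) (dterm j i (derive1 al 0) (derive1 ze 0)).
Proof.
move=> al0 ze0 dal dze; rewrite /qterm /dterm; have [ja|ja] := boolP (near_act j); last first.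
  have w0 : wt j y = 0 by apply: (wt_near_act ja); rewrite (ud_self r0 NA1 cM) invr_gt0.
  have w20 : wt2 j = 0 by apply/eqP; apply: contraT => /wt2_neq0; rewrite w0 eqxx.
  rewrite w0 w20 !mul0r addr0; exact: is_derive_cst.
have [jS yj xj] := near_actP ja.
have yj2 : ud1 y (x1 j) < 2 by rewrite (ud_sym r y); move: yj; move: (ud1 _ _) => v; lra.
have xj2 : ud2 x (x2 j) < 2 by rewrite (ud_sym r x); move: xj; move: (ud2 _ _) => v; lra.
have t1 := trdom_0 r0 NA1 cM yj2; have t2 := trdom_0 r0 NA2 cN xj2.
have o1 := @open_trdom _ _ _ (nc1 y) (nc1 (x1 j)); have o2 := @open_trdom _ _ _ (nc2 x) (nc2 (x2 j)).
have g1 : smooth_fun (trdom (nc1 y) (nc1 (x1 j))) (h1 j) by exact: (nhd_smooth r0 NA1 cM).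
have g2 : smooth_fun (trdom (nc2 x) (nc2 (x2 j))) (h2 j) by exact: (nhd_smooth r0 NA2 cN).
have D1 : is_derive (0 : R) 1 (fun t => h1 j (al t)) (- dot (bv j) (derive1 al 0)).
  have dq : differentiable (h1 j) (al 0) by rewrite al0; exact: (smooth_diff o1 g1 t1).
  apply: is_derive_eq (is_derive_comp_curve dq dal) _; rewrite al0 dotC -dotNr /dot.
  by apply: eq_bigr => k _; rewrite (nhd_partial r0 NA1 cM yj2) [in RHS]mxE.
have D2 : is_derive (0 : R) 1 (fun t => h2 j (ze t)) (- dot (av j) (derive1 ze 0)).
  have dq : differentiable (h2 j) (ze 0) by rewrite ze0; exact: (smooth_diff o2 g2 t2).
  apply: is_derive_eq (is_derive_comp_curve dq dze) _; rewrite ze0 dotC -dotNr /dot.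
  by apply: eq_bigr => k _; rewrite (nhd_partial r0 NA2 cN xj2) [in RHS]mxE.
have D3 : is_derive (0 : R) 1 (fun t => partial i (h2 j) (ze t)) ((derive1 ze 0 *m nhess r nc2 (x2 j) x) 0 i).
  have dq : differentiable (partial i (h2 j)) (ze 0) by rewrite ze0; exact: (smooth_diff o2 (smooth_partial i g2) t2).
  apply: is_derive_eq (is_derive_comp_curve dq dze) _; rewrite ze0 [RHS]mxE. apply: eq_bigr => k _; congr (_ * _).
  by rewrite -[in RHS](nhess_sym r0 NA2 cN xj2) [RHS]mxE [RHS]mxE.
have H1 : h1 j (al 0) = hd1 (x1 j) y by rewrite al0 /nhd (na_0 NA1).
have H2 : h2 j (ze 0) = hd2 (x2 j) x by rewrite ze0 /nhd (na_0 NA2).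
have H3 : partial i (h2 j) (ze 0) = - av j 0 i by rewrite ze0 (nhd_partial r0 NA2 cN xj2).
have Df : is_derive (0 : R) 1 (fun t => flat 0 (32^-1 - h1 j (al t))) (wt2 j * dot (bv j) (derive1 al 0)).
  have da : is_derive (0 : R) 1 (fun t => 32^-1 - h1 j (al t)) (dot (bv j) (derive1 al 0)).
    by have := is_deriveB (is_derive_cst (32^-1 : R) (0 : R) (1 : R)) D1; rewrite sub0r opprK.
  have := @is_derive1_comp R (flat 0) (fun t => 32^-1 - h1 j (al t)) 0 _ _ (is_derive_flat 0 _) da.
  by rewrite H1 mul0r subr0 /wt2 jS.
have De : is_derive (0 : R) 1 (fun t => h2 j (ze t) - h1 j (al t)) (- dot (av j) (derive1 ze 0) - - dot (bv j) (derive1 al 0)).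
  exact: is_deriveB.
have Dm := is_deriveM (is_deriveM Df De) D3.
apply: is_derive_eq Dm _; rewrite /GRing.scale /= [X in X * _]/GRing.mul /=.
rewrite -[(fun t => flat 0 _) 0]/(flat 0 (32^-1 - h1 j (al 0))) H1 H2 H3 /wt jS.
move: (flat 0 (32^-1 - hd1 (x1 j) y)) (dot (bv j) (derive1 al 0)) (dot (av j) (derive1 ze 0)).
move: ((derive1 ze 0 *m nhess r nc2 (x2 j) x) 0 i) (av j 0 i) (hd2 (x2 j) x) (hd1 (x1 j) y) (wt2 j).
by move=> A1 A2 A3 A4 A5 A6 A7 A8; ring.
Qed.

Lemma dterm_contract (u U z : 'rV[R]_n) : \sum_i z 0 i * (\sum_j dterm j i u U) =
  \sum_j wt j y * ((dot (av j) U - dot (bv j) u) * dot (av j) z) -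
  (\sum_j wt2 j * (dot (bv j) u * (gap j y x) * dot (av j) z) -
  \sum_j wt j y * ((gap j y x) * inner (nhess r nc2 (x2 j) x) z U)).
Proof.
rewrite -!sumrB; under eq_bigr do rewrite mulr_sumr; rewrite exchange_big /=; apply: eq_bigr => j _.
have [w0|w0] := eqVneq (wt j y) 0.
  have w20 : wt2 j = 0 by apply/eqP; apply: contraT => /wt2_neq0; rewrite w0 eqxx.
  by rewrite big1 => [|i _]; rewrite /dterm w0 w20 !mul0r ?addr0 ?mulr0 ?subr0.
have [_ xj _] := act_F w0.
have xj2 : ud2 x (x2 j) < 2 by rewrite (ud_sym r x); move: xj; move: (ud2 _ _) => v; lra.
pose K1 := - (wt2 j * (dot (bv j) u * (gap j y x))) - wt j y * (dot (bv j) u - dot (av j) U).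
pose K2 := wt j y * (gap j y x).
rewrite (eq_bigr (fun i => K1 * (av j 0 i * z 0 i) + K2 * ((U *m nhess r nc2 (x2 j) x) 0 i * z 0 i))); last first.
  move=> i _; rewrite /dterm /K1 /K2; move: (av j 0 i) ((U *m _) 0 i) => A1 A2; ring.
rewrite big_split /= -!mulr_sumr -/(dot (av j) z) -/(dot (U *m nhess r nc2 (x2 j) x) z) -innerE.
rewrite (inner_sym z U (nhess_sym r0 NA2 cN xj2)) /K1 /K2.
by move: (inner _ _ _) (dot _ z) => A1 A2; ring.
Qed.

Hypothesis tiny2 : 2 * (Ceta * eps) <= c.

Definition Hloc (u : 'rV[R]_n) : 'rV[R]_n := (pchart (nc2 x) \o F \o ppar (nc1 y)) u.

Lemma qmap_curve (al ze : R -> 'rV[R]_n) i : al 0 = 0 -> ze 0 = 0 -> derivable al 0 1 -> derivable ze 0 1 ->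
  is_derive (0 : R) 1 (fun t => qmap (row_mx (al t) (ze t)) 0 i) (\sum_j dterm j i (derive1 al 0) (derive1 ze 0)).
Proof.
move=> al0 ze0 dal dze.
rewrite (_ : (fun t => _) = (fun t => \sum_j qterm j i (al t) (ze t))).
  by apply: is_derive_bigsum => j; exact: qterm_derive.
by apply/funext => t; rewrite mxE row_mxKl row_mxKr.
Qed.

(** For a kernel vector [v] the linearized equation with [u = 0] and [z = v] bounds
    [\sum wt j y * dot (av j) v ^+ 2] by [Ceta * eps * dot v v], at most half of its lower bound
    [c * dot v v]; so [v = 0]. *)
Lemma jacr_unit : jacr qmap (row_mx 0 0) \in unitmx.
Proof.
apply: (@unitmx_ker R n) => v vA.
have Q0 : qdom (row_mx 0 0) by rewrite /qdom /= row_mxKl row_mxKr /eball /= enorm0.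
have D0 i : \sum_j dterm j i 0 v = 0.
  have [dv ev] := derive1_ray v 0; have [dw ew] := derive1_ray (row_mx (0 : 'rV[R]_n) v) 0.
  have d0 : derivable (cst (0 : 'rV[R]_n)) (0 : R) 1 by exact: derivable_cst. have h0 : (cst (0 : 'rV[R]_n) : R -> _) 0 = 0 by [].
  have hv : (0 : R) *: v = 0 by rewrite scale0r. have := @qmap_curve (cst 0) (fun t => t *: v) i h0 hv d0 dv.
  rewrite ev derive1_cst => -[_ e1]. have dq : differentiable (fun w => qmap w 0 i) ((0 : R) *: row_mx (0 : 'rV[R]_n) v).
    rewrite scale0r -row_mx0; exact: (smooth_diff open_qdom (smooth_qmap i) Q0).
  have [_ e2] := is_derive_comp_curve dq dw. rewrite ew scale0r in e2; apply: etrans (esym e1) _.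
  have fe : (fun t : R => qmap (row_mx (cst 0 t) (t *: v)) 0 i) = (fun t : R => qmap (t *: row_mx (0 : 'rV[R]_n) v) 0 i).
    by apply/funext => t; rewrite scale_row_mx scaler0.
  have e4 : \sum_k row_mx (0 : 'rV[R]_n) v 0 k * partial k (fun w => qmap w 0 i) 0 = (v *m jacr qmap (row_mx 0 0)) 0 i.
    rewrite (sum_row_mx0 v (fun k => partial k (fun w => qmap w 0 i) 0)) [RHS]mxE.
    by apply: eq_bigr => l _; rewrite [jacr _ _ _ _]mxE row_mx0.
  apply: etrans (etrans (congr1 (fun f : R -> R => 'D_1 f (0 : R)) fe) (etrans e2 e4)) _. by rewrite vA mxE.
have := dterm_contract 0 v v; rewrite big1; last by move=> i _; rewrite D0 mulr0.
move=> /esym/eqP; rewrite subr_eq0 => /eqP/wt_estimate; rewrite enorm0 add0r => h.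
apply/dot_eq0/eqP; rewrite eq_le dot_ge0 andbT.
have := lower_a v; rewrite (eq_bigr (fun j => wt j y * ((dot (av j) v - dot (bv j) 0) * dot (av j) v))); last first.
  by move=> j _; rewrite dot0r subr0 -expr2.
move=> /le_trans/(_ (le_trans (ler_norm _) h)) h'.
have e : Ceta * eps * enorm v * enorm v = Ceta * eps * dot v v by rewrite -sqr_enorm; ring.
have c0 := ccst_gt0 R; have := ler_wpM2r (dot_ge0 v) tiny2; rewrite -(mulrA 2) => h4.
move: h' c0 (dot_ge0 v) h4; rewrite e; move: (Ceta * eps * dot v v) (dot v v) c => A B d g1 g2 g3 g4.
by rewrite leNgt; apply/negP => B0; have := mulr_gt0 g2 B0; move: g1 g4; move: (d * B) => p; lra.
Qed.

Lemma F_local : exists V : set 'rV[R]_n, [/\ open V, V 0, V `<=` mdom F (nc1 y) (nc2 x), smooth_on V Hloc &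
  forall u, V u -> [/\ e8 u, e8 (Hloc u) & F (ppar (nc1 y) u) = ppar (nc2 x) (Hloc u)]].
Proof.
pose B2 := ppar (nc2 x) @` e8.
have oB2 : open B2 by apply: (nc_open NA2); lra.
have d1 u : e8 u -> pdom (nc1 y) u by rewrite /eball /= => u8; apply: (nc_dom NA1); move: u8; move: (enorm u) => v; lra.
have d2 u : e8 u -> pdom (nc2 x) u by rewrite /eball /= => u8; apply: (nc_dom NA2); move: u8; move: (enorm u) => v; lra.
have cFp u : e8 u -> {for u, continuous (F \o ppar (nc1 y))}.
  by move=> /d1 ud; apply: (@continuous_comp _ _ _ (ppar (nc1 y)) F u (ppar_continuous ud)); exact: F_continuous.
pose V0 := e8 `&` (F \o ppar (nc1 y)) @^-1` B2.
have oV0 : open V0 by apply: open_preimage_on => //; exact: open_eball0.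
have V0P u : V0 u -> [/\ e8 u, e8 (Hloc u) & F (ppar (nc1 y) u) = ppar (nc2 x) (Hloc u)].
  by move=> [u8 [z z8 zE]]; rewrite /= in zE; split => //; rewrite /Hloc /= -zE pparK//; exact: d2.
have cH : continuous_on V0 Hloc.
  move=> u [u8 [z z8 zE]]; apply: (@continuous_comp _ _ _ (F \o ppar (nc1 y)) (pchart (nc2 x)) u (cFp u u8)).
  by apply: pchart_continuous; rewrite -zE; apply/ppar_ran/d2.
pose G u := row_mx u (Hloc u).
have cG : continuous_on V0 G.
  move=> u Vu; apply: continuous_rowP => j; case: (split_ordP j) => i ->.
    rewrite (_ : (fun y => _) = (fun d : 'rV[R]_n => d 0 i)); last by apply/funext => d; rewrite row_mxEl. exact: coord_continuous.
  rewrite (_ : (fun y => _) = (fun d : 'rV[R]_n => Hloc d 0 i)); last by apply/funext => d; rewrite row_mxEr.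
  by apply: continuous_coord; exact: cH.
have GQ u : V0 u -> qdom (G u) by move=> /V0P[u8 h8 _]; rewrite /qdom /= row_mxKl row_mxKr.
have sB : smooth_mx qdom (jacr qmap).
  move=> a b; rewrite (_ : (fun x => _) = partial (rshift n a) (fun w => qmap w 0 b)).
    exact/smooth_partial/smooth_qmap.
  by apply/funext => w; rewrite mxE.
pose D u := \det (jacr qmap (G u)).
have cD : continuous_on V0 D.
  move=> u Vu; apply: (@continuous_comp _ _ _ G (fun w => \det (jacr qmap w)) u (cG u Vu)).
  exact: (smooth_continuous (smooth_det open_qdom sB) (GQ u Vu)).
(* The partial Jacobian is invertible at the centre by [jacr_unit]; [V] is the open set on which it
   remains so along the graph. *)
pose V := V0 `&` D @^-1` [set d | d != 0].
have oV : open V by apply: (@open_preimage_on _ R V0 _ D oV0 cD (@open_neq0 R)).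
have H0 : Hloc 0 = 0 by rewrite /Hloc /= (na_0 NA1); exact: (pchart_self NA2).
have e80 : e8 0 by rewrite /eball /= enorm0.
exists V; split => //.
- split; first by split => //=; exists 0 => //; rewrite (na_0 NA1) (na_0 NA2).
  by rewrite /D /= /G H0; have := jacr_unit; rewrite unitmxE unitfE.
- by move=> u [/V0P[u8 h8 E] _]; split; [exact: d1|rewrite /= E; apply/ppar_ran/d2].
- apply: (@implicit_smooth R n n V qdom qmap Hloc oV open_qdom smooth_qmap).
  + by move=> u [Vu _]; exact: cH.
  + by move=> u [Vu _]; exact: GQ.
  + by move=> u [/V0P[u8 h8 E] _]; exact: qmap_zero.
  + by move=> u [_ Du]; rewrite unitmxE unitfE.
- by move=> u [/V0P].
Qed.

(** Along [t *: u] the critical equation holds identically near 0, so its derivative there vanishes.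
    Contracted with [z] it is the hypothesis of [wt_estimate], and [gram_estimate] concludes with
    the Gram matrices of [gram_close]. *)
Lemma DF_estimate (u : 'rV[R]_n) : let U := u *m jac Hloc 0 in
  `|enorm U - enorm u| <= C5 * eps * enorm u /\
  forall j, wt j y != 0 -> `|dot (av j) U - dot (bv j) u| <= C5 * eps * enorm u.
Proof.
move=> U; have [V [oV V0 VF sV VP]] := F_local.
have [du eu] := derive1_ray u 0.
have V0' : V ((0 : R) *: u) by rewrite scale0r.
have [dz ez] := derive1_comp_smooth oV sV du V0'.
have H0 : Hloc ((0 : R) *: u) = 0 by rewrite scale0r /Hloc /= (na_0 NA1); exact: (pchart_self NA2).
have ez' : derive1 (fun t : R => Hloc (t *: u)) 0 = U by apply: etrans ez _; rewrite eu scale0r.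
have D0 i : \sum_j dterm j i u U = 0.
  have hv : (0 : R) *: u = 0 by rewrite scale0r.
  have := @qmap_curve (fun t : R => t *: u) (fun t : R => Hloc (t *: u)) i hv H0 du dz. rewrite ez' eu => -[_ e1].
  have n1 : \forall t \near (0 : R), cst 0 t = qmap (row_mx (t *: u) (Hloc (t *: u))) 0 i.
    by apply: filterS (near_ray oV V0') => t /VP[g1 g2 g3]; rewrite (qmap_zero g1 g2 g3) mxE.
  have [_ e2] := near_eq_is_derive n1 (is_derive_cst (0 : R) (0 : R) (1 : R)). exact: etrans (esym e1) e2.
have eta0 : 0 <= Ceta * eps.
  rewrite mulr_ge0 ?(ltW eps0)// /Ceta; have W1 := le_trans ler01 (Wcst_ge1 R n); have c4 := C4_ge0.
  by rewrite !addr_ge0// ?mulr_ge0// exprn_ge0.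
have [||g1 g2] := @gram_estimate R n I (wt^~ y) (fun j => av j) (fun j => bv j) W c (Ceta * eps)
  (wt_ge0^~ y) (sum_wt y) (ccst_gt0 R) eta0 act_av act_bv _ lower_a lower_b u U tiny2.
- move=> j k wj wk; apply: le_trans (gram_close wj wk) _; rewrite ler_pM2r// /Ceta -!addrA lerDr.
  by rewrite !mulr_ge0 ?C4_ge0// (le_trans ler01 (Wcst_ge1 R n)).
- move=> z; have := dterm_contract u U z; rewrite big1; last by move=> i _; rewrite D0 mulr0.
  by move=> /esym/eqP; rewrite subr_eq0 => /eqP/wt_estimate.
by rewrite /C5 -(mulrA _ Ceta); split.
Qed.

End AtPoint.

Hypothesis tiny2 : 2 * (Ceta * eps) <= c.
Hypothesis tiny3 : C5 * eps <= 100^-1.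

Lemma C5eps_le y u : enorm (u *m jac (Hloc y) 0) <= 2 * enorm u /\ 99 / 100 * enorm u <= enorm (u *m jac (Hloc y) 0).
Proof.
have [h _] := DF_estimate y tiny2 u; have u0 := enorm_ge0 u.
have := ler_wpM2r u0 tiny3; move: h; rewrite ler_distl; move: (enorm (u *m _)) (enorm u) (C5 * eps) u0 => A B e B0 /andP[h1 h2] h3.
by split; move: h1 h2 h3; move: (e * B) => p; lra.
Qed.

Lemma jacH_unit y : jac (Hloc y) 0 \in unitmx.
Proof.
apply: unitmx_ker => v vJ; have [_] := C5eps_le y v; rewrite vJ enorm0 => h.
by apply: enorm_eq0; apply/eqP; rewrite eq_le enorm_ge0 andbT; move: h; move: (enorm v) => A; lra.
Qed.

Lemma F_smooth : smooth_map F.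
Proof.
apply: smooth_map_local; first exact: F_continuous.
move=> y; have [V [oV V0 VF sV _]] := F_local y tiny2.
exists (nc1 y), (nc2 (F y)), V; split => //; first exact: (pran_self NA1).
by rewrite (pchart_self NA1).
Qed.

Lemma F_curve (gamma : R -> M) (t : R) : {for t, continuous gamma} ->
  derivable (pchart (nc1 (gamma t)) \o gamma) t 1 ->
  [/\ {for t, continuous (F \o gamma)}, derivable (pchart (nc2 (F (gamma t))) \o (F \o gamma)) t 1 &
     derive1 (pchart (nc2 (F (gamma t))) \o (F \o gamma)) t =
       derive1 (pchart (nc1 (gamma t)) \o gamma) t *m jac (Hloc (gamma t)) 0].
Proof.
move=> ct dz; set y := gamma t in dz *; set z := pchart (nc1 y) \o gamma in dz *.
have [V [oV V0 VF sV VP]] := F_local y tiny2.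
have z0 : z t = 0 by exact: (pchart_self NA1).
have Vz : V (z t) by rewrite z0.
have [d1 e1] := derive1_comp_smooth oV sV dz Vz.
have n1 : \forall s \near t, (Hloc y \o z) s = (pchart (nc2 (F y)) \o (F \o gamma)) s.
  apply: filterS (near_dom (open_pran (nc1 y)) ct (pran_self NA1 y)) => s sy. by rewrite /Hloc /z /= pchartK.
have [d2 e2] := derive1_near n1 d1; split.
- exact: (@continuous_comp _ _ _ gamma F t ct (@F_continuous _)).
- exact: d2.
by apply: etrans (esym e2) _; apply: etrans e1 _; rewrite z0.
Qed.

Lemma F_speed (gamma : R -> M) (t : R) : {for t, continuous gamma} ->
  derivable (pchart (nc1 (gamma t)) \o gamma) t 1 ->
  `|speed (F \o gamma) t - speed gamma t| <= C5 * eps * speed gamma t.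
Proof.
move=> ct dz; have [cF dF eF] := F_curve ct dz.
rewrite (speed_center r0 NA2 cF dF) (speed_center r0 NA1 ct dz) eF -mulrBr normrM (gtr0_norm r0).
by rewrite mulrCA ler_pM2l//; have [] := DF_estimate (gamma t) tiny2 (derive1 (pchart (nc1 (gamma t)) \o gamma) t).
Qed.

Lemma F_close y y' : F y = F y' -> ud1 y y' <= s.
Proof.
move=> E; have [_ [k [yk Fk]]] := HF y; have [_ [k' [yk' Fk']]] := HF y'; rewrite -E in Fk'.
have t1 := tri2 (x2 k) (F y) (x2 k'); rewrite (ud_sym r (x2 k) (F y)) in t1.
have t2 := tri1 y (x1 k) y'; have t3 := tri1 (x1 k) (x1 k') y'.
rewrite (ud_sym r (x1 k') y') in t3; have m := @match12 k k'.
have sl := s_le; have e1 := eps_le; have C1s := tiny1.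
move: yk yk' Fk Fk' t1 t2 t3 m; move: (ud1 y (x1 k)) (ud1 y' (x1 k')) (ud2 (F y) (x2 k)) (ud2 (F y) (x2 k')).
move: (ud2 (x2 k) (x2 k')) (ud1 (x1 k) (x1 k')) (ud1 (x1 k) y') (ud1 y y') (C1 * eps) C1s => A B D E1 c1 C1s a1 a2 a3 a4.
move=> yk yk' Fk Fk' t1 t2 t3 m; have /m : B < 9 / 10 \/ A < 9 / 10 by right; linear.
by rewrite ler_distl => /andP[? ?]; linear.
Qed.

(** If [F y = F y'], the points are within [s] and joined by a ray with vector [v]. Pick by
    [direction] a net point from which the ray recedes: its half squared distance on M grows by at
    least [enorm v / 25]. On N the value is the same at both ends, yet by [DF_estimate] the two
    sides drift apart by at most [enorm v / 100]. Hence [v = 0]. *)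
Lemma F_injective : injective F.
Proof.
move=> y y' E; have yy := F_close E; have sl := s_le.
have yy2 : ud1 y y' < 2 by move: yy; move: (ud1 _ _) => u; linear.
have [v [v2 vy _ ev]] := ud_lt2P r0 NA1 cM yy2.
have [j [jS yj dj]] := direction r0 NA1 cM (ltW eps0) tiny n_gt0 y v covM.
pose gamma (t : R) := ppar (nc1 y) (t *: v).
have tv (t : R) : 0 <= t <= 1 -> enorm (t *: v) <= enorm v by move=> /andP[t0 t1]; rewrite enormZ ger0_norm// ler_piMl ?enorm_ge0.
have yt (t : R) : 0 <= t <= 1 -> ud1 (gamma t) (x1 j) <= 5^-1.
  move=> t01; apply: le_trans (tri1 _ y _) _. have h := tv t t01; have h2 := le_lt_trans h v2.
  rewrite (ud_sym r _ y) (ud_nc r0 NA1 cM y h2); move: h yy; rewrite ev.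
  by move: yj; move: (ud1 _ _) (ud1 _ _) (enorm _) => A B D; linear.
have wj (t : R) : 0 <= t <= 1 -> wt j (gamma t) != 0.
  move=> t01; have := yt t t01; rewrite (ud_sym r) => /(wt_ge jS) h. by rewrite gt_eqF// (lt_le_trans (wmin_gt0 R)).
pose dg t := - dot (ngrad nc2 (x2 j) (F (gamma t))) (derive1 (pchart (nc1 (gamma t)) \o gamma) t *m jac (Hloc (gamma t)) 0)
   - - dot (ngrad nc1 (x1 j) (gamma t)) (derive1 (pchart (nc1 (gamma t)) \o gamma) t).
have D (t : R) : 0 <= t <= 1 -> is_derive t 1 (fun u : R => hd2 (x2 j) (F (gamma u)) - hd1 (x1 j) (gamma u)) (dg t).
  move=> t01; have tv2 := le_lt_trans (tv t t01) v2. have [ct dz _] := ray_curve NA1 y tv2; have [cF dF eF] := F_curve ct dz.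
  have [b1 a1 _] := act_F (wj t t01).
  have a2 : ud2 (F (gamma t)) (x2 j) < 2 by rewrite (ud_sym r); move: a1; move: (ud2 _ _) => A; linear.
  have b2 : ud1 (gamma t) (x1 j) < 2 by rewrite (ud_sym r); move: b1; move: (ud1 _ _) => A; linear.
  have h2 := hd_curve r0 NA2 cN a2 cF dF; rewrite eF in h2. exact: (is_deriveB h2 (hd_curve r0 NA1 cM b2 ct dz)).
have dgb (t : R) : 0 <= t <= 1 -> `|dg t| <= C5 * eps * enorm v.
  move=> t01; have tv2 := le_lt_trans (tv t t01) v2; have [_ _ <-] := ray_curve NA1 y tv2.
  have [_ h] := DF_estimate (gamma t) tiny2 (derive1 (pchart (nc1 (gamma t)) \o gamma) t).
  by rewrite /dg -opprD normrN; exact: h (wj t t01).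
have w01 (t : R) : 0 < t < 1 -> 0 <= t <= 1 by move=> /andP[t0 t1]; rewrite !ltW.
have := @mvt_bound_itv R _ dg 0 1 (C5 * eps * enorm v) ler01 (fun t h => D t (w01 t h)) _ (fun t h => dgb t (w01 t h)).
move=> /(_ (fun t h => derivable_continuous (let: DeriveDef d _ := D t h in d))).
rewrite subr0 mulr1 /gamma scale0r scale1r (na_0 NA1) vy -E => B.
have yj2 : ud1 y (x1 j) + enorm v < 2 by move: yj yy; rewrite -ev; move: (ud1 _ _) (enorm v) => A B'; linear.
have h01 : 0 <= (1 : R) <= 1 by rewrite ler01 lexx.
have [_ T] := rayf_taylor r0 NA1 cM (ltW eps0) (small_of_tiny tiny) n_gt0 yj2 h01.
rewrite /rayf scale1r vy expr1n !mulr1 (enorm_ngrad r0 NA1 cM (ud_lt2_add yj2)) in T.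
have hy : ud1 y (x1 j) ^+ 2 / 2 = hd1 (x1 j) y by rewrite /hd (ud_sym r y).
rewrite hy in T.
have v0 : enorm v = 0.
  apply/eqP; rewrite eq_le enorm_ge0 andbT.
  have e1 : eps1 * dot v v <= dot v v by rewrite ler_piMl ?dot_ge0//; apply: le_trans tiny _; linear.
  have e2 : C5 * eps * enorm v <= 100^-1 * enorm v by rewrite ler_wpM2r ?enorm_ge0.
  move: B T dj e1 e2; move: (hd2 _ _) (hd1 _ y) (hd1 _ y') (dot _ v) (dot v v) (enorm v) (128 * _ * _ * _) (C5 * eps * _).
  by move=> A1 A2 A3 A4 A5 A6 A7 A8; rewrite ler_norml ler_norml => /andP[? ?] /andP[? ?] ? ? ?; linear.
by apply: (ud_eq0 r0 NA1 cM); rewrite -ev.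
Qed.

Lemma closed_ball_compact (m : R) : compact [set v : 'rV[R]_n | enorm v <= m].
Proof.
apply: bounded_closed_compact.
  exists m; split; first exact: num_real. by move=> u su v /= vs; apply: le_trans (norm_le_enorm v) (le_trans vs (ltW su)).
rewrite -openC (_ : ~` _ = (@enorm R n) @^-1` [set u | m < u]); last first.
  by apply/seteqP; split => v /=; rewrite ltNge => /negP.
apply: open_comp; last exact: open_gt.
by move=> v _; apply: (@continuous_enorm R n _ (fun v => v)); exact: cvg_id.
Qed.

(** The distance from [x] to the image is minimized over a ball of radius [s] around a matching net
    point. The minimizer lies within [3 * s / 4], hence in the interior; the derivative vanishes
    there, and since the Jacobian is invertible the vector from [F y] to [x] is 0. *)
Lemma F_surjective (x : N) : exists y, F y = x.
Proof.
have [k xk] := net2 x; have sl := s_le; have e1 := eps_le; have s0 := s_gt0; have C1s := tiny1; set p := x1 k.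
pose B : set 'rV[R]_n := [set v | enorm v <= s].
pose f v := hd2 x (F (ppar (nc1 p) v)).
have B2 (v : 'rV[R]_n) : enorm v <= s -> enorm v < 2 by move: sl; move: (enorm v) => A; lra.
have cf : {within B, continuous f}.
  apply: continuous_in_subspaceT => v; rewrite inE /= => vs.
  apply: (@continuous_comp _ _ _ (F \o ppar (nc1 p)) (hd2 x) v); last exact: (hd_continuous r0 NA2 cN).
  apply: (@continuous_comp _ _ _ (ppar (nc1 p)) F v); last exact: F_continuous.
  by apply: ppar_continuous; apply: (nc_dom NA1); exact: B2.
have B0 : B 0 by rewrite /B /= enorm0 ltW.
have [v vB vmin] := @EVT_min_rV R n f B (ex_intro _ 0 B0) (@closed_ball_compact s) cf.
rewrite inE /B /= in vB; set y := ppar (nc1 p) v.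
have vm u : enorm u <= s -> hd2 x (F y) <= hd2 x (F (ppar (nc1 p) u)) by move=> us; apply: vmin; rewrite inE.
have v2 := B2 v vB.
have Fp : ud2 (F p) (x2 k) <= C1 * eps + 0 + 3 * eps by apply: F_near; [rewrite (ud_self r0 NA1 cM)|linear].
have xy : ud2 x (F y) <= ud2 x (F p).
  have := vm 0; rewrite enorm0 (na_0 NA1) => /(_ (ltW s0)). by rewrite /hd ler_pM2r// ler_pXn2r ?nnegrE ?ud_ge0.
have py : ud1 p y = enorm v by exact: (ud_nc r0 NA1 cM).
have [i yi] := net1 y; have eps2 : eps <= 2^-1 by move: e1 sl; lra.
have Fy := F_near yi eps2.
have vb : enorm v <= 3 * s / 4.
  have t1 := tri1 p (x1 i) y; rewrite (ud_sym r (x1 i) y) py in t1. have t1' := tri1 p y (x1 i); rewrite py in t1'.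
  have t2 := tri2 (x2 k) x (x2 i); have t3 := tri2 x (F y) (x2 i).
  have t4 := tri2 x (x2 k) (F p); rewrite (ud_sym r (x2 k) x) in t2; rewrite (ud_sym r (x2 k) (F p)) in t4.
  have m := @match12 k i; rewrite -/p in m.
  move: vB Fp xy yi Fy t1 t1' t2 t3 t4 m xk; move: (ud2 (F p) (x2 k)) (ud2 x (F y)) (ud2 x (F p)) (ud1 y (x1 i)) (ud2 (F y) (x2 i)).
  move: (ud1 p (x1 i)) (ud2 (x2 k) (x2 i)) (ud2 x (x2 i)) (ud2 x (x2 k)) (enorm v) (C1 * eps) C1s.
  move=> a1 a2 a3 a4 a5 c1 C1s b1 b2 b3 b4 b5 vB Fp xy yi Fy t1 t1' t2 t3 t4 m xk.
  have /m : a1 < 9 / 10 \/ a2 < 9 / 10 by left; linear. by rewrite ler_distl => /andP[? ?]; linear.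
exists y; have Fx2 : ud2 (F y) x < 2.
  rewrite (ud_sym r (F y)); apply: le_lt_trans xy _; apply: le_lt_trans (tri2 x (x2 k) (F p)) _.
  rewrite (ud_sym r (x2 k)); move: xk Fp C1s; move: (ud2 _ _) (ud2 _ _) (C1 * eps) => A A' c1; linear.
have H w : dot (ngrad nc2 x (F y)) (w *m jac (Hloc y) 0) <= 0.
  pose gamma (t : R) := ppar (nc1 y) (t *: w). have w0 : enorm ((0 : R) *: w) < 2 by rewrite scale0r enorm0.
  have [ct dz _] := ray_curve NA1 y w0; have [cF dF eF] := F_curve ct dz.
  have g0 : gamma 0 = y by rewrite /gamma scale0r (na_0 NA1). have Fx2' : ud2 ((F \o gamma) 0) x < 2 by rewrite /= g0.
  have d := hd_curve r0 NA2 cN Fx2' cF dF; rewrite eF in d. have ez : derive1 (pchart (nc1 (gamma 0)) \o gamma) 0 = w.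
    have n1 : \forall t \near (0 : R), t *: w = (pchart (nc1 (gamma 0)) \o gamma) t.
      apply: filterS (near_ray (@open_eball0 R n 2) w0) => t tw. by rewrite g0 /gamma /= pparK//; exact: (nc_dom NA1).
    have [dw ew] := derive1_ray w 0; have [_ e] := derive1_near n1 dw. by apply: etrans (esym e) ew.
  rewrite -/gamma in d; rewrite ez /= g0 in d. rewrite (g0 : ppar (nc1 y) ((0 : R) *: w) = y) in d.
  have d' := is_deriveN d; rewrite opprK in d'. pose dl := s / (4 * (enorm w + 1)).
  have w1 : 0 < 4 * (enorm w + 1) by rewrite mulr_gt0// ltr_wpDl ?enorm_ge0. have dl0 : 0 < dl by rewrite divr_gt0.
  apply: (@derive_le_right R _ _ 0 0 dl d' dl0) => t /andP[t0 td].
  rewrite mul0r addr0 mulr0 -[leLHS]/(- hd2 x (F (gamma t)) - - hd2 x (F (gamma 0))) g0 opprK addrC subr_le0.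
  have tw : t * enorm w <= s / 4.
    move: td; rewrite /dl ltr_pdivlMr// => td; have := enorm_ge0 w; move: td t0.
    by rewrite mulrCA mulrDr mulr1; move: (t * enorm w) => A; linear.
  have tw2 : enorm (t *: w) < 2 by rewrite enormZ gtr0_norm//; move: tw sl; linear.
  have un := ud_nc r0 NA1 cM y tw2; rewrite enormZ gtr0_norm// in un. have up : ud1 p (gamma t) <= s.
    apply: le_trans (tri1 _ y _) _; rewrite un py. by move: vb tw; move: (enorm v) (t * _) => A A'; linear.
  have up2 : ud1 p (gamma t) < 2 by move: up sl; move: (ud1 _ _) => A; linear.
  have [u [_ ux' _ eu]] := ud_lt2P r0 NA1 cM up2; rewrite -ux'. by apply: vm; rewrite eu.
have g0 : ngrad nc2 x (F y) = 0.
  have := H (ngrad nc2 x (F y) *m invmx (jac (Hloc y) 0)); rewrite mulmxKV ?jacH_unit// => h.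
  by apply/dot_eq0/eqP; rewrite eq_le h dot_ge0.
by apply: (ud_eq0 r0 NA2 cN); rewrite -(enorm_ngrad r0 NA2 cN Fx2) g0 enorm0.
Qed.

(** With compactness of M the continuous bijection is a closed map, so its inverse is continuous;
    smoothness of the inverse is then local. *)
Hypothesis compM : compact [set: M].

Lemma F_diffeo : exists G, [/\ cancel F G, cancel G F, smooth_map F & smooth_map G].
Proof.
have [G FG] := boolp.choice F_surjective; exists G.
have GF : cancel F G by move=> y; apply: F_injective; rewrite FG.
split => //; first exact: F_smooth.
have cG : continuous G.
  apply/continuous_closedP => A cA.
  have -> : G @^-1` A = F @` A by apply/seteqP; split => [x Gx|_ [y Ay <-]]; [exists (G x)|rewrite /= GF].
  apply: compact_closed; first exact: points_hausdorff.
  apply: continuous_compact; first by apply: continuous_subspaceT; exact: F_continuous. by apply: (subclosed_compact cA compM).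
apply: smooth_map_local => // x0; set y0 := G x0; have Fy0 : F y0 = x0 by exact: FG.
have [V [oV V0 VF sV VP]] := F_local y0 tiny2; rewrite Fy0 in VF VP.
have d1 u : enorm u < 8^-1 -> pdom (nc1 y0) u by move=> u8; apply: (nc_dom NA1); move: u8; move: (enorm u) => v; lra.
have d2 u : enorm u < 8^-1 -> pdom (nc2 x0) u by move=> u8; apply: (nc_dom NA2); move: u8; move: (enorm u) => v; lra.
have oPV : open (pran (nc1 y0) `&` pchart (nc1 y0) @^-1` V) by apply: open_preimage_on; [exact: open_pran|move=> q; exact: pchart_continuous|].
have cGp z : eball 8^-1 z -> {for z, continuous (G \o ppar (nc2 x0))}.
  by move=> /d2 zd; apply: (@continuous_comp _ _ _ (ppar (nc2 x0)) G z (ppar_continuous zd)); exact: cG.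
pose U0 := @eball R n 8^-1 `&` (G \o ppar (nc2 x0)) @^-1` (pran (nc1 y0) `&` pchart (nc1 y0) @^-1` V).
have oU0 : open U0 by apply: open_preimage_on => //; exact: open_eball0.
pose g := pchart (nc1 y0) \o G \o ppar (nc2 x0).
have U0P z : U0 z -> [/\ pdom (nc2 x0) z, V (g z), pran (nc1 y0) (G (ppar (nc2 x0) z)) & Hloc y0 (g z) = z].
  move=> [z8 [/= Pz Vz]]; have zd := d2 z z8; split => //. by rewrite /Hloc /g /= pchartK// FG Fy0 pparK.
have cg : continuous_on U0 g.
  move=> z [z8 [/= Pz Vz]]; apply: (@continuous_comp _ _ _ (G \o ppar (nc2 x0)) (pchart (nc1 y0)) z (cGp z z8)).
  exact: pchart_continuous.
pose D z := \det (jac (Hloc y0) (g z)).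
have cD : continuous_on U0 D.
  move=> z Uz; have [_ Vz _ _] := U0P z Uz. apply: (@continuous_comp _ _ _ g (fun u => \det (jac (Hloc y0) u)) z (cg z Uz)).
  exact: (smooth_continuous (smooth_det oV (smooth_jac_gen sV)) Vz).
pose U := U0 `&` D @^-1` [set d | d != 0].
have oU : open U by apply: (@open_preimage_on _ R U0 _ D oU0 cD (@open_neq0 R)).
have z80 : @eball R n 8^-1 0 by rewrite /eball /= enorm0.
have p0 : pchart (nc2 x0) x0 = 0 by exact: (pchart_self NA2).
have g00 : g 0 = 0 by rewrite /g /= (na_0 NA2) -/y0; exact: (pchart_self NA1).
exists (nc2 x0), (nc1 y0), U; split => //.
- by move=> z [/U0P[zd _ Pz _] _]; split.
- exact: (pran_self NA2).
- rewrite p0; split; last by rewrite /D /= g00; have := jacH_unit y0; rewrite unitmxE unitfE.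
  split => //; rewrite /= (na_0 NA2) -/y0; split; first exact: (pran_self NA1). by rewrite /= (pchart_self NA1).
apply: (@smooth_left_inverse R n V U (Hloc y0) g oV oU sV).
- by move=> z [Uz _]; exact: cg.
- by move=> z [/U0P[]].
- by move=> z [/U0P[]].
- by move=> z [_ Dz]; rewrite unitmxE unitfE.
Qed.

(** The factor 2 in the second bound comes from inverting [1 - C5 * eps] for small [C5 * eps]. *)
Lemma F_speed_le (gamma : R -> M) (t : R) : (\forall u \near t, C1_at gamma u) ->
  speed (F \o gamma) t <= (1 + C5 * eps) * speed gamma t /\
  speed gamma t <= (1 + 2 * (C5 * eps)) * speed (F \o gamma) t.
Proof.
move=> nC; have [ct _] := nbhs_singleton nC; have [dz _] := C1_param nC (pran_self NA1 (gamma t)).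
have := F_speed ct dz; have s0 := speed_ge0 gamma t; have s1 := speed_ge0 (F \o gamma) t.
have e0 := mulr_ge0 C5_ge0 (ltW eps0).
move: tiny3 e0 s0 s1; move: (C5 * eps) (speed (F \o gamma) t) (speed gamma t) => e B A e3 e0 A0 B0.
rewrite ler_distl => /andP[h1 h2]; split; first by rewrite mulrDl mul1r.
have h3 := ler_wpM2r A0 e3; have h4 := ler_wpM2l e0 h1.
have h5 : e * (e * A) <= 100^-1 * (e * A) by rewrite ler_wpM2r// mulr_ge0.
have eA : 0 <= e * A by rewrite mulr_ge0.
move: h1 h3 h4 h5 eA; rewrite mulrBr mulrDl mul1r -mulrA.
by move: (e * A) (e * (e * A)) (e * B) => p q t'; lra.
Qed.

Lemma stability : exists F' : M -> N, diffeomorphism F' /\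
  forall p q : M, rdist (F' p) (F' q) <= (1 + C5 * eps) * rdist p q /\
     rdist p q <= (1 + 2 * (C5 * eps)) * rdist (F' p) (F' q).
Proof.
have [G [GF FG sF sG]] := F_diffeo; exists F; split; first by split => //; exists G.
have k1 : 0 < 1 + C5 * eps /\ 0 < 1 + 2 * (C5 * eps) by have := mulr_ge0 C5_ge0 (ltW eps0); move: (C5 * eps) => e; lra.
move=> p q; split.
- have [g j] := all_joined r0 NA1 cM p q; rewrite -ler_pdivrMl; last by case: k1.
  apply: (le_rdist j) => g' [pw gp gq]; rewrite ler_pdivrMl; last by case: k1.
  have j' : joins (F p) (F q) (F \o g') by split; [exact: piecewise_map|rewrite /= gp|rewrite /= gq].
  apply: le_trans (rdist_le j') _; apply: length_compare => //; first exact: piecewise_map.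
  by move=> t _ nC _; have [] := F_speed_le nC.
have [g j] := all_joined r0 NA2 cN (F p) (F q); rewrite -ler_pdivrMl; last by case: k1.
apply: (le_rdist j) => g' [pw gp gq]; rewrite ler_pdivrMl; last by case: k1.
have j' : joins p q (G \o g') by split; [exact: piecewise_map|rewrite /= gp GF|rewrite /= gq GF].
apply: le_trans (rdist_le j') _; apply: length_compare => //; first exact: piecewise_map.
move=> t _ _ nC; have [_] := F_speed_le nC.
by have -> : F \o (G \o g') = g' by apply/funext => u; rewrite /= FG.
Qed.

End CriticalMap.

End Stability.

(** * A default manifold and an almost maximal choice *)

(** The reconstruction is a total function of the data; the empty manifold is its value when no
    manifold fits them. *)
Definition no_points R : Type := initial_topology (fun _ : void => 0 : R).
HB.instance Definition _ (R : realType) := Topological.on (no_points R).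

Lemma no_points_second_countable R : @second_countable (no_points R).
Proof. by exists set0; [exact: countable0|split => [U []|[]]]. Qed.

Definition empty_smooth R n : smoothManifold R n.
Proof.
apply: (@SmoothManifold R n (no_points R) _ (no_points_second_countable R) set0).
- by move=> [].
- by move=> [].
- by move=> c c' [].
Defined.

Lemma empty_manifold R n : exists N : riemannianManifold R n, True.
Proof.
have @N : riemannianManifold R n.
  have no c : ~ atlas (s := empty_smooth R n) c by case.
  by apply: (@RiemannianManifold R n (empty_smooth R n) (fun _ _ => 0)) => [c /no []|c /no []|c /no []|c c' /no []].
by exists N.
Qed.

(** If some member exceeds the cap [A], it is taken. Otherwise the supremum is finite and positive,
    and a member above [theta] times the supremum exists because [theta < 1]. The implication inside
    the existential lets [t0] serve when the family is empty. *)
Lemma near_maximal R (T : Type) (t0 : T) (P : T -> Prop) (f : T -> \bar R) (A theta : R) :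
  0 <= theta < 1 -> (forall t, P t -> 0 < f t)%E ->
  exists m, (exists t, P t) -> P m /\ forall t, P t -> (Order.min A%:E (theta%:E * f t) <= f m)%E.
Proof.
move=> /andP[h0 h1] fp.
have [[t Pt]|noP] := pselect (exists t, P t); last by exists t0.
have [[m [Pm Am]]|noA] := pselect (exists m, P m /\ (A%:E <= f m)%E).
  by exists m => _; split => // u Pu; rewrite ge_min Am.
(* The image [f @` P] would need [set T], too small a universe for a type [T] of manifolds. *)
set s := ereal_sup [set y | exists2 t, P t & f t = y].
have fs u : P u -> (f u <= s)%E by move=> Pu; apply: ereal_sup_ubound; exists u.
have s0 : (0 < s)%E by apply: lt_le_trans (fp t Pt) (fs t Pt).
have sA : (s <= A%:E)%E.
  apply: ge_ereal_sup => _ [u Pu <-]; rewrite leNgt; apply/negP => Af. by apply: noA; exists u; split => //; exact: ltW.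
have sfin : s \is a fin_num by rewrite fin_numE gt_eqF ?(lt_trans _ s0)//= lt_eqF// (le_lt_trans sA)// ltry.
have : (theta%:E * s < s)%E.
  move: s0; rewrite -(fineK sfin) -EFinM !lte_fin => p. by rewrite gtr_pMl.
move=> /ereal_sup_gt[_ [m Pm <-] fm]; exists m => _; split => // u Pu.
rewrite ge_min; apply/orP; right; apply: le_trans (ltW fm).
by rewrite lee_wpmul2l// ?lee_fin// fs.
Qed.

(** * Reconstruction *)

Section Scales.
Variables (R : realType) (K delta : R).
Hypotheses (K0 : 0 < K) (d0 : 0 < delta).
Let r := (delta / K) `^ (1 / 3).
Let eps := K `^ (1 / 3) * delta `^ (2 / 3).

Lemma cbrtK (x : R) : 0 < x -> (x `^ (1 / 3)) ^+ 3 = x.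
Proof.
move=> x0; rewrite -powR_mulrn ?powR_ge0// -powRrM (_ : 1 / 3 * 3%:R = 1 :> R) ?powRr1 ?(ltW x0)//.
by field.
Qed.

(** The exponent [1/3] in [r] balances the two errors: curvature [K * r ^+ 2] and relative
    measurement error [delta / r] are the same number [eps]. *)
Lemma scales : [/\ 0 < r, 0 < eps, K * r ^+ 2 = eps & delta = eps * r].
Proof.
have a0 : 0 < K `^ (1 / 3) by exact: powR_gt0.
have b0 : 0 < delta `^ (1 / 3) by exact: powR_gt0.
have e2 : delta `^ (2 / 3) = (delta `^ (1 / 3)) ^+ 2 by rewrite -powR_mulrn ?powR_ge0// -powRrM; congr (_ `^ _); field.
have er : r = delta `^ (1 / 3) / K `^ (1 / 3).
  rewrite /r -{1}(cbrtK d0) -{1}(cbrtK K0) -expr_div_n -powR_mulrn ?divr_ge0 ?(ltW a0) ?(ltW b0)// -powRrM.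
  by rewrite (_ : 3%:R * (1 / 3) = 1 :> R) ?powRr1 ?divr_ge0 ?(ltW a0) ?(ltW b0)//; field.
rewrite /eps e2 er; split.
- exact: divr_gt0.
- by rewrite mulr_gt0 ?exprn_gt0.
- by rewrite -{1}(cbrtK K0); field; rewrite gt_eqF.
- by rewrite -{1}(cbrtK d0); field; rewrite gt_eqF.
Qed.

Lemma small_scale (e0 : R) : 0 < e0 -> delta < (e0 / K `^ (1 / 3)) `^ (3 / 2) -> eps <= e0.
Proof.
move=> e0p h; have a0 : 0 < K `^ (1 / 3) by exact: powR_gt0.
rewrite /eps mulrC -ler_pdivlMr//.
rewrite (_ : e0 / K `^ (1 / 3) = ((e0 / K `^ (1 / 3)) `^ (3 / 2)) `^ (2 / 3)).
  by apply: ge0_ler_powR; rewrite ?nnegrE ?powR_ge0 ?(ltW d0) ?(ltW h).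
by rewrite -powRrM (_ : 3 / 2 * (2 / 3) = 1 :> R) ?powRr1 ?divr_ge0 ?(ltW a0) ?(ltW e0p)//; field.
Qed.

End Scales.

(** The data enter only through [J], [d] and the parameters; the sample points are quantified
    existentially. A choice made from this predicate is therefore a function of the data. *)
Record consistent R n (K delta r : R) (J : nat) (d : 'I_J -> 'I_J -> R)
    (N : riemannianManifold R n) : Prop := Consistent {
  cs_compact : compact [set: N];
  cs_connected : connected [set: N];
  cs_sec : sec_bounded N K;
  cs_inj : ((2 * r)%:E < inj_radius N)%E;
  cs_points : exists x : 'I_J -> N,
    [/\ is_net (@rdist R n N) delta (range x),
        forall i j, rdist (x i) (x j) < r -> `|d i j - rdist (x i) (x j)| <= delta &
        forall i j, r <= rdist (x i) (x j) -> r - delta < d i j] }.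

Lemma normal_atlas_exists R n (M : riemannianManifold R n) (r K : R) :
  0 < r -> 0 <= K -> sec_bounded M K -> ((2 * r)%:E < inj_radius M)%E ->
  exists nc : M -> param M, normal_atlas r (K * r ^+ 2) nc.
Proof.
move=> r0 K0 sK hinj.
have ex (p : M) : exists P : param M, [/\ pdom P = eball 2, ppar P 0 = p &
    normal_metric 2 (K * r ^+ 2) (fun x => (r ^+ 2)^-1 *: pmet P x)].
  have : ((2 * r)%:E < inj_radius_at p)%E by apply: lt_le_trans hinj _; apply: ereal_inf_lbound; exists p.
  move=> /ereal_sup_gt[_ [rho [rho0 ed] <-]]; rewrite lte_fin => h. exact: (normal_chart r0 h K0 ed sK).
have [nc H] := boolp.choice ex.
by exists nc; split => p; have [] := H p.
Qed.

Lemma maximal_separated R (I : finType) (f : I -> I -> R) (m : R) :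
  (forall i j, f i j = f j i) -> (forall i, f i i <= m) ->
  exists S : {set I}, (forall j k, j \in S -> k \in S -> j != k -> m <= f j k) /\
    forall i, exists2 j, j \in S & f i j <= m.
Proof.
move=> fC f0.
pose P (S : {set I}) := [forall j in S, forall k in S, (j != k) ==> (m <= f j k)].
have PP (S : {set I}) : reflect (forall j k, j \in S -> k \in S -> j != k -> m <= f j k) (P S).
  apply: (iffP forall_inP) => h.
    by move=> j k jS kS jk; have /forall_inP/(_ k kS)/implyP := h j jS; exact.
  by move=> j jS; apply/forall_inP => k kS; apply/implyP; exact: h.
have [S /maxsetP[/PP sepS maxS]] : {S | maxset P S} by apply: ex_maxset; exists finset.set0; apply/PP => j k; rewrite inE.
exists S; split => // i; apply: contrapT => no.
have far j : j \in S -> m < f i j by move=> jS; rewrite ltNge; apply/negP => h; apply: no; exists j.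
have iS : i \notin S by apply/negP => /far; rewrite ltNge f0.
have : i \in S.
  rewrite -(maxS (i |: S)%SET) ?finset.setU11 ?finset.subsetUr//; apply/PP => j k.
  rewrite !inE => /orP[/eqP->|jS] /orP[/eqP->|kS] jk.
  - by rewrite eqxx in jk.
  - exact/ltW/far.
  - by rewrite fC; exact/ltW/far.
  - exact: sepS.
by rewrite (negbTE iS).
Qed.

(** If one distance is below [9/10 * r], the measured value [D] is below [19/20 * r], hence below
    [r - delta]. The other distance must then also be below [r], where [D] approximates it as
    well. *)
Lemma match_distances R n (M N : riemannianManifold R n) (delta r eps D : R) (p q : M) (p' q' : N) :
  0 < r -> delta = eps * r -> eps <= 20^-1 ->
  (rdist p q < r -> `|D - rdist p q| <= delta) ->
  (rdist p' q' < r -> `|D - rdist p' q'| <= delta) -> (r <= rdist p' q' -> r - delta < D) ->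
  ud r p q < 9 / 10 -> `|ud r p q - ud r p' q'| <= 2 * eps.
Proof.
move=> r0 de es h1 h2 h3; rewrite /ud ltr_pdivrMr// => lt.
have dr : delta <= 20^-1 * r by rewrite de ler_pM2r.
rewrite -mulrBl normrM (gtr0_norm (_ : 0 < r^-1)) ?invr_gt0// ler_pdivrMr// -mulrA -de.
have k1 := h1 (ltac:(move: lt; lra)).
have k3 : rdist p' q' < r by rewrite ltNge; apply/negP => /h3; move: k1 lt dr; rewrite ler_distl => /andP[]; lra.
move: (h2 k3) k1; rewrite !ler_distl => /andP[? ?] /andP[? ?]; apply/andP; lra.
Qed.

Section Assembly.
Context R n.
Hypothesis n_gt0 : (0 < n)%N.

Lemma small_eps (a b : R) : 0 <= a -> 0 < b -> exists2 e0, 0 < e0 & forall e, 0 < e -> e <= e0 -> a * e <= b.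
Proof.
move=> a0 b0; have a1 : 0 < a + 1 by rewrite ltr_wpDl.
exists (b / (a + 1)); first exact: divr_gt0.
move=> e e0; rewrite ler_pdivlMr// => h; apply: le_trans h.
by rewrite mulrC ler_pM2l// lerDl.
Qed.

Lemma small_constants (C : R) : 0 <= C -> exists2 e0 : R, 0 < e0 & forall e, 0 < e -> e <= e0 ->
  [/\ 128 * n%:R ^+ 4 * e <= 2000^-1, C1cst R n * e <= scst R n / 4, 2 * (Ceta R n * e) <= ccst R,
      C5 R n * e <= 100^-1 & e <= 20^-1 /\ C * e <= 2^-1].
Proof.
move=> C0.
have C1 : 0 <= C1cst R n by apply: le_trans (C1cst_ge R n).
have [e1 p1 h1] := @small_eps (128 * n%:R ^+ 4) 2000^-1 (mulr_ge0 (ler0n _ _) (exprn_ge0 _ (ler0n _ _))) ltac:(rewrite invr_gt0; exact: ltr0n).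
have [e2 p2 h2] := @small_eps (C1cst R n) (scst R n / 4) C1 ltac:(by rewrite divr_gt0 ?scst_gt0).
have [e3 p3 h3] := @small_eps (2 * Ceta R n) (ccst R) ltac:(by rewrite mulr_ge0 ?Ceta_ge0) (ccst_gt0 R).
have [e4 p4 h4] := @small_eps (C5 R n) 100^-1 (C5_ge0 R n) ltac:(rewrite invr_gt0; exact: ltr0n).
have [e5 p5 h5] := @small_eps C 2^-1 C0 ltac:(rewrite invr_gt0; exact: ltr0n).
exists (Num.min (Num.min e1 e2) (Num.min (Num.min e3 e4) (Num.min e5 20^-1))).
  by rewrite !lt_min p1 p2 p3 p4 p5 invr_gt0 ltr0n.
move=> e e0; rewrite !le_min => /andP[/andP[k1 k2] /andP[/andP[k3 k4] /andP[k5 k6]]].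
by split; [exact: h1|exact: h2|rewrite mulrA; exact: h3|exact: h4|split => //; exact: h5].
Qed.

Lemma consistent_diffeo (K delta r eps : R) (J : nat) (d : 'I_J -> 'I_J -> R) (M N : riemannianManifold R n) :
  0 < r -> 0 < eps -> 0 <= K -> K * r ^+ 2 = eps -> delta = eps * r ->
  [/\ 128 * n%:R ^+ 4 * eps <= 2000^-1, C1cst R n * eps <= scst R n / 4, 2 * (Ceta R n * eps) <= ccst R,
      C5 R n * eps <= 100^-1 & eps <= 20^-1] ->
  consistent K delta r d M -> consistent K delta r d N ->
  exists F : M -> N, diffeomorphism F /\ forall p q : M, p <> q ->
    0 < rdist p q /\ rdist (F p) (F q) <= (1 + C5 R n * eps) * rdist p q /\
    rdist p q <= (1 + 2 * (C5 R n * eps)) * rdist (F p) (F q).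
Proof.
move=> r0 e0 K0 eK de [t1 t2 t3 t4 t5] cM cN.
have [nc1 NA1] := normal_atlas_exists r0 K0 (cs_sec cM) (cs_inj cM).
have [nc2 NA2] := normal_atlas_exists r0 K0 (cs_sec cN) (cs_inj cN).
rewrite eK in NA1 NA2.
have [x1 [net1 near1 far1]] := cs_points cM; have [x2 [net2 near2 far2]] := cs_points cN.
have kM := cs_connected cM; have kN := cs_connected cN.
have m12 i j : ud r (x1 i) (x1 j) < 9 / 10 \/ ud r (x2 i) (x2 j) < 9 / 10 ->
    `|ud r (x1 i) (x1 j) - ud r (x2 i) (x2 j)| <= 2 * eps.
  move=> [h|h].
    exact: (match_distances r0 de t5 (near1 i j) (near2 i j) (far2 i j) h).
  rewrite distrC; exact: (match_distances r0 de t5 (near2 i j) (near1 i j) (far1 i j) h).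
have n1 (y : M) : exists i, ud r y (x1 i) <= eps by have [_ [i _ <-] h] := net1 y; exists i; rewrite /ud ler_pdivrMr// -de.
have n2 (y : N) : exists i, ud r y (x2 i) <= eps by have [_ [i _ <-] h] := net2 y; exists i; rewrite /ud ler_pdivrMr// -de.
have self i : ud r (x1 i) (x1 i) <= 20^-1 by rewrite (ud_self r0 NA1 kM) invr_ge0 ler0n.
have [S [sepS covS]] := @maximal_separated R 'I_J (fun i j => ud r (x1 i) (x1 j)) 20^-1
  (fun i j => ud_sym r _ _) self.
have [F HF] := crit_map r0 NA1 NA2 kM kN e0 n_gt0 t1 t2 m12 n1 n2 sepS covS.
have [F' [dF bF]] := stability r0 NA1 NA2 kM kN e0 n_gt0 t1 t2 m12 n1 n2 sepS covS HF t3 t4 (cs_compact cM).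
exists F'; split => // p q pq; split; last exact: bF.
rewrite lt_neqAle rdist_ge0 andbT; apply/negP => /eqP e.
by apply: pq; apply: (ud_eq0 r0 NA1 kM); rewrite /ud -e mul0r.
Qed.

End Assembly.

Theorem corollary1p10 (R : realType) (n : nat) (n_gt0 : (0 < n)%N) :
  exists C9 C10 : R, 0 < C9 /\ 0 < C10 /\
  forall K : R, 0 < K ->
  exists delta0 : R, 0 < delta0 /\
  forall delta : R, 0 < delta -> delta < delta0 ->
  exists reconstruct :
    forall J : nat, ('I_J -> 'I_J -> R) -> riemannianManifold R n,
  forall N : riemannianManifold R n,
  compact [set: N] -> connected [set: N] -> sec_bounded N K ->
  let r := (delta / K) `^ (1 / 3) in
  ((2 * r)%:E < inj_radius N)%E ->
  forall (J : nat) (x : 'I_J -> N), injective x ->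
  is_net (@rdist R n N) delta (range x) ->
  forall d : 'I_J -> 'I_J -> R,
  (forall i j, 0 <= d i j) ->
  (forall i j, rdist (x i) (x j) < r ->
     `|d i j - rdist (x i) (x j)| <= delta) ->
  (forall i j, r <= rdist (x i) (x j) -> r - delta < d i j) ->
  let M := reconstruct J d in
  let L := 1 + C10 * K `^ (1 / 3) * delta `^ (2 / 3) in
  [/\ compact [set: M],
      connected [set: M],
      exists F : M -> N,
        diffeomorphism F /\
        forall p q : M, p <> q ->
          1 / L <= rdist (F p) (F q) / rdist p q /\
          rdist (F p) (F q) / rdist p q <= L,
      sec_bounded M (C9 * K) &
      (Order.min ((C9 * K) `^ (- (1 / 2)))%:E
         ((1 - C10 * K `^ (1 / 3) * delta `^ (2 / 3))%:E * inj_radius N)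
       <= inj_radius M)%E].
Proof.
(* The factor 2 covers the Lipschitz bound of the inverse map, and the summand 1 makes the constant
   positive. *)
pose C := 2 * C5 R n + 1; have c5 := C5_ge0 R n.
have C0 : 0 < C by rewrite /C; lra.
(* The reconstruction is itself consistent with the data, so its curvature bound is [K] and [C9 = 1]
   is possible. *)
exists 1, C; do 2!split => //; move=> K K0.
have [e0 e0p small] := small_constants n (ltW C0).
(* This is the condition [eps <= e0] solved for [delta], where [eps = K^(1/3) * delta^(2/3)]. *)
exists ((e0 / K `^ (1 / 3)) `^ (3 / 2)); split; first by rewrite powR_gt0// divr_gt0// powR_gt0.
move=> delta d0 dlt; have le0 := small_scale K0 d0 e0p dlt.
have [r0 ep eK de] := scales K0 d0.
set r := (delta / K) `^ (1 / 3) in r0 eK de *.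
have epsE : C * K `^ (1 / 3) * delta `^ (2 / 3) = C * (K `^ (1 / 3) * delta `^ (2 / 3)) by rewrite mulrA.
rewrite epsE; set eps := _ * _ in ep eK de le0 epsE *.
have [t1 t2 t3 t4 [t5 t6]] := small eps ep le0.
have [N0 _] := empty_manifold R n.
(* The factor lost on the injectivity radius in (3) is used as the margin below the supremum. *)
have theta : 0 <= 1 - C * eps < 1 by have := mulr_gt0 C0 ep; move: t6; move: (C * eps) => z; lra.
have ex J (d : 'I_J -> 'I_J -> R) := @near_maximal R _ N0 (consistent K delta r d) (@inj_radius R n)
  ((1 * K) `^ (- (1 / 2))) _ theta
  (fun N cN => lt_trans (ltac:(by rewrite lte_fin mulr_gt0) : (0 < (2 * r)%:E)%E) (cs_inj cN)).
(* The choice is made before [N] is introduced. Afterwards [N] and the chosen manifold are two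
   members of the same family: [near_maximal] compares their injectivity radii and
   [consistent_diffeo] gives the diffeomorphism. *)
exists (fun J d => sval (cid (ex J d))) => N cN kN sN r' iN J x _ net d _ near far.
case: (cid (ex J d)) => M /= HM.
have csN : consistent K delta r d N by split => //; exists x.
have [csM maxM] := HM (ex_intro _ N csN).
have [F [dF bF]] := consistent_diffeo n_gt0 r0 ep (ltW K0) eK de (And5 t1 t2 t3 t4 t5) csM csN.
split; [exact: (cs_compact csM)|exact: (cs_connected csM)| |by rewrite mul1r; exact: (cs_sec csM)|exact: maxM].
exists F; split => // p q pq; have [p0 [b1 b2]] := bF p q pq.
have L0 : 0 < 1 + C * eps := addr_gt0 ltr01 (mulr_gt0 C0 ep).
have ce : C * eps = 2 * (C5 R n * eps) + eps by rewrite /C; ring.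
have ce0 : 0 <= C5 R n * eps by rewrite mulr_ge0 ?(ltW ep).
clear HM bF iN net near far maxM small; split.
  rewrite ler_pdivlMr// mulrAC ler_pdivrMr// mul1r mulrC; apply: le_trans b2 _.
  by apply: ler_wpM2r; [exact: rdist_ge0|rewrite ce; move: ce0 ep; move: (C5 R n * eps) => z; lra].
rewrite ler_pdivrMr//; apply: le_trans b1 _.
by rewrite ler_pM2r// ce; move: ce0 ep; move: (C5 R n * eps) => z; lra.
Qed.
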